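(* Let $\lambda\in(0,\infty)$ and suppose that the random variable $\alpha$ with values in $(0,1)$ has a probability density of the form $\psi(x)(1-x)^{\beta}$, $x\in(0,1)$, where $\psi$ is a function on $(0,1)$ having a limit $\lim_{x\uparrow 1}\psi(x)=\psi_1\in(0,\infty)$. Let $\widetilde S^{(N,n)}$ be the doubly aggregated, conditionally centered partial sum process of independent copies of the randomized INAR(1) process with Poisson innovations (defined in the context). If $\beta\in(-1,1)$, then $$\mathcal D_{\mathrm f}\text{-}\lim_{N\to\infty}\ \mathcal D_{\mathrm f}\text{-}\lim_{n\to\infty}\ N^{-\frac{1}{1+\beta}}n^{-\frac12}\,\widetilde S^{(N,n)}=\mathcal Y_{1+\beta},$$ where $\mathcal Y_{1+\beta}=\bigl(\mathcal Y_{1+\beta}(t):=\sqrt{Y_{(1+\beta)/2}}\,B_t\bigr)_{t\in[0,\infty)}$ is a $(1+\beta)$-stable Lévy process. Here $Y_{(1+\beta)/2}$ is a positive $\frac{1+\beta}{2}$-stable random variable with Laplace transform $\mathbb E(e^{-\theta Y_{(1+\beta)/2}})=e^{-k_\beta\theta^{\frac{1+\beta}{2}}}$, $\theta\in[0,\infty)$, and with characteristic function $$\mathbb E(e^{i\theta Y_{(1+\beta)/2}})=\exp\left\{-k_\beta|\theta|^{\frac{1+\beta}{2}}e^{-i\,\operatorname{sign}(\theta)\frac{\pi(1+\beta)}{4}}\right\},\qquad\theta\in\mathbb R,$$ where $$k_\beta:=\frac{(2\lambda)^{\frac{1+\beta}{2}}\psi_1}{1+\beta}\,\Gamma\!\left(\frac{1-\beta}{2}\right),$$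 and $(B_t)_{t\in[0,\infty)}$ is an independent standard Wiener process (that is, independent of $Y_{(1+\beta)/2}$).
   Context: Randomized INAR(1) process: let $\lambda\in(0,\infty)$ and let $\alpha$ be a random variable with values in $(0,1)$. Let $X_0$, $\xi_{k,j}$, $\varepsilon_k$ ($k,j\in\mathbb N=\{1,2,\dots\}$) be random variables which are conditionally independent given $\alpha$ and such that, conditionally on $\alpha$, each $\xi_{k,j}$ is Bernoulli with $\mathbb P(\xi_{k,j}=1\mid\alpha)=\alpha=1-\mathbb P(\xi_{k,j}=0\mid\alpha)$, each $\varepsilon_k$ is Poisson with parameter $\lambda$, and $X_0$ is Poisson with parameter $\lambda/(1-\alpha)$. Define $X_k=\sum_{j=1}^{X_{k-1}}\xi_{k,j}+\varepsilon_k$, $k\in\mathbb N$ (with $\sum_{j=1}^0:=0$). Let $(\alpha^{(j)},(X^{(j)}_k)_{k\in\mathbb Z_+})$, $j\in\mathbb N$, be independent copies of $(\alpha,(X_k)_{k\in\mathbb Z_+})$, where $\mathbb Z_+=\{0,1,2,\dots\}$. Conditional expectations are in the generalized sense, and $\mathbb E(X_k\mid\alpha)=\lambda/(1-\alpha)$. For $N,n\in\mathbb N$ set $\widetilde S^{(N,n)}_t:=\sum_{j=1}^N\sum_{k=1}^{\lfloor nt\rfloor}\bigl(X^{(j)}_k-\mathbb E(X^{(j)}_k\mid\alpha^{(j)})\bigr)=\sum_{j=1}^N\sum_{k=1}^{\lfloor nt\rfloor}\bigl(X^{(j)}_k-\frac{\lambda}{1-\alpha^{(j)}}\bigr)$,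 $t\in[0,\infty)$, and $\widetilde S^{(N,n)}=(\widetilde S^{(N,n)}_t)_{t\in[0,\infty)}$. $\mathcal D_{\mathrm f}\text{-}\lim$ denotes weak convergence of finite dimensional distributions. An iterated limit $\mathcal D_{\mathrm f}\text{-}\lim_{N\to\infty}\mathcal D_{\mathrm f}\text{-}\lim_{n\to\infty}$ means: for each fixed $N$ the limit in finite dimensional distributions as $n\to\infty$ is taken first, and then these limit processes converge in finite dimensional distributions as $N\to\infty$ to the stated process.
   Formalization: The limit process is not literally a Lévy process, since the increments of √Y·B are dependent through Y; independence of increments is stated conditionally on Y, while the other Lévy axioms and (1+β)-stability are kept. *)

(* Defs.v *)
From HB Require Import structures.
From mathcomp Require Import all_boot all_order all_algebra.
From mathcomp Require Import complex.
From mathcomp Require Import all_classical all_reals all_analysis.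

Set Implicit Arguments.
Unset Strict Implicit.
Unset Printing Implicit Defensive.

Import Order.TTheory GRing.Theory Num.Theory.
Import numFieldNormedType.Exports.

Local Open Scope classical_set_scope.
Local Open Scope ring_scope.

Section Laws.
Context {R : realType}.

Definition cylinder_sigma (I : Type) : set (set (I -> R)) :=
  <<s [set E | exists i (A : set R), measurable A /\ E = [set f | A (f i)]] >>.

Definition same_law (I T1 T2 : Type)
    (mu1 : set T1 -> \bar R) (Z1 : I -> T1 -> R)
    (mu2 : set T2 -> \bar R) (Z2 : I -> T2 -> R) : Prop :=
  forall E, cylinder_sigma E ->
    mu1 [set w | E (fun i => Z1 i w)] = mu2 [set w | E (fun i => Z2 i w)].

End Laws.

Section Independence.
Context {R : realType} {d : measure_display} {T : measurableType d}.
Variable P : probability T R.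

Definition sigma_rv d' (S : measurableType d') (Z : T -> S) : set (set T) :=
  preimage_set_system setT Z measurable.

Definition sigma_family (I : Type) (D : set I) (Z : I -> T -> R) :
    set (set T) :=
  <<s [set E | exists i, D i /\ sigma_rv (Z i) E] >>.

Definition indep_sigma (I : eqType) (F : I -> set (set T)) : Prop :=
  forall (s : seq I) (E : I -> set T),
    uniq s -> (forall i, i \in s -> F i (E i)) ->
    P (\big[setI/setT]_(i <- s) E i) = (\prod_(i <- s) P (E i))%E.

(* [h] is a version of E(f | alpha), in the generalized sense for f >= 0: the
   integrals range over [0, +oo], so E(f) = +oo is allowed. The condition
   forces h >= 0 almost surely, as \int f >= 0 on the event {h < 0}. *)
Definition is_cexp (alpha f h : T -> R) : Prop :=
  (forall A : set R, measurable A -> sigma_rv alpha (h @^-1` A)) /\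
  (forall A : set R, measurable A ->
     (\int[P]_(w in alpha @^-1` A) (h w)%:E =
      \int[P]_(w in alpha @^-1` A) (f w)%:E)%E).

Definition is_cprob (alpha : T -> R) (E : set T) (h : T -> R) : Prop :=
  is_cexp alpha (\1_E) h.

Definition cond_indep_sigma (alpha : T -> R) (I : eqType)
    (F : I -> set (set T)) : Prop :=
  forall (s : seq I) (E : I -> set T) (h : I -> T -> R),
    uniq s -> (forall i, i \in s -> F i (E i)) ->
    (forall i, i \in s -> is_cprob alpha (E i) (h i)) ->
    is_cprob alpha (\big[setI/setT]_(i <- s) E i)
      (fun w => \prod_(i <- s) h i w).

End Independence.

Section RandomizedINAR.
Context {R : realType} {d : measure_display} {T : measurableType d}.
Variable P : probability T R.

(* In [xi] and [eps] the indices are shifted by one: [xi k j] and [eps k] stand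
   for xi_(k+1, j+1) and epsilon_(k+1). *)
Definition noise (X0 : T -> nat) (xi : nat -> nat -> T -> nat)
    (eps : nat -> T -> nat) (i : unit + (nat * nat) + nat) : T -> nat :=
  match i with
  | inl (inl _) => X0
  | inl (inr kj) => xi kj.1 kj.2
  | inr k => eps k
  end.

Fixpoint inar (X0 : T -> nat) (xi : nat -> nat -> T -> nat)
    (eps : nat -> T -> nat) (k : nat) (w : T) : nat :=
  match k with
  | 0%N => X0 w
  | k'.+1 => (\sum_(j < inar X0 xi eps k' w) xi k' j w + eps k' w)%N
  end.

Definition randomized_inar_noise (lambda : R) (alpha : {RV P >-> R})
    (X0 : {RV P >-> nat}) (xi : nat -> nat -> {RV P >-> nat})
    (eps : nat -> {RV P >-> nat}) : Prop :=
  [/\ forall w, 0 < alpha w < 1,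
      cond_indep_sigma P alpha (fun i => sigma_rv (noise X0 xi eps i)),
      forall k j, is_cprob P alpha [set w | xi k j w = 1%N] alpha /\
        is_cprob P alpha [set w | xi k j w = 0%N] (fun w => 1 - alpha w),
      forall k n, is_cprob P alpha [set w | eps k w = n]
        (fun _ => poisson_pmf lambda n) &
      forall n, is_cprob P alpha [set w | X0 w = n]
        (fun w => poisson_pmf (lambda / (1 - alpha w)) n)].

Definition joint (alpha : T -> R) (X : nat -> T -> nat) (i : option nat) :
    T -> R :=
  if i is Some k then fun w => (X k w)%:R else alpha.

(* [m j k] is the centering E(X^(j)_k | alpha^(j)); the copies are numbered from
   0 and only times k >= 1 enter the sum. *)
Definition Stilde (X : nat -> nat -> T -> nat) (m : nat -> nat -> T -> R)
    (N n : nat) (t : R) (w : T) : R :=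
  \sum_(j < N) \sum_(1 <= k < (Num.truncn (n%:R * t)).+1)
     ((X j k w)%:R - m j k w).

End RandomizedINAR.

(* Time ranges over [0, +oo): the values of a path at negative times are never
   used. *)
Record process (R : realType) := Process {
  proc_disp : measure_display;
  proc_space : measurableType proc_disp;
  proc_prob : probability proc_space R;
  proc_val : R -> proc_space -> R
}.
Arguments proc_val {R} p t w.

Definition is_process (R : realType) (Z : process R) : Prop :=
  forall t, 0 <= t -> measurable_fun setT (proc_val Z t).

Definition fdd_expectation (R : realType) (Z : process R) (m : nat)
    (t : 'I_m -> R) (f : 'rV[R]_m -> R) : \bar R :=
  'E_(proc_prob Z) [fun w => f (\row_i proc_val Z (t i) w)].

Definition fdd_cvg (R : realType) (Z : nat -> process R) (L : process R) :
    Prop :=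
  [/\ forall n, is_process (Z n), is_process L &
    forall (m : nat) (t : 'I_m -> R) (f : 'rV[R]_m -> R),
      (forall i, 0 <= t i) -> continuous f ->
      (exists M : R, forall x, `|f x| <= M) ->
      fdd_expectation (Z n) t f @[n --> \oo] --> fdd_expectation L t f].

Section LimitProcess.
Context {R : realType} {d : measure_display} {T : measurableType d}.
Variable P : probability T R.

Definition nondecreasing_times (t : nat -> R) : Prop :=
  0 <= t 0%N /\ {homo t : i j / (i <= j)%N >-> i <= j}.

Definition increment (Z : R -> T -> R) (s t : R) : T -> R :=
  fun w => Z t w - Z s w.

Definition wiener (B : R -> T -> R) : Prop :=
  [/\ {ae P, forall w, B 0 w = 0},
      forall t, nondecreasing_times t ->
        indep_sigma P (fun i : nat => sigma_rv (increment B (t i) (t i.+1))),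
      forall s t, 0 <= s -> s < t -> forall A : set R, measurable A ->
        P (increment B s t @^-1` A) = normal_prob 0 (Num.sqrt (t - s)) A &
      {ae P, forall w, {within `[0, +oo[, continuous (fun t => B t w)}}].

Definition cadlag (f : R -> R) : Prop :=
  (forall t, 0 <= t -> f s @[s --> t^'+] --> f t) /\
  (forall t, 0 < t -> cvg (f s @[s --> t^'-])).

(* The axioms of a Levy process, except that the increments are independent
   conditionally on [V]. For V constant this is a Levy process. For
   sqrt V * B with B a Wiener process independent of a nondegenerate V, the
   increments are not independent unconditionally. *)
Definition levy_given (V : T -> R) (Z : R -> T -> R) : Prop :=
  [/\ {ae P, forall w, Z 0 w = 0},
      forall t, nondecreasing_times t ->
        cond_indep_sigma P V
          (fun i : nat => sigma_rv (increment Z (t i) (t i.+1))),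
      forall s h, 0 <= s -> 0 <= h -> forall A : set R, measurable A ->
        P (increment Z s (s + h) @^-1` A) = P (increment Z 0 h @^-1` A),
      forall t e, 0 <= t -> 0 < e ->
        P [set w | e <= `|Z s w - Z t w|]
          @[s --> within [set s | 0 <= s] (nbhs t)] --> 0%E &
      {ae P, forall w, cadlag (fun t => Z t w)}].

(* For independent copies Z', Z'' of Z (built on the product space), A Z' + B Z''
   has the law of C Z + D, with C^a = A^a + B^a. *)
Definition stable_family (a : R) (I : Type) (Z : I -> T -> R) : Prop :=
  forall A B : R, 0 < A -> 0 < B -> exists D : I -> R,
    same_law (P \x P)%E (fun i w => A * Z i w.1 + B * Z i w.2)
      P (fun i w => (A `^ a + B `^ a) `^ a^-1 * Z i w + D i).

Definition stable_rv (a : R) (Y : T -> R) : Prop :=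
  (forall c, P (Y @^-1` [set c]) != 1%E) /\
  stable_family a (fun _ : unit => Y).

Definition stable_process (a : R) (Z : R -> T -> R) : Prop :=
  (forall t, 0 < t -> stable_rv a (Z t)) /\
  (forall m (t : 'I_m -> R), (forall i, 0 <= t i) ->
     stable_family a (fun i => Z (t i))).

End LimitProcess.

Section Transforms.
Context {R : realType}.

Definition Gamma (s : R) : R :=
  Rintegral lebesgue_measure `]0, +oo[ (fun x => x `^ (s - 1) * expR (- x)).

Definition k_beta (lambda psi1 beta : R) : R :=
  (2 * lambda) `^ ((1 + beta) / 2) * psi1 / (1 + beta) * Gamma ((1 - beta) / 2).

Definition cexp (z : R[i]) : R[i] :=
  (expR (complex.Re z) * cos (complex.Im z) +i*
   (expR (complex.Re z) * sin (complex.Im z)))%C.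

Definition char_fun d (T : measurableType d) (P : probability T R)
    (Y : T -> R) (theta : R) : R[i] :=
  (fine 'E_P[fun w => cos (theta * Y w)] +i*
   fine 'E_P[fun w => sin (theta * Y w)])%C.

End Transforms.

(* Main.v *)
Require Import Defs.
From HB Require Import structures.
From mathcomp Require Import all_boot all_order all_algebra.
From mathcomp Require Import complex.
From mathcomp Require Import all_classical all_reals all_analysis.
From mathcomp Require Import measurable_realfun lebesgue_integral_under.
From mathcomp Require Import ring lra.

Set Implicit Arguments.
Unset Strict Implicit.
Unset Printing Implicit Defensive.

Import Order.TTheory GRing.Theory Num.Theory.
Import numFieldNormedType.Exports.

Local Open Scope classical_set_scope.
Local Open Scope ring_scope.

(** Why the theorem holds.

    Conditionally on [alpha = a] the process is a stationary INAR(1) process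
    with Poisson innovations, whose generating functions are explicit: a
    population of [x] individuals evolves by thinning, and immigration is
    Poisson. A backward recursion over time ([inar_path]) gives, for numbers [z]
    of norm at most 1,
      E (prod z_k ^ X_k | alpha) = exp (lambda / (1 - alpha) * cumulant alpha z).
    All information on the process enters through this formula. At
    [z = (1, .., 1, s)] it is the generating function of the Poisson law with
    mean [lambda / (1 - alpha)], whose derivative at [s = 1] identifies the
    centering ([copy_centering]). At [z_k = exp (i c_k)] with [c_k] of order
    [n ^ (- 1 / 2)] and piecewise constant in [k], a second-order expansion with
    error [O (size * delta ^ 3)] ([cumulant_expansion], [quad_variation]) shows
    that the centered partial sums, divided by [sqrt n], have in the limit the
    characteristic function of [sqrt v * B], where [B] is a Wiener process and
    [v = lambda (1 + a) / (1 - a) ^ 2] is the long-run variance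
    ([cvg_cumulant]). So for N independent copies the limit in [n] is
    [sqrt (V_1 + .. + V_N) * B] with [V_j] the long-run variance at [alpha_j]
    ([fdd_cvg_aggregated]).

    For the limit in N, the density [psi x (1 - x) ^ beta] makes the tail of [V]
    regularly varying of index [a = (1 + beta) / 2]: as [V > v] means that
    [1 - alpha] is below about [sqrt (2 lambda / v)], the probability is
    about [(2 lambda) ^ a psi1 / (1 + beta) * v ^ (- a)]
    ([long_run_variance_tail]). Writing [1 - exp (- tau V)] as an integral of
    [exp (- x)] over [x <= tau V], dominated convergence turns this into
    [1 - E exp (- tau V) ~ k_beta tau ^ a] ([laplace_tauberian], where the
    factor [Gamma (1 - a)] appears), hence
    [(E exp (- N ^ (- 1 / a) theta V)) ^ N] tends to
    [exp (- k_beta theta ^ a)], the Laplace transform of [Y]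
    ([long_run_variance_laplace]). With [theta] half the variance of a linear
    combination of values of [B], this is the characteristic function of
    [sqrt Y * B] ([subordinated_cf]).

    Both limits are limits of characteristic functions, and the continuity
    theorem ([levy_continuity]) turns them into convergence in distribution. It
    is proved by uniform approximation of a continuous function by trigonometric
    polynomials on a cube ([trig_approx], from Bernstein polynomials in the
    sines of the coordinates) and a bound on the tails by Gaussian averages of
    the characteristic function. It also gives the uniqueness of laws with given
    characteristic functions ([same_law_cf]), from which the stability of [Y]
    and of [sqrt Y * B] and the stationarity of the increments follow.

    The characteristic function of [Y] is not obtained from the Laplace
    transform by a general continuation principle. Stability says that the
    complex Laplace transform [L] satisfies [L (A s) L (B s) = L (C s)] with
    [C ^ a = A ^ a + B ^ a]; differentiating twice gives an ordinary
    differential equation for [L] ([lap_ode]), which is solved along vertical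
    lines starting at the real axis, where [L] is known ([lap_closed]). The
    imaginary axis is reached as a limit ([stable_char_fun]). *)

Local Notation Re := complex.Re.
Local Notation Im := complex.Im.
Local Notation normc := ComplexField.Normc.normc.

(** * Expectations of bounded real and complex random variables *)

Section BoundedExpectation.
Context {R : realType} {d : measure_display} {T : measurableType d}.
Implicit Types (f g : T -> R) (P : probability T R).

Definition bmeas f := measurable_fun setT f /\ exists M : R, forall w, `|f w| <= M.

Definition Ex P f : R := Rintegral P setT f.

Lemma bmeas_cst c : bmeas (fun=> c).
Proof. by split; [exact: measurable_cst|exists `|c|]. Qed.

Lemma bmeasD f g : bmeas f -> bmeas g -> bmeas (fun w => f w + g w).
Proof.
move=> [mf [M hM]] [mg [N hN]]; split; first exact: measurable_funD.
by exists (M + N) => w; rewrite (le_trans (ler_normD _ _))// lerD.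
Qed.

Lemma bmeasM f g : bmeas f -> bmeas g -> bmeas (fun w => f w * g w).
Proof.
move=> [mf [M hM]] [mg [N hN]]; split; first exact: measurable_funM.
by exists (M * N) => w; rewrite normrM ler_pM.
Qed.

Lemma bmeasN f : bmeas f -> bmeas (fun w => - f w).
Proof.
move=> [mf [M hM]]; split; first exact: measurable_funN.
by exists M => w; rewrite normrN.
Qed.

Lemma bmeasB f g : bmeas f -> bmeas g -> bmeas (fun w => f w - g w).
Proof. by move=> bf bg; apply: bmeasD => //; exact: bmeasN. Qed.

Lemma bmeas_indic (A : set T) : measurable A -> bmeas (\1_A).
Proof.
move=> mA; split; first exact: measurable_indic.
by exists 1 => w; rewrite indicE; case: (_ \in _); rewrite ?normr1 ?normr0.
Qed.

Lemma bmeas_sum (I : Type) (s : seq I) (f : I -> T -> R) :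
  (forall i, bmeas (f i)) -> bmeas (fun w => \sum_(i <- s) f i w).
Proof.
move=> bf; elim: s => [|i s ih].
  by under eq_fun do rewrite big_nil; exact: bmeas_cst.
by under eq_fun do rewrite big_cons; exact: bmeasD.
Qed.

Lemma bmeas_prod (I : Type) (s : seq I) (f : I -> T -> R) :
  (forall i, bmeas (f i)) -> bmeas (fun w => \prod_(i <- s) f i w).
Proof.
move=> bf; elim: s => [|i s ih].
  by under eq_fun do rewrite big_nil; exact: bmeas_cst.
by under eq_fun do rewrite big_cons; exact: bmeasM.
Qed.

Lemma bmeas_le f M : measurable_fun setT f -> (forall w, `|f w| <= M) -> bmeas f.
Proof. by move=> mf fM; split => //; exists M. Qed.

Lemma bmeas_comp (h : R -> R) f M : measurable_fun setT h ->
  (forall x, `|h x| <= M) -> measurable_fun setT f -> bmeas (fun w => h (f w)).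
Proof.
move=> mh hM mf; split; last by exists M.
exact: measurableT_comp mh mf.
Qed.

Lemma bmeas_integrable P f : bmeas f -> P.-integrable setT (EFin \o f).
Proof.
move=> [mf [M hM]]; apply: measurable_bounded_integrable => //.
  by rewrite (@le_lt_trans _ _ 1%E)// ?probability_le1// ltry.
by exists M; split; [rewrite num_real|move=> y My w _; rewrite /= (le_trans (hM w))// ltW].
Qed.

Lemma EFin_Ex P f : bmeas f -> (\int[P]_w (f w)%:E = (Ex P f)%:E)%E.
Proof.
move=> bf; rewrite /Ex /Rintegral fineK//.
by apply: integrable_fin_num => //; exact: bmeas_integrable.
Qed.

Lemma Ex_cst P c : Ex P (fun=> c) = c.
Proof. rewrite /Ex Rintegral_cst//. rewrite -[X in _ * X]/(fine (P setT)). rewrite (probability_setT P) mulr1//. Qed.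

Lemma ExD P f g : bmeas f -> bmeas g ->
  Ex P (fun w => f w + g w) = Ex P f + Ex P g.
Proof. by move=> bf bg; rewrite /Ex RintegralD//; exact: bmeas_integrable. Qed.

Lemma ExZ P c f : bmeas f -> Ex P (fun w => c * f w) = c * Ex P f.
Proof. by move=> bf; rewrite /Ex RintegralZl//; exact: bmeas_integrable. Qed.

Lemma ExN P f : bmeas f -> Ex P (fun w => - f w) = - Ex P f.
Proof.
move=> bf; rewrite -mulN1r -ExZ//; congr (Ex P _).
by apply/funext => w; rewrite mulN1r.
Qed.

Lemma ExB P f g : bmeas f -> bmeas g ->
  Ex P (fun w => f w - g w) = Ex P f - Ex P g.
Proof. by move=> bf bg; rewrite ExD ?ExN//; exact: bmeasN. Qed.

Lemma Ex_le P f g : bmeas f -> bmeas g -> (forall w, f w <= g w) ->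
  Ex P f <= Ex P g.
Proof.
move=> bf bg fg; rewrite /Ex; apply: le_Rintegral => //; exact: bmeas_integrable.
Qed.

Lemma Ex_ge0 P f : (forall w, 0 <= f w) -> 0 <= Ex P f.
Proof. by move=> f0; apply: Rintegral_ge0 => w _. Qed.

Lemma Ex_norm P f M : bmeas f -> (forall w, `|f w| <= M) -> `|Ex P f| <= M.
Proof.
move=> bf fM; rewrite ler_norml; apply/andP; split.
  rewrite -[leLHS](Ex_cst P); apply: Ex_le => //; first exact: bmeas_cst.
  by move=> w; move: (fM w); rewrite ler_norml => /andP[].
rewrite -[leRHS](Ex_cst P); apply: Ex_le => //; first exact: bmeas_cst.
by move=> w; move: (fM w); rewrite ler_norml => /andP[].
Qed.

Lemma Ex_indic P (A : set T) : measurable A -> Ex P (\1_A) = fine (P A).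
Proof. by move=> mA; rewrite /Ex /Rintegral integral_indic// setIT. Qed.

Lemma Ex_sum P (I : Type) (s : seq I) (f : I -> T -> R) :
  (forall i, bmeas (f i)) ->
  Ex P (fun w => \sum_(i <- s) f i w) = \sum_(i <- s) Ex P (f i).
Proof.
move=> bf; elim: s => [|i s ih].
  by under eq_fun do rewrite big_nil; rewrite Ex_cst big_nil.
under eq_fun do rewrite big_cons; rewrite ExD// ?ih ?big_cons//.
exact: bmeas_sum.
Qed.

Lemma bmeas_lim (F : nat -> T -> R) f (M : R) :
  (forall n, measurable_fun setT (F n)) -> (forall n w, `|F n w| <= M) ->
  (forall w, F n w @[n --> \oo] --> f w) -> bmeas f.
Proof.
move=> mF FM Ff; split.
  by apply: (measurable_fun_cvg mF) => w _; exact: Ff.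
exists M => w; rewrite -(cvg_lim _ (cvg_norm (Ff w)))//.
apply: limr_le; first by apply: is_cvg_norm; apply/cvg_ex; exists (f w).
by near=> n.
Unshelve. all: by end_near. Qed.

Lemma Ex_dct P (F : nat -> T -> R) f (M : R) :
  (forall n, measurable_fun setT (F n)) -> (forall n w, `|F n w| <= M) ->
  {ae P, forall w, F n w @[n --> \oo] --> f w} -> measurable_fun setT f ->
  Ex P (F n) @[n --> \oo] --> Ex P f.
Proof.
move=> mF FM Ff mf.
have [|||||if_ _ h] := @dominated_convergence _ _ _ P setT measurableT
  (fun n => EFin \o F n) (EFin \o f) (EFin \o cst M).
- by move=> n; exact/measurable_EFinP.
- exact/measurable_EFinP.
- by apply: filterS Ff => w Ffw _; apply: cvg_EFin; [near=> n|].
- exact/bmeas_integrable/bmeas_cst.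
- by apply: aeW => /= w n _; rewrite lee_fin.
by apply: fine_cvg; rewrite fineK; [exact: h|exact: integrable_fin_num].
Unshelve. all: by end_near. Qed.

Lemma Ex_ae P f g : bmeas f -> bmeas g -> {ae P, forall w, f w = g w} ->
  Ex P f = Ex P g.
Proof.
move=> [mf _] [mg _] fg; rewrite /Ex /Rintegral; congr fine.
apply: ae_eq_integral => //; [exact/measurable_EFinP..|].
by apply: filterS fg => w + _ /= => ->.
Qed.

End BoundedExpectation.

Lemma Ex_fubini {R : realType} {d1 d2} {T1 : measurableType d1}
    {T2 : measurableType d2} (P1 : probability T1 R) (P2 : probability T2 R)
    (f : T1 * T2 -> R) : bmeas f ->
  bmeas (fun x => Ex P2 (fun y => f (x, y))) /\
  Ex (P1 \x P2)%E f = Ex P1 (fun x => Ex P2 (fun y => f (x, y))).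
Proof.
move=> bf; have [mf [M fM]] := bf.
have fi : (P1 \x P2)%E.-integrable setT (EFin \o f) by exact: bmeas_integrable.
have bx x : bmeas (fun y => f (x, y)).
  split; last by exists M.
  exact: measurableT_comp mf (pair1_measurable x).
have E x : (\int[P2]_y (f (x, y))%:E = (Ex P2 (fun y => f (x, y)))%:E)%E.
  by rewrite EFin_Ex.
have b1 : bmeas (fun x => Ex P2 (fun y => f (x, y))).
  split.
    have := measurable_fubini_F fi; rewrite /fubini_F => h.
    by apply/measurable_EFinP; apply: eq_measurable_fun h => x _ /=; rewrite E.
  by exists M => x; apply: Ex_norm.
split => //; apply: EFin_inj; rewrite -EFin_Ex// -EFin_Ex//.
rewrite -(integral12_prod_meas1 fi); apply: eq_integral => x _.
by rewrite /fubini_F /= E.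
Qed.

Section ComplexSequences.
Context {R : realType}.
Implicit Types (z : R[i]) (u v : nat -> R[i]).

Lemma ReM z1 z2 : Re (z1 * z2) = Re z1 * Re z2 - Im z1 * Im z2.
Proof. by case: z1 z2 => a b [c e]. Qed.

Lemma ImM z1 z2 : Im (z1 * z2) = Re z1 * Im z2 + Im z1 * Re z2.
Proof. by case: z1 z2 => a b [c e]. Qed.

Lemma ReD z1 z2 : Re (z1 + z2) = Re z1 + Re z2.
Proof. by case: z1 z2 => a b [c e]. Qed.

Lemma ImD z1 z2 : Im (z1 + z2) = Im z1 + Im z2.
Proof. by case: z1 z2 => a b [c e]. Qed.

Lemma ReN z : Re (- z) = - Re z. Proof. by case: z. Qed.

Lemma ImN z : Im (- z) = - Im z. Proof. by case: z. Qed.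

Lemma complex_eq z1 z2 : Re z1 = Re z2 -> Im z1 = Im z2 -> z1 = z2.
Proof. by case: z1 z2 => a b [c e] /= -> ->. Qed.

Lemma normc_Re z : `|Re z| <= normc z.
Proof.
case: z => a b /=; rewrite -sqrtr_sqr ler_sqrt ?addr_ge0 ?sqr_ge0//.
by rewrite lerDl sqr_ge0.
Qed.

Lemma normc_Im z : `|Im z| <= normc z.
Proof.
case: z => a b /=; rewrite -sqrtr_sqr ler_sqrt ?addr_ge0 ?sqr_ge0//.
by rewrite lerDr sqr_ge0.
Qed.

Lemma normc_ge0 z : 0 <= normc z.
Proof. by rewrite (le_trans _ (normc_Re z)). Qed.

Lemma normc_le z : normc z <= `|Re z| + `|Im z|.
Proof.
case: z => a b /=; rewrite -(@ger0_norm _ (`|a| + `|b|)) ?addr_ge0//.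
rewrite -sqrtr_sqr ler_sqrt ?sqr_ge0// sqrrD !real_normK ?num_real//.
by rewrite lerD2r lerDl mulrn_wge0// mulr_ge0.
Qed.

Lemma normcD z1 z2 : normc (z1 + z2) <= normc z1 + normc z2.
Proof.
have := @ler_normD _ _ z1 z2.
have E z : `|z| = (normc z)%:C%C by case: z => a b; rewrite normc_def.
by rewrite !E -(rmorphD (real_complex R)) /= lecR.
Qed.

Lemma normcN z : normc (- z) = normc z.
Proof. by case: z => a b /=; rewrite !sqrrN. Qed.

Lemma normcB z1 z2 : normc (z1 - z2) <= normc z1 + normc z2.
Proof. by rewrite -(normcN z2); exact: normcD. Qed.

Lemma normc_real (x : R) : normc (x%:C)%C = `|x|.
Proof. by rewrite /= expr0n /= addr0 sqrtr_sqr. Qed.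

Lemma normcX z n : normc (z ^+ n) = normc z ^+ n.
Proof.
elim: n => [|n ih]; first by rewrite !expr0 ComplexField.Normc.normc1.
by rewrite !exprS ComplexField.Normc.normcM ih.
Qed.

Lemma normc_prod (I : Type) (s : seq I) (F : I -> R[i]) :
  normc (\prod_(i <- s) F i) = \prod_(i <- s) normc (F i).
Proof.
elim: s => [|i s ih]; first by rewrite !big_nil ComplexField.Normc.normc1.
by rewrite !big_cons ComplexField.Normc.normcM ih.
Qed.

Lemma normc_sum (I : Type) (s : seq I) (F : I -> R[i]) :
  normc (\sum_(i <- s) F i) <= \sum_(i <- s) normc (F i).
Proof.
elim: s => [|i s ih]; first by rewrite !big_nil ComplexField.Normc.normc0.
by rewrite !big_cons (le_trans (normcD _ _))// lerD2l.
Qed.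

Definition ccvg u (l : R[i]) :=
  Re (u n) @[n --> \oo] --> Re l /\ Im (u n) @[n --> \oo] --> Im l.

Lemma ccvg_cst z : ccvg (fun=> z) z.
Proof. by split; exact: cvg_cst. Qed.

Lemma ccvgD u v l m : ccvg u l -> ccvg v m -> ccvg (fun n => u n + v n) (l + m).
Proof.
move=> [ul ul'] [vm vm']; split.
  by rewrite ReD; under eq_fun do rewrite ReD; exact: cvgD.
by rewrite ImD; under eq_fun do rewrite ImD; exact: cvgD.
Qed.

Lemma ccvgM u v l m : ccvg u l -> ccvg v m -> ccvg (fun n => u n * v n) (l * m).
Proof.
move=> [ul ul'] [vm vm']; split.
  by rewrite ReM; under eq_fun do rewrite ReM; apply: cvgB; exact: cvgM.
by rewrite ImM; under eq_fun do rewrite ImM; apply: cvgD; exact: cvgM.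
Qed.

Lemma ccvgX u l k : ccvg u l -> ccvg (fun n => u n ^+ k) (l ^+ k).
Proof.
move=> ul; elim: k => [|k ih]; first exact: ccvg_cst.
rewrite exprS; have := ccvgM ul ih.
by under [X in ccvg X _ -> _]eq_fun do rewrite -exprS.
Qed.

Lemma ccvg_unique u l m : ccvg u l -> ccvg u m -> l = m.
Proof.
by move=> [ul ul'] [um um']; apply: complex_eq;
  [exact: cvg_unique ul um|exact: cvg_unique ul' um'].
Qed.

Lemma ccvg_normc u l : ccvg u l <-> normc (u n - l) @[n --> \oo] --> (0 : R).
Proof.
split=> [[ul ul']|h].
  have h : `|Re (u n) - Re l| + `|Im (u n) - Im l| @[n --> \oo] --> (0 : R).
    rewrite -[X in _ --> X](addr0 0); apply: cvgD; apply/norm_cvg0P;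
    by apply/subr_cvg0.
  apply: (squeeze_cvgr _ (cvg_cst 0) h); near=> n.
  by rewrite normc_ge0 /= -ReN -ImN -ReD -ImD; exact: normc_le.
split; apply/subr_cvg0/norm_cvg0P; apply: (squeeze_cvgr _ (cvg_cst 0) h);
  near=> n; rewrite normr_ge0 /=.
  by rewrite -ReN -ReD normc_Re.
by rewrite -ImN -ImD normc_Im.
Unshelve. all: by end_near. Qed.

Lemma ccvg_squeeze u l (b : nat -> R) : (forall n, normc (u n - l) <= b n) ->
  b n @[n --> \oo] --> (0 : R) -> ccvg u l.
Proof.
move=> ub b0; apply/ccvg_normc; apply: (squeeze_cvgr _ (cvg_cst 0) b0).
by near=> n; rewrite normc_ge0 ub.
Unshelve. all: by end_near. Qed.

Definition cis (x : R) : R[i] := (cos x +i* sin x)%C.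

Lemma cisD x y : cis (x + y) = cis x * cis y.
Proof.
by apply: complex_eq; rewrite ?ReM ?ImM /cis/= ?cosD ?sinD//; ring.
Qed.

Lemma cis0 : cis 0 = 1.
Proof. by apply: complex_eq; rewrite /= ?cos0 ?sin0. Qed.

Lemma normc_cis x : normc (cis x) = 1.
Proof. by rewrite /cis /= cos2Dsin2 sqrtr1. Qed.

Lemma cis_sum (I : Type) (s : seq I) (F : I -> R) :
  cis (\sum_(i <- s) F i) = \prod_(i <- s) cis (F i).
Proof.
elim: s => [|i s ih]; first by rewrite !big_nil cis0.
by rewrite !big_cons cisD ih.
Qed.

Lemma cisX x n : cis x ^+ n = cis (x * n%:R).
Proof.
elim: n => [|n ih]; first by rewrite mulr0 cis0.
by rewrite exprS ih -cisD -natr1 mulrDr mulr1 addrC.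
Qed.

End ComplexSequences.

Section ComplexExpectation.
Context {R : realType} {d : measure_display} {T : measurableType d}.
Implicit Types (f g : T -> R[i]) (P : probability T R).

Definition cbm f := bmeas (fun w => Re (f w)) /\ bmeas (fun w => Im (f w)).

Definition cE P f : R[i] :=
  (Ex P (fun w => Re (f w)) +i* Ex P (fun w => Im (f w)))%C.

Lemma cbm_cst z : cbm (fun=> z).
Proof. by split; exact: bmeas_cst. Qed.

Lemma cbmD f g : cbm f -> cbm g -> cbm (fun w => f w + g w).
Proof.
move=> [f1 f2] [g1 g2]; split.
  by under eq_fun do rewrite ReD; exact: bmeasD.
by under eq_fun do rewrite ImD; exact: bmeasD.
Qed.

Lemma cbmN f : cbm f -> cbm (fun w => - f w).
Proof.
move=> [f1 f2]; split.
  by under eq_fun do rewrite ReN; exact: bmeasN.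
by under eq_fun do rewrite ImN; exact: bmeasN.
Qed.

Lemma cbmM f g : cbm f -> cbm g -> cbm (fun w => f w * g w).
Proof.
move=> [f1 f2] [g1 g2]; split.
  by under eq_fun do rewrite ReM; apply: bmeasB; exact: bmeasM.
by under eq_fun do rewrite ImM; apply: bmeasD; exact: bmeasM.
Qed.

Lemma cbm_real (f : T -> R) : bmeas f -> cbm (fun w => (f w)%:C%C).
Proof. by move=> bf; split => //=; exact: bmeas_cst. Qed.

Lemma cbm_indic (A : set T) : measurable A -> cbm (fun w => (\1_A w)%:C%C).
Proof. by move=> mA; apply: cbm_real; exact: bmeas_indic. Qed.

Lemma cbm_prod (I : Type) (s : seq I) (f : I -> T -> R[i]) :
  (forall i, cbm (f i)) -> cbm (fun w => \prod_(i <- s) f i w).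
Proof.
move=> bf; elim: s => [|i s ih].
  by under eq_fun do rewrite big_nil; exact: cbm_cst.
by under eq_fun do rewrite big_cons; exact: cbmM.
Qed.

Lemma cbm_sum (I : Type) (s : seq I) (f : I -> T -> R[i]) :
  (forall i, cbm (f i)) -> cbm (fun w => \sum_(i <- s) f i w).
Proof.
move=> bf; elim: s => [|i s ih].
  by under eq_fun do rewrite big_nil; exact: cbm_cst.
by under eq_fun do rewrite big_cons; exact: cbmD.
Qed.

Lemma measurable_cos : measurable_fun setT (@cos R).
Proof. by apply: continuous_measurable_fun; exact: continuous_cos. Qed.

Lemma measurable_sin : measurable_fun setT (@sin R).
Proof. by apply: continuous_measurable_fun; exact: continuous_sin. Qed.

Lemma cbm_cis (f : T -> R) : measurable_fun setT f -> cbm (fun w => cis (f w)).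
Proof.
move=> mf; split; apply: (@bmeas_le _ _ _ _ 1).
- exact: measurableT_comp measurable_cos mf.
- by move=> w; rewrite ler_norml cos_geN1 cos_le1.
- exact: measurableT_comp measurable_sin mf.
- by move=> w; rewrite ler_norml sin_geN1 sin_le1.
Qed.

Lemma cbm_le f M : measurable_fun setT (fun w => Re (f w)) ->
  measurable_fun setT (fun w => Im (f w)) -> (forall w, normc (f w) <= M) ->
  cbm f.
Proof.
move=> m1 m2 fM; split; apply: (@bmeas_le _ _ _ _ M) => // w.
  exact: le_trans (normc_Re _) (fM w).
exact: le_trans (normc_Im _) (fM w).
Qed.

Lemma cbm_bound f : cbm f -> exists M : R, forall w, normc (f w) <= M.
Proof.
move=> [[_ [M fM]] [_ [N fN]]]; exists (M + N) => w.
by rewrite (le_trans (normc_le _))// lerD.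
Qed.

Lemma cE_cst P z : cE P (fun=> z) = z.
Proof. by rewrite /cE !Ex_cst; case: z. Qed.

Lemma cED P f g : cbm f -> cbm g -> cE P (fun w => f w + g w) = cE P f + cE P g.
Proof.
move=> [f1 f2] [g1 g2]; apply: complex_eq; rewrite ?ReD ?ImD /= -ExD//; congr Ex;
  by apply/funext => w; rewrite ?ReD ?ImD.
Qed.

Lemma cEZ P z f : cbm f -> cE P (fun w => z * f w) = z * cE P f.
Proof.
move=> [f1 f2]; apply: complex_eq; rewrite ?ReM ?ImM /= -!ExZ//.
  rewrite -ExB; [|exact: bmeasM (bmeas_cst _) _..].
  by congr Ex; apply/funext => w; rewrite ReM.
rewrite -ExD; [|exact: bmeasM (bmeas_cst _) _..].
by congr Ex; apply/funext => w; rewrite ImM.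
Qed.

Lemma cEZr P z f : cbm f -> cE P (fun w => f w * z) = cE P f * z.
Proof. by move=> bf; under eq_fun do rewrite mulrC; rewrite cEZ// mulrC. Qed.

Lemma cE_sum P (I : Type) (s : seq I) (f : I -> T -> R[i]) :
  (forall i, cbm (f i)) ->
  cE P (fun w => \sum_(i <- s) f i w) = \sum_(i <- s) cE P (f i).
Proof.
move=> bf; elim: s => [|i s ih].
  by under eq_fun do rewrite big_nil; rewrite cE_cst big_nil.
under eq_fun do rewrite big_cons; rewrite cED// ?ih ?big_cons//.
exact: cbm_sum.
Qed.

Lemma cE_real P (f : T -> R) : cE P (fun w => (f w)%:C%C) = (Ex P f)%:C%C.
Proof. by rewrite /cE /= Ex_cst. Qed.

Lemma cE_dct P (F : nat -> T -> R[i]) f (M : R) :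
  (forall n, cbm (F n)) -> (forall n w, normc (F n w) <= M) ->
  cbm f -> {ae P, forall w, ccvg (F ^~ w) (f w)} ->
  ccvg (fun n => cE P (F n)) (cE P f).
Proof.
move=> bF FM [[mf1 _] [mf2 _]] Ff; split => /=; apply: (@Ex_dct _ _ _ _ _ _ M).
- by move=> n; case: (bF n) => -[].
- by move=> n w; exact: le_trans (normc_Re _) (FM n w).
- by apply: filterS Ff => w [].
- by [].
- by move=> n; case: (bF n) => _ [].
- by move=> n w; exact: le_trans (normc_Im _) (FM n w).
- by apply: filterS Ff => w [].
- by [].
Qed.

Lemma cE_ae P f g : cbm f -> cbm g -> {ae P, forall w, f w = g w} ->
  cE P f = cE P g.
Proof.
move=> [f1 f2] [g1 g2] fg; rewrite /cE; congr (_ +i* _)%C;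
  by apply: Ex_ae => //; apply: filterS fg => w ->.
Qed.

End ComplexExpectation.

Lemma cE_fubini {R : realType} {d1 d2} {T1 : measurableType d1}
    {T2 : measurableType d2} (P1 : probability T1 R) (P2 : probability T2 R)
    (f : T1 * T2 -> R[i]) : cbm f ->
  cbm (fun x => cE P2 (fun y => f (x, y))) /\
  cE (P1 \x P2)%E f = cE P1 (fun x => cE P2 (fun y => f (x, y))).
Proof.
move=> [f1 f2]; have [h1 e1] := Ex_fubini P1 P2 f1.
by have [h2 e2] := Ex_fubini P1 P2 f2; split => //; rewrite /cE e1 e2.
Qed.

Section IndicatorExtension.
Import HBSimple HBNNSimple.
Context {R : realType}.
Context {d1} {T1 : measurableType d1} (P1 : probability T1 R).
Context {d2} {T2 : measurableType d2} (P2 : probability T2 R).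
Context {dS} {S : measurableType dS} (Z1 : T1 -> S) (Z2 : T2 -> S).
Variables (A1 : T1 -> R[i]) (A2 : T2 -> R[i]).
Hypotheses (mZ1 : measurable_fun setT Z1) (mZ2 : measurable_fun setT Z2).
Hypotheses (bA1 : cbm A1) (bA2 : cbm A2).
Hypothesis indicE : forall E : set S, measurable E ->
  cE P1 (fun w => (\1_E (Z1 w))%:C%C * A1 w) =
  cE P2 (fun w => (\1_E (Z2 w))%:C%C * A2 w).

Let comp_bmeas d (T : measurableType d) (Z : T -> S) (f : S -> R) :
  measurable_fun setT Z -> bmeas f -> bmeas (fun w => f (Z w)).
Proof.
move=> mZ [mf [M fM]]; split; first exact: measurableT_comp mf mZ.
by exists M.
Qed.

Let nnsfun_case (g : {nnsfun S >-> R}) :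
  cE P1 (fun w => (g (Z1 w))%:C%C * A1 w) =
  cE P2 (fun w => (g (Z2 w))%:C%C * A2 w).
Proof.
pose s : seq R := finmap.enum_fset (fset_set (range g)).
have gE x : (g x)%:C%C =
    \sum_(y <- s) (y%:C%C * (\1_(g @^-1` [set y]) x)%:C%C) :> R[i].
  rewrite {1}fimfunE fsbig_finite//= rmorph_sum/=.
  by apply: eq_bigr => y _; rewrite rmorphM.
have bi d (T : measurableType d) (Z : T -> S) y : measurable_fun setT Z ->
    cbm (fun w => (\1_(g @^-1` [set y]) (Z w))%:C%C : R[i]).
  by move=> mZ; apply: cbm_real; apply: comp_bmeas => //; exact: bmeas_indic.
transitivity (\sum_(y <- s) y%:C%C * cE P1
    (fun w => (\1_(g @^-1` [set y]) (Z1 w))%:C%C * A1 w)).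
  under eq_fun do rewrite gE mulr_suml.
  rewrite cE_sum; last first.
    by move=> y; apply: cbmM => //; apply: cbmM; [exact: cbm_cst|exact: bi].
  apply: eq_bigr => y _; rewrite -cEZ; last by apply: cbmM => //; exact: bi.
  by under eq_fun do rewrite -mulrA.
under eq_bigr do rewrite indicE//.
symmetry; under eq_fun do rewrite gE mulr_suml.
rewrite cE_sum; last first.
  by move=> y; apply: cbmM => //; apply: cbmM; [exact: cbm_cst|exact: bi].
apply: eq_bigr => y _; rewrite -cEZ; last by apply: cbmM => //; exact: bi.
by under eq_fun do rewrite -mulrA.
Qed.

Let pos_case (f : S -> R) : bmeas f -> (forall x, 0 <= f x) ->
  cE P1 (fun w => (f (Z1 w))%:C%C * A1 w) =
  cE P2 (fun w => (f (Z2 w))%:C%C * A2 w).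
Proof.
move=> bf f0; have [mf [M fM]] := bf.
have mEf : measurable_fun setT (EFin \o f) by exact/measurable_EFinP.
pose g n := nnsfun_approx measurableT mEf n.
have gf n x : g n x <= f x.
  by rewrite -lee_fin /g nnsfun_approxE; apply: le_approx => // y _; rewrite lee_fin.
have gcvg x : g n x @[n --> \oo] --> f x.
  have := @cvg_nnsfun_approx _ _ _ _ measurableT _ mEf (fun y _ => f0 y) x I.
  by move=> /fine_cvg; rewrite /=.
have gM n x : `|g n x| <= M.
  by rewrite ger0_norm// (le_trans (gf _ _))// (le_trans _ (fM x))// ler_norm.
have bg n : bmeas (g n) by apply: (bmeas_le (M := M)).
suff key d (T : measurableType d) (P : probability T R) (Z : T -> S) A :
    measurable_fun setT Z -> cbm A ->
    ccvg (fun n => cE P (fun w => (g n (Z w))%:C%C * A w))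
      (cE P (fun w => (f (Z w))%:C%C * A w)).
  have := key _ _ P1 _ _ mZ1 bA1; under [X in ccvg X _ -> _]eq_fun do rewrite nnsfun_case.
  by move=> h; apply: ccvg_unique h (key _ _ P2 _ _ mZ2 bA2).
move=> mZ bA; have [N AN] := cbm_bound bA.
apply: (@cE_dct _ _ _ _ _ _ (M * N)).
- by move=> n; apply: cbmM => //; apply: cbm_real; exact: comp_bmeas.
- move=> n w; rewrite ComplexField.Normc.normcM normc_real.
  by rewrite ler_pM ?normc_ge0.
- by apply: cbmM => //; apply: cbm_real; exact: comp_bmeas.
- apply: aeW => w; apply: ccvgM; last exact: ccvg_cst.
  by split; [exact: gcvg|exact: cvg_cst].
Qed.

Let real_case (f : S -> R) : bmeas f ->
  cE P1 (fun w => (f (Z1 w))%:C%C * A1 w) =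
  cE P2 (fun w => (f (Z2 w))%:C%C * A2 w).
Proof.
move=> bf; have [mf [M fM]] := bf.
have bM : bmeas (fun=> `|M| : R) by move=> ? ?; exact: bmeas_cst.
have := @pos_case (fun x => f x + `|M|) (bmeasD bf (bM _ _)).
have h d (T : measurableType d) (P : probability T R) (Z : T -> S) A :
    measurable_fun setT Z -> cbm A ->
    cE P (fun w => (f (Z w) + `|M|)%:C%C * A w) =
    cE P (fun w => (f (Z w))%:C%C * A w) + cE P (fun w => `|M|%:C%C * A w).
  move=> mZ bA; rewrite -cED.
  - by congr (cE P _); apply/funext => w; rewrite -mulrDl -rmorphD.
  - by apply: cbmM => //; apply: cbm_real; exact: comp_bmeas.
  - by apply: cbmM => //; exact: cbm_cst.
rewrite !h// => /(_ _)/wrap[x|].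
  move: (fM x) => /ler_normlP[h1 h2].
  by rewrite -lerBlDr sub0r lerNl (le_trans h1)// ler_norm.
have := @pos_case (fun=> `|M|) (bM _ _) (fun=> normr_ge0 _) => ->.
exact: addIr.
Qed.

(** Both sides are linear in [f] and continuous under bounded pointwise limits,
    so it suffices to know the identity for indicators: pass to simple
    functions, to nonnegative bounded functions, and then split [f] into real
    and imaginary parts. *)
Lemma cE_indic_ext (f : S -> R[i]) : cbm f ->
  cE P1 (fun w => f (Z1 w) * A1 w) = cE P2 (fun w => f (Z2 w) * A2 w).
Proof.
move=> [f1 f2].
have h d (T : measurableType d) (P : probability T R) (Z : T -> S) A :
    measurable_fun setT Z -> cbm A -> cE P (fun w => f (Z w) * A w) =
    cE P (fun w => (Re (f (Z w)))%:C%C * A w) +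
    'i%C * cE P (fun w => (Im (f (Z w)))%:C%C * A w).
  move=> mZ bA.
  have b1 : cbm (fun w => (Re (f (Z w)))%:C%C * A w).
    by apply: cbmM => //; apply: cbm_real; exact: (comp_bmeas mZ f1).
  have b2 : cbm (fun w => (Im (f (Z w)))%:C%C * A w).
    by apply: cbmM => //; apply: cbm_real; exact: (comp_bmeas mZ f2).
  rewrite -cEZ// -cED//; last by apply: cbmM => //; exact: cbm_cst.
  congr (cE P _); apply/funext => w; rewrite mulrA -mulrDl; congr (_ * _).
  by apply: complex_eq; rewrite ?ReD ?ImD ?ReM ?ImM /=; ring.
by rewrite !h// (real_case f1) (real_case f2).
Qed.

End IndicatorExtension.

(** * Uniform polynomial approximation in several variables *)

Section Bernstein.
Context {R : realType}.

(** The expectation of [g] at a binomial variable with parameters [n] and [x],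
    in the recursive form that conditions on one trial. *)
Fixpoint bern (n : nat) (g : nat -> R) (x : R) : R :=
  if n is n'.+1 then x * bern n' (fun k => g k.+1) x + (1 - x) * bern n' g x
  else g 0%N.

Lemma bern_cst n c x : bern n (fun=> c) x = c.
Proof. by elim: n => //= n ->; ring. Qed.

Lemma bernD n g h x : bern n (fun k => g k + h k) x = bern n g x + bern n h x.
Proof. by elim: n g h => //= n ih g h; rewrite !ih; ring. Qed.

Lemma bernZ n c g x : bern n (fun k => c * g k) x = c * bern n g x.
Proof. by elim: n g => //= n ih g; rewrite !ih; ring. Qed.

Lemma bern_le n g h x : 0 <= x <= 1 -> (forall k, (k <= n)%N -> g k <= h k) ->
  bern n g x <= bern n h x.
Proof.
move=> /andP[x0 x1]; elim: n g h => [|n ih] g h gh /=; first exact: gh.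
apply: lerD; apply: ler_wpM2l; rewrite ?subr_ge0//; apply: ih => k kn.
  exact: gh.
by apply: gh; rewrite leqW.
Qed.

Lemma bern_sqr n x a :
  bern n (fun k => (k%:R - a) ^+ 2) x = n%:R * x * (1 - x) + (n%:R * x - a) ^+ 2.
Proof.
elim: n a => [|n ih] a /=; first by ring.
have -> : bern n (fun k => (k.+1%:R - a) ^+ 2) x =
    bern n (fun k => (k%:R - (a - 1)) ^+ 2) x.
  by congr (bern n _ x); apply/funext => k; rewrite -natr1; ring.
by rewrite !ih -natr1; ring.
Qed.

Lemma bern_variance n x : 0 <= x <= 1 ->
  bern n.+1 (fun k => (k%:R / n.+1%:R - x) ^+ 2) x <= n.+1%:R^-1.
Proof.
move=> /andP[x0 x1]; have n0 : n.+1%:R != 0 :> R by rewrite pnatr_eq0.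
have -> : (fun k : nat => (k%:R / n.+1%:R - x) ^+ 2) =
    (fun k : nat => (n.+1%:R ^- 2) * (k%:R - n.+1%:R * x) ^+ 2) :> (nat -> R).
  by apply/funext => k; field.
rewrite bernZ bern_sqr subrr expr0n /= addr0.
rewrite [leLHS](_ : _ = n.+1%:R^-1 * (x * (1 - x))); last by field.
by rewrite ger_pMr ?invr_gt0// mulr_ile1// ?subr_ge0// gerBl.
Qed.

(** The expectation of [F] at the list of independent binomial variables with
    parameters [n] and the entries of [xs]. *)
Fixpoint mbern (n : nat) (F : seq nat -> R) (xs : seq R) : R :=
  if xs is x :: xs' then bern n (fun k => mbern n (fun ks => F (k :: ks)) xs') x
  else F [::].

Definition unit_seq (xs : seq R) := all (fun x => 0 <= x <= 1) xs.

Lemma mbern_le n F G xs : unit_seq xs ->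
  (forall ks, size ks = size xs -> all (leq^~ n) ks -> F ks <= G ks) ->
  mbern n F xs <= mbern n G xs.
Proof.
elim: xs F G => [|x xs ih] F G /=; first by move=> _; apply.
move=> /andP[x01 xs01] FG; apply: bern_le => // k kn; apply: ih => // ks sks aks.
by apply: FG => /=; rewrite ?sks// kn.
Qed.

Lemma mbern_cst n c xs : mbern n (fun=> c) xs = c.
Proof.
elim: xs => //= x xs ih; rewrite -[RHS](bern_cst n c x).
by congr (bern n _ x); apply/funext => k.
Qed.

Lemma mbernD n F G xs :
  mbern n (fun ks => F ks + G ks) xs = mbern n F xs + mbern n G xs.
Proof.
elim: xs F G => //= x xs ih F G; rewrite -bernD.
by congr (bern n _ x); apply/funext => k; rewrite ih.
Qed.

Lemma mbernZ n c F xs : mbern n (fun ks => c * F ks) xs = c * mbern n F xs.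
Proof.
elim: xs F => //= x xs ih F; rewrite -bernZ.
by congr (bern n _ x); apply/funext => k; rewrite ih.
Qed.

Lemma mbern_nth n g xs i : (i < size xs)%N ->
  mbern n (fun ks => g (nth 0%N ks i)) xs = bern n g (nth 0 xs i).
Proof.
elim: xs i => [//|x xs ih] [|i] /= si.
  by congr (bern n _ x); apply/funext => k; rewrite mbern_cst.
under eq_fun do rewrite ih//.
by rewrite bern_cst.
Qed.

Lemma mbern_sum n m (F : nat -> seq nat -> R) xs :
  mbern n (fun ks => \sum_(i < m) F i ks) xs = \sum_(i < m) mbern n (F i) xs.
Proof.
elim: m => [|m ih].
  by under eq_fun do rewrite big_ord0; rewrite big_ord0 mbern_cst.
by under eq_fun do rewrite big_ord_recr; rewrite big_ord_recr/= mbernD ih.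
Qed.

Lemma mbern_norm_le n F G xs : unit_seq xs ->
  (forall ks, size ks = size xs -> all (leq^~ n) ks -> `|F ks| <= G ks) ->
  `|mbern n F xs| <= mbern n G xs.
Proof.
move=> xs01 FG; rewrite ler_norml; apply/andP; split.
  rewrite -mulN1r -mbernZ; apply: mbern_le => // ks sks aks.
  by have := FG _ sks aks; rewrite ler_norml mulN1r => /andP[].
apply: mbern_le => // ks sks aks.
by have := FG _ sks aks; rewrite ler_norml => /andP[].
Qed.

Lemma mbern_norm n F xs M : unit_seq xs -> (forall ks, `|F ks| <= M) ->
  `|mbern n F xs| <= M.
Proof.
move=> xs01 FM; rewrite -[leRHS](mbern_cst n _ xs).
exact: mbern_norm_le.
Qed.

(** Every class of functions that contains the constants and is closed under
    sums and products contains the Bernstein polynomials in its elements. *)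
Lemma mbern_class (X : Type) (Q : (X -> R) -> Prop) n F (s : seq (X -> R)) :
  (forall c, Q (fun=> c)) ->
  (forall f g, Q f -> Q g -> Q (fun x => f x + g x)) ->
  (forall f g, Q f -> Q g -> Q (fun x => f x * g x)) ->
  (forall i, (i < size s)%N -> Q (nth (fun=> 0) s i)) ->
  Q (fun x => mbern n F [seq f x | f <- s]).
Proof.
move=> Qc QD QM; elim: s F => [|f s ih] F Qs /=; first exact: Qc.
have Qf : Q f by exact: (Qs 0%N).
have {}ih F' : Q (fun x => mbern n F' [seq f x | f <- s]).
  by apply: ih => i si; exact: (Qs i.+1).
suff H k (g : nat -> X -> R) : (forall j, Q (g j)) ->
    Q (fun x => bern k (fun j => g j x) (f x)) by exact: H.
elim: k g => [|k ihk] g Qg /=; first exact: Qg.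
apply: (QD _ _); apply: (QM _ _) => //; first exact: (ihk (fun j => g j.+1)).
  by apply: (QD _ _) => //; under eq_fun do rewrite -mulN1r; exact: (QM _ _).
exact: ihk.
Qed.

Definition row_of m (xs : seq R) : 'rV[R]_m := \row_(i < m) nth 0 xs i.

Lemma unit_cube_compact m :
  compact [set v : 'rV[R]_m | forall i, 0 <= v ord0 i <= 1].
Proof.
have := @rV_compact R m (fun=> `[0, 1]%classic) (fun=> @segment_compact R 0 1).
by congr compact; apply/seteqP; split => v h i; have := h i; rewrite /= in_itv.
Qed.

(** Uniform continuity on the unit cube: the sets of admissible radii at the
    points of a compact set have a common element. *)
Lemma cube_unif_continuous m (f : 'rV[R]_m -> R) (e : R) : continuous f ->
  0 < e -> exists2 dt : R, 0 < dt & forall v w : 'rV[R]_m,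
    (forall i, 0 <= v ord0 i <= 1) -> (forall i, `|v ord0 i - w ord0 i| < dt) ->
    `|f v - f w| <= e.
Proof.
move=> cf e0.
have := @unit_cube_compact m; rewrite compact_near_coveringP => nc.
have : \forall dt \near 0^'+, [set v : 'rV[R]_m | forall i, 0 <= v ord0 i <= 1]
    `<=` (fun v => forall w : 'rV[R]_m, ball v dt w -> `|f v - f w| <= e).
  apply: nc => v _.
  have /cvgrPdist_lt/(_ _ (divr_gt0 e0 (ltr0n _ 2))) := cf v.
  rewrite -nbhs_ballE => -[r /= r0 rv].
  exists (ball v (r / 2), [set dt | 0 < dt < r / 2]) => /=.
    split; first by apply: nbhsx_ballx; rewrite divr_gt0.
    by near=> dt; apply/andP; split; near: dt;
      [exact: nbhs_right_gt|apply: nbhs_right_lt; rewrite divr_gt0].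
  move=> [u dt] /= [vu /andP[dt0 dtr]] w uw.
  have h1 : `|f v - f u| < e / 2.
    by apply: rv; apply: le_ball vu; lra.
  have h2 : `|f v - f w| < e / 2.
    apply: rv; rewrite [r]splitr; apply: ball_triangle vu _.
    by apply: le_ball uw; exact: ltW.
  rewrite [e]splitr (_ : f u - f w = (f v - f w) - (f v - f u)); last by ring.
  by rewrite (le_trans (ler_normB _ _))// lerD// ltW.
move=> h.
have : \forall dt \near 0^'+, (0 < dt) /\ [set v : 'rV[R]_m | forall i, 0 <= v ord0 i <= 1]
    `<=` (fun v => forall w : 'rV[R]_m, ball v dt w -> `|f v - f w| <= e).
  by apply: filterI => //; exact: nbhs_right_gt.
move=> /filter_ex[dt [dt0 hdt]]; exists dt => // v w v01 vw.
apply: hdt => //; split=> // i j; rewrite (ord1 i); exact: vw.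
Unshelve. all: by end_near. Qed.

(** Chebyshev's inequality for binomial variables controls the weight of the
    grid points that are far from [xs]. *)
Lemma mbern_approx m (f : 'rV[R]_m -> R) (M e : R) : continuous f ->
  (forall v, `|f v| <= M) -> 0 < e ->
  exists n, forall xs, size xs = m -> unit_seq xs ->
    `|f (row_of m xs) - mbern n (fun ks => f (row_of m [seq k%:R / n%:R | k : nat <- ks])) xs|
      <= e.
Proof.
move=> cf fM e0.
have M0 : 0 <= M by rewrite (le_trans _ (fM 0)).
have [dt dt0 hdt] := cube_unif_continuous cf (divr_gt0 e0 (ltr0n _ 2)).
pose C := 2 * M / dt ^+ 2.
have C0 : 0 <= C by apply: divr_ge0; [exact: mulr_ge0|exact: sqr_ge0].
pose n := Num.truncn (C * m%:R / (e / 2)).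
exists n.+1 => xs sxs xs01.
pose g ks := f (row_of m [seq k%:R / n.+1%:R | k : nat <- ks]).
rewrite -[X in `|X - _|](mbern_cst n.+1 _ xs) -mulN1r -mbernZ -mbernD.
pose D i (ks : seq nat) := (((nth 0%N ks i)%:R : R) / n.+1%:R - nth 0 xs i) ^+ 2.
have D0 i ks : 0 <= D i ks by exact: sqr_ge0.
have key ks : size ks = size xs -> all (leq^~ n.+1) ks ->
    `|f (row_of m xs) + -1 * g ks| <= e / 2 + C * \sum_(i < m) D i ks.
  move=> sks aks; rewrite mulN1r.
  have [h|] := pselect (forall i : 'I_m, `|nth 0 xs i - (nth 0%N ks i)%:R / n.+1%:R| < dt).
    rewrite -[leLHS]addr0; apply: lerD; last by rewrite mulr_ge0// sumr_ge0.
    apply: hdt => i; rewrite !mxE.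
      by move/all_nthP : xs01; apply; rewrite sxs.
    by rewrite (nth_map 0%N) ?sks ?sxs// h.
  move=> /existsNP[i /negP]; rewrite -leNgt => hi.
  apply: (@le_trans _ _ (2 * M)).
    rewrite (le_trans (ler_normB _ _))// mulr_natl mulr2n.
    by apply: lerD; exact: fM.
  rewrite -[leLHS]add0r lerD ?divr_ge0 ?(ltW e0)//.
  rewrite (bigD1 i)//= mulrDr -[leLHS]addr0; apply: lerD; last first.
    by rewrite mulr_ge0// sumr_ge0.
  rewrite (_ : 2 * M = C * dt ^+ 2); last first.
    by rewrite /C divfK// expf_neq0// gt_eqF.
  apply: ler_wpM2l => //; rewrite /D -[leRHS]real_normK ?num_real// distrC.
  by rewrite ler_pXn2r// nnegrE ?normr_ge0// ltW.
apply: (le_trans (mbern_norm_le xs01 key)).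
rewrite mbernD mbern_cst mbernZ mbern_sum [leRHS]splitr lerD2l.
apply: (@le_trans _ _ (C * (m%:R / n.+1%:R))).
  apply: ler_wpM2l => //; rewrite mulr_natl -[in leRHS](card_ord m) -sumr_const.
  apply: ler_sum => i _; have si : (i < size xs)%N by rewrite sxs.
  have -> := mbern_nth n.+1 (fun k => (k%:R / n.+1%:R - nth 0 xs i) ^+ 2) si.
  by apply: bern_variance; move/all_nthP : xs01; exact.
have h : C * m%:R / (e / 2) < n.+1%:R by apply: truncnS_gt.
rewrite mulrA ler_pdivrMr// [leRHS]mulrC -ler_pdivrMr ?divr_gt0//; exact: ltW.
Qed.

End Bernstein.

Section TrigonometricPolynomials.
Context {R : realType}.

Definition trig_poly m (F : ('I_m -> R) -> R) :=
  exists s : seq (R[i] * ('I_m -> R)), forall x,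
    (F x)%:C%C = \sum_(p <- s) p.1 * cis (\sum_i p.2 i * x i).

Lemma trig_poly_cst m c : trig_poly (fun _ : 'I_m -> R => c).
Proof.
exists [:: (c%:C%C, fun=> 0)] => x; rewrite big_seq1 /=.
by rewrite big1 ?cis0 ?mulr1// => i _; rewrite mul0r.
Qed.

Lemma trig_polyD m (F G : ('I_m -> R) -> R) : trig_poly F -> trig_poly G ->
  trig_poly (fun x => F x + G x).
Proof.
by move=> [s Fs] [t Gt]; exists (s ++ t) => x; rewrite big_cat rmorphD/= Fs Gt.
Qed.

Lemma trig_polyM m (F G : ('I_m -> R) -> R) : trig_poly F -> trig_poly G ->
  trig_poly (fun x => F x * G x).
Proof.
move=> [s Fs] [t Gt].
exists [seq (p.1 * q.1, fun i => p.2 i + q.2 i) | p <- s, q <- t] => x.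
rewrite rmorphM/= Fs Gt big_allpairs_dep/= mulr_suml; apply: eq_bigr => p _.
rewrite mulr_sumr; apply: eq_bigr => q _; rewrite mulrACA -cisD -big_split/=.
by congr (_ * cis _); apply: eq_bigr => i _; rewrite mulrDl.
Qed.

Lemma trig_poly_sin m c (i : 'I_m) : trig_poly (fun x => sin (c * x i)).
Proof.
have E x y : \sum_j (if j == i then y else 0) * x j = y * x i :> R.
  by rewrite (bigD1 i)//= eqxx big1 ?addr0// => j /negPf ->; rewrite mul0r.
exists [:: ((0 -i* 2^-1)%C, fun j => if j == i then c else 0);
           ((0 +i* 2^-1)%C, fun j => if j == i then - c else 0)] => x.
rewrite !big_cons big_nil /= !E mulNr /cis cosN sinN addr0.
by apply: complex_eq; rewrite ?ReD ?ImD ?ReM ?ImM /=; field.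
Qed.

Lemma continuous_row_map m (h : R -> R) : continuous h ->
  continuous (fun v : 'rV[R]_m => \row_i h (v ord0 i)).
Proof.
move=> ch v.
rewrite /continuous_at.
pose F := nbhs (v : 'rV[R]_m).
have FF : ProperFilter F by exact: nbhs_pfilter.
change ((fun v0 : 'rV[R]_m => \row_i h (v0 ord0 i)) @ F --> (\row_i h (v ord0 i) : 'rV[R]_m)).
apply/cvg_ballP => e e0.
 near=> w; split=> // i j.
rewrite !mxE; move: j; near: w; apply: filter_forall => j.
have : h (w ord0 j) @[w --> v] --> h (v ord0 j).
  by apply: continuous_comp; [exact: coord_continuous|exact: ch].
by move=> /cvg_ballP/(_ _ e0); apply.
Unshelve. all: by end_near. Qed.

(** On the cube, [f] is a continuous function of the bounded coordinates
    [(1 + sin (c x_i)) / 2] with [c] so small that the sine is injective; its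
    Bernstein polynomial in these coordinates is a trigonometric polynomial that
    keeps the bound of [f] everywhere. *)
Lemma trig_approx m (f : 'rV[R]_m -> R) (M r e : R) : continuous f ->
  (forall v, `|f v| <= M) -> 0 < r -> 0 < e ->
  exists F : ('I_m -> R) -> R, [/\ trig_poly F, forall x, `|F x| <= M &
    forall x, (forall i, `|x i| <= r) -> `|f (\row_i x i) - F x| <= e].
Proof.
move=> cf fM r0 e0; have pi0 := pi_gt0 R.
pose c : R := pi / (4 * r); have c0 : 0 < c by rewrite divr_gt0// mulr_gt0.
pose K : R := sin (pi / 4).
have K0 : 0 <= K by apply: sin_ge0_pi; apply/andP; split; lra.
have K1 : K < 1.
  rewrite -(@sin_pihalf R) /K ltr_sin// ?in_itv/=; try (apply/andP; split); lra.
pose clip (y : R) := Num.max (- K) (Num.min K y).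
have clipK y : - K <= clip y <= K.
  by rewrite /clip le_max lexx/= ge_max ge_min lexx/= andbT; lra.
have clip_id y : - K <= y <= K -> clip y = y.
  by move=> /andP[h1 h2]; rewrite /clip min_r// max_r.
pose h (y : R) := asin (clip (2 * y - 1)) / c.
have cclip : continuous clip.
  move=> y; apply: (@continuous_max _ _ (fun=> - K)); first exact: cvg_cst.
  by apply: (@continuous_min _ _ (fun=> K) id); [exact: cvg_cst|exact: cvg_id].
have ch : continuous h.
  have c1 : continuous (fun y : R => clip (2 * y - 1)).
    move=> y; apply: (@continuous_comp _ _ _ (fun y : R => 2 * y - 1) clip); last exact: cclip.
    by apply: cvgB; [apply: cvgMr; exact: cvg_id|exact: cvg_cst].
  have c2 : continuous (fun y : R => asin (clip (2 * y - 1))).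
    move=> y; apply: (@continuous_comp _ _ _ (fun y : R => clip (2 * y - 1)) asin); first exact: c1.
    by apply: continuous_asin; have /andP[h1 h2] := clipK (2 * y - 1); apply/andP; split; lra.
  by move=> y; apply: cvgMl; exact: c2.
pose g (v : 'rV[R]_m) := f (\row_i h (v ord0 i)).
have cg : continuous g.
  by move=> v; apply: continuous_comp; [exact: continuous_row_map|exact: cf].
have [n gn] := mbern_approx cg (fun v => fM _) e0.
pose s (i : 'I_m) (x : 'I_m -> R) := (1 + sin (c * x i)) / 2.
pose S := [seq s i | i <- enum 'I_m].
have sS : size S = m by rewrite size_map size_enum_ord.
pose b ks := g (row_of m [seq k%:R / n%:R | k : nat <- ks]).
exists (fun x => mbern n b [seq t x | t <- S]).
have S01 x : unit_seq [seq t x | t <- S].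
  rewrite /unit_seq all_map; apply/allP => t /mapP[i _ ->] /=.
  by have := sin_geN1 (c * x i); have := sin_le1 (c * x i); rewrite /s; lra.
split.
- apply: mbern_class.
  + exact: trig_poly_cst.
  + exact: trig_polyD.
  + exact: trig_polyM.
  + move=> i; rewrite sS => im.
    rewrite (nth_map (Ordinal im)) ?size_enum_ord// (nth_ord_enum _ (Ordinal im)).
    apply: trig_polyM; last exact: trig_poly_cst.
    by apply: trig_polyD; [exact: trig_poly_cst|exact: trig_poly_sin].
- by move=> x; apply: mbern_norm => // ks; exact: fM.
- move=> x xr; have := gn [seq t x | t <- S] _ (S01 x).
  rewrite size_map => /(_ sS); congr (`|_ - _| <= _).
  congr f; apply/rowP => i; rewrite !mxE.
  have im : (i < size S)%N by rewrite sS.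
  rewrite (nth_map (fun=> 0)) ?sS// (nth_map i) ?size_enum_ord// nth_ord_enum.
  have cx : - (pi / 4) <= c * x i <= pi / 4.
    rewrite -ler_norml normrM (gtr0_norm c0).
    rewrite (_ : pi / 4 = c * r); last by rewrite /c; field; rewrite gt_eqF.
    by rewrite ler_pM2l.
  rewrite /h (_ : 2 * s i x - 1 = sin (c * x i)); last by rewrite /s; field.
  rewrite clip_id.
    have -> : asin (sin (c * x i)) = c * x i.
      by move/andP: cx => [h1 h2]; rewrite sinK// in_itv/=; apply/andP; split; lra.
    by rewrite mulrC mulKf// gt_eqF.
  have sin_le (y z : R) : - (pi / 2) <= y -> y <= z -> z <= pi / 2 -> sin y <= sin z.
    move=> h1; rewrite le_eqVlt => /predU1P[-> //|yz] h2; apply: ltW.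
    by rewrite ltr_sin// in_itv/=; apply/andP; split => //; lra.
  by move/andP: cx => [h1 h2]; rewrite /K -sinN; apply/andP; split; apply: sin_le; lra.
Qed.

End TrigonometricPolynomials.

(** * Characteristic functions of normal distributions *)

Section Density.
Import HBSimple HBNNSimple.
Context {R : realType} {d : measure_display} {T : measurableType d}.
Variables (mu : {measure set T -> \bar R}) (P : probability T R) (p : T -> R).
Hypothesis mp : measurable_fun setT p.
Hypothesis p0 : forall x, 0 <= p x.
Hypothesis Pp : forall A, measurable A -> (P A = \int[mu]_(x in A) (p x)%:E)%E.

Lemma ge0_integral_density (f : T -> R) : measurable_fun setT f ->
  (forall x, 0 <= f x) ->
  (\int[P]_x (f x)%:E = \int[mu]_x (f x * p x)%:E)%E.
Proof.
move=> mf f0.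
have mEf : measurable_fun setT (EFin \o f) by exact/measurable_EFinP.
pose h := nnsfun_approx measurableT mEf.
have hf x : EFin (h n x) @[n --> \oo] --> (f x)%:E.
  by apply: (@cvg_nnsfun_approx _ _ _ _ measurableT _ mEf) => // y _; rewrite lee_fin.
have nd n m : (n <= m)%N -> forall x, h n x <= h m x.
  by move=> nm x; exact/lefP/nd_nnsfun_approx.
have e1 : (\int[P]_x (h n x)%:E @[n --> \oo] --> \int[P]_x (f x)%:E)%E.
  have -> : (\int[P]_x (f x)%:E = \int[P]_x (limn (fun n => (h n x)%:E)))%E.
    by apply: eq_integral => x _; apply/esym/cvg_lim.
  apply: cvg_monotone_convergence => //.
  - by move=> n; exact/measurable_EFinP.
  - by move=> n x _; rewrite lee_fin.
  - by move=> x _ n m nm; rewrite lee_fin nd.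
have e2 : (\int[mu]_x (h n x * p x)%:E @[n --> \oo] --> \int[mu]_x (f x * p x)%:E)%E.
  have -> : (\int[mu]_x (f x * p x)%:E = \int[mu]_x (limn (fun n => (h n x * p x)%:E)))%E.
    apply: eq_integral => x _; apply/esym/cvg_lim => //.
    apply: cvg_EFin; first exact: nearW.
    by apply: cvgMl; have /fine_cvg := hf x.
  apply: cvg_monotone_convergence => //.
  - by move=> n; apply/measurable_EFinP; exact: measurable_funM.
  - by move=> n x _; rewrite lee_fin mulr_ge0.
  - by move=> x _ n m nm; rewrite lee_fin ler_wpM2r// nd.
suff e3 n : (\int[P]_x (h n x)%:E = \int[mu]_x (h n x * p x)%:E)%E.
  rewrite -(cvg_lim _ e1)// -(cvg_lim _ e2)//.
  by under eq_fun do rewrite e3.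
move: (h n) => g.
transitivity (\sum_(y \in range g) y%:E * P (g @^-1` [set y]))%E.
  by rewrite integralT_nnsfun sintegralE.
have gE x : (g x * p x)%:E = (\sum_(y \in range g) (y * (\1_(g @^-1` [set y]) x * p x))%:E)%E.
  rewrite {1}(fimfunE g x) fsbig_finite//= [RHS]fsbig_finite//=.
  rewrite mulr_suml sumEFin; congr EFin; apply: eq_bigr => y _.
  by rewrite mulrA.
have mi y : measurable_fun setT (fun x => \1_(g @^-1` [set y]) x * p x).
  by apply: measurable_funM => //; exact: measurable_indic.
under [RHS]eq_integral do rewrite gE.
rewrite ge0_integral_fsum//; last 2 first.
- by move=> y; apply/measurable_EFinP; apply: measurable_funM => //; exact: measurable_cst.
- move=> y x _; have [/= [t _ <-]|/= yg] := pselect (range g y).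
    by rewrite lee_fin !mulr_ge0.
  rewrite indicE memNset ?mul0r ?mulr0//= => gxy; apply: yg.
  by exists x.
apply: eq_fsbigr => y; rewrite inE => -[t _ <-].
under [RHS]eq_integral do rewrite EFinM.
rewrite ge0_integralZl//; last 3 first.
- exact/measurable_EFinP.
- by move=> x _; rewrite lee_fin mulr_ge0.
- by rewrite lee_fin.
congr (_ * _)%E; rewrite Pp// integral_mkcond; apply: eq_integral => x _.
rewrite /patch indicE; case: ifPn => _; first by rewrite mul1r.
by rewrite mul0r.
Qed.

Lemma Ex_density (f : T -> R) : bmeas f ->
  mu.-integrable setT (fun x => (f x * p x)%:E) /\
  Ex P f = Rintegral mu setT (fun x => f x * p x).
Proof.
move=> bf; have [mf [M fM]] := bf.
have M0 : 0 <= M by rewrite (le_trans _ (fM point)).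
have ip : mu.-integrable setT (EFin \o p).
  apply/integrableP; split; first exact/measurable_EFinP.
  under eq_integral do rewrite /= ger0_norm//.
  by rewrite -Pp// probability_setT ltry.
have iM : mu.-integrable setT (fun x => (M * p x)%:E).
  by under eq_fun do rewrite EFinM; exact: integrableZl.
have ifp : mu.-integrable setT (fun x => (f x * p x)%:E).
  apply: le_integrable iM => //.
    by apply/measurable_EFinP; exact: measurable_funM.
  move=> x _; rewrite /= lee_fin !normrM (ger0_norm M0) (ger0_norm (p0 x)).
  by rewrite ler_wpM2r.
split => //.
have fM0 x : 0 <= f x + M.
  by have := fM x; rewrite ler_norml => /andP[h _]; rewrite -lerBlDr sub0r.
have bM : bmeas (fun=> M : R) by move=> ? ?; exact: bmeas_cst.
have eM : M = fine (\int[mu]_x (M * p x)%:E)%E.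
  under eq_integral do rewrite EFinM.
  by rewrite integralZl// -Pp// (probability_setT P) mule1.
have ifM : mu.-integrable setT (fun x => ((f x + M) * p x)%:E).
  by under eq_fun do rewrite mulrDl EFinD; exact: integrableD.
have -> : Ex P f = Ex P (fun x => f x + M) - M.
  by rewrite ExD// Ex_cst addrK.
rewrite {1}/Ex /Rintegral ge0_integral_density//; last exact: measurable_funD.
rewrite [X in _ - X = _]eM -fineB; [|exact: integrable_fin_num..].
rewrite -integralB//.
by congr fine; apply: eq_integral => x _; rewrite /= -EFinB mulrDl addrK.
Qed.

End Density.

Section NormalCharacteristicFunction.
Context {R : realType}.
Local Notation mu := (@lebesgue_measure R).
Variables (s : R) (s0 : 0 < s).

Let p (x : R) := normal_pdf 0 s x.

Let k := (s ^+ 2 *+ 2)^-1.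

Let k0 : 0 < k.
Proof. by rewrite invr_gt0 mulrn_wgt0// exprn_gt0. Qed.

Let pE x : p x = normal_peak s * expR (- (k * x ^+ 2)).
Proof.
rewrite /p normal_pdfE ?gt_eqF// /normal_fun subr0.
by congr (_ * expR _); rewrite /k mulNr mulrC.
Qed.

Let dp (x : R) : is_derive x (1 : R) p (- (2 * k * x * p x)).
Proof.
have -> : p = (fun x => normal_peak s * expR (- (k * x ^+ 2))).
  by apply/funext => y; exact: pE.
apply: is_derive_eq; rewrite /GRing.scale/=.
ring.
Qed.

Let mp : measurable_fun setT p. Proof. exact: measurable_normal_pdf. Qed.

(* The density with variance doubled dominates [x * p x]. *)
Let xp_le : exists C, forall x, `|x * p x| <= C * normal_pdf 0 (s * Num.sqrt 2) x.
Proof.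
pose t := s * Num.sqrt 2; have t0 : t != 0 by rewrite mulf_neq0 ?gt_eqF// sqrtr_gt0.
exists ((1 + 2 / k) * normal_peak s / normal_peak t) => x.
have px : 0 <= p x := normal_pdf_ge0 _ _ _.
rewrite normrM (ger0_norm px) pE normal_pdfE// /normal_fun subr0.
have -> : - x ^+ 2 / (t ^+ 2 *+ 2) = - (k * x ^+ 2) / 2.
  rewrite /t exprMn sqr_sqrtr// /k; field.
  by rewrite gt_eqF.
rewrite -/t [leRHS]mulrA divfK ?gt_eqF ?normal_peak_gt0// -mulrA.
rewrite mulrCA [leRHS]mulrCA; apply: ler_wpM2l; first exact: normal_peak_ge0.
have -> : expR (- (k * x ^+ 2)) = expR (- (k * x ^+ 2) / 2) * expR (- (k * x ^+ 2) / 2).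
  by rewrite -expRD; congr expR; field.
rewrite mulrA; apply: ler_wpM2r; first exact: expR_ge0.
rewrite mulNr expRN ler_pdivrMr ?expR_gt0//.
have h := expR_ge1Dx (k * x ^+ 2 / 2).
apply: (@le_trans _ _ ((1 + 2 / k) * (1 + k * x ^+ 2 / 2))); last first.
  by apply: ler_wpM2l => //; rewrite addr_ge0// divr_ge0// ltW.
have -> : (1 + 2 / k) * (1 + k * x ^+ 2 / 2) = 1 + x ^+ 2 + 2 / k + k * x ^+ 2 / 2.
  by field; rewrite gt_eqF.
have h1 : 0 <= 2 / k by rewrite divr_ge0// ltW.
have h2 : 0 <= k * x ^+ 2 / 2 by rewrite divr_ge0// mulr_ge0 ?sqr_ge0// ltW.
have h3 : `|x| <= 1 + x ^+ 2 by rewrite -[x ^+ 2]real_normK ?num_real//; have := normr_ge0 x; nra.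
by lra.
Qed.

Variable th : R.

Let f (u x : R) := cos (u * x + th) * p x.

Let df (u x : R) : is_derive u (1 : R) (f ^~ x) (- (x * sin (u * x + th) * p x)).
Proof.
rewrite /f; apply: is_derive_eq; rewrite /GRing.scale/=.
ring.
Qed.

Let dg (u x : R) : is_derive x (1 : R) (fun x : R => sin (u * x + th) * p x)
  (u * (cos (u * x + th) * p x) - 2 * k * (x * sin (u * x + th) * p x)).
Proof.
have h := dp x.
apply: is_derive_eq; rewrite /GRing.scale/=.
ring.
Qed.

Let ip : mu.-integrable setT (EFin \o p).
Proof. by apply: integrable_normal_pdf; rewrite gt_eqF. Qed.

Let dominated (g : R -> R) (C : R) : measurable_fun setT g ->
  (forall x, `|g x| <= C * p x) -> mu.-integrable setT (EFin \o g).
Proof.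
move=> mg gC.
have iC : mu.-integrable setT (fun x => (C * p x)%:E).
  by under eq_fun do rewrite EFinM; exact: integrableZl.
apply: le_integrable iC => //; first exact/measurable_EFinP.
by move=> x _ /=; rewrite lee_fin (le_trans (gC x))// ler_norm.
Qed.

Let dominatedx (g : R -> R) : measurable_fun setT g ->
  (forall x, `|g x| <= `|x * p x|) -> mu.-integrable setT (EFin \o g).
Proof.
move=> mg gC; have [C hC] := xp_le.
have iC : mu.-integrable setT (fun x => (C * normal_pdf 0 (s * Num.sqrt 2) x)%:E).
  under eq_fun do rewrite EFinM; apply: integrableZl => //.
  by apply: integrable_normal_pdf; rewrite mulf_neq0 ?gt_eqF// sqrtr_gt0.
apply: le_integrable iC => //; first exact/measurable_EFinP.
by move=> x _ /=; rewrite lee_fin (le_trans (gC x))// (le_trans (hC x))// ler_norm.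
Qed.

Let maff u : measurable_fun setT (fun x : R => u * x + th).
Proof. by apply: measurable_funD => //; exact: measurable_funM. Qed.

Let mcos u : measurable_fun setT (fun x : R => cos (u * x + th)).
Proof. exact: measurableT_comp measurable_cos (maff u). Qed.

Let msin u : measurable_fun setT (fun x : R => sin (u * x + th)).
Proof. exact: measurableT_comp measurable_sin (maff u). Qed.

Let if_ u : mu.-integrable setT (EFin \o f u).
Proof.
apply: (@dominated _ 1); first by apply: measurable_funM => //; exact: mcos.
move=> x; rewrite normrM mul1r (ger0_norm (normal_pdf_ge0 _ _ _)).
by rewrite ler_piMl ?normal_pdf_ge0// ler_norml cos_geN1 cos_le1.
Qed.

Let ixs u : mu.-integrable setT (EFin \o (fun x => x * sin (u * x + th) * p x)).
Proof.
apply: dominatedx.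
  by apply: measurable_funM => //; apply: measurable_funM => //; exact: msin.
move=> x; rewrite mulrAC normrM ler_piMr//.
by rewrite ler_norml sin_geN1 sin_le1.
Qed.

Let F u := Rintegral mu setT (f u).
Let G u := Rintegral mu setT (fun x => x * sin (u * x + th) * p x).

Let dF u : is_derive u (1 : R) F (- G u).
Proof.
have [C hC] := xp_le.
pose D (x : R) := `|x * p x|.
have iD : mu.-integrable setT (EFin \o D).
  apply: dominatedx => [|x]; last by rewrite normr_id.
  by apply: measurableT_comp => //; exact: measurable_funM.
have I1 : `]u - 1, u + 1[%classic u by rewrite /= in_itv/=; lra.
have d1E v y : partial1of2 f v y = - (y * sin (v * y + th) * p y).
  by rewrite partial1of2E; have := df v y => h; rewrite derive_val.
have dD v y : `|partial1of2 f v y| <= D y.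
  rewrite d1E normrN mulrAC normrM ler_piMr//.
  by rewrite ler_norml sin_geN1 sin_le1.
have D0 y : 0 <= D y by exact: normr_ge0.
have dv v y : derivable (f ^~ y) v 1 by have [] := df v y.
split; first exact: (@derivable_under_integral R _ _ mu f setT measurableT u _ _ I1
  (fun v _ => if_ v) (fun v y _ _ => dv v y) D D0 iD (fun v y _ _ => dD v y)).
rewrite -derive1E (@differentiation_under_integral R _ _ mu f setT measurableT u _ _ I1
  (fun v _ => if_ v) (fun v y _ _ => dv v y) D D0 iD (fun v y _ _ => dD v y)).
rewrite /G -[LHS](_ : Rintegral mu setT (fun y => -1 * (y * sin (u * y + th) * p y)) = _).
  by rewrite RintegralZl// mulN1r.
by apply: eq_Rintegral => y _; rewrite d1E mulN1r.
Qed.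

(* Integration by parts: the boundary terms vanish at infinity. *)
Let ibp u : u * F u = 2 * k * G u.
Proof.
pose g' x := u * f u x - 2 * k * (x * sin (u * x + th) * p x).
have i1 : mu.-integrable setT (EFin \o (fun x => u * f u x)).
  by rewrite /comp; under eq_fun do rewrite EFinM; exact: (integrableZl measurableT _ (if_ u)).
have i2 : mu.-integrable setT (EFin \o (fun x => 2 * k * (x * sin (u * x + th) * p x))).
  by rewrite /comp; under eq_fun do rewrite EFinM; exact: (integrableZl measurableT _ (ixs u)).
have ig : mu.-integrable setT (EFin \o g').
  by rewrite /comp /g'; under eq_fun do rewrite EFinB; exact: (integrableB measurableT i1 i2).
suff : Rintegral mu setT g' = 0.
  rewrite /g' RintegralB// !RintegralZl// => /eqP; rewrite subr_eq0 => /eqP//.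
pose g x := sin (u * x + th) * p x.
have dg' x : is_derive x (1 : R) g (g' x) by exact: dg.
have cg' : continuous g'.
  move=> x; apply: cvgB.
    apply: cvgMr; apply: cvgM; last by apply: continuous_normal_pdf; rewrite gt_eqF.
    apply: (@continuous_comp _ _ _ (fun x : R => u * x + th) cos); last exact: continuous_cos.
    by apply: cvgD; [apply: cvgMr; exact: cvg_id|exact: cvg_cst].
  apply: cvgMr; apply: cvgM; last by apply: continuous_normal_pdf; rewrite gt_eqF.
  apply: cvgM; first exact: cvg_id.
  apply: (@continuous_comp _ _ _ (fun x : R => u * x + th) sin); last exact: continuous_sin.
  by apply: cvgD; [apply: cvgMr; exact: cvg_id|exact: cvg_cst].
have cg : continuous g.
  by move=> x; apply: differentiable_continuous; apply/derivable1_diffP; have [] := dg' x.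
have ftc (n : nat) : (\int[mu]_(x in `[(- n.+1%:R)%R, n.+1%:R]) (g' x)%:E =
    (g n.+1%:R)%:E - (g (- n.+1%:R))%:E)%E.
  apply: continuous_FTC2.
  - by rewrite gtrN.
  - exact: continuous_subspaceT.
  - split=> [x _||]; first by have [] := dg' x.
    + by apply/cvg_at_right_filter; exact: cg.
    + by apply/cvg_at_left_filter; exact: cg.
  - by move=> x _; rewrite derive1E; have := dg' x => h; rewrite derive_val.
pose I (n : nat) := `[(- n.+1%:R : R), n.+1%:R]%classic.
have mI n : measurable (I n) by exact: measurable_itv.
have [_ _ lim1] : [/\ mu.-integrable setT (EFin \o g'),
    [sequence (\int[mu]_x (`| ((EFin \o g') \_ (I n)) x - (g' x)%:E |))%E]_n @ \oo --> 0%E &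
    [sequence (\int[mu]_x (((EFin \o g') \_ (I n)) x))%E]_n @ \oo --> (\int[mu]_x (g' x)%:E)%E].
  apply: (@dominated_convergence _ _ _ mu setT measurableT _ _ (fun x => `|g' x|%:E)).
  - move=> n; apply/(measurable_restrictT _ (mI n)); apply: measurable_funTS.
    by have /integrableP[] := ig.
  - by have /integrableP[] := ig.
  - apply: aeW => x _.
    apply: cvg_near_cst.
    exists (Num.truncn `|x|) => // n /= xn; rewrite /patch ifT//.
    rewrite inE /I /= in_itv/= -ler_norml.
    apply: (@le_trans _ _ (Num.truncn `|x|).+1%:R); first exact/ltW/truncnS_gt.
    by rewrite ler_nat.
  - exact: (integrable_norm ig).
  - apply: aeW => x n _; rewrite /patch; case: ifP => _ //=.
    by rewrite normr0 lee_fin.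
have lim2 : (g n.+1%:R - g (- n.+1%:R)) @[n --> \oo] --> (0 : R).
  have gb (n : nat) (x : R) : `|x| = n.+1%:R -> `|g x| <= normal_peak s / k * n.+1%:R^-1.
    move=> xn; have px : 0 <= p x := normal_pdf_ge0 _ _ _.
    apply: (@le_trans _ _ (p x)).
      rewrite normrM (ger0_norm px) ler_piMl//.
      by rewrite ler_norml sin_geN1 sin_le1.
    rewrite pE -mulrA; apply: ler_wpM2l; first exact: normal_peak_ge0.
    rewrite -invfM expRN lef_pV2 ?posrE ?expR_gt0 ?mulr_gt0//.
    rewrite -[x ^+ 2]real_normK ?num_real// xn.
    apply: (@le_trans _ _ (k * n.+1%:R ^+ 2)).
      by rewrite ler_pM2l// expr2 ler_peMr// ler1n.
    by apply: le_trans (expR_ge1Dx _); rewrite lerDr.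
  apply: norm_cvg0.
  apply: (@squeeze_cvgr _ _ _ _ (cst 0) (fun n => 2 * (normal_peak s / k) * harmonic n)).
  - apply: nearW => n /=; rewrite normr_ge0/= (le_trans (ler_normB _ _))//.
    have h1 := gb n n.+1%:R (ger0_norm (ler0n _ _)).
    have h2 := gb n (- n.+1%:R); rewrite normrN ger0_norm// in h2; have {}h2 := h2 erefl.
    by rewrite -mulrA mulr_natl mulr2n lerD.
  - exact: cvg_cst.
  - by rewrite -[X in _ --> X](mulr0 (2 * (normal_peak s / k))); apply: cvgMr; exact: cvg_harmonic.
rewrite /Rintegral.
have e n : (\int[mu]_x (((EFin \o g') \_ (I n)) x) = (g n.+1%:R - g (- n.+1%:R))%:E)%E.
  by rewrite -integral_mkcond; exact: ftc.
move: lim1; rewrite /=; under eq_fun do rewrite e.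
have -> : (\int[mu]_x (g' x)%:E = (Rintegral mu setT g')%:E)%E.
  by rewrite /Rintegral fineK//; exact: integrable_fin_num.
move=> /fine_cvg lim1.
exact: (cvg_unique _ lim1 lim2).
Qed.

Let FE u : F u = cos th * expR (- ((s * u) ^+ 2 / 2)).
Proof.
have kE : (2 * k)^-1 = s ^+ 2 by rewrite /k; field; rewrite gt_eqF.
pose H v := F v * expR ((s * v) ^+ 2 / 2).
have dH v : is_derive v (1 : R) H 0.
  have h := dF v; rewrite /H; apply: is_derive_eq.
  rewrite /GRing.scale/=.
  have -> : G v = s ^+ 2 * (v * F v).
    by rewrite ibp -kE mulKf// mulf_neq0// gt_eqF.
  by field.
have h0 : H u = H 0 by exact: is_derive_0_is_cst.
have F0 : F 0 = cos th.
  rewrite /F /f; under eq_Rintegral do rewrite mul0r add0r.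
  rewrite RintegralZl// /Rintegral integral_normal_pdf ?mulr1// gt_eqF//.
rewrite /H F0 mulr0 expr0n /= mul0r expR0 mulr1 in h0.
by rewrite -h0 -mulrA -expRD subrr expR0 mulr1.
Qed.

(** As a function of [u] the integral satisfies [F' u = - s ^+ 2 * u * F u]:
    differentiate under the integral sign and integrate by parts. *)
Lemma Ex_normal_cos u :
  Ex (normal_prob 0 s) (fun x => cos (u * x + th)) = cos th * expR (- ((s * u) ^+ 2 / 2)).
Proof.
have p0 x : 0 <= p x by exact: normal_pdf_ge0.
have bc : bmeas (fun x => cos (u * x + th)).
  by split=> //; exists 1 => x; rewrite ler_norml cos_geN1 cos_le1.
rewrite -FE.
by have [_ ->] := @Ex_density _ _ _ mu (normal_prob 0 s) p mp p0 (fun A mA => erefl) _ bc.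
Qed.

End NormalCharacteristicFunction.

Lemma normal_cf {R : realType} (s u : R) : 0 < s ->
  cE (normal_prob 0 s) (fun x => cis (u * x)) = (expR (- ((s * u) ^+ 2 / 2)))%:C%C.
Proof.
move=> s0; apply: complex_eq; rewrite /cE/=.
  have := @Ex_normal_cos R s s0 0 u; rewrite cos0 mul1r => <-.
  by congr Ex; apply/funext => x; rewrite addr0.
have := @Ex_normal_cos R s s0 (- (pi / 2)) u; rewrite cosN cos_pihalf mul0r; apply: eq_trans.
congr Ex; apply/funext => x; by rewrite cosD cosN cos_pihalf mulr0 sub0r sinN sin_pihalf mulrN mulr1 opprK.
Qed.

(** * Convergence in distribution from characteristic functions *)

Lemma Ex_fubini_swap {R : realType} {d1 d2} {T1 : measurableType d1}
    {T2 : measurableType d2} (P1 : probability T1 R) (P2 : probability T2 R)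
    (f : T1 * T2 -> R) : bmeas f ->
  bmeas (fun y => Ex P1 (fun x => f (x, y))) /\
  Ex P1 (fun x => Ex P2 (fun y => f (x, y))) =
  Ex P2 (fun y => Ex P1 (fun x => f (x, y))).
Proof.
move=> bf; have [mf [M fM]] := bf.
have fi : (P1 \x P2)%E.-integrable setT (EFin \o f) by exact: bmeas_integrable.
have bx y : bmeas (fun x => f (x, y)).
  split; last by exists M.
  exact: measurableT_comp mf (pair2_measurable y).
have E y : (\int[P1]_x (f (x, y))%:E = (Ex P1 (fun x => f (x, y)))%:E)%E.
  by rewrite EFin_Ex.
have b1 : bmeas (fun y => Ex P1 (fun x => f (x, y))).
  split.
    have := measurable_fubini_G fi; rewrite /fubini_G => h.
    by apply/measurable_EFinP; apply: eq_measurable_fun h => y _ /=; rewrite E.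
  by exists M => y; apply: Ex_norm.
split => //; have [_ <-] := Ex_fubini P1 P2 bf.
apply: EFin_inj; rewrite -EFin_Ex// -EFin_Ex//.
rewrite -(integral21_prod_meas1 fi); apply: eq_integral => y _.
by rewrite /fubini_G /= E.
Qed.

Lemma ccvg_sum {R : realType} (I : Type) (s : seq I) (u : I -> nat -> R[i])
    (l : I -> R[i]) : (forall i, ccvg (u i) (l i)) ->
  ccvg (fun n => \sum_(i <- s) u i n) (\sum_(i <- s) l i).
Proof.
move=> ul; elim: s => [|i s ih].
  by under [X in ccvg X _]eq_fun do rewrite big_nil; rewrite big_nil; exact: ccvg_cst.
rewrite big_cons; under [X in ccvg X _]eq_fun do rewrite big_cons.
exact: ccvgD.
Qed.

Lemma cvg_bigsum {R : realType} (m : nat) (u : 'I_m -> nat -> R) (l : 'I_m -> R) :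
  (forall i, u i n @[n --> \oo] --> l i) ->
  \sum_i u i n @[n --> \oo] --> \sum_i l i.
Proof.
elim: m u l => [|m ih] u l ul.
  by under eq_fun do rewrite big_ord0; rewrite big_ord0; exact: cvg_cst.
rewrite big_ord_recl; under eq_fun do rewrite big_ord_recl.
by apply: cvgD => //; apply: ih => i; exact: ul.
Qed.

Lemma cvg_bigprod {R : realType} (I : Type) (s : seq I) (u : I -> nat -> R) (l : I -> R) :
  (forall i, u i n @[n --> \oo] --> l i) ->
  \prod_(i <- s) u i n @[n --> \oo] --> \prod_(i <- s) l i.
Proof.
move=> ul; elim: s => [|i s ih].
  by under eq_fun do rewrite big_nil; rewrite big_nil; exact: cvg_cst.
rewrite big_cons; under eq_fun do rewrite big_cons.
exact: cvgM.
Qed.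

Lemma continuous_bigprod {R : realType} (V : topologicalType) (I : Type) (s : seq I)
  (F : I -> V -> R) : (forall i, continuous (F i)) ->
  continuous (fun v => \prod_(i <- s) F i v).
Proof.
move=> cF; elim: s => [|i s ih] v.
  by under [X in continuous_at _ X]eq_fun do rewrite big_nil; exact: cvg_cst.
under [X in continuous_at _ X]eq_fun do rewrite big_cons.
by apply: cvgM; [exact: cF|exact: ih].
Qed.

Section Levy.
Context {R : realType} {m : nat}.

Section RandomVector.
Context {d} {T : measurableType d} (P : probability T R) (Z : 'I_m -> T -> R).
Hypothesis mZ : forall i, measurable_fun setT (Z i).

Lemma measurable_lin_comb (u : 'I_m -> R) :
  measurable_fun setT (fun w => \sum_i u i * Z i w).
Proof.
have h (s : seq 'I_m) : measurable_fun setT (fun w => \sum_(i <- s) u i * Z i w).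
  elim: s => [|i s ih].
    by under eq_fun do rewrite big_nil; exact: measurable_cst.
  under eq_fun do rewrite big_cons; apply: measurable_funD => //.
  by apply: measurable_funM => //; exact: measurable_cst.
by under eq_fun do rewrite -big_enum; exact: h.
Qed.

Lemma cbm_cis_comb (u : 'I_m -> R) : cbm (fun w => cis (\sum_i u i * Z i w)).
Proof. by apply: cbm_cis; exact: measurable_lin_comb. Qed.

Lemma trig_poly_Ex (F : ('I_m -> R) -> R) (s : seq (R[i] * ('I_m -> R))) :
  (forall x, (F x)%:C%C = \sum_(p <- s) p.1 * cis (\sum_i p.2 i * x i)) ->
  bmeas (fun w => F (Z ^~ w)) /\
  (Ex P (fun w => F (Z ^~ w)))%:C%C =
    \sum_(p <- s) p.1 * cE P (fun w => cis (\sum_i p.2 i * Z i w)).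
Proof.
move=> Fs.
have b p : cbm (fun w => p.1 * cis (\sum_i p.2 i * Z i w) : R[i]).
  by apply: cbmM; [exact: cbm_cst|exact: cbm_cis_comb].
split.
  have [b1 _] := cbm_sum s b.
  suff -> : (fun w => F (Z ^~ w)) =
    (fun w => Re (\sum_(p <- s) p.1 * cis (\sum_i p.2 i * Z i w))) by [].
  by apply/funext => w; rewrite -Fs.
rewrite -cE_real; under eq_fun do rewrite Fs; rewrite cE_sum//.
by apply: eq_bigr => p _; rewrite cEZ//; exact: cbm_cis_comb.
Qed.

(** A continuous function of finitely many random variables is a pointwise limit
    of trigonometric polynomials. *)
Lemma bmeas_continuous (f : 'rV[R]_m -> R) M : continuous f ->
  (forall v, `|f v| <= M) -> bmeas (fun w => f (\row_i Z i w)).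
Proof.
move=> cf fM.
have h n : exists F : ('I_m -> R) -> R, [/\ trig_poly F, forall x, `|F x| <= M &
    forall x, (forall i, `|x i| <= n.+1%:R) -> `|f (\row_i x i) - F x| <= n.+1%:R^-1].
  by apply: trig_approx => //; rewrite ?invr_gt0.
pose F n := projT1 (cid (h n)).
have F1 n : trig_poly (F n) by rewrite /F; case: (cid _) => /= ? [].
have F2 n x : `|F n x| <= M by rewrite /F; case: (cid _) => /= ? [].
have F3 n x : (forall i, `|x i| <= n.+1%:R) -> `|f (\row_i x i) - F n x| <= n.+1%:R^-1.
  by rewrite /F; case: (cid _) => /= ? [_ _]; apply.
apply: (@bmeas_lim _ _ _ (fun n w => F n (Z ^~ w)) _ M) => //.
  by move=> n; have [s Fs] := F1 n; have [[]] := trig_poly_Ex Fs.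
move=> w; apply/subr_cvg0; apply: norm_cvg0.
apply: (@squeeze_cvgr _ _ _ _ (cst 0) (@harmonic R)); last 2 first.
- exact: cvg_cst.
- exact: cvg_harmonic.
exists (\max_(i < m) Num.truncn `|Z i w|)%N => // n /= hn.
rewrite normr_ge0/= distrC; apply: (F3 n (Z ^~ w)) => i.
apply: (@le_trans _ _ (Num.truncn `|Z i w|).+1%:R); first exact/ltW/truncnS_gt.
rewrite ler_nat ltnS; apply: leq_trans hn.
exact: (@leq_bigmax _ (fun i => Num.truncn `|Z i w|)).
Qed.

(** [1 - E cos (v x N)] for a standard normal variable [N]: small where [x] is
    small and close to 1 where [x] is large. *)
Definition gauss_gap (v x : R) := 1 - expR (- ((v * x) ^+ 2 / 2)).

Lemma gauss_gap_ge0 v x : 0 <= gauss_gap v x.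
Proof. by rewrite subr_ge0 expR_le1 oppr_le0 divr_ge0 ?sqr_ge0. Qed.

Lemma gauss_gap_le1 v x : gauss_gap v x <= 1.
Proof. by rewrite gerBl expR_ge0. Qed.

Lemma bmeas_gauss_gap v i : bmeas (fun w => gauss_gap v (Z i w)).
Proof.
apply: (bmeas_le (M := 1)).
  apply: measurable_funB => //; apply: measurableT_comp => //; apply: measurable_funN.
  apply: measurable_funM => //; apply: measurable_funX; exact: measurable_funM.
by move=> w; rewrite ger0_norm ?gauss_gap_ge0 ?gauss_gap_le1.
Qed.

(** Averaging the characteristic function over a normal variable controls the
    tails of [Z i]. *)
Lemma Ex_gauss_gap v i : Ex P (fun w => gauss_gap v (Z i w)) =
  1 - Ex (normal_prob 0 1) (fun y => Re (cE P (fun w => cis (v * y * Z i w)))).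
Proof.
have b : bmeas (fun z : T * R => cos (v * z.2 * Z i z.1)).
  apply: (bmeas_comp (h := cos) measurable_cos (M := 1)).
    by move=> x; rewrite ler_norml cos_geN1 cos_le1.
  apply: measurable_funM; first exact: measurable_funM.
  exact: measurableT_comp (mZ i) measurable_fst.
have [bb e] := Ex_fubini_swap P (normal_prob 0 1) b.
rewrite /= in e; rewrite /cE /= -e -[X in X - _](Ex_cst P) -ExB; [|exact: bmeas_cst|].
  congr Ex; apply/funext => w; rewrite /gauss_gap; congr (_ - _).
  have := @Ex_normal_cos R 1 ltr01 0 (v * Z i w); rewrite cos0 !mul1r => <-.
  by congr Ex; apply/funext => y; rewrite addr0 mulrAC.
by have [] := Ex_fubini P (normal_prob 0 1) b.
Qed.

End RandomVector.

Variables (d_ : nat -> measure_display) (T_ : forall n, measurableType (d_ n)).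
Variables (P_ : forall n, probability (T_ n) R) (Z_ : forall n, 'I_m -> T_ n -> R).
Arguments Z_ : clear implicits.
Context {d : measure_display} {T : measurableType d}.
Variables (P : probability T R) (Z : 'I_m -> T -> R).
Hypothesis mZ_ : forall n i, measurable_fun setT (Z_ n i).
Hypothesis mZ : forall i, measurable_fun setT (Z i).
Hypothesis cfcvg : forall u : 'I_m -> R,
  ccvg (fun n => cE (P_ n) (fun w => cis (\sum_i u i * Z_ n i w)))
    (cE P (fun w => cis (\sum_i u i * Z i w))).

Let trig_cvg (F : ('I_m -> R) -> R) : trig_poly F ->
  Ex (P_ n) (fun w => F (fun i => Z_ n i w)) @[n --> \oo] --> Ex P (fun w => F (Z ^~ w)).
Proof.
move=> [s Fs].
have [h _] : ccvg (fun n => (Ex (P_ n) (fun w => F (fun i => Z_ n i w)))%:C%C)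
    (Ex P (fun w => F (Z ^~ w)))%:C%C.
  have [_ ->] := trig_poly_Ex P mZ Fs.
  have -> : (fun n => (Ex (P_ n) (fun w => F (fun i => Z_ n i w)))%:C%C) =
    (fun n => \sum_(p <- s) p.1 * cE (P_ n) (fun w => cis (\sum_i p.2 i * Z_ n i w))).
    by apply/funext => n; have [_ ->] := trig_poly_Ex (P_ n) (@mZ_ n) Fs.
  by apply: ccvg_sum => p; apply: ccvgM; [exact: ccvg_cst|exact: cfcvg].
exact: h.
Qed.

Let gap_cvg v i : Ex (P_ n) (fun w => gauss_gap v (Z_ n i w)) @[n --> \oo] -->
  Ex P (fun w => gauss_gap v (Z i w)).
Proof.
rewrite (Ex_gauss_gap P mZ).
have -> : (fun n => Ex (P_ n) (fun w => gauss_gap v (Z_ n i w))) = (fun n =>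
    1 - Ex (normal_prob 0 1) (fun y => Re (cE (P_ n) (fun w => cis (v * y * Z_ n i w))))).
  by apply/funext => n; rewrite (Ex_gauss_gap (P_ n) (@mZ_ n)).
apply: cvgB; first exact: cvg_cst.
have bb d0 (T0 : measurableType d0) (P0 : probability T0 R) (Z0 : 'I_m -> T0 -> R) :
    (forall i, measurable_fun setT (Z0 i)) ->
    measurable_fun setT (fun y => Re (cE P0 (fun w => cis (v * y * Z0 i w)))) /\
    forall y, `|Re (cE P0 (fun w => cis (v * y * Z0 i w)))| <= 1.
  move=> mZ0.
  have b : bmeas (fun z : T0 * R => cos (v * z.2 * Z0 i z.1)).
    apply: (bmeas_comp (h := cos) measurable_cos (M := 1)).
      by move=> x; rewrite ler_norml cos_geN1 cos_le1.
    apply: measurable_funM; first exact: measurable_funM.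
    exact: measurableT_comp (mZ0 i) measurable_fst.
  have [[h _] _] := Ex_fubini_swap P0 (normal_prob 0 1) b; split => // y.
  apply: Ex_norm => [|w /=]; last by rewrite ler_norml cos_geN1 cos_le1.
  apply: (bmeas_comp (h := cos) measurable_cos (M := 1)).
    by move=> x; rewrite ler_norml cos_geN1 cos_le1.
  exact: measurable_funM.
apply: (@Ex_dct _ _ _ _ _ _ 1).
- by move=> n; have [] := bb _ _ (P_ n) (Z_ n) (@mZ_ n).
- by move=> n y; have [_] := bb _ _ (P_ n) (Z_ n) (@mZ_ n); exact.
- apply: aeW => y; have [h _] := cfcvg (fun j => if j == i then v * y else 0).
  have E (x : 'I_m -> R) : \sum_j (if j == i then v * y else 0) * x j = v * y * x i.
    by rewrite (bigD1 i)//= eqxx big1 ?addr0// => j /negPf ->; rewrite mul0r.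
  have Er d0 (T0 : measurableType d0) (P0 : probability T0 R) (Z0 : 'I_m -> T0 -> R) :
      cE P0 (fun w => cis (v * y * Z0 i w)) =
      cE P0 (fun w => cis (\sum_j (if j == i then v * y else 0) * Z0 j w)).
    by congr cE; apply/funext => w; rewrite E.
  rewrite (Er _ _ P Z).
  have -> : (fun n => Re (cE (P_ n) (fun w => cis (v * y * Z_ n i w)))) =
    (fun n => Re (cE (P_ n) (fun w => cis (\sum_j (if j == i then v * y else 0) * Z_ n j w)))).
    by apply/funext => n; rewrite (Er _ _ (P_ n) (Z_ n)).
  exact: h.
- by have [] := bb _ _ P Z mZ.
Qed.

Let gap_small (e : R) : 0 < e -> exists2 v : R, 0 < v &
  \sum_(i < m) Ex P (fun w => gauss_gap v (Z i w)) < e.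
Proof.
move=> e0.
have h : \sum_(i < m) Ex P (fun w => gauss_gap n.+1%:R^-1 (Z i w)) @[n --> \oo] --> (0 : R).
  rewrite -[X in _ --> X](_ : \sum_(i < m) 0 = _); last by rewrite big1.
  apply: cvg_bigsum => i; rewrite -[X in _ --> X](Ex_cst P).
  apply: (@Ex_dct _ _ _ _ _ _ 1).
  - by move=> n; have [] := bmeas_gauss_gap mZ n.+1%:R^-1 i.
  - by move=> n w; rewrite ger0_norm ?gauss_gap_ge0 ?gauss_gap_le1.
  - apply: aeW => w; rewrite /gauss_gap -[X in _ --> X](subrr 1).
    apply: cvgB; first exact: cvg_cst.
    rewrite -[X in _ --> X](@expR0 R); apply: continuous_cvg; first exact: continuous_expR.
    rewrite -[X in _ --> X]oppr0; apply: cvgN.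
    rewrite -[X in _ --> X](mul0r 2^-1); apply: cvgMl.
    rewrite -[X in _ --> X](_ : (0 * Z i w) ^+ 2 = _); last by rewrite mul0r expr0n.
    by rewrite expr2; under eq_fun do rewrite expr2; apply: cvgM; apply: cvgMl;
      exact: cvg_harmonic.
  - exact: measurable_cst.
have /cvgrPdist_lt/(_ _ e0) := h; move=> /filter_ex[n]; rewrite sub0r normrN => hn.
by exists n.+1%:R^-1; [rewrite invr_gt0|rewrite (le_lt_trans (ler_norm _))].
Qed.

(** The continuity theorem: [f] is close to a trigonometric polynomial on a
    large cube, and outside the cube the error is controlled by the Gaussian
    averages of the characteristic functions. *)
Theorem levy_continuity (f : 'rV[R]_m -> R) (M : R) : continuous f ->
  (forall v, `|f v| <= M) ->
  Ex (P_ n) (fun w => f (\row_i Z_ n i w)) @[n --> \oo] --> Ex P (fun w => f (\row_i Z i w)).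
Proof.
move=> cf fM; have M0 : 0 <= M by rewrite (le_trans _ (fM 0)).
apply/cvgrPdist_le => e e0.
pose C := 4 * M + 1; have C0 : 0 < C by rewrite /C ltr_wpDl// mulr_ge0.
have [v v0 hv] := gap_small (divr_gt0 (divr_gt0 e0 (ltr0n _ 8)) C0).
have r0 : 0 < 2 / v by rewrite divr_gt0.
have [F [F1 F2 F3]] := trig_approx cf fM r0 (divr_gt0 e0 (ltr0n _ 8)).
have key x : `|f (\row_i x i) - F x| <= e / 8 + C * \sum_(i < m) gauss_gap v (x i).
  have [h|] := pselect (forall i, `|x i| <= 2 / v).
    apply: (le_trans (F3 _ h)); rewrite lerDl mulr_ge0 ?(ltW C0)// sumr_ge0// => i _.
    exact: gauss_gap_ge0.
  move=> /existsNP[i /negP]; rewrite -ltNge => hi.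
  apply: (@le_trans _ _ (2 * M)).
    rewrite (le_trans (ler_normB _ _))// mulr_natl mulr2n.
    by apply: lerD; [exact: fM|exact: F2].
  have gi : 1 / 2 <= gauss_gap v (x i).
    have h2 : 2 <= (v * x i) ^+ 2 / 2.
      rewrite ler_pdivlMr// -natrM -[leRHS]real_normK ?num_real// normrM gtr0_norm//.
      have : 2 < v * `|x i| by rewrite mulrC -ltr_pdivrMr.
      by move=> h; rewrite (_ : (2 * 2)%:R = 2 ^+ 2 :> R) ?ler_pXn2r ?nnegrE ?ltW//;
        [exact: lt_trans h|rewrite -natrX].
    have h3 := expR_ge1Dx ((v * x i) ^+ 2 / 2).
    rewrite /gauss_gap expRN lerBrDl -lerBrDr.
    apply: (@le_trans _ _ 2^-1); last by lra.
    by rewrite lef_pV2 ?posrE ?expR_gt0//; lra.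
  have -> : 2 * M = 0 + 4 * M * (1 / 2) by field.
  apply: lerD; first by rewrite divr_ge0// ltW.
  apply: ler_pM; rewrite ?mulr_ge0 ?divr_ge0//; first by rewrite lerDl.
  apply: (le_trans gi); rewrite (bigD1 i)//= lerDl sumr_ge0// => j _.
  exact: gauss_gap_ge0.
have diff d0 (T0 : measurableType d0) (P0 : probability T0 R) (Z0 : 'I_m -> T0 -> R) :
    (forall i, measurable_fun setT (Z0 i)) ->
    `|Ex P0 (fun w => f (\row_i Z0 i w)) - Ex P0 (fun w => F (Z0 ^~ w))| <=
    e / 8 + C * \sum_(i < m) Ex P0 (fun w => gauss_gap v (Z0 i w)).
  move=> mZ0; have bf := bmeas_continuous P0 mZ0 cf fM.
  have bF : bmeas (fun w => F (Z0 ^~ w)).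
    by have [s Fs] := F1; have [] := trig_poly_Ex P0 mZ0 Fs.
  have bS : bmeas (fun w => \sum_(i < m) gauss_gap v (Z0 i w)).
    under eq_fun do rewrite -big_enum; apply: bmeas_sum => i; exact: bmeas_gauss_gap.
  have bC : bmeas (fun w => e / 8 + C * \sum_(i < m) gauss_gap v (Z0 i w)).
    by apply: bmeasD; [exact: bmeas_cst|apply: bmeasM => //; exact: bmeas_cst].
  have -> : e / 8 + C * \sum_(i < m) Ex P0 (fun w => gauss_gap v (Z0 i w)) =
     Ex P0 (fun w => e / 8 + C * \sum_(i < m) gauss_gap v (Z0 i w)).
    rewrite ExD ?Ex_cst ?ExZ//; last 2 first.
      exact: bmeas_cst.
      by apply: bmeasM => //; exact: bmeas_cst.
    congr (_ + _ * _); rewrite -big_enum -Ex_sum; last by move=> i; exact: bmeas_gauss_gap.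
    by congr Ex; apply/funext => w; rewrite big_enum.
  rewrite -ExB// ler_norml; apply/andP; split.
    rewrite -ExN//; apply: Ex_le => //; [exact: bmeasN|exact: bmeasB|].
    by move=> w; have := key (Z0 ^~ w); rewrite ler_norml => /andP[].
  apply: Ex_le => //; first exact: bmeasB.
  by move=> w; have := key (Z0 ^~ w); rewrite ler_norml => /andP[].
have hP := diff _ _ P Z mZ.
have hS : \sum_(i < m) Ex (P_ n) (fun w => gauss_gap v (Z_ n i w)) @[n --> \oo] -->
    \sum_(i < m) Ex P (fun w => gauss_gap v (Z i w)) by apply: cvg_bigsum => i; exact: gap_cvg.
have hv' : C * \sum_(i < m) Ex P (fun w => gauss_gap v (Z i w)) < e / 8.
  by rewrite mulrC -ltr_pdivlMr.
near=> n.
have hn := diff _ _ (P_ n) (Z_ n) (@mZ_ n).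
have hSn : \sum_(i < m) Ex (P_ n) (fun w => gauss_gap v (Z_ n i w)) < e / 8 / C.
  near: n; exact: (cvgr_lt _ hS).
have {}hSn : C * \sum_(i < m) Ex (P_ n) (fun w => gauss_gap v (Z_ n i w)) < e / 8.
  by rewrite mulrC -ltr_pdivlMr.
have hFn : `|Ex P (fun w => F (Z ^~ w)) - Ex (P_ n) (fun w => F (fun i => Z_ n i w))| <= e / 8.
  near: n; have /cvgrPdist_le := trig_cvg F1; apply; by rewrite divr_gt0.
move: hP hn hFn; rewrite !ler_norml => /andP[? ?] /andP[? ?] /andP[? ?].
apply/andP; split; lra.
Unshelve. all: by end_near. Qed.

End Levy.

(** * Uniqueness of laws *)

Section LawUniqueness.
Context {R : realType}.
Context {d1} {T1 : measurableType d1} (P1 : probability T1 R).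
Context {d2} {T2 : measurableType d2} (P2 : probability T2 R).

Definition boxes (I : finType) : set (set (I -> R)) :=
  [set E | exists a : I -> R, E = [set x | forall i, a i < x i]].

(** The sigma-algebra generated by the coordinates is generated by the
    intersections of open half-spaces. *)
Lemma cylinder_boxes (I : finType) E : @cylinder_sigma R I E -> <<s @boxes I >> E.
Proof.
apply: smallest_sub; first exact: smallest_sigma_algebra.
move=> _ [i [A [mA ->]]].
have h : measurable_fun setT ((fun x => x i) : g_sigma_algebraType (@boxes I) -> R).
  apply: (@measurability _ _ (g_sigma_algebraType (@boxes I)) _ setT (fun x : I -> R => x i) _ (RGenOInfty.measurableE R)) => _ [_ [a ->] <-].
  rewrite setTI.
  have -> : (fun x : g_sigma_algebraType (@boxes I) => x i) @^-1` `]a, +oo[%classic =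
    \bigcup_(k in [set: nat]) [set x : I -> R | forall j, (if j == i then a else - k%:R) < x j].
    apply/seteqP; split=> x /=.
      rewrite in_itv/= andbT => ax.
      exists (\max_(j : I) (Num.truncn `|x j|).+1)%N => // j; case: eqP => [-> //|_].
      rewrite ltrNl; apply: (le_lt_trans (y := `|x j|)); first by rewrite -normrN ler_norm.
      apply: (lt_le_trans (truncnS_gt _)); rewrite ler_nat.
      exact: (@leq_bigmax _ (fun j => (Num.truncn `|x j|).+1)).
    by move=> [k _] /(_ i); rewrite eqxx in_itv/= andbT.
  apply: bigcupT_measurable => k; apply: sub_sigma_algebra.
  by exists (fun j => if j == i then a else - k%:R).
by have := h measurableT A mA; rewrite setTI.
Qed.

(** Boxes are stable under finite intersections, and probabilities that agree on
    such a class agree on the sigma-algebra that it generates. *)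
Lemma same_law_boxes (I : finType) (Z1 : I -> T1 -> R) (Z2 : I -> T2 -> R) :
  (forall i, measurable_fun setT (Z1 i)) -> (forall i, measurable_fun setT (Z2 i)) ->
  (forall a : I -> R, P1 [set w | forall i, a i < Z1 i w] =
    P2 [set w | forall i, a i < Z2 i w]) ->
  same_law P1 Z1 P2 Z2.
Proof.
move=> mZ1 mZ2 h E /cylinder_boxes.
have mZ d (T : measurableType d) (Z : I -> T -> R) : (forall i, measurable_fun setT (Z i)) ->
    forall S, <<s @boxes I >> S -> measurable [set w | S (fun i => Z i w)].
  move=> mZ S mS.
  have : measurable_fun setT ((fun w i => Z i w) : T -> g_sigma_algebraType (@boxes I)).
    apply: (@measurability _ _ T (g_sigma_algebraType (@boxes I)) setT _ (@boxes I) erefl) => _ [_ [a ->] <-]; rewrite setTI.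
    have -> : (fun w i => Z i w) @^-1` [set x : I -> R | forall i, a i < x i] =
      \big[setI/setT]_(i : I) (Z i @^-1` `]a i, +oo[%classic).
      apply/seteqP; split=> w /=.
        by move=> aw; rewrite -bigcap_seq => i _ /=; rewrite in_itv/= andbT.
      by rewrite -bigcap_seq => aw i; have := aw i; rewrite /= in_itv/= andbT;
        apply; rewrite mem_index_enum.
    apply: bigsetI_measurable => i _; rewrite -[_ @^-1` _]setTI.
    by apply: mZ => //; exact: measurable_itv.
  by move=> /(_ measurableT S mS); rewrite setTI.
have m1 := mZ _ _ _ mZ1; have m2 := mZ _ _ _ mZ2.
apply: (@dynkin_induction _ (g_sigma_algebraType (@boxes I)) (@boxes I)
  (fun E => P1 [set w | E (fun i => Z1 i w)] = P2 [set w | E (fun i => Z2 i w)])).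
- by [].
- move=> _ _ [a ->] [b ->]; exists (fun i => Num.max (a i) (b i)).
  apply/seteqP; split=> x /=.
    by move=> [ha hb] i; rewrite gt_max ha hb.
  by move=> hab; split=> i; have := hab i; rewrite gt_max => /andP[].
- by rewrite /= !probability_setT.
- by move=> _ [a ->]; exact: h.
- move=> S mS hS; rewrite -[LHS]/(P1 (~` [set w | S (fun i => Z1 i w)])).
  rewrite -[RHS]/(P2 (~` [set w | S (fun i => Z2 i w)])).
  by rewrite !probability_setC ?hS//; [exact: m2|exact: m1].
- move=> F mF tF hF.
  have B d (T : measurableType d) (Z : I -> T -> R) :
      [set w | (\bigcup_k F k) (fun i => Z i w)] = \bigcup_k [set w | F k (fun i => Z i w)].
    by apply/seteqP; split.
  have tr d (T : measurableType d) (Z : I -> T -> R) :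
      trivIset setT (fun k => [set w | F k (fun i => Z i w)]).
    move=> i j _ _ [w [/= h1 h2]]; apply: tF => //.
    by exists (fun i => Z i w).
  have m1' k : measurable [set w | F k (fun i => Z1 i w)] by exact: m1 (mF k).
  have m2' k : measurable [set w | F k (fun i => Z2 i w)] by exact: m2 (mF k).
  have tr1 := tr _ _ Z1; have tr2 := tr _ _ Z2.
  rewrite !B !measure_bigcup//; congr (lim (_ @ \oo)); apply/funext => n.
  by apply: eq_bigr => k _; exact: hF.
Qed.

Let ramp (k : nat) (a x : R) : R := Num.min 1 (k%:R * Num.max 0 (x - a)).

Let ramp01 k a x : 0 <= ramp k a x <= 1.
Proof.
rewrite /ramp le_min ler01/= ge_min lexx/= andbT.
by rewrite mulr_ge0// le_max lexx.
Qed.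

Let continuous_ramp k a : continuous (ramp k a).
Proof.
move=> x; apply: (@continuous_min _ _ (fun=> 1) (fun x => k%:R * Num.max 0 (x - a)) x); first exact: cvg_cst.
apply: cvgMr; apply: (@continuous_max _ _ (fun=> 0) (fun x => x - a)); first exact: cvg_cst.
by apply: cvgB; [exact: cvg_id|exact: cvg_cst].
Qed.

Let ramp_cvg a x : ramp k a x @[k --> \oo] --> ((a < x)%R%:R : R).
Proof.
apply: cvg_near_cst; have [ax|xa] := ltP a x; last first.
  by apply: nearW => k; rewrite /ramp max_l ?subr_le0// mulr0 min_r.
exists (Num.truncn (x - a)^-1).+1 => // k /= hk.
rewrite /ramp max_r ?subr_ge0 ?(ltW ax)// min_l//.
rewrite -ler_pdivrMr ?subr_gt0// mul1r.
by apply: (le_trans (ltW (truncnS_gt _))); rewrite ler_nat.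
Qed.

(** The indicator of an open box is a pointwise limit of products of ramps. *)
Lemma same_law_continuous (I : finType) (Z1 : I -> T1 -> R) (Z2 : I -> T2 -> R) :
  (forall i, measurable_fun setT (Z1 i)) -> (forall i, measurable_fun setT (Z2 i)) ->
  (forall f : 'rV[R]_#|I| -> R, continuous f -> (forall v, `|f v| <= 1) ->
    Ex P1 (fun w => f (\row_j Z1 (enum_val j) w)) =
    Ex P2 (fun w => f (\row_j Z2 (enum_val j) w))) ->
  same_law P1 Z1 P2 Z2.
Proof.
move=> mZ1 mZ2 h; apply: same_law_boxes => // a.
pose g k (v : 'rV[R]_#|I|) := \prod_j ramp k (a (enum_val j)) (v ord0 j).
have g01 k v : 0 <= g k v <= 1.
  rewrite /g; apply/andP; split.
    by apply: prodr_ge0 => j _; have /andP[] := ramp01 k (a (enum_val j)) (v ord0 j).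
  by apply: prodr_ile1 => j _; exact: ramp01.
have gn k v : `|g k v| <= 1 by have /andP[g0 g1] := g01 k v; rewrite ger0_norm.
have cg k : continuous (g k).
  apply: continuous_bigprod => j v.
  apply: (@continuous_comp _ _ _ (fun v : 'rV[R]_#|I| => v ord0 j)); first exact: coord_continuous.
  exact: continuous_ramp.
have lim d (T : measurableType d) (P : probability T R) (Z : I -> T -> R) :
    (forall i, measurable_fun setT (Z i)) ->
    measurable [set w | forall i, a i < Z i w] /\
    Ex P (fun w => g k (\row_j Z (enum_val j) w)) @[k --> \oo] -->
      fine (P [set w | forall i, a i < Z i w]).
  move=> mZ.
  have mA : measurable [set w | forall i, a i < Z i w].
    have -> : [set w | forall i, a i < Z i w] =
      \big[setI/setT]_(i : I) (Z i @^-1` `]a i, +oo[%classic).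
      apply/seteqP; split=> w /=.
        by move=> aw; rewrite -bigcap_seq => i _ /=; rewrite in_itv/= andbT.
      by rewrite -bigcap_seq => aw i; have := aw i; rewrite /= in_itv/= andbT;
        apply; rewrite mem_index_enum.
    apply: bigsetI_measurable => i _; rewrite -[_ @^-1` _]setTI.
    by apply: mZ => //; exact: measurable_itv.
  split => //; rewrite -Ex_indic//.
  have mg k : bmeas (fun w => g k (\row_j Z (enum_val j) w)).
    exact: (bmeas_continuous P (Z := fun j => Z (enum_val j)) (fun j => mZ _) (cg k) (gn k)).
  apply: (@Ex_dct _ _ _ _ _ _ 1) => //.
  - by move=> k; have [] := mg k.
  - apply: aeW => w.
    have -> : \1_[set w | forall i, a i < Z i w] w = \prod_(j < #|I|) (a (enum_val j) < Z (enum_val j) w)%R%:R :> R.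
      rewrite indicE; case: (boolP [forall i, a i < Z i w]) => [/forallP hw|/forallPn[i hi]].
        by rewrite mem_set// big1// => j _; rewrite hw.
      rewrite memNset; last by move=> /(_ i); rewrite (negPf hi).
      by rewrite (bigD1 (enum_rank i))//= enum_rankK (negPf hi) mul0r.
    rewrite /g; under eq_fun do under eq_bigr do rewrite mxE.
    by apply: cvg_bigprod => j; exact: ramp_cvg.
have [mA1 l1] := lim _ _ P1 Z1 mZ1; have [mA2 l2] := lim _ _ P2 Z2 mZ2.
have e : fine (P1 [set w | forall i, a i < Z1 i w]) = fine (P2 [set w | forall i, a i < Z2 i w]).
  move: l1; under eq_fun do rewrite (h _ (cg _) (gn _)).
  by move=> l1; exact: cvg_unique l1 l2.
by rewrite -[LHS]fineK ?fin_num_measure// e fineK ?fin_num_measure.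
Qed.

(** The continuity theorem for a constant sequence. *)
Lemma same_law_cf (I : finType) (Z1 : I -> T1 -> R) (Z2 : I -> T2 -> R) :
  (forall i, measurable_fun setT (Z1 i)) -> (forall i, measurable_fun setT (Z2 i)) ->
  (forall u : I -> R, cE P1 (fun w => cis (\sum_i u i * Z1 i w)) =
    cE P2 (fun w => cis (\sum_i u i * Z2 i w))) ->
  same_law P1 Z1 P2 Z2.
Proof.
move=> mZ1 mZ2 h; apply: same_law_continuous => // f cf f1.
have := @levy_continuity R #|I| (fun=> d1) (fun=> T1) (fun=> P1)
  (fun _ j => Z1 (enum_val j)) d2 T2 P2 (fun j => Z2 (enum_val j))
  (fun _ j => mZ1 _) (fun j => mZ2 _) _ f 1 cf f1.
have E (x : I -> R) (u : 'I_#|I| -> R) :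
    \sum_j u j * x (enum_val j) = \sum_i u (enum_rank i) * x i.
  rewrite (reindex (@enum_val I I)); last by apply: onW_bij; exact: enum_val_bij.
  by apply: eq_bigr => j _; rewrite enum_valK.
move=> H; apply: cvg_unique (H _) => //; first exact: cvg_cst.
move=> u; have -> : cE P2 (fun w => cis (\sum_j u j * Z2 (enum_val j) w)) =
   cE P1 (fun w => cis (\sum_j u j * Z1 (enum_val j) w)); last exact: ccvg_cst.
transitivity (cE P2 (fun w => cis (\sum_i u (enum_rank i) * Z2 i w))).
  by congr cE; apply/funext => w; rewrite (E (Z2 ^~ w)).
by rewrite -h; congr cE; apply/funext => w; rewrite (E (Z1 ^~ w)).
Qed.

End LawUniqueness.

Section LaplaceUniqueness.
Context {R : realType}.
Context {d1} {T1 : measurableType d1} (P1 : probability T1 R).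
Context {d2} {T2 : measurableType d2} (P2 : probability T2 R).
Variables (V1 : T1 -> R) (V2 : T2 -> R).
Hypotheses (mV1 : measurable_fun setT V1) (mV2 : measurable_fun setT V2).
Hypotheses (V1_ge0 : forall w, 0 <= V1 w) (V2_ge0 : forall w, 0 <= V2 w).
Hypothesis laplaceE : forall j : nat,
  Ex P1 (fun w => expR (- (j%:R * V1 w))) = Ex P2 (fun w => expR (- (j%:R * V2 w))).

Let bexp d (T : measurableType d) (V : T -> R) (j : nat) : measurable_fun setT V ->
  (forall w, 0 <= V w) -> bmeas (fun w => expR (- (j%:R * V w))).
Proof.
move=> mV V0; apply: (bmeas_le (M := 1)).
  apply: measurableT_comp => //; apply: measurable_funN; exact: measurable_funM.
by move=> w; rewrite ger0_norm ?expR_ge0// expR_le1 oppr_le0 mulr_ge0.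
Qed.

Let poly_case (p : {poly R}) :
  [/\ bmeas (fun w => p.[expR (- V1 w)]), bmeas (fun w => p.[expR (- V2 w)]) &
  Ex P1 (fun w => p.[expR (- V1 w)]) = Ex P2 (fun w => p.[expR (- V2 w)])].
Proof.
have E x : p.[expR (- x)] = \sum_(j <- index_iota 0 (size p)) p`_j * expR (- (j%:R * x)).
  rewrite horner_coef big_mkord; apply: eq_bigr => j _.
  by rewrite -expRM_natl mulrN.
have b d (T : measurableType d) (V : T -> R) j : measurable_fun setT V ->
    (forall w, 0 <= V w) -> bmeas (fun w => p`_j * expR (- (j%:R * V w))).
  by move=> mV V0; apply: bmeasM; [exact: bmeas_cst|exact: bexp].
split.
- by under eq_fun do rewrite E; apply: bmeas_sum => j; exact: b.
- by under eq_fun do rewrite E; apply: bmeas_sum => j; exact: b.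
under eq_fun do rewrite E; rewrite Ex_sum; last by move=> j; exact: b.
symmetry; under eq_fun do rewrite E; rewrite Ex_sum; last by move=> j; exact: b.
apply: eq_bigr => j _; rewrite !ExZ; [|exact: bexp..].
by rewrite laplaceE.
Qed.

(** A nonnegative law is determined by its Laplace transform at the integers:
    these are the moments of [expR (- V)], which takes values in [[0, 1]], where
    polynomials are dense. *)
Lemma laplace_Ex (h : R -> R) (M : R) : continuous h -> (forall x, `|h x| <= M) ->
  Ex P1 (fun w => h (V1 w)) = Ex P2 (fun w => h (V2 w)).
Proof.
move=> ch hM.
have mh : measurable_fun setT h by exact: continuous_measurable_fun.
have cut (r : nat) : Ex P1 (fun w => h (Num.min (V1 w) r%:R)) =
    Ex P2 (fun w => h (Num.min (V2 w) r%:R)).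
  pose g (y : R) := h (- ln (Num.max y (expR (- r%:R)))).
  have gE x : g (expR (- x)) = h (Num.min x r%:R).
    rewrite /g; congr h; case: (leP x r%:R) => xr.
      by rewrite max_l ?ler_expR ?lerN2// expRK opprK.
    by rewrite max_r ?ler_expR ?lerN2 ?(ltW xr)// expRK opprK.
  have cg : continuous g.
    have c1 : continuous (fun y : R => Num.max y (expR (- r%:R))).
      by move=> y; apply: (@continuous_max _ _ id (fun=> expR (- r%:R)) y); [exact: cvg_id|exact: cvg_cst].
    have c2 : continuous (fun y : R => ln (Num.max y (expR (- r%:R)))).
      move=> y; apply: (@continuous_comp R R R (fun y : R => Num.max y (expR (- r%:R))) (@ln R) y); first exact: c1.
      by apply: continuous_ln; rewrite lt_max expR_gt0 orbT.
    have c3 : continuous (fun y : R => - ln (Num.max y (expR (- r%:R)))).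
      by move=> y; apply: cvgN; exact: c2.
    by move=> y; apply: (@continuous_comp R R R (fun y : R => - ln (Num.max y (expR (- r%:R)))) h y);
      [exact: c3|exact: ch].
  pose G (v : 'rV[R]_1) := g (v ord0 ord0).
  have cG : continuous G.
    by move=> v; apply: (@continuous_comp _ _ _ (fun v : 'rV[R]_1 => v ord0 ord0));
      [exact: coord_continuous|exact: cg].
  apply/eqP; rewrite -subr_eq0 -normr_le0; apply/ler_addgt0Pr => e e0; rewrite add0r.
  have [n hn] := mbern_approx cG (fun v => hM _) (divr_gt0 e0 (ltr0n _ 2)).
  set F := (fun ks : seq nat => _) in hn.
  have [p pE] : exists p : {poly R}, forall x, mbern n F [:: expR (- x)] = p.[expR (- x)].
    apply: (@mbern_class _ R (fun f => exists p : {poly R}, forall x, f x = p.[expR (- x)]) n F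
      [:: fun x => expR (- x)]).
    - by move=> c; exists c%:P => x; rewrite hornerC.
    - by move=> f1 f2 [p1 h1] [p2 h2]; exists (p1 + p2) => x; rewrite hornerD h1 h2.
    - by move=> f1 f2 [p1 h1] [p2 h2]; exists (p1 * p2) => x; rewrite hornerM h1 h2.
    - by case=> //= _; exists 'X => x; rewrite hornerX.
  have near x : 0 <= x -> `|h (Num.min x r%:R) - p.[expR (- x)]| <= e / 2.
    move=> x0; rewrite -gE -pE.
    have := hn [:: expR (- x)] erefl; rewrite /G mxE /=; apply.
    by rewrite /unit_seq /= expR_ge0 expR_le1 oppr_le0 x0.
  have [b1 b2 e12] := poly_case p.
  have bh d (T : measurableType d) (V : T -> R) : measurable_fun setT V ->
      bmeas (fun w => h (Num.min (V w) r%:R)).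
    move=> mV; apply: (bmeas_comp (h := h) mh hM).
    by apply: measurable_minr => //; exact: measurable_cst.
  have d1' : `|Ex P1 (fun w => h (Num.min (V1 w) r%:R)) - Ex P1 (fun w => p.[expR (- V1 w)])| <= e / 2.
    rewrite -ExB//; last exact: bh.
    by apply: Ex_norm => [|w]; [apply: bmeasB => //; exact: bh|exact: near].
  have d2' : `|Ex P2 (fun w => h (Num.min (V2 w) r%:R)) - Ex P2 (fun w => p.[expR (- V2 w)])| <= e / 2.
    rewrite -ExB//; last exact: bh.
    by apply: Ex_norm => [|w]; [apply: bmeasB => //; exact: bh|exact: near].
  rewrite e12 in d1'; move: d1' d2'; rewrite !ler_norml => /andP[? ?] /andP[? ?].
  by apply/andP; split; lra.
have lim d (T : measurableType d) (P : probability T R) (V : T -> R) : measurable_fun setT V ->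
    Ex P (fun w => h (Num.min (V w) r%:R)) @[r --> \oo] --> Ex P (fun w => h (V w)).
  move=> mV; apply: (@Ex_dct _ _ _ _ _ _ M) => //.
  - move=> r; apply: measurableT_comp mh _.
    by apply: measurable_minr => //; exact: measurable_cst.
  - apply: aeW => w; apply: cvg_near_cst; exists (Num.truncn (V w)).+1 => // r /= hr.
    rewrite min_l//; apply: (le_trans (ltW (truncnS_gt _))).
    by rewrite ler_nat.
  - exact: measurableT_comp mh mV.
have l1 := lim _ _ P1 V1 mV1; have l2 := lim _ _ P2 V2 mV2.
move: l1; under eq_fun do rewrite cut.
by move=> l1; exact: cvg_unique l1 l2.
Qed.

End LaplaceUniqueness.

(** * Independence and the Wiener process *)

Lemma cbm_comp {R : realType} {d d'} {T : measurableType d} {S : measurableType d'}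
    (f : S -> R[i]) (Z : T -> S) : cbm f -> measurable_fun setT Z ->
  cbm (fun w => f (Z w)).
Proof.
move=> [[m1 [M1 h1]] [m2 [M2 h2]]] mZ; split; split.
- exact: (@measurableT_comp _ _ _ T S _ (fun x => Re (f x)) setT Z m1 mZ).
- by exists M1.
- exact: (@measurableT_comp _ _ _ T S _ (fun x => Im (f x)) setT Z m2 mZ).
- by exists M2.
Qed.

Section IndependentProduct.
Context {R : realType} {d : measure_display} {T : measurableType d}.
Variable P : probability T R.
Context {I : eqType} (F : I -> set (set T)).
Hypothesis FI : indep_sigma P F.
Hypothesis mF : forall i E, F i E -> measurable E.
Context {dS : I -> measure_display} {S : forall i, measurableType (dS i)}.
Variable Z : forall i, T -> S i.
Arguments Z : clear implicits.
Hypothesis mZ : forall i, measurable_fun setT (Z i).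
Hypothesis FZ : forall i (E : set (S i)), measurable E -> F i (Z i @^-1` E).
Variable f : forall i, S i -> R[i].
Arguments f : clear implicits.
Hypothesis bf : forall i, cbm (f i).

Lemma prod_indic (s : seq I) (G : I -> set T) w :
  \prod_(i <- s) ((\1_(G i) w)%:C%C : R[i]) = (\1_(\big[setI/setT]_(i <- s) G i) w)%:C%C.
Proof.
elim: s => [|i s ih]; first by rewrite !big_nil indicT.
by rewrite !big_cons ih -rmorphM/= indicI.
Qed.

Let cbm_fZ i : cbm (fun w => f i (Z i w)).
Proof.
exact: cbm_comp (bf i) (@mZ i).
Qed.

Let key (s2 s1 : seq I) (G : I -> set T) : uniq (s1 ++ s2) ->
  (forall i, i \in s1 -> F i (G i)) ->
  cE P (fun w => (\prod_(i <- s1) (\1_(G i) w)%:C%C) * \prod_(i <- s2) f i (Z i w)) =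
  (\prod_(i <- s1) (fine (P (G i)))%:C%C) * \prod_(i <- s2) cE P (fun w => f i (Z i w)).
Proof.
elim: s2 s1 G => [|i s2 ih] s1 G.
  rewrite cats0 => us1 FG; rewrite big_nil mulr1.
  under eq_fun do rewrite big_nil mulr1 prod_indic.
  have mG : measurable (\big[setI/setT]_(i <- s1) G i).
    rewrite big_seq; apply: big_ind => //; first exact: measurableI.
    by move=> i /FG; exact: mF.
  rewrite cE_real Ex_indic// FI//.
  have -> : (\prod_(i <- s1) P (G i) = (\prod_(i <- s1) fine (P (G i)))%:E)%E.
    rewrite -prodEFin; rewrite big_seq [RHS]big_seq; apply: eq_bigr => i /FG /mF mGi.
    by rewrite fineK// fin_num_measure.
  by rewrite /= rmorph_prod.
move=> us FG.
pose A1 w := (\prod_(i <- s1) ((\1_(G i) w)%:C%C : R[i])) * \prod_(i <- s2) f i (Z i w).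
pose c := (\prod_(i <- s1) ((fine (P (G i)))%:C%C : R[i])) * \prod_(i <- s2) cE P (fun w => f i (Z i w)).
have is1 : i \notin s1.
  by move: us; rewrite cat_uniq/= negb_or => /and3P[_ /andP[]].
have us' : uniq ((i :: s1) ++ s2).
  by rewrite -(perm_uniq (_ : perm_eq (s1 ++ i :: s2) _))// -cat1s perm_catCA.
have bA1 : cbm A1.
  apply: cbmM; last by apply: cbm_prod => j; exact: cbm_fZ.
  have -> : (fun w => \prod_(i <- s1) ((\1_(G i) w)%:C%C : R[i])) =
    (fun w => (\1_(\big[setI/setT]_(i <- s1) G i) w)%:C%C).
    by apply/funext => w; rewrite prod_indic.
  apply: cbm_indic; rewrite big_seq; apply: big_ind => //; first exact: measurableI.
  by move=> j /FG; exact: mF.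
have := @cE_indic_ext R _ T P _ T P _ (S i) (Z i) (Z i) A1 (fun=> c) (@mZ i) (@mZ i) bA1 (cbm_cst c) _ (f i) (bf i).
rewrite cEZr// big_cons => H.
transitivity (cE P (fun w => f i (Z i w)) * c); last by rewrite /c mulrCA.
rewrite -H.
  by congr cE; apply/funext => w; rewrite big_cons /A1 mulrCA.
move=> E mE.
pose G' j := if j == i then Z i @^-1` E else G j.
have FG' j : j \in i :: s1 -> F j (G' j).
  rewrite inE /G'; case: eqP => [-> _|_ /=]; first exact: FZ.
  exact: FG.
have G'i : G' i = Z i @^-1` E by rewrite /G' eqxx.
have := ih (i :: s1) G' us' FG'.
rewrite big_cons G'i.
have EG (g : set T -> R[i]) : \prod_(j <- s1) g (G' j) = \prod_(j <- s1) g (G j).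
  rewrite big_seq [RHS]big_seq; apply: eq_bigr => j js.
  by rewrite /G'; case: eqP js => // ->; rewrite (negPf is1).
rewrite (EG (fun A => (fine (P A))%:C%C)) => H2.
have mZE : measurable (Z i @^-1` E) by rewrite -[X in measurable X]setTI; exact: mZ.
have -> : (fun w => (\1_E (Z i w))%:C%C * A1 w) =
  (fun w => (\prod_(j <- i :: s1) (\1_(G' j) w)%:C%C) * \prod_(i <- s2) f i (Z i w)).
  apply/funext => w; rewrite big_cons G'i (EG (fun A => (\1_A w)%:C%C)).
  by rewrite /A1 mulrA.
rewrite H2 cEZr; last by apply: cbm_real; apply: bmeas_indic.
rewrite cE_real -mulrA; congr (_%:C%C * _).
by rewrite -Ex_indic.
Qed.

(** Expectations of independent complex functions multiply: replace the
    functions by indicators one after the other. *)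
Lemma cE_indep_prod (s : seq I) : uniq s ->
  cE P (fun w => \prod_(i <- s) f i (Z i w)) =
  \prod_(i <- s) cE P (fun w => f i (Z i w)).
Proof.
move=> us; have := @key s [::] (fun=> setT) us (fun i => _).
rewrite big_nil mul1r => <- //.
by congr cE; apply/funext => w; rewrite big_nil mul1r.
Qed.

End IndependentProduct.

Lemma cE_law {R : realType} {d} {T : measurableType d} (P : probability T R)
    {d'} {T' : measurableType d'} (P' : probability T' R)
    {dS} {S : measurableType dS} (Z : T -> S) (Z' : T' -> S) (f : S -> R[i]) :
  measurable_fun setT Z -> measurable_fun setT Z' ->
  (forall E, measurable E -> P (Z @^-1` E) = P' (Z' @^-1` E)) -> cbm f ->
  cE P (fun w => f (Z w)) = cE P' (fun w => f (Z' w)).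
Proof.
move=> mZ mZ' h bf.
have := @cE_indic_ext R _ T P _ T' P' _ S Z Z' (fun=> 1) (fun=> 1) mZ mZ' (cbm_cst _) (cbm_cst _) _ f bf.
under eq_fun do rewrite mulr1; under [in RHS]eq_fun do rewrite mulr1; apply => E mE.
under eq_fun do rewrite mulr1; under [in RHS]eq_fun do rewrite mulr1.
have m1 : measurable (Z @^-1` E) by rewrite -[X in measurable X]setTI; exact: mZ.
have m2 : measurable (Z' @^-1` E) by rewrite -[X in measurable X]setTI; exact: mZ'.
rewrite !cE_real; congr (_%:C%C); have := congr1 fine (h E mE).
by rewrite -!Ex_indic.
Qed.

(** The indicator selects the steps up to [tau k], and possibly later steps of
    length 0, across which [b] does not change. *)
Lemma telescope_indicator {R : realType} (tau b : nat -> R) (N k : nat) :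
  {homo tau : i j / (i <= j)%N >-> i <= j} -> (k <= N)%N ->
  (forall i j, tau i = tau j -> b i = b j) ->
  \sum_(r < N) (tau r.+1 <= tau k)%R%:R * (b r.+1 - b r) = b k - b 0%N.
Proof.
move=> nd kN hb; rewrite -(subnKC kN) big_split_ord/=.
rewrite [X in _ + X]big1 ?addr0; last first.
  move=> i _; have [h|] := leP (tau (k + i).+1) (tau k); last by rewrite mul0r.
  rewrite mul1r (hb (k + i).+1 (k + i)%N) ?subrr//; apply/eqP; rewrite eq_le.
  by apply/andP; split; [apply: le_trans h _; apply: nd; exact: leq_addr|exact: nd].
rewrite -(telescope_sumr b (leq0n k)) big_mkord; apply: eq_bigr => i _.
by rewrite nd ?mul1r//; exact: ltn_ord.
Qed.

Section WienerCharacteristicFunction.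
Context {R : realType} {d : measure_display} {T : measurableType d}.
Variable P : probability T R.
Variable B : R -> {RV P >-> R}.
Hypothesis wB : wiener P B.

(** The variance of [\sum_i u i * B (t i)]. *)
Definition fdd_variance m (u t : 'I_m -> R) : R :=
  \sum_i \sum_j u i * u j * Num.min (t i) (t j).

Let minc s t : measurable_fun setT (increment B s t).
Proof. by apply: measurable_funB => //. Qed.

Let increment_cf s t g : 0 <= s -> s <= t ->
  cE P (fun w => cis (g * increment B s t w)) = (expR (- (g ^+ 2 * (t - s) / 2)))%:C%C.
Proof.
move=> s0; rewrite le_eqVlt => /predU1P[<-|st].
  rewrite subrr mulr0 mul0r oppr0 expR0 -[RHS](cE_cst P 1).
  by congr cE; apply/funext => w; rewrite /increment subrr mulr0 cis0.
have [_ _ law _] := wB.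
have ts : 0 < Num.sqrt (t - s) by rewrite sqrtr_gt0 subr_gt0.
have mc : cbm (fun x : R => cis (g * x)) by apply: cbm_cis; exact: measurable_funM.
rewrite (@cE_law R _ T P _ _ (normal_prob 0 (Num.sqrt (t - s))) _ _ (increment B s t) id
  (fun x : R => cis (g * x)))//.
  rewrite normal_cf//; congr (_%:C%C); congr (expR (- (_ / 2))).
  by rewrite exprMn sqr_sqrtr ?subr_ge0 ?(ltW st)// mulrC.
by move=> E mE; exact: law.
Qed.

(** Sorting the times turns the linear combination of values into a combination
    of independent increments. *)
Lemma wiener_cf m (u t : 'I_m -> R) : (forall i, 0 <= t i) ->
  cE P (fun w => cis (\sum_i u i * B (t i) w)) =
  (expR (- (fdd_variance u t / 2)))%:C%C.
Proof.
move=> t0.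
pose s := sort <=%R (0 :: [seq t i | i <- enum 'I_m]).
pose N := size s.
pose tau r := nth 0 s (minn r N.-1).
have N0 : (0 < N)%N by rewrite /N size_sort.
have ss : sorted <=%R s by apply: sort_sorted; exact: le_total.
have nd : {homo tau : i j / (i <= j)%N >-> i <= j}.
  move=> i j ij; apply: (sorted_leq_nth le_trans lexx) => //; rewrite ?inE -?/N.
  - by rewrite (leq_ltn_trans (geq_minr _ _))// prednK.
  - by rewrite (leq_ltn_trans (geq_minr _ _))// prednK.
  - by rewrite leq_min geq_minr andbT (leq_trans (geq_minl _ _)).
have ins x : x \in s -> exists2 k, (k <= N)%N & tau k = x.
  move=> xs; have xN : (index x s < N)%N by rewrite index_mem.
  exists (index x s); first exact: ltnW.
  by rewrite /tau (minn_idPl _) ?nth_index// -ltnS prednK.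
have tis i : t i \in s by rewrite mem_sort inE map_f ?orbT// mem_enum.
have tau0 : tau 0%N = 0.
  apply/eqP; rewrite eq_le; apply/andP; split.
    have [|k _ <-] := ins 0; first by rewrite mem_sort inE eqxx.
    exact: nd.
  have : tau 0%N \in s by rewrite /tau min0n mem_nth.
  by rewrite mem_sort inE => /predU1P[->//|/mapP[i _ ->]].
have [Bz Bi _ _] := wB.
have tnd : nondecreasing_times tau by split => //; rewrite tau0.
pose c i r : R := (tau r.+1 <= t i)%R%:R.
pose g r := \sum_i u i * c i r.
transitivity (cE P (fun w => \prod_(r <- index_iota 0 N) cis (g r * increment B (tau r) (tau r.+1) w))).
  apply: cE_ae.
  - apply: cbm_cis; apply: measurable_lin_comb => i; exact: measurable_funPT.
  - apply: cbm_prod => r; apply: cbm_cis; apply: measurable_funM => //; exact: minc.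
  apply: filterS Bz => w Bw0; rewrite -cis_sum; congr cis.
  rewrite big_mkord.
  under [RHS]eq_bigr do rewrite mulr_suml; rewrite exchange_big/=; apply: eq_bigr => i _.
  have [k kN tk] := ins _ (tis i).
  under eq_bigr do rewrite -mulrA.
  rewrite -mulr_sumr; congr (_ * _).
  have := @telescope_indicator R tau (fun r => B (tau r) w) N k nd kN _.
  rewrite tk tau0 Bw0 subr0 => <-; last by move=> a b /= ->.
  by apply: eq_bigr => r _.
rewrite (@cE_indep_prod R _ T P _ _ (Bi _ tnd) _ _ (fun=> R : measurableType _)
  (fun r => increment B (tau r) (tau r.+1)) _ _ (fun r x => cis (g r * x)))//; last 4 first.
- by move=> r _ [A mA <-]; exact: minc.
- by move=> r E mE; exists E => //; rewrite setTI.
- by move=> r; apply: cbm_cis; exact: measurable_funM.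
- exact: iota_uniq.
have tp r : 0 <= tau r by rewrite -[leLHS]tau0; exact: nd.
under eq_bigr => r _ do rewrite (increment_cf (g r) (tp r) (nd _ _ (leqnSn r))).
rewrite -rmorph_prod /= -expR_sum; congr ((expR _)%:C%C).
rewrite sumrN -mulr_suml; congr (- (_ / 2)).
rewrite big_mkord /fdd_variance.
transitivity (\sum_(r < N) \sum_i \sum_j u i * u j * (c i r * c j r * (tau r.+1 - tau r))).
  apply: eq_bigr => r _; rewrite expr2 /g mulr_suml mulr_suml; apply: eq_bigr => i _.
  rewrite mulr_sumr mulr_suml; apply: eq_bigr => j _; ring.
rewrite exchange_big/=; apply: eq_bigr => i _.
rewrite exchange_big/=; apply: eq_bigr => j _.
rewrite -mulr_sumr; congr (_ * _).
have [k kN tk] : exists2 k, (k <= N)%N & tau k = Num.min (t i) (t j).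
  by apply: ins; case: leP.
have := @telescope_indicator R tau tau N k nd kN (fun _ _ => id).
rewrite tk tau0 subr0 => <-; apply: eq_bigr => r _; congr (_ * _).
by rewrite /c le_min; case: (_ <= t i); case: (_ <= t j); rewrite ?mulr0 ?mul0r ?mulr1.
Qed.

End WienerCharacteristicFunction.

(** * A Wiener process with an independent random variance *)

Lemma cE_indep_pair {R : realType} {d} {T : measurableType d} (P : probability T R)
    {d1} {S1 : measurableType d1} {d2} {S2 : measurableType d2}
    (U : T -> S1) (V : T -> S2) (H : S1 * S2 -> R[i]) :
  measurable_fun setT U -> measurable_fun setT V ->
  (forall A C, measurable A -> measurable C ->
    P (U @^-1` A `&` V @^-1` C) = (P (U @^-1` A) * P (V @^-1` C))%E) ->
  cbm H ->
  cbm (fun x => cE P (fun w' => H (x, V w'))) /\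
  cE P (fun w => H (U w, V w)) = cE P (fun w => cE P (fun w' => H (U w, V w'))).
Proof.
move=> mU mV UV bH.
pose U' : {mfun T >-> S1} := mfun_Sub (mem_set mU).
pose V' : {mfun T >-> S2} := mfun_Sub (mem_set mV).
have mUV : measurable_fun setT (fun w => (U w, V w)) by exact: measurable_fun_pair.
pose W : {mfun T >-> (S1 * S2)%type} := mfun_Sub (mem_set mUV).
have law E : measurable E -> P ((fun w => (U w, V w)) @^-1` E) =
    (distribution P U' \x distribution P V')%E (id @^-1` E).
  move=> mE; have := @product_measure_unique _ _ S1 S2 R (distribution P U') (distribution P V') (distribution P W) _ E mE.
  by move=> ->// A C mA mC; rewrite /distribution/= /pushforward/= -UV.
have := @cE_law R _ T P _ _ _ _ _ (fun w => (U w, V w)) id H mUV (@measurable_id _ _ setT) law bH.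
have [b1 ->] := cE_fubini (distribution P U') (distribution P V') bH.
have inner x : cE (distribution P V') (fun y => H (x, y)) = cE P (fun w' => H (x, V w')).
  apply/esym; apply: (@cE_law R _ T P _ _ (distribution P V') _ _ V id (fun y => H (x, y))) => //.
  exact: (cbm_comp bH (pair1_measurable x)).
have E1 : (fun x => cE (distribution P V') (fun y => H (x, y))) =
    (fun x => cE P (fun w' => H (x, V w'))) by apply/funext => x; exact: inner.
rewrite E1 in b1 *; move=> ->; split => //.
apply/esym; apply: (@cE_law R _ T P _ _ (distribution P U') _ _ U id
  (fun x => cE P (fun w' => H (x, V w'))) mU) => //.
Qed.

Lemma cE_prod_fun {R : realType} {d1 d2} {T1 : measurableType d1} {T2 : measurableType d2}
    (P1 : probability T1 R) (P2 : probability T2 R) (f : T1 -> R[i]) (g : T2 -> R[i]) :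
  cbm f -> cbm g ->
  cE (P1 \x P2)%E (fun w => f w.1 * g w.2) = cE P1 f * cE P2 g.
Proof.
move=> bf bg.
have b : cbm (fun w : T1 * T2 => f w.1 * g w.2).
  by apply: cbmM; [exact: (cbm_comp bf measurable_fst)|exact: (cbm_comp bg measurable_snd)].
have [_ ->] := cE_fubini P1 P2 b; rewrite -cEZr//.
by congr cE; apply/funext => x /=; rewrite cEZ.
Qed.

Lemma Ex_expectation {R : realType} {d} {T : measurableType d} (P : probability T R)
    (f : T -> R) (c : R) : ('E_P[f])%E = c%:E -> Ex P f = c.
Proof. by rewrite unlock /Ex /Rintegral => ->. Qed.

Lemma bmeas_laplace {R : realType} {d} {T : measurableType d} (V : T -> R) (theta : R) :
  measurable_fun setT V -> 0 <= theta -> bmeas (fun w => expR (- (theta * `|V w|))).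
Proof.
move=> mV t0; apply: (bmeas_le (M := 1)).
  apply: measurableT_comp => //; apply: measurable_funN; apply: measurable_funM => //.
  exact: measurableT_comp.
by move=> w; rewrite ger0_norm ?expR_ge0// expR_le1 oppr_le0 mulr_ge0.
Qed.

Section StrictStability.
Context {R : realType} {d : measure_display} {T : measurableType d}.
Variables (P : probability T R) (V : T -> R) (a K : R).
Hypothesis mV : measurable_fun setT V.
Hypothesis V_ge0 : forall w, 0 <= V w.
Hypothesis a0 : 0 < a.
Hypothesis laplaceV : forall theta, 0 <= theta ->
  Ex P (fun w => expR (- (theta * V w))) = expR (- (K * theta `^ a)).

(** Both sides have the Laplace transform [exp (- K (A ^ a + C ^ a) theta ^ a)]. *)
Lemma stable_bounded (A C M : R) (h : R -> R) : 0 < A -> 0 < C ->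
  continuous h -> (forall x, `|h x| <= M) ->
  Ex (P \x P)%E (fun w => h (A * V w.1 + C * V w.2)) =
  Ex P (fun w => h ((A `^ a + C `^ a) `^ a^-1 * V w)).
Proof.
move=> A0 C0; set D := (_ `^ a^-1).
have D0 : 0 <= D by exact: powR_ge0.
have Da : D `^ a = A `^ a + C `^ a.
  by rewrite -powRrM mulVf ?gt_eqF// powRr1// addr_ge0 ?powR_ge0.
have m1 : measurable_fun setT (fun w : T * T => A * V w.1).
  by apply: measurable_funM => //; exact: (measurableT_comp mV measurable_fst).
have m2 : measurable_fun setT (fun w : T * T => C * V w.2).
  by apply: measurable_funM => //; exact: (measurableT_comp mV measurable_snd).
apply: (@laplace_Ex R _ _ (P \x P)%E _ T P (fun w => A * V w.1 + C * V w.2)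
  (fun w => D * V w)).
- exact: measurable_funD.
- exact: measurable_funM.
- by move=> w; rewrite addr_ge0// mulr_ge0// ltW.
- by move=> w; rewrite mulr_ge0.
move=> j.
have j0 (c : R) : 0 <= c -> 0 <= j%:R * c by move=> c0; rewrite mulr_ge0.
have -> : (fun w => expR (- (j%:R * (D * V w)))) = (fun w => expR (- (j%:R * D * V w))).
  by apply/funext => w; rewrite mulrA.
rewrite laplaceV ?j0//.
have := @cE_prod_fun R _ _ T T P P (fun w => (expR (- (j%:R * A * V w)))%:C%C)
  (fun w => (expR (- (j%:R * C * V w)))%:C%C).
have b c : 0 <= c -> bmeas (fun w => expR (- (j%:R * c * V w))).
  move=> c0; have := bmeas_laplace mV (j0 _ c0).
  by under eq_fun do rewrite ger0_norm//.
move=> /(_ (cbm_real (b _ (ltW A0))) (cbm_real (b _ (ltW C0)))).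
have -> : (fun w : T * T => (expR (- (j%:R * A * V w.1)))%:C%C * (expR (- (j%:R * C * V w.2)))%:C%C) =
  (fun w : T * T => (expR (- (j%:R * (A * V w.1 + C * V w.2))))%:C%C : R[i]).
  by apply/funext => w; rewrite -rmorphM /= -expRD; congr ((expR _)%:C%C); ring.
rewrite !cE_real -rmorphM /= !laplaceV ?j0 ?(ltW A0) ?(ltW C0)// => -[->].
rewrite -expRD; congr expR; rewrite !powRM ?(ltW A0) ?(ltW C0)// Da; ring.
Qed.

End StrictStability.

Section StableSubordination.
Context {R : realType} {d : measure_display} {T : measurableType d}.
Variable P : probability T R.
Variables (Y : {RV P >-> R}) (B : R -> {RV P >-> R}) (a K : R).
Hypothesis a01 : 0 < a < 1.
Hypothesis K0 : 0 < K.
Hypothesis Y_gt0 : {ae P, forall w, 0 < Y w}.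
Hypothesis Y_laplace : forall theta, 0 <= theta ->
  ('E_P[fun w => expR (- theta * Y w)])%E = (expR (- K * theta `^ a))%:E.

Let mY : measurable_fun setT Y. Proof. exact: measurable_funPT. Qed.

Let a0 : 0 < a. Proof. by case/andP: a01. Qed.

Let Yabs w := `|Y w|.

Let mYabs : measurable_fun setT Yabs. Proof. exact: measurableT_comp. Qed.

Lemma Ex_laplace theta : 0 <= theta ->
  Ex P (fun w => expR (- (theta * `|Y w|))) = expR (- (K * theta `^ a)).
Proof.
move=> t0; rewrite -mulNr -(Ex_expectation (Y_laplace t0)) /Ex /Rintegral; congr fine.
apply: ae_eq_integral => //.
- by have [/measurable_EFinP] := bmeas_laplace mY t0.
- apply/measurable_EFinP; apply: measurableT_comp => //; exact: measurable_funM.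
- by apply: filterS Y_gt0 => w Yw _; rewrite gtr0_norm// mulNr.
Qed.

Lemma cf_abs (u : R) : cE P (fun w => cis (u * Y w)) = cE P (fun w => cis (u * `|Y w|)).
Proof.
apply: cE_ae; [by apply: cbm_cis; exact: measurable_funM..|].
by apply: filterS Y_gt0 => w Yw; rewrite gtr0_norm.
Qed.

Lemma stable_cf (A C u : R) : 0 < A -> 0 < C ->
  cE P (fun w => cis (u * (A * Y w))) * cE P (fun w => cis (u * (C * Y w))) =
  cE P (fun w => cis (u * ((A `^ a + C `^ a) `^ a^-1 * Y w))).
Proof.
move=> A0 C0; set D := (_ `^ a^-1).
have E c : (fun w => cis (u * (c * Y w))) = (fun w => cis (u * c * Y w)).
  by apply/funext => w; rewrite mulrA.
rewrite !E !cf_abs -cE_prod_fun; [|apply: cbm_cis; exact: measurable_funM..].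
have -> : (fun w : T * T => cis (u * A * `|Y w.1|) * cis (u * C * `|Y w.2|)) =
    (fun w => cis (u * (A * `|Y w.1| + C * `|Y w.2|))).
  by apply/funext => w; rewrite -cisD; congr cis; ring.
have -> : (fun w => cis (u * D * `|Y w|)) = (fun w => cis (u * (D * `|Y w|))).
  by apply/funext => w; rewrite mulrA.
have stable := @stable_bounded _ _ _ P Yabs a K mYabs (fun w => normr_ge0 _) a0 Ex_laplace A C 1.
apply: complex_eq => /=.
  apply: (stable (fun x => cos (u * x))) => // x; last by rewrite ler_norml cos_geN1 cos_le1.
  apply: (@continuous_comp _ _ _ (fun x => u * x) cos); last exact: continuous_cos.
  by apply: cvgMr; exact: cvg_id.
apply: (stable (fun x => sin (u * x))) => // x; last by rewrite ler_norml sin_geN1 sin_le1.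
apply: (@continuous_comp _ _ _ (fun x => u * x) sin); last exact: continuous_sin.
by apply: cvgMr; exact: cvg_id.
Qed.

Lemma not_constant (X : T -> R) (c : R) : measurable_fun setT X ->
  P (X @^-1` [set c]) = 1%E -> {ae P, forall w, X w = c}.
Proof.
move=> mX h; exists (~` (X @^-1` [set c])); split.
- by apply: measurableC; rewrite -[X in measurable X]setTI; apply: mX.
- rewrite probability_setC ?h ?subee//.
  by rewrite -[X in measurable X]setTI; apply: mX.
- by move=> w /= h1 h2; exact: h1.
Qed.

(** The Laplace transform of a constant is the exponential of a linear function,
    while [theta `^ a] is not linear as [a < 1]. *)
Lemma stable_rv_subordinator : stable_rv P a Y.
Proof.
split=> [c|A C A0 C0].
  apply/eqP => /(not_constant mY) Yc.
  have L theta : 0 <= theta -> expR (- (theta * `|c|)) = expR (- (K * theta `^ a)).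
    move=> t0; rewrite -Ex_laplace// -[LHS](Ex_cst P); apply: Ex_ae => //.
    - exact: bmeas_cst.
    - exact: bmeas_laplace.
    - by apply: filterS Yc => w ->.
  have /expR_inj/oppr_inj := L 1 ler01; rewrite powR1 mul1r mulr1 => cK.
  have /expR_inj/oppr_inj := L 2 (ler0n _ _); rewrite cK mulrC => /(mulfI (lt0r_neq0 K0)) h.
  have : 2 `^ a < 2 `^ 1 :> R.
    by rewrite /powR (negPf (lt0r_neq0 _)) ?ltr_expR ?ltr_pM2r ?ln_gt0 ?ltr1n//; case/andP: a01.
  by rewrite powRr1// -h ltxx.
exists (fun=> 0); apply: same_law_cf.
- move=> i; apply: measurable_funD; apply: measurable_funM => //.
    exact: (measurableT_comp mY measurable_fst).
  exact: (measurableT_comp mY measurable_snd).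
- by move=> i; apply: measurable_funD => //; exact: measurable_funM.
move=> u.
have -> : (fun w : T * T => cis (\sum_i u i * (A * Y w.1 + C * Y w.2))) =
   (fun w => cis (u tt * (A * Y w.1)) * cis (u tt * (C * Y w.2))).
  by apply/funext => w; rewrite (big_pred1 tt)// -cisD mulrDr//; case.
rewrite [LHS](@cE_prod_fun R _ _ T T P P (fun w => cis (u tt * (A * Y w)))
  (fun w => cis (u tt * (C * Y w)))); [|apply: cbm_cis; apply: measurable_funM => //; exact: measurable_funM..].
rewrite stable_cf//; congr cE; apply/funext => w.
by rewrite (big_pred1 tt) ?addr0//; case.
Qed.

Hypothesis wB : wiener P B.
Hypothesis YB_indep : forall E F, sigma_rv Y E ->
  sigma_family [set t : R | 0 <= t] B F -> P (E `&` F) = (P E * P F)%E.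

Definition subordinated (t : R) (w : T) := Num.sqrt (Y w) * B t w.

(** The sample space with the sigma-algebra of the Wiener process on [[0, +oo)]. *)
Definition wiener_space := g_sigma_algebraType
  [set E | exists i, [set t : R | 0 <= t] i /\ sigma_rv (B i) E].

Lemma measurable_wiener_space t : 0 <= t ->
  measurable_fun setT (B t : wiener_space -> R).
Proof.
move=> t0 _ A mA; rewrite setTI; apply: sub_sigma_algebra; exists t; split => //.
by exists A => //; rewrite setTI.
Qed.

Lemma measurable_to_wiener_space : measurable_fun setT (id : T -> wiener_space).
Proof.
move=> _ E mE; rewrite setTI; apply: (smallest_sub _ _ mE).
  split; [exact: measurable0|by move=> A; rewrite setTD; exact: measurableC|].
  by move=> F mF; exact: bigcupT_measurable.
by move=> A [t [_ [C mC <-]]]; exact: measurable_funPT.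
Qed.

(** Conditioning on the variance: it may be frozen at its value. *)
Lemma cE_freeze (H : R * wiener_space -> R[i]) : cbm H ->
  cbm (fun y : R => cE P (fun w' => H (y, w'))) /\
  cE P (fun w => H (Y w, w)) = cE P (fun w => cE P (fun w' => H (Y w, w'))).
Proof.
move=> bH; apply: (@cE_indep_pair R _ T P _ R _ wiener_space Y id H) => //.
  exact: measurable_to_wiener_space.
move=> A C mA mC; apply: YB_indep; first by exists A => //; rewrite setTI.
exact: mC.
Qed.

Lemma fdd_variance_ge0 m (u t : 'I_m -> R) : (forall i, 0 <= t i) -> 0 <= fdd_variance u t.
Proof.
move=> t0; have := wiener_cf wB u t0; rewrite /cE /= => -[h _].
have : expR (- (fdd_variance u t / 2)) <= 1.
  rewrite -h -[leRHS](Ex_cst P); apply: Ex_le; [|exact: bmeas_cst|by move=> w; exact: cos_le1].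
  have [] : cbm (fun w => cis (\sum_i u i * B (t i) w)); last by [].
  by apply: cbm_cis; apply: measurable_lin_comb => i; exact: measurable_funPT.
by rewrite expR_le1 oppr_le0 pmulr_lge0// invr_gt0.
Qed.

Lemma measurable_sqrt : measurable_fun setT (@Num.sqrt R).
Proof. by apply: continuous_measurable_fun; exact: sqrt_continuous. Qed.

Lemma measurable_subordinated t : measurable_fun setT (subordinated t).
Proof.
apply: measurable_funM; last exact: measurable_funPT.
by apply: measurableT_comp => //; exact: measurable_sqrt.
Qed.

Lemma subordinated_cf_mixture m (u t : 'I_m -> R) : (forall i, 0 <= t i) ->
  cE P (fun w => cis (\sum_i u i * subordinated (t i) w)) =
  (Ex P (fun w => expR (- (fdd_variance u t / 2 * `|Y w|))))%:C%C.
Proof.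
move=> t0; have q0 := fdd_variance_ge0 u t0.
pose H (z : R * wiener_space) := cis (\sum_i u i * (Num.sqrt z.1 * B (t i) z.2)).
have bH : cbm H.
  apply: cbm_cis; apply: measurable_lin_comb => i; apply: measurable_funM.
    exact: (measurableT_comp measurable_sqrt measurable_fst).
  exact: (measurableT_comp (measurable_wiener_space (t0 i)) measurable_snd).
have [bm e] := cE_freeze bH.
rewrite -[LHS]/(cE P (fun w => H (Y w, w))) e -cE_real.
apply: cE_ae.
- exact: (cbm_comp bm mY).
- by apply: cbm_real; apply: bmeas_laplace => //; rewrite divr_ge0.
apply: filterS Y_gt0 => w Yw.
have -> : (fun w' => H (Y w, w')) = (fun w' => cis (\sum_i (u i * Num.sqrt (Y w)) * B (t i) w')).
  by apply/funext => w'; rewrite /H; congr cis; apply: eq_bigr => i _; rewrite mulrA.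
rewrite wiener_cf// gtr0_norm//; congr ((expR (- _))%:C%C).
rewrite mulrAC; congr (_ / 2); rewrite /fdd_variance mulr_suml; apply: eq_bigr => i _.
rewrite mulr_suml; apply: eq_bigr => j _.
rewrite -[X in _ = _ * X](sqr_sqrtr (ltW Yw)); ring.
Qed.

Lemma subordinated_cf m (u t : 'I_m -> R) : (forall i, 0 <= t i) ->
  cE P (fun w => cis (\sum_i u i * subordinated (t i) w)) =
  (expR (- (K * (fdd_variance u t / 2) `^ a)))%:C%C.
Proof.
move=> t0; rewrite subordinated_cf_mixture// Ex_laplace//.
by rewrite divr_ge0// fdd_variance_ge0.
Qed.

(** The logarithm of the characteristic function is homogeneous of degree
    [2 * a] in the coefficients, and the product of the characteristic functions
    adds these logarithms. *)
Lemma subordinated_stable_family (I : finType) (t : I -> R) : (forall i, 0 <= t i) ->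
  stable_family P (2 * a) (fun i => subordinated (t i)).
Proof.
move=> t0 A C A0 C0; exists (fun=> 0).
set D := (_ `^ (2 * a)^-1).
have D0 : 0 <= D by exact: powR_ge0.
have D2a : (D ^+ 2) `^ a = (A ^+ 2) `^ a + (C ^+ 2) `^ a.
  have e (x : R) : 0 <= x -> (x ^+ 2) `^ a = x `^ (2 * a) by move=> x0; rewrite -powR_mulrn// -powRrM.
  rewrite !e ?(ltW A0) ?(ltW C0)// /D -powRrM mulVf ?powRr1 ?addr_ge0 ?powR_ge0//.
  by rewrite mulf_neq0 ?gt_eqF.
have ms i := measurable_subordinated (t i).
apply: same_law_cf.
- move=> i; apply: measurable_funD; apply: measurable_funM => //.
    exact: (measurableT_comp (ms i) measurable_fst).
  exact: (measurableT_comp (ms i) measurable_snd).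
- by move=> i; apply: measurable_funD => //; exact: measurable_funM.
move=> u.
pose u' (c : R) (j : 'I_#|I|) := c * u (enum_val j).
pose t' (j : 'I_#|I|) := t (enum_val j).
have E (c : R) w : \sum_i u i * (c * subordinated (t i) w) =
    \sum_j u' c j * subordinated (t' j) w.
  rewrite (reindex (@enum_val I I)); last by apply: onW_bij; exact: enum_val_bij.
  by apply: eq_bigr => j _; rewrite /u' mulrCA mulrA.
have cf (c : R) : cE P (fun w => cis (\sum_i u i * (c * subordinated (t i) w))) =
    (expR (- (K * ((c ^+ 2) `^ a * (fdd_variance (u' 1) t' / 2) `^ a))))%:C%C.
  under eq_fun do rewrite E.
  rewrite subordinated_cf; last by move=> j; exact: t0.
  congr ((expR (- (K * _)))%:C%C).
  rewrite -powRM ?sqr_ge0//; last first.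
    by rewrite divr_ge0// fdd_variance_ge0// => j; exact: t0.
  congr (_ `^ a); rewrite mulrA; congr (_ / 2).
  rewrite /fdd_variance mulr_sumr; apply: eq_bigr => i _.
  rewrite mulr_sumr; apply: eq_bigr => j _; rewrite /u'; ring.
have -> : (fun w : T * T => cis (\sum_i u i * (A * subordinated (t i) w.1 + C * subordinated (t i) w.2))) =
   (fun w => cis (\sum_i u i * (A * subordinated (t i) w.1)) * cis (\sum_i u i * (C * subordinated (t i) w.2))).
  apply/funext => w; rewrite -cisD -big_split/=; congr cis.
  by apply: eq_bigr => i _; rewrite mulrDr.
have bc (c : R) : cbm (fun w => cis (\sum_i u i * (c * subordinated (t i) w))).
  under eq_fun do rewrite E.
  by apply: cbm_cis; apply: measurable_lin_comb => j; exact: measurable_subordinated.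
rewrite [LHS](@cE_prod_fun R _ _ T T P P (fun w => cis (\sum_i u i * (A * subordinated (t i) w)))
  (fun w => cis (\sum_i u i * (C * subordinated (t i) w))))// !cf -rmorphM /= -expRD.
transitivity (cE P (fun w => cis (\sum_i u i * (D * subordinated (t i) w)))).
  by rewrite cf D2a; congr ((expR _)%:C%C); ring.
by congr cE; apply/funext => w; congr cis; apply: eq_bigr => i _; rewrite addr0.
Qed.

Lemma stable_process_subordinated : stable_process P (2 * a) subordinated.
Proof.
split=> [t t0|m t t0]; last exact: subordinated_stable_family.
split=> [c|]; last first.
  by apply: (@subordinated_stable_family unit (fun=> t)) => _; exact: ltW.
apply/eqP => /(not_constant (measurable_subordinated t)) Zc.
have := @subordinated_cf 1 (fun=> 1) (fun=> t) (fun _ => ltW t0).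
have -> : cE P (fun w => cis (\sum_(i < 1) 1 * subordinated t w)) = cis c.
  rewrite -(cE_cst P (cis c)); apply: cE_ae.
  - by apply: cbm_cis; apply: (measurable_lin_comb (Z := fun=> subordinated t)) => j;
      exact: measurable_subordinated.
  - exact: cbm_cst.
  - by apply: filterS Zc => w ->; rewrite big_ord1 mul1r.
move=> /(congr1 (@normc R)); rewrite normc_cis normc_real ger0_norm ?expR_ge0//.
have : expR (- (K * (fdd_variance (fun _ : 'I_1 => 1) (fun=> t) / 2) `^ a)) < 1.
  rewrite expR_lt1 oppr_lt0 mulr_gt0// powR_gt0// /fdd_variance !big_ord1 minxx.
  by rewrite !mul1r divr_gt0.
by move=> h1 h2; move: h1; rewrite -h2 ltxx.
Qed.

End StableSubordination.

(** * Uniqueness of conditional expectations *)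

Lemma indic_preimage {R : realType} (T S : Type) (f : T -> S) (A : set S) w :
  \1_(f @^-1` A) w = \1_A (f w) :> R.
Proof. by rewrite !indicE; congr (nat_of_bool _)%:R; apply/idP/idP; rewrite !inE. Qed.

Lemma bmeas_indic_comp {R : realType} {d d'} {T : measurableType d} {S : measurableType d'}
    (f : T -> S) (A : set S) : measurable_fun setT f -> measurable A ->
  bmeas (fun w => \1_A (f w) : R).
Proof.
move=> mf mA; have -> : (fun w => \1_A (f w) : R) = \1_(f @^-1` A).
  by apply/funext => w; rewrite indic_preimage.
by apply: bmeas_indic; rewrite -[X in measurable X]setTI; exact: mf.
Qed.

Section ConditionalExpectation.
Context {R : realType} {d : measure_display} {T : measurableType d}.
Variable P : probability T R.
Variable Y : T -> R.
Hypothesis mY : measurable_fun setT Y.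

Lemma preimageY_measurable A : measurable A -> measurable (Y @^-1` A).
Proof. by move=> mA; rewrite -[X in measurable X]setTI; exact: mY. Qed.

Lemma sigma_rv_measurable E : sigma_rv Y E -> measurable E.
Proof. by move=> [A mA <-]; exact: mY. Qed.

Definition rv_space := g_sigma_algebraType (sigma_rv Y).

Lemma measurable_rv_space (E : set T) : measurable (E : set rv_space) <-> sigma_rv Y E.
Proof.
split=> [mE|mE]; last exact: sub_sigma_algebra.
apply: (smallest_sub _ _ mE) => //.
exact: sigma_algebra_preimage (sigma_algebra_measurable _).
Qed.

Lemma sigma_rv_fun (h : T -> R) :
  (forall A : set R, measurable A -> sigma_rv Y (h @^-1` A)) <->
  measurable_fun setT (h : rv_space -> R).
Proof.
split=> [H _ A mA|H A mA].
  by rewrite setTI; apply/measurable_rv_space; exact: H.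
by apply/measurable_rv_space; rewrite -[X in measurable X]setTI; exact: H.
Qed.

Lemma rv_space_fun (h : T -> R) : measurable_fun setT (h : rv_space -> R) ->
  measurable_fun setT h.
Proof.
move=> /sigma_rv_fun H _ A mA; rewrite setTI; exact: sigma_rv_measurable (H _ mA).
Qed.

Lemma sigma_rv_comp (f : R -> R) : measurable_fun setT f ->
  measurable_fun setT (f \o Y : rv_space -> R).
Proof.
move=> mf; apply/sigma_rv_fun => A mA; exists (f @^-1` A); last by rewrite setTI.
by rewrite -[X in measurable X]setTI; exact: mf.
Qed.

Lemma integral_Ex_indic (D : set T) (f : T -> R) : measurable D -> bmeas f ->
  (\int[P]_(w in D) (f w)%:E = (Ex P (fun w => \1_D w * f w))%:E)%E.
Proof.
move=> mD bf; rewrite -EFin_Ex; last by apply: bmeasM => //; exact: bmeas_indic.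
rewrite integral_mkcond; apply: eq_integral => w _.
by rewrite patchE indicE; case: ifP => _; rewrite ?mul1r ?mul0r.
Qed.

Lemma ae_prod (I : eqType) (s : seq I) (h g : I -> T -> R) :
  (forall i, i \in s -> {ae P, forall w, h i w = g i w}) ->
  {ae P, forall w, \prod_(i <- s) h i w = \prod_(i <- s) g i w}.
Proof.
elim: s => [|i s IH] H; first by apply: aeW => w; rewrite !big_nil.
have h1 := H i (mem_head _ _).
have h2 : {ae P, forall w, \prod_(i <- s) h i w = \prod_(i <- s) g i w}.
  by apply: IH => j js; apply: H; rewrite inE js orbT.
by apply: filterS2 h1 h2 => w e1 e2; rewrite !big_cons e1 e2.
Qed.

Lemma negligible_lt (D : set T) (p q : T -> R) (M : R) : measurable D ->
  measurable_fun setT p -> measurable_fun setT q ->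
  (forall w, D w -> 0 <= p w <= M) -> (forall w, D w -> p w < q w) ->
  (\int[P]_(w in D) (q w)%:E = \int[P]_(w in D) (p w)%:E)%E ->
  {ae P, forall w, ~ D w}.
Proof.
move=> mD mp mq p0 pq.
have mpD : measurable_fun D (EFin \o p).
  by apply/measurable_EFinP; exact: measurable_funTS.
have mqD : measurable_fun D (EFin \o (fun w => q w - p w)).
  by apply/measurable_EFinP; apply: measurable_funTS; exact: measurable_funB.
have qE : (\int[P]_(w in D) (q w)%:E =
    \int[P]_(w in D) (p w)%:E + \int[P]_(w in D) (q w - p w)%:E)%E.
  rewrite -ge0_integralD//.
  - by apply: eq_integral => w _; rewrite -EFinD addrC subrK.
  - by move=> w /p0/andP[]; rewrite lee_fin.
  - by move=> w /pq; rewrite lee_fin subr_ge0 => /ltW.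
have fp : (\int[P]_(w in D) (p w)%:E)%E \is a fin_num.
  rewrite ge0_fin_numE; last by apply: integral_ge0 => w /p0/andP[]; rewrite lee_fin.
  apply: (@le_lt_trans _ _ (\int[P]_(w in D) (cst M%:E w))%E).
    by apply: ge0_le_integral => //= w Dw; have /andP[? ?] := p0 _ Dw; rewrite lee_fin// (le_trans _ (y := p w)).
  rewrite integral_cst// -ge0_fin_numE ?fin_numM// ?fin_num_measure//.
  have [->|/set0P[w Dw]] := eqVneq D set0; first by rewrite measure0 mule0.
  by rewrite mule_ge0// lee_fin; have /andP[? ?] := p0 _ Dw; rewrite (le_trans _ (y := p w)).
rewrite qE => /(congr1 (fun x => x - (\int[P]_(w in D) (p w)%:E))%E).
rewrite addeAC subee// add0e => h0.
have /ae_eq_integral_abs : measurable_fun D (EFin \o (fun w => q w - p w)) by [].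
move=> /(_ P mD) [H _].
have /H : (\int[P]_(x in D) `|(EFin \o (fun w : T => q w - p w)%R) x| = 0)%E.
  rewrite -[RHS]h0; apply: eq_integral => w; rewrite inE => Dw /=.
  by rewrite ger0_norm// subr_ge0 ltW// pq.
apply: filterS => w /= h Dw; have := pq w Dw.
by move: (h Dw) => [] /eqP; rewrite subr_eq0 => /eqP ->; rewrite ltxx.
Qed.

(** The set where the two versions differ splits into three events generated by
    [Y], on which the integrals of [h] and [g] could not agree unless they are
    negligible; the bound on [g] keeps those integrals finite. *)
Lemma cexp_unique (S : set R) (M : R) (h g : T -> R) : measurable S ->
  (forall A : set R, measurable A -> sigma_rv Y (h @^-1` A)) ->
  (forall A : set R, measurable A -> sigma_rv Y (g @^-1` A)) ->
  (forall w, S (Y w) -> 0 <= g w <= M) ->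
  (forall A : set R, measurable A -> A `<=` S ->
    \int[P]_(w in Y @^-1` A) (h w)%:E = \int[P]_(w in Y @^-1` A) (g w)%:E)%E ->
  {ae P, forall w, S (Y w) -> h w = g w}.
Proof.
move=> mS /sigma_rv_fun mh /sigma_rv_fun mg g0 hg.
have mh' := rv_space_fun mh; have mg' := rv_space_fun mg.
have mS' : measurable (Y @^-1` S : set rv_space) by apply/measurable_rv_space; exists S => //; rewrite setTI.
have split_int (D : set rv_space) : measurable D -> D `<=` Y @^-1` S ->
    (\int[P]_(w in (D : set T)) (h w)%:E = \int[P]_(w in (D : set T)) (g w)%:E)%E.
  move=> /measurable_rv_space [A mA <-]; rewrite setTI => AS.
  have -> : Y @^-1` A = Y @^-1` (A `&` S) by apply/seteqP; split => [w Aw|w []//]; split => //; exact: AS.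
  by apply: hg; [exact: measurableI|exact: subIsetr].
pose D1 : set rv_space := Y @^-1` S `&` [set w | g w < h w].
pose D2 : set rv_space := Y @^-1` S `&` ([set w | 0 <= h w] `&` [set w | h w < g w]).
pose D3 : set rv_space := Y @^-1` S `&` [set w | h w < 0].
have pos (u v : T -> R) : measurable_fun setT (u : rv_space -> R) -> measurable_fun setT (v : rv_space -> R) ->
    measurable ([set w | u w < v w] : set rv_space).
  move=> mu mv; have := measurable_fun_ltr mu mv => /(_ measurableT [set true] I).
  by rewrite setTI.
have posw (u v : T -> R) : measurable_fun setT (u : rv_space -> R) -> measurable_fun setT (v : rv_space -> R) ->
    measurable ([set w | u w <= v w] : set rv_space).
  move=> mu mv; have := measurable_fun_ler mu mv => /(_ measurableT [set true] I).
  by rewrite setTI.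
have m0 : measurable_fun setT ((fun=> 0) : rv_space -> R) by exact: measurable_cst.
have mD1 : measurable D1 by apply: measurableI => //; exact: pos.
have mD2 : measurable D2 by apply: measurableI => //; apply: measurableI; [exact: posw|exact: pos].
have mD3 : measurable D3 by apply: measurableI => //; exact: pos.
have mT (D : set rv_space) : measurable D -> measurable (D : set T).
  by move=> /measurable_rv_space; exact: sigma_rv_measurable.
have n1 : {ae P, forall w : T, ~ D1 w}.
  apply: (@negligible_lt _ g h M) => //; first exact: mT.
  - by move=> w [/g0].
  - by move=> w [].
  - by apply: split_int => // w [].
have n2 : {ae P, forall w : T, ~ D2 w}.
  apply: (@negligible_lt _ h g M) => //; first exact: mT.
  - by move=> w [/g0/andP[_ gM] [/= -> /ltW hg']]; rewrite (le_trans hg').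
  - by move=> w [_ []].
  - by symmetry; apply: split_int => // w [].
have n3 : {ae P, forall w : T, ~ D3 w}.
  apply: (@negligible_lt _ (cst 0) (fun w => - h w) 0) => //; first exact: mT.
  - exact: measurable_funN.
  - by move=> w; rewrite lexx.
  - by move=> w [_ /=]; rewrite oppr_gt0.
  rewrite [RHS]integral0_eq//; apply/eqP; rewrite eq_le; apply/andP; split; last first.
    by apply: integral_ge0 => w [_ /= ]; rewrite lee_fin oppr_ge0 => /ltW.
  have : (0 <= \int[P]_(w in (D3 : set T)) (h w)%:E)%E.
    rewrite split_int//; last by move=> w [].
    by apply: integral_ge0 => w [/g0/andP[]]; rewrite lee_fin.
  have -> : (\int[P]_(w in (D3 : set T)) (h w)%:E = - \int[P]_(w in (D3 : set T)) (- h w)%:E)%E.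
    rewrite -integral_ge0N; last by move=> w [_ /= ]; rewrite lee_fin oppr_ge0 => /ltW.
    by apply: eq_integral => w _; rewrite EFinN oppeK.
  by rewrite oppe_ge0.
move: n1 n2 n3; apply: filterS3 => w h1 h2 h3 Sw; apply/eqP; rewrite eq_le !leNgt; apply/andP; split; apply/negP => hh.
- by apply: h1.
- have [h0|h0] := leP 0 (h w); first by apply: h2; split.
  by apply: h3.
Qed.

End ConditionalExpectation.

Lemma cvg_powR0 {R : realType} (u : nat -> R) (a : R) : 0 < a -> (forall n, 0 <= u n) ->
  u n @[n --> \oo] --> 0 -> u n `^ a @[n --> \oo] --> 0.
Proof.
move=> a0 u0 ul; apply/cvgr0Pnorm_lt => e e0.
have e' : 0 < e `^ a^-1 by exact: powR_gt0.
move/cvgr0Pnorm_lt : ul => /(_ _ e'); apply: filterS => n.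
rewrite !ger0_norm ?powR_ge0// => ue.
have -> : e = (e `^ a^-1) `^ a by rewrite -powRrM mulVf ?gt_eqF// powRr1// ltW.
by apply: gt0_ltr_powR => //; rewrite nnegrE ?powR_ge0 ?u0.
Qed.

(** * The subordinated process is a conditional Levy process *)

Section ConditionalLevy.
Context {R : realType} {d : measure_display} {T : measurableType d}.
Variable P : probability T R.
Variables (Y : {RV P >-> R}) (B : R -> {RV P >-> R}) (a K : R).
Hypothesis a01 : 0 < a < 1.
Hypothesis K0 : 0 < K.
Hypothesis Y_gt0 : {ae P, forall w, 0 < Y w}.
Hypothesis Y_laplace : forall theta, 0 <= theta ->
  ('E_P[fun w => expR (- theta * Y w)])%E = (expR (- K * theta `^ a))%:E.
Hypothesis wB : wiener P B.
Hypothesis YB_indep : forall E F, sigma_rv Y E ->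
  sigma_family [set t : R | 0 <= t] B F -> P (E `&` F) = (P E * P F)%E.

Let Z := subordinated Y B.

Let mY : measurable_fun setT Y. Proof. exact: measurable_funPT. Qed.

Let mZ t : measurable_fun setT (Z t). Proof. exact: measurable_subordinated. Qed.

Lemma increment_cf (s h x : R) : 0 <= s -> 0 <= h ->
  cE P (fun w => cis (x * increment Z s (s + h) w)) =
  (expR (- (K * (x ^+ 2 * h / 2) `^ a)))%:C%C.
Proof.
move=> s0 h0.
have := @subordinated_cf _ _ _ _ Y B a K Y_gt0 Y_laplace wB YB_indep 2
  (fun i => if i == 0 then x else - x) (fun i => if i == 0 then s + h else s).
have -> : (fun w => cis (\sum_(i < 2) (if i == 0 then x else - x) *
    subordinated Y B (if i == 0 then s + h else s) w)) =
    (fun w => cis (x * increment Z s (s + h) w)).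
  by apply/funext => w; rewrite !big_ord_recl big_ord0 /= /increment; congr cis; rewrite /Z; ring.
move=> -> => [|i]; last by case: ifP => _ //; rewrite addr_ge0.
congr ((expR (- (K * (_ / 2) `^ a)))%:C%C).
rewrite /fdd_variance; under eq_bigr do rewrite !big_ord_recl big_ord0 /=.
rewrite !big_ord_recl big_ord0 /=.
have -> : Num.min (s + h) s = s by apply/min_idPr; rewrite lerDl.
have -> : Num.min s (s + h) = s by apply/min_idPl; rewrite lerDl.
rewrite !minxx; ring.
Qed.

(** By [increment_cf] the characteristic function depends on the length alone. *)
Lemma subordinated_stationary (s h : R) : 0 <= s -> 0 <= h ->
  forall A : set R, measurable A ->
  P (increment Z s (s + h) @^-1` A) = P (increment Z 0 h @^-1` A).
Proof.
move=> s0 h0 A mA.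
have : same_law P (fun _ : unit => increment Z s (s + h)) P (fun _ : unit => increment Z 0 h).
  apply: same_law_cf => [_|_|u]; [exact: measurable_funB..|].
  have E (X : T -> R) : (fun w => cis (\sum_(i : unit) u i * X w)) = (fun w => cis (u tt * X w)).
    by apply/funext => w; rewrite (big_pred1 tt)//; case.
  by rewrite !E increment_cf// -[X in increment Z 0 X]add0r increment_cf.
move=> /(_ [set f | A (f tt)]); apply.
by apply: sub_sigma_algebra; exists tt, A.
Qed.

Lemma measurable_tail (e s t : R) : measurable [set w | e <= `|Z s w - Z t w|].
Proof.
rewrite -[X in measurable X]setTI.
have mX : measurable_fun setT (increment Z t s) by exact: measurable_funB.
have := measurable_fun_ler (measurable_cst e) (measurableT_comp (@normr_measurable R setT) mX).
by move=> /(_ measurableT [set true] I).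
Qed.

(** On the event, the Gaussian gap of the increment at scale [2 / e] is at least
    one half. *)
Lemma subordinated_tail (e s t : R) : 0 < e -> 0 <= s -> 0 <= t ->
  fine (P [set w | e <= `|Z s w - Z t w|]) <=
  2 * (1 - Ex (normal_prob 0 1) (fun y => expR (- (K * ((2 / e * y) ^+ 2 * `|s - t| / 2) `^ a)))).
Proof.
move=> e0; wlog st : s t / t <= s.
  move=> H s0 t0; have [|/ltW] := leP t s; first by move=> /H; exact.
  move=> /H -/(_ t0 s0); rewrite distrC.
  by have -> : [set w | e <= `|Z s w - Z t w|] = [set w | e <= `|Z t w - Z s w|] by apply/seteqP; split => w /=; rewrite distrC.
move=> s0 t0.
have mX : measurable_fun setT (increment Z t s) by exact: measurable_funB.
have mE := measurable_tail e s t.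
have := @Ex_gauss_gap R 1 _ T P (fun=> increment Z t s) (fun=> mX) (2 / e) 0.
have -> : (fun y => Re (cE P (fun w => cis (2 / e * y * increment Z t s w)))) =
  (fun y => expR (- (K * ((2 / e * y) ^+ 2 * `|s - t| / 2) `^ a))).
  apply/funext => y; have := @increment_cf t (s - t) (2 / e * y) t0.
  by rewrite subrKC ger0_norm subr_ge0// => ->.
move=> <-; rewrite -Ex_indic// -ExZ; last exact: (@bmeas_gauss_gap R 1 _ T (fun=> increment Z t s) (fun=> mX) _ 0).
apply: Ex_le; [exact: bmeas_indic| |].
  by apply: bmeasM; [exact: bmeas_cst|apply: (@bmeas_gauss_gap R 1 _ T (fun=> increment Z t s) (fun=> mX) _ 0)].
move=> w; rewrite indicE; case: (boolP (w \in _)) => /=; last first.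
  by move=> _; rewrite mulr_ge0// gauss_gap_ge0.
rewrite inE /= => ew; rewrite /gauss_gap -/(increment Z t s w).
(* on the event, the exponent is at least 2, and exp(-2) <= 1/2 *)
have x2 : 2 <= (2 / e * increment Z t s w) ^+ 2 / 2.
  rewrite ler_pdivlMr// exprMn -[leLHS]/(2 * 2) -expr2.
  rewrite -(real_normK (num_real (increment Z t s w))) exprMn -mulrA ler_peMr ?sqr_ge0//.
  by rewrite exprVn mulrC ler_pdivlMr ?exprn_gt0// mul1r lerXn2r ?nnegrE// ltW.
have : expR (- ((2 / e * increment Z t s w) ^+ 2 / 2)) <= 2^-1.
  rewrite expRN lef_pV2 ?posrE ?expR_gt0//.
  by apply: le_trans (expR_ge1Dx _); rewrite (le_trans x2)// lerDr.
lra.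
Qed.

Lemma subordinated_stochastic_continuity (t e : R) : 0 <= t -> 0 < e ->
  P [set w | e <= `|Z s w - Z t w|] @[s --> within [set s | 0 <= s] (nbhs t)] --> 0%E.
Proof.
move=> t0 e0.
pose g (h y : R) := expR (- (K * ((2 / e * y) ^+ 2 * h / 2) `^ a)).
have mg h : measurable_fun setT (g h).
  apply: measurableT_comp => //; apply: measurable_funN; apply: measurable_funM => //.
  apply: (measurableT_comp (measurable_powR _)).
  apply: measurable_funM => //; apply: measurable_funM => //.
  by apply: measurable_funX; exact: measurable_funM.
have g1 h y : `|g h y| <= 1.
  by rewrite ger0_norm ?expR_ge0// /g expR_le1 oppr_le0 mulr_ge0 ?powR_ge0//; exact: ltW.
have bg h : @bmeas R _ (measurableTypeR R) (g h) by exact: (bmeas_le (mg h) (g1 h)).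
have G0 : Ex (normal_prob 0 1) (g n.+1%:R^-1) @[n --> \oo] --> (1 : R).
  rewrite -[X in _ --> X](Ex_cst (normal_prob 0 1)).
  apply: (@Ex_dct _ _ _ _ _ _ 1) => [n|n y| |]; [exact: mg|exact: g1| |by []].
  apply: aeW => y.
  have h0 : (2 / e * y) ^+ 2 * n.+1%:R^-1 / 2 @[n --> \oo] --> (0 : R).
    rewrite -[X in _ --> X](mul0r 2^-1) -(mulr0 ((2 / e * y) ^+ 2)).
    by apply: cvgMr_tmp; apply: cvgMl_tmp; exact: cvg_harmonic.
  have a0 : 0 < a by case/andP: a01.
  have := cvg_powR0 a0 _ h0 => /(_ (fun n => _)) h1.
  rewrite /g -[X in _ --> X]expR0 -[X in expR X]oppr0 -[X in - X](mulr0 K).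
  apply: continuous_cvg; first exact: continuous_expR.
  by apply: cvgN; apply: cvgMl_tmp; apply: h1 => n; rewrite divr_ge0// mulr_ge0 ?sqr_ge0.
pose G h := 2 * (1 - Ex (normal_prob 0 1) (g h)).
have G_le h h' : 0 <= h -> h <= h' -> G h <= G h'.
  move=> h0 hh; apply: ler_wpM2l; first by rewrite ler0n.
  apply: lerB; first exact: lexx.
  apply: (Ex_le _ (bg h') (bg h)) => y.
  rewrite ler_expR lerN2; apply: ler_wpM2l; first exact: ltW.
  apply: ge0_ler_powR; rewrite ?nnegrE.
  - by case/andP: a01 => /ltW.
  - by rewrite divr_ge0// mulr_ge0 ?sqr_ge0.
  - by rewrite divr_ge0// mulr_ge0 ?sqr_ge0// (le_trans h0).
  - by rewrite ler_pM2r// ler_wpM2l ?sqr_ge0.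
have -> : (fun s => P [set w | e <= `|Z s w - Z t w|]) =
    EFin \o (fun s => fine (P [set w | e <= `|Z s w - Z t w|])).
  by apply/funext => s /=; rewrite fineK//; apply: fin_num_measure; exact: measurable_tail.
apply: cvg_EFin; first by apply: nearW => s.
apply/cvgr0Pnorm_lt => eps eps0.
have [n Gn] : exists n : nat, G n.+1%:R^-1 < eps.
  move/cvgrPdist_lt : G0 => /(_ (eps / 2)); rewrite divr_gt0// => /(_ isT) [n _ /(_ n (leqnn n))] /= Hn.
  exists n; rewrite /G mulrC -ltr_pdivlMr//; exact: le_lt_trans (ler_norm _) Hn.
have tn : \forall s \near t, `|t - s| < n.+1%:R^-1.
  by apply: nbhsx_ballx; rewrite invr_gt0.
rewrite near_withinE; near=> s => s0.
rewrite /= ger0_norm ?fine_ge0//; apply: le_lt_trans Gn.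
apply: le_trans (subordinated_tail e0 s0 t0) _; apply: G_le => //.
Unshelve. all: by end_near. Qed.

Lemma incrementE s t w : increment Z s t w = Num.sqrt (Y w) * increment B s t w.
Proof. by rewrite /increment /Z /subordinated mulrBr. Qed.

Section Freezing.
Variables (t : nat -> R) (A : nat -> set R).
Hypothesis tnd : nondecreasing_times t.
Hypothesis mA : forall i, measurable (A i).

Let dB i := increment B (t i) (t i.+1).

Definition frozen i (y : R) : R := Ex P (fun w => \1_(A i) (Num.sqrt y * dB i w)).

Let frozen_prod (C : set R) (s : seq nat) (z : R * wiener_space B) : R[i] :=
  (\1_C z.1)%:C%C * \prod_(i <- s) (\1_(A i) (Num.sqrt z.1 * dB i z.2))%:C%C.

Let t_ge0 i : 0 <= t i.
Proof. by case: tnd => t0 th; exact: le_trans t0 (th _ _ _). Qed.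

Let cbm_frozen_prod C s : measurable C -> cbm (frozen_prod C s).
Proof.
move=> mC; apply: cbmM.
  by apply: cbm_real; apply: bmeas_indic_comp => //; exact: measurable_fst.
apply: cbm_prod => i; apply: cbm_real; apply: bmeas_indic_comp => //.
apply: measurable_funM; first exact: (measurableT_comp (@measurable_sqrt R) measurable_fst).
have mB j : measurable_fun setT (fun x : R * wiener_space B => B (t j) x.2).
  exact: (measurableT_comp (measurable_wiener_space (B:=B) (t_ge0 j)) measurable_snd).
exact: (measurable_funB (mB i.+1) (mB i)).
Qed.

Let cE_frozen_prod C s y : uniq s ->
  cE P (fun w => frozen_prod C s (y, w)) = (\1_C y * \prod_(i <- s) frozen i y)%:C%C.
Proof.
move=> us.
have bi i : cbm (fun x => (\1_(A i) (Num.sqrt y * x))%:C%C : R[i]).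
  by apply: cbm_real; apply: bmeas_indic_comp => //; exact: measurable_funM.
have mdB i : measurable_fun setT (dB i) by apply: measurable_funB; exact: measurable_funPT.
rewrite /frozen_prod /= cEZ; last by apply: cbm_prod => i; exact: (cbm_comp (bi i) (mdB i)).
rewrite rmorphM /=; congr (_ * _); rewrite rmorph_prod /=.
have [_ iB _ _] := wB.
rewrite (@cE_indep_prod _ _ _ P nat (fun i => sigma_rv (dB i)) (iB t tnd) _ _ _ dB mdB _
  (fun i x => (\1_(A i) (Num.sqrt y * x))%:C%C) bi s us).
- by apply: eq_bigr => i _; rewrite cE_real.
- by move=> i E; exact: sigma_rv_measurable.
- by move=> i E mE; exists E => //; rewrite setTI.
Qed.

Lemma measurable_frozen i : measurable_fun setT (frozen i).
Proof.
have E1 : (fun y => (frozen i y)%:C%C) =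
    (fun y => cE P (fun w' => frozen_prod setT [:: i] (y, w'))).
  by apply/funext => y; rewrite cE_frozen_prod// big_seq1 indicT mul1r.
have : cbm (fun y => (frozen i y)%:C%C).
  by rewrite E1; have [] := cE_freeze YB_indep (cbm_frozen_prod [:: i] measurableT).
by case=> -[].
Qed.

Lemma bmeas_frozen i : bmeas (fun w => frozen i (Y w)).
Proof.
apply: (bmeas_le (M := 1)); first exact: (measurableT_comp (measurable_frozen i) mY).
move=> w; apply: Ex_norm.
  apply: bmeas_indic_comp => //; apply: measurable_funM => //; apply: measurable_funB; exact: measurable_funPT.
by move=> x; rewrite indicE; case: (_ \in _); rewrite ?normr0 ?normr1.
Qed.

Lemma frozen_itv i y : 0 <= frozen i y <= 1.
Proof.
have b : bmeas (fun w => \1_(A i) (Num.sqrt y * dB i w) : R).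
  apply: bmeas_indic_comp => //; apply: measurable_funM => //; apply: measurable_funB; exact: measurable_funPT.
rewrite Ex_ge0 => [|w]; last by rewrite indicE.
rewrite -[X in _ <= X](Ex_cst P); apply: (Ex_le P b (bmeas_cst _)) => w.
by rewrite indicE; case: (_ \in _).
Qed.

Lemma Ex_frozen (C : set R) (s : seq nat) : measurable C -> uniq s ->
  Ex P (fun w => \1_(Y @^-1` C) w * \prod_(i <- s) \1_(increment Z (t i) (t i.+1) @^-1` A i) w) =
  Ex P (fun w => \1_(Y @^-1` C) w * \prod_(i <- s) frozen i (Y w)).
Proof.
move=> mC us; have [_] := cE_freeze YB_indep (cbm_frozen_prod s mC).
have -> : (fun w => frozen_prod C s (Y w, w)) =
   (fun w => (\1_(Y @^-1` C) w * \prod_(i <- s) \1_(increment Z (t i) (t i.+1) @^-1` A i) w)%:C%C).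
  apply/funext => w; rewrite /frozen_prod /= rmorphM rmorph_prod /=; congr (_ * _).
  by apply: eq_bigr => i _; rewrite indic_preimage incrementE.
have -> : (fun w => cE P (fun w' => frozen_prod C s (Y w, w'))) =
   (fun w => (\1_(Y @^-1` C) w * \prod_(i <- s) frozen i (Y w))%:C%C).
  by apply/funext => w; rewrite cE_frozen_prod// indic_preimage.
by rewrite !cE_real => -[].
Qed.

End Freezing.

(** The conditional probability of an increment event is its frozen probability
    at [Y], and frozen probabilities multiply. *)
Lemma subordinated_cond_indep t : nondecreasing_times t ->
  cond_indep_sigma P Y (fun i : nat => sigma_rv (increment Z (t i) (t i.+1))).
Proof.
move=> tnd s E h us FE hE.
have /choice [A HA] : forall i, exists A, measurable A /\
    (i \in s -> E i = increment Z (t i) (t i.+1) @^-1` A).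
  move=> i; have [/FE [A mA <-]|_] := boolP (i \in s); last by exists set0.
  by exists A; rewrite setTI.
have mA i : measurable (A i) by case: (HA i).
have mE i : measurable (increment Z (t i) (t i.+1) @^-1` A i).
  by rewrite -[X in measurable X]setTI; apply: measurable_funB.
have hfr i : i \in s -> {ae P, forall w, h i w = frozen t A i (Y w)}.
  move=> iS; have [hm hi] := hE i iS.
  have : {ae P, forall w, setT (Y w) -> h i w = frozen t A i (Y w)}.
    apply: (@cexp_unique _ _ _ P Y mY setT 1) => //.
    - by apply/sigma_rv_fun; apply: sigma_rv_comp; exact: measurable_frozen tnd mA i.
    - by move=> w _; exact: frozen_itv.
    move=> C mC _; have mYC := preimageY_measurable mY mC.
    rewrite hi// (integral_Ex_indic P mYC (bmeas_frozen tnd mA i)).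
    rewrite integral_Ex_indic//; last by apply: bmeas_indic; case: (HA i) => _ ->.
    congr EFin.
    have := Ex_frozen tnd mA (s := [:: i]) mC isT.
    under eq_fun do rewrite big_seq1; under [in RHS]eq_fun do rewrite big_seq1.
    by case: (HA i) => _ -> // ->.
  by apply: filterS => w; exact.
have mh : measurable_fun setT ((fun w => \prod_(i <- s) h i w) : rv_space Y -> R).
  have : forall i, i \in s -> measurable_fun setT (h i : rv_space Y -> R).
    by move=> i iS; apply/sigma_rv_fun; case: (hE i iS).
  elim: (s) => [|i r IH] H; first by under eq_fun do rewrite big_nil; exact: measurable_cst.
  under eq_fun do rewrite big_cons; apply: measurable_funM; first by apply: H; rewrite mem_head.
  by apply: IH => j jr; apply: H; rewrite inE jr orbT.
split; first exact/sigma_rv_fun.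
move=> C mC; have mYC := preimageY_measurable mY mC.
have bfr : bmeas (fun w => \prod_(i <- s) frozen t A i (Y w)).
  by apply: bmeas_prod => i; exact: bmeas_frozen tnd mA i.
transitivity (\int[P]_(w in Y @^-1` C) (\prod_(i <- s) frozen t A i (Y w))%:E)%E.
  apply: ae_eq_integral => //.
  - apply/measurable_EFinP; apply: measurable_funTS; exact: rv_space_fun mh.
  - by apply/measurable_EFinP; apply: measurable_funTS; case: bfr.
  - by apply: filterS (ae_prod hfr) => w -> _.
have -> : \big[setI/setT]_(i <- s) E i =
    \big[setI/setT]_(i <- s) (increment Z (t i) (t i.+1) @^-1` A i).
  by apply: eq_big_seq => i iS; case: (HA i) => _ ->.
have E1 : \1_(\big[setI/setT]_(i <- s) (increment Z (t i) (t i.+1) @^-1` A i)) =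
    (fun w => \prod_(i <- s) (\1_(increment Z (t i) (t i.+1) @^-1` A i) w : R)).
  apply/funext => w; have := prod_indic s (fun i => increment Z (t i) (t i.+1) @^-1` A i) w.
  by move=> /(_ R); rewrite -rmorph_prod => -[].
rewrite !integral_Ex_indic//; last by rewrite E1; apply: bmeas_prod => i; exact: bmeas_indic.
by rewrite -Ex_frozen// E1.
Qed.

Theorem levy_given_subordinated : levy_given P Y Z.
Proof.
have [B0 _ _ Bc] := wB.
split.
- by apply: filterS B0 => w /= b0; rewrite /Z /subordinated b0 mulr0.
- exact: subordinated_cond_indep.
- exact: subordinated_stationary.
- exact: subordinated_stochastic_continuity.
apply: filterS Bc => w /continuous_within_itvcyP [c1 c2]; split => [t t0|t t0].
- apply: cvgMl_tmp; move: t0; rewrite le_eqVlt => /predU1P[<-//|t0].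
  by apply: cvg_at_right_filter; apply: c1; rewrite in_itv/= t0.
- apply/cvg_ex; exists (Z t w); apply: cvgMl_tmp.
  by apply: cvg_at_left_filter; apply: c1; rewrite in_itv/= t0.
Qed.

End ConditionalLevy.

(** * Complex-valued functions of a real variable *)

Section ComplexDerivative.
Context {R : realType}.
Implicit Types (g h : R -> R[i]) (x : R) (D E : R[i]).

Definition cderiv g x D :=
  is_derive x 1 (fun y => Re (g y)) (Re D) /\ is_derive x 1 (fun y => Im (g y)) (Im D).

Lemma cderiv_cst z x : cderiv (fun=> z) x 0.
Proof. by split; apply: is_derive_cst. Qed.

Lemma cderivD g h x D E : cderiv g x D -> cderiv h x E ->
  cderiv (fun y => g y + h y) x (D + E).
Proof.
move=> [g1 g2] [h1 h2]; split.
  have -> : (fun y => Re (g y + h y)) = (fun y => Re (g y)) + (fun y => Re (h y)).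
    by apply/funext => y; rewrite ReD.
  by rewrite ReD; exact: is_deriveD.
have -> : (fun y => Im (g y + h y)) = (fun y => Im (g y)) + (fun y => Im (h y)).
  by apply/funext => y; rewrite ImD.
by rewrite ImD; exact: is_deriveD.
Qed.

Lemma cderivM g h x D E : cderiv g x D -> cderiv h x E ->
  cderiv (fun y => g y * h y) x (D * h x + g x * E).
Proof.
move=> [g1 g2] [h1 h2]; split.
  have -> : (fun y => Re (g y * h y)) =
      (fun y => Re (g y)) * (fun y => Re (h y)) - (fun y => Im (g y)) * (fun y => Im (h y)).
    by apply/funext => y; rewrite ReM.
  apply: is_derive_eq; rewrite !ReD !ReM /GRing.scale /=.
  by move: (Re (g x)) (Im (g x)) (Re (h x)) (Im (h x)) (Re D) (Im D) (Re E) (Im E) => *; ring.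
have -> : (fun y => Im (g y * h y)) =
    (fun y => Re (g y)) * (fun y => Im (h y)) + (fun y => Im (g y)) * (fun y => Re (h y)).
  by apply/funext => y; rewrite ImM.
apply: (is_derive_eq (is_deriveD (is_deriveM g1 h2) (is_deriveM g2 h1))).
rewrite !ImD !ImM /GRing.scale /=.
by move: (Re (g x)) (Im (g x)) (Re (h x)) (Im (h x)) (Re D) (Im D) (Re E) (Im E) => *; ring.
Qed.

Lemma cderiv_real (f : R -> R) x (D : R) : is_derive x 1 f D ->
  cderiv (fun y => (f y)%:C%C) x D%:C%C.
Proof. by move=> f1; split => //=; exact: is_derive_cst. Qed.

Lemma cderiv_comp g (r : R -> R) x D (r' : R) : cderiv g (r x) D -> is_derive x 1 r r' ->
  cderiv (fun y => g (r y)) x (r'%:C%C * D).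
Proof.
move=> [g1 g2] r1; split.
  have := @is_derive1_comp _ (fun y => Re (g y)) r x _ _ g1 r1.
  by rewrite ReM /= mul0r subr0 mulrC.
have := @is_derive1_comp _ (fun y => Im (g y)) r x _ _ g2 r1.
by rewrite ImM /= mul0r addr0 mulrC.
Qed.

Lemma cderiv_unique g x D E : cderiv g x D -> cderiv g x E -> D = E.
Proof.
move=> [g1 g2] [h1 h2]; apply: complex_eq.
  by rewrite -(@derive_val _ _ _ _ _ _ _ g1) (@derive_val _ _ _ _ _ _ _ h1).
by rewrite -(@derive_val _ _ _ _ _ _ _ g2) (@derive_val _ _ _ _ _ _ _ h2).
Qed.

Lemma cderiv0_cst g : (forall x, cderiv g x 0) -> forall x y, g x = g y.
Proof.
move=> g0 x y; apply: complex_eq.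
  by apply: (@is_derive_0_is_cst _ (fun y => Re (g y))) => z; case: (g0 z).
by apply: (@is_derive_0_is_cst _ (fun y => Im (g y))) => z; case: (g0 z).
Qed.

Lemma cderiv_cexp g x D : cderiv g x D ->
  cderiv (fun y => cexp (g y)) x (D * cexp (g x)).
Proof.
move=> [g1 g2].
have e1 := @is_derive1_comp _ (@expR R) _ x _ _ (is_derive_expR _) g1.
have e2 := @is_derive1_comp _ (@cos R) _ x _ _ (is_derive_cos _) g2.
have e3 := @is_derive1_comp _ (@sin R) _ x _ _ (is_derive_sin _) g2.
split.
  have -> : (fun y => Re (cexp (g y))) =
      (@expR R \o (fun y => Re (g y))) * (@cos R \o (fun y => Im (g y))) by [].
  by apply: is_derive_eq; rewrite ReM /GRing.scale /=; ring.
have -> : (fun y => Im (cexp (g y))) =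
    (@expR R \o (fun y => Re (g y))) * (@sin R \o (fun y => Im (g y))) by [].
by apply: is_derive_eq; rewrite ImM /GRing.scale /=; ring.
Qed.

Lemma cexpD (z w : R[i]) : cexp (z + w) = cexp z * cexp w.
Proof.
apply: complex_eq; rewrite ?(ReM, ImM) /= ReD ImD expRD ?cosD ?sinD.
  by move: (expR _) (expR _) (cos _) (cos _) (sin _) (sin _) => *; ring.
by move: (expR _) (expR _) (cos _) (cos _) (sin _) (sin _) => *; ring.
Qed.

Lemma cexp_real (x : R) : cexp x%:C%C = (expR x)%:C%C.
Proof. by apply: complex_eq; rewrite /= ?cos0 ?sin0 ?mulr1 ?mulr0. Qed.

Lemma cexp0 : cexp (0 : R[i]) = 1.
Proof. by rewrite -(rmorph0 (real_complex R)) cexp_real expR0. Qed.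

Lemma cexpNr (z : R[i]) : cexp z * cexp (- z) = 1.
Proof. by rewrite -cexpD subrr cexp0. Qed.

Lemma cderivV g x D : g x != 0 -> cderiv g x D ->
  cderiv (fun y => (g y)^-1) x (- D / g x ^+ 2).
Proof.
move=> gx [g1 g2].
have n0 : Re (g x) ^+ 2 + Im (g x) ^+ 2 != 0.
  apply: contra gx; rewrite paddr_eq0 ?sqr_ge0// !sqrf_eq0 => /andP[/eqP h1 /eqP h2].
  by apply/eqP; apply: complex_eq.
pose n := (fun y => Re (g y)) * (fun y => Re (g y)) + (fun y => Im (g y)) * (fun y => Im (g y)).
have nx : n x != 0 by rewrite /n/= !fctE -!expr2.
have dn : is_derive x 1 n (2 * (Re (g x) * Re D + Im (g x) * Im D)).
  apply: (is_derive_eq (is_deriveD (is_deriveM g1 g1) (is_deriveM g2 g2))).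
  rewrite /GRing.scale /=.
  by move: (Re (g x)) (Im (g x)) (Re D) (Im D) => *; ring.
have dV : is_derive x 1 (fun y => (n y)^-1) (- (n x) ^- 2 *: (2 * (Re (g x) * Re D + Im (g x) * Im D))).
  exact: is_deriveV.
have VE z : z^-1 = (Re z / (Re z * Re z + Im z * Im z) +i* - (Im z / (Re z * Re z + Im z * Im z)))%C :> R[i].
  by case: z => u v; rewrite -!expr2.
have DE : - D / g x ^+ 2 = (- D) * ((g x)^-1 * (g x)^-1) by rewrite expr2 invfM.
rewrite DE; split.
  have -> : (fun y => Re (g y)^-1) = (fun y => Re (g y)) * (fun y => (n y)^-1).
    by apply/funext => y; rewrite VE.
  apply: is_derive_eq; rewrite !(ReM, ImM, ReN, ImN) VE /= /GRing.scale /= /n !fctE.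
  move: (Re (g x)) (Im (g x)) (Re D) (Im D) n0 => p q p' q' pq0.
  by field; rewrite -!expr2.
have -> : (fun y => Im (g y)^-1) = - ((fun y => Im (g y)) * (fun y => (n y)^-1)).
  by apply/funext => y; rewrite VE.
apply: is_derive_eq; rewrite !(ReM, ImM, ReN, ImN) VE /= /GRing.scale /= /n !fctE.
move: (Re (g x)) (Im (g x)) (Re D) (Im D) n0 => p q p' q' pq0.
by field; rewrite -!expr2.
Qed.

End ComplexDerivative.

(** * The Laplace transform in the right half-plane *)

Lemma exp_decay_bound {R : realType} (k : nat) (c : R) : 0 < c ->
  exists M : R, forall y, 0 <= y -> 0 <= y ^+ k * expR (- (c * y)) <= M.
Proof.
elim: k c => [|k IH] c c0.
  exists 1 => y y0; rewrite expr0 mul1r expR_ge0 expR_le1 oppr_le0 mulr_ge0//.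
  exact: ltW.
have c2 : 0 < c / 2 by rewrite divr_gt0.
have [M hM] := IH _ c2; exists (2 / c * M) => y y0.
rewrite mulr_ge0 ?exprn_ge0 ?expR_ge0//=.
have -> : y ^+ k.+1 * expR (- (c * y)) =
   (y * expR (- (c / 2 * y))) * (y ^+ k * expR (- (c / 2 * y))).
  by rewrite mulrACA -expRD -exprS; congr (_ * expR _); field.
have /andP[h1 h2] := hM _ y0.
apply: ler_pM => //; first by rewrite mulr_ge0// expR_ge0.
rewrite expRN ler_pdivrMr ?expR_gt0// -ler_pdivrMl ?divr_gt0// invf_div.
by apply: le_trans (expR_ge1Dx _); rewrite lerDr.
Qed.

Section LaplaceTransform.
Context {R : realType} {d : measure_display} {T : measurableType d}.
Variables (P : probability T R) (V : T -> R).
Hypothesis mV : measurable_fun setT V.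
Hypothesis V_ge0 : forall w, 0 <= V w.

Let moment_trig k p (c b y : R) := y ^+ k * expR (- (c * y)) * cos (b * y + p).

Definition lap_trig (k : nat) (p c b : R) : R := Ex P (fun w => moment_trig k p c b (V w)).

(** The expectation of [V ^ k * exp (- s V)]: shifting the phase by a quarter turn
    yields the imaginary part. *)
Definition lap (k : nat) (s : R[i]) : R[i] :=
  (lap_trig k 0 (Re s) (Im s) +i* lap_trig k (pi / 2) (Re s) (Im s))%C.

Let bmeas_moment k p c b : 0 < c -> bmeas (fun w => moment_trig k p c b (V w)).
Proof.
move=> c0; have [M hM] := exp_decay_bound k c0; apply: (bmeas_le (M := M)).
  apply: measurable_funM; first apply: measurable_funM.
  - exact: measurable_funX.
  - by apply: measurableT_comp => //; apply: measurable_funN; exact: measurable_funM.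
  - by apply: (measurableT_comp measurable_cos); apply: measurable_funD => //; exact: measurable_funM.
move=> w; have /andP[h1 h2] := hM _ (V_ge0 w).
rewrite normrM (ger0_norm h1) -[leRHS]mulr1; apply: ler_pM => //.
by rewrite ler_norml cos_geN1 cos_le1.
Qed.

Let moment_derive k p c0 c1 b0 b1 y (x : R) :
  is_derive x 1 (fun x : R => moment_trig k p (c0 + x * c1) (b0 + x * b1) y)
    (- c1 * moment_trig k.+1 p (c0 + x * c1) (b0 + x * b1) y +
     b1 * moment_trig k.+1 (p + pi / 2) (c0 + x * c1) (b0 + x * b1) y).
Proof.
have lin (u v : R) : is_derive x 1 (fun x : R => u + x * v) v.
  have -> : (fun x : R => u + x * v) = cst u + v \*: id by apply/funext => z /=; rewrite mulrC.
  by apply: is_derive_eq; rewrite /GRing.scale /= add0r mulr1.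
have d1 : is_derive x 1 (fun x : R => - ((c0 + x * c1) * y)) (- (c1 * y)).
  have -> : (fun x : R => - ((c0 + x * c1) * y)) = (fun x => - (c0 * y) + x * (- (c1 * y))).
    by apply/funext => z; ring.
  exact: lin.
have d2 : is_derive x 1 (fun x : R => (b0 + x * b1) * y + p) (b1 * y).
  have -> : (fun x : R => (b0 + x * b1) * y + p) = (fun x => (b0 * y + p) + x * (b1 * y)).
    by apply/funext => z; ring.
  exact: lin.
have e1 := @is_derive1_comp _ (@expR R) _ x _ _ (is_derive_expR _) d1.
have e2 := @is_derive1_comp _ (@cos R) _ x _ _ (is_derive_cos _) d2.
have := is_deriveZ (y ^+ k) (is_deriveM e1 e2).
have -> : (y ^+ k \*: ((@expR R \o (fun x => - ((c0 + x * c1) * y))) *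
    (@cos R \o (fun x => (b0 + x * b1) * y + p)))) =
    (fun x => moment_trig k p (c0 + x * c1) (b0 + x * b1) y).
  by apply/funext => z; rewrite /moment_trig -mulrA.
move=> h; apply: (is_derive_eq h); rewrite /GRing.scale /= /moment_trig addrA cosDpihalf exprS.
ring.
Qed.

Lemma is_derive_lap_trig k p c0 c1 b0 b1 (x : R) : 0 < c0 + x * c1 ->
  is_derive x 1 (fun x : R => lap_trig k p (c0 + x * c1) (b0 + x * b1))
    (- c1 * lap_trig k.+1 p (c0 + x * c1) (b0 + x * b1) +
     b1 * lap_trig k.+1 (p + pi / 2) (c0 + x * c1) (b0 + x * b1)).
Proof.
move=> cx; set c := c0 + x * c1 in cx *.
have c2 : 0 < c / 2 by rewrite divr_gt0.
have [M hM] := exp_decay_bound k.+1 c2.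
have M0 : 0 <= M by have /andP[h1 h2] := hM 0 (lexx _); exact: le_trans h1 h2.
pose e := c / (2 * (`|c1| + 1)).
have c1e : 0 < `|c1| + 1 by rewrite ltr_wpDl.
have e0 : 0 < e by rewrite divr_gt0// mulr_gt0.
have near z : `](x - e), (x + e)[%classic z -> c / 2 < c0 + z * c1.
  rewrite /= in_itv /= => /andP[z1 z2].
  have zx : `|z - x| < e by rewrite ltr_norml; apply/andP; split; lra.
  have : `|(z - x) * c1| < c / 2.
    rewrite normrM; apply: (@le_lt_trans _ _ (`|z - x| * (`|c1| + 1))).
      by apply: ler_wpM2l => //; rewrite lerDl.
    rewrite -ltr_pdivlMr//; suff -> : c / 2 / (`|c1| + 1) = e by [].
    by rewrite /e; field; rewrite gt_eqF.
  have -> : c0 + z * c1 = c + (z - x) * c1 by rewrite /c; ring.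
  by rewrite ltr_norml => /andP[? ?]; lra.
have near0 z : `](x - e), (x + e)[%classic z -> 0 < c0 + z * c1.
  by move=> /near; exact: lt_trans.
have Ix : `](x - e), (x + e)[%classic x by rewrite /= in_itv /=; apply/andP; split; lra.
pose f (z : R) (w : T) := moment_trig k p (c0 + z * c1) (b0 + z * b1) (V w).
have intf z : `](x - e), (x + e)[%classic z -> P.-integrable setT (EFin \o f z).
  by move=> /near0 /bmeas_moment bm; apply: bmeas_integrable; exact: bm.
have derf z w : `](x - e), (x + e)[%classic z -> setT w -> derivable (f ^~ w) z 1.
  by move=> _ _; have [] := moment_derive k p c0 c1 b0 b1 (V w) z.
have partialE z w : partial1of2 f z w = - c1 * moment_trig k.+1 p (c0 + z * c1) (b0 + z * b1) (V w) +
     b1 * moment_trig k.+1 (p + pi / 2) (c0 + z * c1) (b0 + z * b1) (V w).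
  by rewrite partial1of2E; have h := moment_derive k p c0 c1 b0 b1 (V w) z; rewrite derive_val.
have bound q z w : `](x - e), (x + e)[%classic z ->
    `|moment_trig k.+1 q (c0 + z * c1) (b0 + z * b1) (V w)| <= M.
  move=> /near cz; have /andP[h1 h2] := hM _ (V_ge0 w).
  rewrite /moment_trig normrM -[leRHS]mulr1; apply: ler_pM => //; last first.
    by rewrite ler_norml cos_geN1 cos_le1.
  rewrite ger0_norm ?mulr_ge0 ?exprn_ge0 ?expR_ge0//; apply: le_trans h2.
  apply: ler_wpM2l; first exact: exprn_ge0.
  by rewrite ler_expR lerN2; apply: ler_wpM2r => //; exact: ltW.
pose G (w : T) := (`|c1| + `|b1|) * M.
have G0 w : 0 <= G w by rewrite mulr_ge0// addr_ge0.
have intG : P.-integrable setT (EFin \o G).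
  by apply: bmeas_integrable; exact: bmeas_cst.
have Gub z w : `](x - e), (x + e)[%classic z -> setT w -> `|partial1of2 f z w| <= G w.
  move=> zx _; rewrite partialE (le_trans (ler_normD _ _))// [leRHS]mulrDl.
  rewrite [X in X + _]normrM [X in _ + X]normrM normrN.
  by apply: lerD; apply: ler_wpM2l => //; exact: bound.
have D := @derivable_under_integral _ _ _ P f setT measurableT x (x - e) (x + e) Ix intf derf G G0 intG Gub.
have E := @differentiation_under_integral _ _ _ P f setT measurableT x (x - e) (x + e) Ix intf derf G G0 intG Gub.
split; first exact: D.
rewrite -derive1E E.
rewrite /lap_trig -!ExZ; [|exact: bmeas_moment..].
rewrite -ExD; last 2 first.
- by apply: bmeasM; [exact: bmeas_cst|exact: bmeas_moment].
- by apply: bmeasM; [exact: bmeas_cst|exact: bmeas_moment].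
by rewrite /Ex; apply: eq_Rintegral => w _; rewrite partialE.
Qed.

Lemma cderiv_lap k (s v : R[i]) (x : R) : 0 < Re (s + x%:C%C * v) ->
  cderiv (fun x => lap k (s + x%:C%C * v)) x (- v * lap k.+1 (s + x%:C%C * v)).
Proof.
have ReE z : Re (s + z%:C%C * v) = Re s + z * Re v by rewrite ReD ReM /= mul0r subr0.
have ImE z : Im (s + z%:C%C * v) = Im s + z * Im v by rewrite ImD ImM /= mul0r addr0.
rewrite ReE => sx; split.
  under eq_fun do rewrite /= ReE ImE.
  have := is_derive_lap_trig k 0 (Im s) (Im v) sx; rewrite add0r => h.
  by apply: (is_derive_eq h); rewrite ReM ReN ImN /= ReE ImE [X in _ = _ - X]mulNr opprK.
under eq_fun do rewrite /= ReE ImE.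
have h := is_derive_lap_trig k (pi / 2) (Im s) (Im v) sx.
apply: (is_derive_eq h); rewrite ImM ReN ImN /= ReE ImE.
have -> : lap_trig k.+1 (pi / 2 + pi / 2) (Re s + x * Re v) (Im s + x * Im v) =
    - lap_trig k.+1 0 (Re s + x * Re v) (Im s + x * Im v).
  rewrite /lap_trig -ExN; last exact: bmeas_moment.
  congr Ex; apply/funext => w; rewrite /moment_trig addr0 addrA cosDpihalf sinDpihalf.
  by rewrite mulrN.
by rewrite [X in _ = _ + X]mulNr mulrN.
Qed.

Definition lexp (s : R[i]) (y : R) : R[i] := (expR (- (Re s * y)))%:C%C * cis (- (Im s * y)).

Lemma lap0E s : lap 0 s = cE P (fun w => lexp s (V w)).
Proof.
apply: complex_eq; rewrite /= /lap_trig; congr Ex; apply/funext => w; rewrite /moment_trig expr0 mul1r.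
  by rewrite mul0r subr0 addr0 cosN.
by rewrite mul0r addr0 cosDpihalf sinN.
Qed.

Lemma cbm_lexp s : 0 <= Re s -> cbm (fun w => lexp s (V w)).
Proof.
move=> s0; apply: cbmM; last first.
  by apply: cbm_cis; apply: measurable_funN; exact: measurable_funM.
apply: cbm_real; have := bmeas_laplace mV s0.
by under eq_fun do rewrite ger0_norm//.
Qed.

Variables (a K : R).
Hypothesis a0 : 0 < a.
Hypothesis laplaceV : forall theta, 0 <= theta ->
  Ex P (fun w => expR (- (theta * V w))) = expR (- (K * theta `^ a)).

Let scale u v := expR (ln (expR (a * u) + expR (a * v)) / a).

(** Equality of laws, proved with real Laplace transforms, carries over to
    complex arguments. *)
Lemma lap_stable u v s : 0 < Re s ->
  lap 0 ((expR u)%:C%C * s) * lap 0 ((expR v)%:C%C * s) = lap 0 ((scale u v)%:C%C * s).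
Proof.
move=> s0.
have Re_s (x : R) : Re (x%:C%C * s) = x * Re s by rewrite ReM /= mul0r subr0.
have Im_s (x : R) : Im (x%:C%C * s) = x * Im s by rewrite ImM /= mul0r addr0.
have powE x : expR x `^ a = expR (a * x) by rewrite /powR gt_eqF ?expR_gt0// expRK.
have scaleE : scale u v = (expR u `^ a + expR v `^ a) `^ a^-1.
  rewrite !powE /scale /powR gt_eqF ?addr_gt0 ?expR_gt0//; congr expR; exact: mulrC.
have R0 x : 0 <= Re ((expR x)%:C%C * s) by rewrite Re_s mulr_ge0 ?expR_ge0// ltW.
rewrite !lap0E.
have := cE_prod_fun P P (cbm_lexp (R0 u)) (cbm_lexp (R0 v)) => <-.
have lE (A y : R) : lexp (A%:C%C * s) y = lexp s (A * y).
  by rewrite /lexp Re_s Im_s; congr ((expR (- _))%:C%C * cis (- _)); ring.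
have -> : (fun w : T * T => lexp ((expR u)%:C%C * s) (V w.1) * lexp ((expR v)%:C%C * s) (V w.2)) =
   (fun w => lexp s `|expR u * V w.1 + expR v * V w.2|).
  apply/funext => w; rewrite !lE /lexp mulrACA -rmorphM /= -expRD -cisD.
  rewrite ger0_norm; last by rewrite addr_ge0// mulr_ge0// expR_ge0.
  by congr ((expR _)%:C%C * cis _); ring.
have -> : (fun w => lexp ((scale u v)%:C%C * s) (V w)) = (fun w => lexp s `|scale u v * V w|).
  by apply/funext => w; rewrite lE ger0_norm// mulr_ge0// expR_ge0.
have stable := @stable_bounded _ _ _ P V a K mV V_ge0 a0 laplaceV (expR u) (expR v) 1.
have cont (f : R -> R) : continuous f ->
    continuous (fun x : R => expR (- (Re s * `|x|)) * f (- (Im s * `|x|))).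
  move=> cf x.
  have cn (r : R) : (fun x => - (r * `|x|)) y @[y --> x] --> - (r * `|x|).
    by apply: cvgN; apply: cvgMl_tmp; exact: norm_continuous.
  by apply: cvgM; [apply: continuous_cvg (cn _); exact: continuous_expR|apply: continuous_cvg (cn _); exact: cf].
have bnd (f : R -> R) (x : R) : (forall y, `|f y| <= 1) ->
    `|expR (- (Re s * `|x|)) * f (- (Im s * `|x|))| <= 1.
  move=> f1; rewrite normrM mulr_ile1// ger0_norm ?expR_ge0// expR_le1 oppr_le0.
  by rewrite mulr_ge0// ltW.
apply: complex_eq => /=.
  under eq_fun do rewrite mul0r subr0; under [in RHS]eq_fun do rewrite mul0r subr0; rewrite scaleE.
  apply: (stable (fun x => expR (- (Re s * `|x|)) * cos (- (Im s * `|x|)))); rewrite ?expR_gt0//.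
    exact: (cont (@cos R) (@continuous_cos R)).
  by move=> x; apply: bnd => y; rewrite ler_norml cos_geN1 cos_le1.
under eq_fun do rewrite mul0r addr0; under [in RHS]eq_fun do rewrite mul0r addr0; rewrite scaleE.
apply: (stable (fun x => expR (- (Re s * `|x|)) * sin (- (Im s * `|x|)))); rewrite ?expR_gt0//.
  exact: (cont (@sin R) (@continuous_sin R)).
by move=> x; apply: bnd => y; rewrite ler_norml sin_geN1 sin_le1.
Qed.

Let cderiv_ray k (s : R[i]) (r : R -> R) (u r' : R) : 0 < Re s -> 0 < r u ->
  is_derive u 1 r r' ->
  cderiv (fun u => lap k ((r u)%:C%C * s)) u (- (r'%:C%C * s) * lap k.+1 ((r u)%:C%C * s)).
Proof.
move=> s0 ru r1; have := @cderiv_lap k 0 s (r u).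
rewrite add0r ReM /= mul0r subr0 mulr_gt0// => /(_ isT).
under eq_fun do rewrite add0r.
by move=> h; have := cderiv_comp h r1; rewrite mulrA mulrN.
Qed.

Let is_derive_scale (u v : R) : is_derive u 1 (scale^~ v)
  (scale u v * (expR (a * u) / (expR (a * u) + expR (a * v)))).
Proof.
have e1 : is_derive u 1 (fun u : R => expR (a * u)) (expR (a * u) * a).
  have l : is_derive u 1 (fun u : R => a * u) a.
    have -> : (fun u : R => a * u) = a \*: id by [].
    by apply: is_derive_eq; rewrite /GRing.scale /= mulr1.
  exact: (@is_derive1_comp _ (@expR R) _ u _ _ (is_derive_expR _) l).
have e2 : is_derive u 1 (fun u : R => expR (a * u) + expR (a * v)) (expR (a * u) * a).
  by rewrite -[X in is_derive _ _ _ X]addr0; exact: is_deriveD.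
have p : 0 < expR (a * u) + expR (a * v) by rewrite addr_gt0 ?expR_gt0.
have e3 := @is_derive1_comp _ (@ln R) _ u _ _ (is_derive1_ln p) e2.
have e4 : is_derive u 1 (fun u : R => ln (expR (a * u) + expR (a * v)) / a)
    (expR (a * u) / (expR (a * u) + expR (a * v))).
  have -> : (fun u => ln (expR (a * u) + expR (a * v)) / a) =
      a^-1 \*: (@ln R \o (fun u => expR (a * u) + expR (a * v))).
    by apply/funext => z /=; rewrite /GRing.scale /= mulrC.
  apply: (is_derive_eq (is_deriveZ _ e3)); rewrite /GRing.scale /=.
  by field; rewrite !gt_eqF.
exact: (@is_derive1_comp _ (@expR R) _ u _ _ (is_derive_expR _) e4).
Qed.

Let is_derive_expRZ (c u : R) : is_derive u 1 (fun u : R => expR (c * u)) (c * expR (c * u)).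
Proof.
have l : is_derive u 1 (fun u : R => c * u) c.
  have -> : (fun u : R => c * u) = c \*: id by [].
  by apply: is_derive_eq; rewrite /GRing.scale /= mulr1.
by rewrite mulrC; exact: (@is_derive1_comp _ (@expR R) _ u _ _ (is_derive_expR _) l).
Qed.

Let ray_deriv u v s : 0 < Re s ->
  lap 1 ((expR u)%:C%C * s) * (expR ((1 - a) * u))%:C%C * lap 0 ((expR v)%:C%C * s) =
  lap 1 ((scale u v)%:C%C * s) * (scale u v / (expR (a * u) + expR (a * v)))%:C%C.
Proof.
move=> s0; have sn0 : s != 0 by apply/eqP => s0'; move: s0; rewrite s0' /= ltxx.
have p : expR (a * u) + expR (a * v) != 0 by rewrite gt_eqF// addr_gt0 ?expR_gt0.
have h1 := cderivM (cderiv_ray 0 s0 (expR_gt0 u) (is_derive_expR u)) (cderiv_cst (lap 0 ((expR v)%:C%C * s)) u).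
have h2 := @cderiv_ray 0 s (scale^~ v) u _ s0 (expR_gt0 _) (is_derive_scale u v).
move: h1; under eq_fun do rewrite lap_stable//; move=> /cderiv_unique - /(_ _ h2).
have eu : (expR (a * u))%:C%C != 0 :> R[i].
  by rewrite -(rmorph0 (real_complex R)) (inj_eq (@complexI R)) gt_eqF ?expR_gt0.
have -> : (expR ((1 - a) * u))%:C%C = (expR u)%:C%C / (expR (a * u))%:C%C :> R[i].
  by rewrite mulrBl mul1r expRD expRN rmorphM fmorphV.
have -> : (scale u v * (expR (a * u) / (expR (a * u) + expR (a * v))))%:C%C =
   (scale u v / (expR (a * u) + expR (a * v)))%:C%C * (expR (a * u))%:C%C :> R[i].
  by rewrite -rmorphM mulrCA mulrC.
have alg (l1 l0 l2 l3 q x e : R[i]) : e != 0 ->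
    - (x * s) * l1 * l0 + l2 * 0 = - (q * e * s) * l3 -> l1 * (x / e) * l0 = l3 * q.
  move=> e0 h; apply: (mulIf (mulf_neq0 e0 sn0)).
  transitivity (- (- (x * s) * l1 * l0 + l2 * 0)); first by field.
  by rewrite h; ring.
exact: alg.
Qed.

(** Differentiate [lap_stable] in each of its two parameters: the right-hand
    side is symmetric. *)
Lemma lap_homogeneous u s : 0 < Re s ->
  lap 1 ((expR u)%:C%C * s) * (expR ((1 - a) * u))%:C%C * lap 0 s =
  lap 0 ((expR u)%:C%C * s) * lap 1 s.
Proof.
move=> s0; have h1 := ray_deriv u 0 s0; have h2 := ray_deriv 0 u s0.
have sc : scale u 0 = scale 0 u by rewrite /scale addrC.
have E0 : (expR 0)%:C%C * s = s by rewrite expR0 mul1r.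
rewrite E0 in h1 h2; apply: (etrans h1).
have -> : (scale u 0 / (expR (a * u) + expR (a * 0)))%:C%C =
    (scale 0 u / (expR (a * 0) + expR (a * u)))%:C%C :> R[i].
  by rewrite sc [X in _ / X]addrC.
rewrite sc; apply: (etrans (esym h2)).
by rewrite mulr0 expR0 mulr1 mulrC.
Qed.

(** Differentiate [lap_homogeneous] at [u = 0]. *)
Lemma lap_ode s : 0 < Re s ->
  s * lap 2 s * lap 0 s = (1 - a)%:C%C * lap 1 s * lap 0 s + s * lap 1 s ^+ 2.
Proof.
move=> s0.
have e0 : 0 < expR 0 :> R by exact: expR_gt0.
have d0 := cderivM (cderivM (cderiv_ray 1 s0 e0 (is_derive_expR 0))
  (cderiv_real (is_derive_expRZ (1 - a) 0))) (cderiv_cst (lap 0 s) 0).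
have d1 := cderivM (cderiv_ray 0 s0 e0 (is_derive_expR 0)) (cderiv_cst (lap 1 s) 0).
move: d0; under eq_fun do rewrite lap_homogeneous//; move=> /cderiv_unique - /(_ _ d1).
have E0 : (expR 0)%:C%C * s = s by rewrite expR0 mul1r.
have alg (l0 l1 l2 c : R[i]) :
    (- s * l2 * 1 + l1 * c) * l0 + l1 * 1 * 0 = - s * l1 * l1 + l0 * 0 ->
    s * l2 * l0 = c * l1 * l0 + s * l1 ^+ 2.
  move=> h'; transitivity (l1 * c * l0 - ((- s * l2 * 1 + l1 * c) * l0 + l1 * 1 * 0)); first by ring.
  by rewrite h'; ring.
have e1 : expR ((1 - a) * 0) = 1 by rewrite mulr0 expR0.
by rewrite !E0 e1 mulr1; exact: alg.
Qed.

(** Powers of [s = c + i b], with the principal branch of the logarithm. *)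
Let logc (c b : R) : R[i] := (ln (c ^+ 2 + b ^+ 2) / 2 +i* atan (b / c))%C.

Let point (c b : R) : R[i] := c%:C%C + b%:C%C * 'i%C.

Let ReP c b : Re (point c b) = c.
Proof. by rewrite ReD ReM /= mul0r mulr0 subr0 addr0. Qed.

Let ImP c b : Im (point c b) = b.
Proof. by rewrite ImD ImM /= mul0r mulr1 !addr0 add0r. Qed.

Let cderiv_point k c b : 0 < c ->
  cderiv (fun b => lap k (point c b)) b (- 'i%C * lap k.+1 (point c b)).
Proof. by move=> c0; apply: cderiv_lap; rewrite ReP. Qed.

Let lin_derive (u v x : R) : is_derive x 1 (fun x : R => u + x * v) v.
Proof.
have -> : (fun x : R => u + x * v) = cst u + v \*: id by apply/funext => z /=; rewrite mulrC.
by apply: is_derive_eq; rewrite /GRing.scale /= add0r mulr1.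
Qed.

Let point_neq0 c b : 0 < c -> point c b != 0.
Proof. by move=> c0; apply/eqP => /(congr1 (@complex.Re R)); rewrite ReP /= => /eqP; rewrite gt_eqF. Qed.

Let cderiv_logc c b : 0 < c -> cderiv (logc c) b ('i%C / point c b).
Proof.
move=> c0; have n0 : 0 < c ^+ 2 + b ^+ 2 by rewrite ltr_wpDr ?sqr_ge0// exprn_gt0.
have -> : 'i%C / point c b = (b / (c ^+ 2 + b ^+ 2) +i* (c / (c ^+ 2 + b ^+ 2)))%C.
  apply: (mulIf (point_neq0 b c0)); rewrite mulfVK ?point_neq0//.
  apply: complex_eq; rewrite ?(ReM, ImM) ReP ImP /=; field; rewrite gt_eqF//.
split.
  have dq : is_derive b 1 (fun b : R => c ^+ 2 + b ^+ 2) (2 * b).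
    have -> : (fun b : R => c ^+ 2 + b ^+ 2) = cst (c ^+ 2) + id * id.
      by apply/funext => z; rewrite expr2.
    apply: (is_derive_eq (is_deriveD (is_derive_cst (c ^+ 2) b 1)
      (is_deriveM (is_derive_id b 1) (is_derive_id b 1)))).
    by rewrite /GRing.scale /= add0r !mulr1 mulr_natl mulr2n.
  have dl := @is_derive1_comp _ (@ln R) _ b _ _ (is_derive1_ln n0) dq.
  have -> : (fun y => Re (logc c y)) = 2^-1 \*: (@ln R \o (fun b => c ^+ 2 + b ^+ 2)).
    by apply/funext => z /=; rewrite /GRing.scale /= mulrC.
  by apply: (is_derive_eq (is_deriveZ _ dl)); rewrite /GRing.scale /=; field; rewrite gt_eqF.
have dq : is_derive b 1 (fun b : R => b / c) c^-1.
  by have := lin_derive 0 c^-1 b; under eq_fun do rewrite add0r.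
have da := @is_derive1_comp _ (@atan R) _ b _ _ (is_derive1_atan _) dq.
by apply: (is_derive_eq da) => /=; field; rewrite !gt_eqF.
Qed.

Let powc (e c b : R) := cexp (e%:C%C * logc c b).

Let cderiv_powc e c b : 0 < c ->
  cderiv (powc e c) b (e%:C%C * ('i%C / point c b) * powc e c b).
Proof.
move=> c0; apply: cderiv_cexp.
have := cderivM (cderiv_cst e%:C%C b) (cderiv_logc b c0).
by rewrite mul0r add0r.
Qed.

Let lap_real c : 0 < c -> lap 0 (point c 0) = (expR (- (K * c `^ a)))%:C%C /\
  c%:C%C * lap 1 (point c 0) = (a * K * c `^ a)%:C%C * lap 0 (point c 0).
Proof.
move=> c0.
have real k x : lap k (point x 0) = (lap_trig k 0 x 0)%:C%C.
  rewrite /lap ReP ImP; suff -> : lap_trig k (pi / 2) x 0 = 0 by [].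
  rewrite /lap_trig -[RHS](Ex_cst P); congr Ex; apply/funext => w.
  by rewrite /moment_trig mul0r add0r cos_pihalf mulr0.
have l0 x : 0 < x -> lap 0 (point x 0) = (expR (- (K * x `^ a)))%:C%C.
  move=> x0; rewrite real -laplaceV ?ltW//; congr (Ex _ _)%:C%C; apply/funext => w.
  by rewrite /moment_trig mul0r add0r cos0 mulr1 expr0 mul1r.
split; first exact: l0.
have pE u : point (expR u) 0 = (expR u)%:C%C * 1 by rewrite mulr1 /point rmorph0 mul0r addr0.
have d1 := @cderiv_ray 0 1 (@expR R) (ln c) _ ltr01 (expR_gt0 _) (is_derive_expR _).
have dE := is_derive_expRZ a (ln c).
have d2 : is_derive (ln c) 1 (fun u : R => expR (- (K * expR (a * u))))
    (- (K * (a * expR (a * ln c))) * expR (- (K * expR (a * ln c)))).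
  have d3 : is_derive (ln c) 1 (fun u : R => - (K * expR (a * u))) (- (K * (a * expR (a * ln c)))).
    have -> : (fun u : R => - (K * expR (a * u))) = (- K) \*: (fun u : R => expR (a * u)).
      by apply/funext => z; exact: esym (mulNr _ _).
    by apply: (is_derive_eq (is_deriveZ _ dE)); rewrite /GRing.scale /= mulNr.
  apply: (is_derive_eq (@is_derive1_comp _ (@expR R) _ _ _ _ (is_derive_expR _) d3)).
  exact: mulrC.
move: d1; under eq_fun do rewrite -pE l0 ?expR_gt0//.
have powE x : expR x `^ a = expR (a * x) by rewrite /powR gt_eqF ?expR_gt0// expRK.
under eq_fun do rewrite powE.
move=> /cderiv_unique - /(_ _ (cderiv_real d2)).
rewrite -pE lnK ?posrE// l0//.
have -> : c `^ a = expR (a * ln c) by rewrite /powR gt_eqF.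
have {1}-> : point c 0 = c%:C%C by rewrite /point rmorph0 mul0r addr0.
rewrite mulNr => h; apply: oppr_inj; rewrite h -!rmorphM -rmorphN; congr (_%:C%C).
ring.
Qed.

Let lap0_neq0 s : 0 < Re s -> lap 0 s != 0.
Proof.
move=> s0; apply/eqP => l0; pose u := - (ln 2 / a).
have sc : scale u u = 1.
  have eu : expR (a * u) = 2^-1.
    by rewrite /u mulrN mulrCA divff ?gt_eqF// mulr1 expRN lnK ?posrE.
  have -> : 1 = expR (ln 1 / a) :> R by rewrite ln1 mul0r expR0.
  by rewrite /scale eu; congr (expR (ln _ / a)); field.
have eu0 : 0 < expR u by exact: expR_gt0.
have ReE (x : R) (z : R[i]) : Re (x%:C%C * z) = x * Re z by rewrite ReM /= mul0r subr0.
have ImE (x : R) (z : R[i]) : Im (x%:C%C * z) = x * Im z by rewrite ImM /= mul0r addr0.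
have h n : lap 0 ((expR u ^+ n)%:C%C * s) = 0.
  elim: n => [|n IH]; first by rewrite expr0 mul1r.
  have sn : 0 < Re ((expR u ^+ n)%:C%C * s) by rewrite ReE mulr_gt0// exprn_gt0.
  have := lap_stable u u sn; rewrite sc mul1r IH => /eqP.
  by rewrite mulf_eq0 orbb mulrA -rmorphM -exprS => /eqP.
have r0 : expR u ^+ n @[n --> \oo] --> (0 : R).
  apply: cvg_expr; rewrite ger0_norm ?expR_ge0// expR_lt1 oppr_lt0 divr_gt0// ln_gt0//.
  by rewrite ltr1n.
have : lap_trig 0 0 (expR u ^+ n * Re s) (expR u ^+ n * Im s) @[n --> \oo] --> (1 : R).
  rewrite -[X in _ --> X](Ex_cst P).
  apply: (@Ex_dct _ _ _ _ _ _ 1) => [n|n w| |]; last by [].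
  - by have [] := bmeas_moment 0 0 (expR u ^+ n * Im s) (mulr_gt0 (exprn_gt0 n eu0) s0).
  - rewrite /moment_trig expr0 mul1r normrM mulr_ile1//.
      rewrite ger0_norm ?expR_ge0// expR_le1 oppr_le0 mulr_ge0// mulr_ge0 ?exprn_ge0 ?expR_ge0//.
      exact: ltW.
    by rewrite ler_norml cos_geN1 cos_le1.
  apply: aeW => w.
  have l0' z : expR u ^+ n * z * V w @[n --> \oo] --> (0 : R).
    rewrite -(mul0r (V w)) -(mul0r z).
    by apply: cvgMr_tmp; apply: cvgMr_tmp; exact: r0.
  have l1 z : - (expR u ^+ n * z * V w) @[n --> \oo] --> (0 : R).
    by rewrite -oppr0; apply: cvgN; exact: l0'.
  have l2 : expR u ^+ n * Im s * V w + 0 @[n --> \oo] --> (0 : R).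
    by under eq_fun do rewrite addr0; exact: l0'.
  rewrite /moment_trig; under eq_fun do rewrite expr0 mul1r.
  have -> : 1 = expR 0 * cos 0 :> R by rewrite expR0 cos0 mulr1.
  apply: cvgM; apply: continuous_cvg; [exact: continuous_expR|exact: l1|exact: continuous_cos|exact: l2].
have -> : (fun n => lap_trig 0 0 (expR u ^+ n * Re s) (expR u ^+ n * Im s)) = (fun=> 0).
  by apply/funext => n; have := congr1 (@complex.Re R) (h n); rewrite /= -ReE -ImE.
move=> h1; have h0 : 0 @[_ --> \oo : set_system nat] --> (0 : R) by exact: cvg_cst.
by have := oner_neq0 R; rewrite (cvg_unique _ h1 h0) // eqxx.
Qed.

(** Integrating the equation along a vertical line from the real axis. *)
Lemma lap_closed c b : 0 < c ->
  lap 0 (c +i* b)%C = cexp (- (K%:C%C * cexp (a%:C%C * (ln (c ^+ 2 + b ^+ 2) / 2 +i* atan (b / c))%C))).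
Proof.
move=> c0; rewrite -/(logc c b) -/(powc a c b).
have -> : (c +i* b)%C = point c b by apply: complex_eq; rewrite ?ReP ?ImP.
have l0 x : lap 0 (point c x) != 0 by apply: lap0_neq0; rewrite ReP.
have pE x : powc a c x * powc (- a) c x = 1.
  by rewrite /powc rmorphN mulNr cexpNr.
have powc0 e : powc e c 0 = (expR (e * ln c))%:C%C.
  have l2 : ln (c ^+ 2 + 0 ^+ 2) / 2 = ln c.
    by rewrite expr0n /= addr0 lnXn//; field.
  by rewrite /powc -cexp_real /logc mul0r atan0 l2 rmorphM.
have [r0 r1] := lap_real c0.
have cpt x : cderiv (point c) x 'i%C.
  have := cderivD (cderiv_cst c%:C%C x) (cderivM (cderiv_real (is_derive_id x 1)) (cderiv_cst 'i%C x)).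
  by rewrite mulr0 addr0 add0r mul1r.
pose W x := point c x * lap 1 (point c x) * (lap 0 (point c x))^-1 * powc (- a) c x.
have W0 x : cderiv W x 0.
  have h := cderivM (cderivM (cderivM (cpt x) (cderiv_point 1 x c0)) (cderivV (l0 x) (cderiv_point 0 x c0)))
    (cderiv_powc (- a) x c0).
  move: h; rewrite /W; set D := (X in cderiv _ _ X) => h; suff <- : D = 0 by exact: h.
  have := @lap_ode (point c x); rewrite ReP => /(_ c0).
  have alg (q0 q1 q2 w p e : R[i]) : q0 != 0 -> p != 0 ->
      p * q2 * q0 = (1 - e) * q1 * q0 + p * q1 ^+ 2 ->
      (('i%C * q1 + p * (- 'i%C * q2)) / q0 + p * q1 * (- (- 'i%C * q1) / q0 ^+ 2)) * w +
      p * q1 / q0 * (- e * ('i%C / p) * w) = 0.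
    move=> q00 p0 ode.
    have -> : ('i%C * q1 + p * (- 'i%C * q2)) / q0 = ('i%C * q1 * q0 - 'i%C * (p * q2 * q0)) / q0 ^+ 2 by field.
    by rewrite ode; field; rewrite q00 p0.
  by rewrite rmorphB rmorph1 /D rmorphN; apply: alg; [exact: l0|exact: point_neq0].
have W1 x : point c x * lap 1 (point c x) = (a * K)%:C%C * powc a c x * lap 0 (point c x).
  have := cderiv0_cst W0 x 0; rewrite /W.
  have -> : point c 0 * lap 1 (point c 0) / lap 0 (point c 0) * powc (- a) c 0 = (a * K)%:C%C.
    have {1}-> : point c 0 = c%:C%C by rewrite /point rmorph0 mul0r addr0.
    rewrite r1 mulfK// powc0 -rmorphM -!mulrA.
    have -> : c `^ a * expR (- a * ln c) = 1.
      by rewrite /powR gt_eqF// -expRD mulNr subrr expR0.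
    by rewrite mulr1.
  have alg (q0 q1 w w' p e : R[i]) : q0 != 0 -> w * w' = 1 -> p * q1 / q0 * w' = e ->
      p * q1 = e * w * q0.
    move=> q00 ww <-; transitivity (p * q1 * (w * w')); first by rewrite ww mulr1.
    by field.
  exact: alg.
pose U x := lap 0 (point c x) * cexp (K%:C%C * powc a c x).
have U0 x : cderiv U x 0.
  have h := cderivM (cderiv_point 0 x c0) (cderiv_cexp (cderivM (cderiv_cst K%:C%C x) (cderiv_powc a x c0))).
  move: h; rewrite /U; set D := (X in cderiv _ _ X) => h; suff <- : D = 0 by exact: h.
  have alg (q0 q1 e w p a' K' : R[i]) : p != 0 -> p * q1 = a' * K' * w * q0 ->
      - 'i%C * q1 * e + q0 * ((0 * w + K' * (a' * ('i%C / p) * w)) * e) = 0.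
    move=> p0 h'; transitivity ('i%C / p * e * (- (p * q1) + a' * K' * w * q0)); first by field.
    by rewrite h' addNr mulr0.
  by rewrite /D; apply: alg; [exact: point_neq0|rewrite W1 rmorphM].
have := cderiv0_cst U0 b 0; rewrite /U r0 powc0 -rmorphM cexp_real -rmorphM -expRD.
rewrite /powR gt_eqF// addNr expR0 => h.
rewrite -[LHS]mulr1 -(cexpNr (K%:C%C * powc a c b)) mulrA h mul1r.
by [].
Qed.

Lemma ccvg_cexp (u : nat -> R[i]) l : ccvg u l -> ccvg (fun n => cexp (u n)) (cexp l).
Proof.
move=> [ur ui].
by split; apply: cvgM; apply: continuous_cvg => //;
  [exact: continuous_expR|exact: continuous_cos|exact: continuous_expR|exact: continuous_sin].
Qed.

Let ccvg_pair (u v : nat -> R) x y : u n @[n --> \oo] --> x -> v n @[n --> \oo] --> y ->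
  ccvg (fun n => u n +i* v n)%C (x +i* y)%C.
Proof. by split. Qed.

(** The characteristic function is the boundary value on the imaginary axis. *)
Theorem stable_char_fun theta :
  cE P (fun w => cis (theta * V w)) =
  cexp (- ((K * `|theta| `^ a)%:C%C * cexp (- ('i%C * (Num.sg theta * (a * pi / 2))%:C%C)))).
Proof.
have [->|t0] := eqVneq theta 0.
  rewrite normr0 powR0 ?gt_eqF// mulr0 mul0r oppr0 cexp0 -[RHS](cE_cst P).
  by congr cE; apply/funext => w; rewrite mul0r cis0.
pose c n : R := n.+1%:R^-1.
have c_gt0 n : 0 < c n by rewrite /c invr_gt0.
have c_to0 : c n @[n --> \oo] --> (0 : R) by exact: cvg_harmonic.
have lhs : ccvg (fun n => lap 0 (c n +i* - theta)%C) (cE P (fun w => cis (theta * V w))).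
  have trig p : lap_trig 0 p (c n) (- theta) @[n --> \oo] --> Ex P (fun w => cos (- theta * V w + p)).
    apply: (@Ex_dct _ _ _ _ _ _ 1) => [n|n w| |].
    - by have [] := bmeas_moment 0 p (- theta) (c_gt0 n).
    - rewrite /moment_trig expr0 mul1r normrM mulr_ile1//.
        by rewrite ger0_norm ?expR_ge0// expR_le1 oppr_le0 mulr_ge0// ltW.
      by rewrite ler_norml cos_geN1 cos_le1.
    - apply: aeW => w; rewrite /moment_trig; under eq_fun do rewrite expr0 mul1r.
      have h : expR (- (c n * V w)) @[n --> \oo] --> (1 : R).
        rewrite -(@expR0 R); apply: continuous_cvg; first exact: continuous_expR.
        by rewrite -oppr0 -(mul0r (V w)); apply: cvgN; apply: cvgMr_tmp.
      suff : expR (- (c n * V w)) * cos (- theta * V w + p) @[n --> \oo] -->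
          1 * cos (- theta * V w + p) by rewrite mul1r.
      by apply: cvgM => //; exact: cvg_cst.
    - apply: (measurableT_comp measurable_cos); apply: measurable_funD => //.
      exact: measurable_funM.
  have := ccvg_pair (trig 0) (trig (pi / 2)).
  congr ccvg; apply: complex_eq => /=; congr Ex; apply/funext => w.
    by rewrite addr0 mulNr cosN.
  by rewrite cosDpihalf mulNr sinN opprK.
have rhs : ccvg (fun n => cexp (- (K%:C%C * cexp (a%:C%C *
      (ln (c n ^+ 2 + (- theta) ^+ 2) / 2 +i* atan (- theta / c n))%C))))
    (cexp (- (K%:C%C * cexp (a%:C%C * (ln (theta ^+ 2) / 2 +i* (- (Num.sg theta * (pi / 2))))%C)))).
  apply: ccvg_cexp.
  have h : ccvg (fun n => ln (c n ^+ 2 + (- theta) ^+ 2) / 2 +i* atan (- theta / c n))%C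
      (ln (theta ^+ 2) / 2 +i* (- (Num.sg theta * (pi / 2))))%C.
    apply: ccvg_pair.
      apply: cvgMr_tmp; apply: continuous_cvg.
        by apply: continuous_ln; rewrite exprn_even_gt0.
      rewrite -[X in _ --> X]add0r sqrrN; apply: cvgD; last exact: cvg_cst.
      rewrite -[X in _ --> X](expr0n R 2); under eq_fun do rewrite expr2.
      by rewrite expr2; exact: cvgM.
    have sg1 x : atan (Num.sg theta * x) = Num.sg theta * atan x.
      by rewrite /Num.sg (negPf t0); case: ifP => _; rewrite ?mulN1r ?atanN ?mul1r.
    have E n : atan (- theta / c n) = - (Num.sg theta * atan (`|theta| * n.+1%:R)).
      by rewrite -sg1 -atanN mulrA -numEsg mulNr invrK.
    under eq_fun do rewrite E.
    apply: cvgN; apply: cvgMl_tmp; apply: (@cvg_comp _ _ _ _ (@atan R) _ _ _ _ (@cvgy_atan R)).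
    apply/cvgryPge => A; near=> n.
    rewrite mulrC -ler_pdivrMr ?normr_gt0//; apply: (le_trans (ltW (truncnS_gt _))).
    by rewrite ler_nat ltnS; near: n; exact: nbhs_infty_ge.
  have -> : (fun n => - (K%:C%C * cexp (a%:C%C *
      (ln (c n ^+ 2 + (- theta) ^+ 2) / 2 +i* atan (- theta / c n))%C))) = (fun n => (- K%:C%C) * cexp (a%:C%C *
      (ln (c n ^+ 2 + (- theta) ^+ 2) / 2 +i* atan (- theta / c n))%C)).
    by apply/funext => n; exact: esym (mulNr _ _).
  rewrite -[X in ccvg _ X]mulNr; apply: ccvgM; first exact: ccvg_cst.
  by apply: ccvg_cexp; apply: ccvgM => //; exact: ccvg_cst.
have E : (fun n => lap 0 (c n +i* - theta)%C) = (fun n => cexp (- (K%:C%C * cexp (a%:C%C *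
      (ln (c n ^+ 2 + (- theta) ^+ 2) / 2 +i* atan (- theta / c n))%C)))).
  by apply/funext => n; rewrite lap_closed.
rewrite E in lhs; rewrite (ccvg_unique lhs rhs); congr cexp.
have -> : (K * `|theta| `^ a)%:C%C = K%:C%C * cexp (a * ln `|theta|)%:C%C.
  by rewrite cexp_real -rmorphM /powR normr_eq0 (negPf t0).
rewrite -[X in _ = - X]mulrA -cexpD; congr (- (_ * cexp _)).
apply: complex_eq; rewrite ?(ReM, ImM) /=; last by ring.
rewrite -(real_normK (num_real theta)) lnXn ?normr_gt0//; field.
Unshelve. all: by end_near. Qed.

End LaplaceTransform.

(** * The complex exponential series *)

Section ExponentialSeries.
Context {R : realType}.
Implicit Types z : R[i].

Lemma normcM z w : normc (z * w) = normc z * normc w.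
Proof. exact: ComplexField.Normc.normcM. Qed.

Lemma normc1 : normc (1 : R[i]) = 1.
Proof. by rewrite (normc_real 1) normr1. Qed.

(** The mean value theorem for the real and the imaginary part, whence the
    factor 2. *)
Lemma cderiv_bound (g D : R -> R[i]) (M : R) : (forall x, cderiv g x (D x)) ->
  (forall x, 0 <= x <= 1 -> normc (D x) <= M) -> normc (g 1 - g 0) <= 2 * M.
Proof.
move=> gD DM.
have part (f df : R -> R) : (forall x : R, is_derive x 1 f (df x)) ->
    (forall x, 0 <= x <= 1 -> `|df x| <= M) -> `|f 1 - f 0| <= M.
  move=> fd dM.
  have cf : {within `[0, 1], continuous f}.
    by apply: derivable_within_continuous => x _; have [] := fd x.
  have [c c01 ->] := MVT ltr01 (fun x _ => fd x) cf.
  rewrite subr0 mulr1; apply: dM; move: c01; rewrite in_itv /= => /andP[h1 h2].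
  by rewrite !ltW.
apply: le_trans (normc_le _) _; rewrite ReD ReN ImD ImN mulr_natl mulr2n; apply: lerD.
  apply: (part (fun x => Re (g x)) (fun x => Re (D x))) => x; first by case: (gD x).
  by move=> /DM; apply: le_trans; exact: normc_Re.
apply: (part (fun x => Im (g x)) (fun x => Im (D x))) => x; first by case: (gD x).
by move=> /DM; apply: le_trans; exact: normc_Im.
Qed.

Lemma cderiv_linear z x : cderiv (fun x => x%:C%C * z) x z.
Proof.
have := cderivM (cderiv_real (is_derive_id x 1)) (cderiv_cst z x).
by rewrite mulr0 addr0 mul1r.
Qed.

Definition exp_sum (N : nat) z : R[i] := \sum_(n < N) z ^+ n / n`!%:R.

Lemma exp_sumS N z : exp_sum N.+1 z = exp_sum N z + z ^+ N / N`!%:R.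
Proof. exact: big_ord_recr. Qed.

Let natC (n : nat) : (n%:R : R[i]) = n%:R%:C%C.
Proof. by rewrite rmorph_nat. Qed.

Let fact_neq0 (n : nat) : (n`!%:R : R[i]) != 0.
Proof. by rewrite natC -(rmorph0 (real_complex R)) (inj_eq (@complexI R)) pnatr_eq0 -lt0n fact_gt0. Qed.

Lemma cderiv_monomial z N x : cderiv (fun x => (x%:C%C * z) ^+ N.+1 / (N.+1)`!%:R) x
  (z * ((x%:C%C * z) ^+ N / N`!%:R)).
Proof.
have pow n : cderiv (fun x => (x%:C%C * z) ^+ n.+1) x (n.+1%:R * z * (x%:C%C * z) ^+ n).
  elim: n => [|n IH].
    by under eq_fun do rewrite expr1; rewrite expr0 mul1r mulr1; exact: cderiv_linear.
  have := cderivM (cderiv_linear z x) IH.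
  under eq_fun do rewrite -exprS.
  have -> : z * (x%:C%C * z) ^+ n.+1 + x%:C%C * z * (n.+1%:R * z * (x%:C%C * z) ^+ n) =
     n.+2%:R * z * (x%:C%C * z) ^+ n.+1.
    rewrite -[n.+2%:R]natr1 [(x%:C%C * z) ^+ n.+1]exprS.
    by move: (n.+1%:R : R[i]) ((x%:C%C * z) ^+ n) (x%:C%C) => *; ring.
  exact.
have := cderivM (pow N) (cderiv_cst ((N.+1)`!%:R)^-1 x).
rewrite mulr0 addr0.
have -> : N.+1%:R * z * (x%:C%C * z) ^+ N / (N.+1)`!%:R = z * ((x%:C%C * z) ^+ N / N`!%:R).
  rewrite factS natrM; move: (fact_neq0 N) => f0.
  have n0 : (N.+1%:R : R[i]) != 0.
    by rewrite natC -(rmorph0 (real_complex R)) (inj_eq (@complexI R)) pnatr_eq0.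
  by move: (N.+1%:R : R[i]) ((x%:C%C * z) ^+ N) (N`!%:R : R[i]) n0 f0 => u v w u0 w0; field; rewrite ?u0 ?w0.
exact.
Qed.

Lemma cderiv_exp_sum z N x :
  cderiv (fun x => exp_sum N.+1 (x%:C%C * z)) x (z * exp_sum N (x%:C%C * z)).
Proof.
elim: N => [|N IH].
  rewrite {2}/exp_sum big_ord0 mulr0.
  under eq_fun do rewrite /exp_sum big_ord1 expr0.
  exact: cderiv_cst.
under eq_fun do rewrite exp_sumS.
by rewrite exp_sumS mulrDr; apply: cderivD => //; exact: cderiv_monomial.
Qed.

Lemma normc_cexp z : normc (cexp z) = expR (Re z).
Proof.
have -> : cexp z = (expR (Re z))%:C%C * cis (Im z).
  by apply: complex_eq; rewrite ?(ReM, ImM) /= mul0r ?subr0 ?addr0.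
by rewrite normcM normc_cis mulr1 normc_real ger0_norm ?expR_ge0.
Qed.

(** The derivative of [cexp (- x z) * exp_sum N.+1 (x z)] in [x] telescopes to
    the last monomial of the sum. *)
Lemma exp_sum_error z N :
  normc (cexp (- z) * exp_sum N.+1 z - 1) <= 2 * (normc z ^+ N.+1 / N`!%:R * expR (normc z)).
Proof.
pose g (x : R) := cexp (x%:C%C * - z) * exp_sum N.+1 (x%:C%C * z).
have gD x : cderiv g x (- z * ((x%:C%C * z) ^+ N / N`!%:R) * cexp (x%:C%C * - z)).
  have := cderivM (cderiv_cexp (cderiv_linear (- z) x)) (cderiv_exp_sum z N x).
  rewrite exp_sumS.
  move: (cexp _) (exp_sum N _) (_ / _) => e s t.
  have -> : - z * e * (s + t) + e * (z * s) = - z * t * e by ring.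
  exact.
have := @cderiv_bound g _ (normc z ^+ N.+1 / N`!%:R * expR (normc z)) gD.
have -> : g 1 - g 0 = cexp (- z) * exp_sum N.+1 z - 1.
  have e0 : exp_sum N.+1 (0%:C%C * z) = 1.
    rewrite mul0r /exp_sum big_ord_recl /= expr0 mul1r fact0 invr1.
    by rewrite big1 ?addr0// => i _; rewrite /bump /= expr0n mul0r.
  by rewrite /g e0 !mul1r mul0r cexp0 mul1r.
apply => x /andP[x0 x1].
rewrite !normcM normcN normcX normcM natC -fmorphV !normc_real (ger0_norm x0).
rewrite exprS -!mulrA; apply: ler_wpM2l; first exact: normc_ge0.
rewrite exprMn !mulrA; apply: ler_pM; rewrite ?mulr_ge0 ?exprn_ge0 ?normc_ge0//.
- by rewrite ger0_norm ?invr_ge0 ?ler0n// ler_wpM2r ?invr_ge0 ?ler0n// ler_piMl ?exprn_ge0 ?normc_ge0// exprn_ile1.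
- rewrite normc_cexp ler_expR ReM /= mul0r subr0; apply: le_trans (ler_norm _) _.
  by rewrite normrM (ger0_norm x0) ReN normrN; apply: le_trans (normc_Re z); rewrite ler_piMl.
Qed.

Lemma ccvg_exp_sum z : ccvg (fun N => exp_sum N z) (cexp z).
Proof.
have fast : normc z ^+ N / N`!%:R @[N --> \oo] --> (0 : R).
  by apply/cvg_series_cvg_0; exact: is_cvg_series_exp_coeff.
have h1 : ccvg (fun N => cexp (- z) * exp_sum N.+1 z) 1.
  apply: (@ccvg_squeeze _ _ _ (fun N => 2 * (normc z ^+ N.+1 / N`!%:R * expR (normc z)))).
    exact: exp_sum_error.
  rewrite -(mulr0 2) -(mul0r (expR (normc z))); apply: cvgMl_tmp; apply: cvgMr_tmp.
  rewrite -(mulr0 (normc z)).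
  under eq_fun do rewrite exprS -mulrA; exact: cvgMl_tmp.
have h2 : ccvg (fun N => exp_sum N.+1 z) (cexp z).
  have := ccvgM (ccvg_cst (cexp z)) h1; rewrite mulr1.
  by under eq_fun do rewrite mulrA cexpNr mul1r.
by case: h2 => h3 h4; split; rewrite -cvg_shiftS.
Qed.

End ExponentialSeries.

(** * Noise that is independent conditionally on a random variable *)

Lemma cbmX {R : realType} {d} {T : measurableType d} (f : T -> R[i]) n :
  cbm f -> cbm (fun w => f w ^+ n).
Proof.
move=> bf; elim: n => [|n IH]; first by under eq_fun do rewrite expr0; exact: cbm_cst.
by under eq_fun do rewrite exprS; exact: cbmM.
Qed.

Lemma normc_prod_le1 {R : realType} (I : Type) (s : seq I) (F : I -> R[i]) :
  (forall i, normc (F i) <= 1) -> normc (\prod_(i <- s) F i) <= 1.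
Proof.
move=> F1; rewrite normc_prod; elim: s => [|i s IH]; rewrite ?big_nil// big_cons.
by rewrite mulr_ile1 ?normc_ge0// -normc_prod normc_ge0.
Qed.

Lemma normc_lim {R : realType} (u : nat -> R[i]) l (M : R) :
  ccvg u l -> (forall n, normc (u n) <= M) -> normc l <= M.
Proof.
move=> /ccvg_normc ul uM; apply/ler_addgt0Pr => e e0.
move/cvgr0Pnorm_lt : ul => /(_ _ e0) [n _ /(_ n (leqnn n))] /= h.
have -> : l = u n - (u n - l) by rewrite subKr.
apply: le_trans (normcB _ _) _; apply: lerD => //; apply: ltW.
by apply: le_lt_trans h; exact: ler_norm.
Qed.

Section CountableDecomposition.
Context {R : realType} {d : measure_display} {T : measurableType d}.
Variable P : probability T R.

Lemma cbm_nat (H : T -> nat) (n : nat) : measurable [set w | H w = n] ->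
  cbm (fun w => (H w == n)%:R : R[i]).
Proof.
move=> mH; have -> : (fun w => (H w == n)%:R : R[i]) = (fun w => (\1_[set w | H w = n] w)%:C%C).
  apply/funext => w; rewrite indicE /= rmorph_nat; congr (nat_of_bool _)%:R.
  by apply/eqP/idP; rewrite inE.
exact: cbm_indic.
Qed.

Lemma normc_bool (b : bool) : normc (b%:R : R[i]) <= 1.
Proof.
by case: b; rewrite ?normc1// /= !expr0n /= addr0 sqrtr0.
Qed.

Variables (H : T -> nat) (f : nat -> T -> R[i]) (M : R).
Hypothesis bf : forall n, cbm (fun w => (H w == n)%:R * f n w).
Hypothesis fM : forall n w, normc (f n w) <= M.

Let partial N w := \sum_(n < N) (H w == n)%:R * f n w.

Let partialE N w : partial N w = if (H w < N)%N then f (H w) w else 0.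
Proof.
rewrite /partial; case: ltnP => h.
  rewrite (bigD1 (Ordinal h)) //= eqxx mul1r big1 ?addr0// => i ni.
  rewrite (_ : (H w == i) = false) ?mul0r//; apply/negbTE; apply: contra ni => /eqP e.
  by apply/eqP/val_inj.
by rewrite big1// => i _; rewrite gtn_eqF ?mul0r// (leq_trans (ltn_ord i)).
Qed.

Let partial_cvg w : ccvg (partial^~ w) (f (H w) w).
Proof.
split; apply: cvg_near_cst; exists (H w).+1 => // N /= hN; by rewrite partialE hN.
Qed.

Let partial_bound N w : normc (partial N w) <= M.
Proof.
rewrite partialE; case: ifP => _; first exact: fM.
by rewrite /= !expr0n /= addr0 sqrtr0; apply: le_trans (fM 0 w); exact: normc_ge0.
Qed.

Let cbm_partial N : cbm (partial N).
Proof. by apply: cbm_sum => n; exact: bf. Qed.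

Lemma cbm_countable : cbm (fun w => f (H w) w).
Proof.
split.
  apply: (@bmeas_lim _ _ _ (fun N w => Re (partial N w)) _ M).
  - by move=> N; have [[]] := cbm_partial N.
  - by move=> N w; exact: le_trans (normc_Re _) (partial_bound _ _).
  - by move=> w; have [] := partial_cvg w.
apply: (@bmeas_lim _ _ _ (fun N w => Im (partial N w)) _ M).
- by move=> N; have [_ []] := cbm_partial N.
- by move=> N w; exact: le_trans (normc_Im _) (partial_bound _ _).
- by move=> w; have [] := partial_cvg w.
Qed.

(** The partial sums are the expectations restricted to the event [H < N]. *)
Lemma cE_countable : ccvg (fun N => \sum_(n < N) cE P (fun w => (H w == n)%:R * f n w))
  (cE P (fun w => f (H w) w)).
Proof.
have -> : (fun N => \sum_(n < N) cE P (fun w => (H w == n)%:R * f n w)) =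
    (fun N => cE P (partial N)).
  by apply/funext => N; rewrite cE_sum.
apply: (@cE_dct _ _ _ P _ _ M) => //; first exact: cbm_countable.
by apply: aeW => w; exact: partial_cvg.
Qed.

End CountableDecomposition.

Section ConditionallyIndependentNoise.
Context {R : realType} {d : measure_display} {T : measurableType d}.
Variables (P : probability T R) (alpha : T -> R).
Hypothesis malpha : measurable_fun setT alpha.
Variables (I : eqType) (Z : I -> T -> nat) (q : I -> nat -> T -> R).
Hypothesis mZ : forall i n, measurable [set w | Z i w = n].
Hypothesis mq : forall i n, measurable_fun setT (q i n : rv_space alpha -> R).
Hypothesis q01 : forall i n w, 0 <= q i n w <= 1.
Hypothesis q_indep : forall (s : seq I) (n : I -> nat) (A : set R), uniq s -> measurable A ->
  Ex P (fun w => \1_A (alpha w) * \prod_(i <- s) (Z i w == n i)%:R) =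
  Ex P (fun w => \1_A (alpha w) * \prod_(i <- s) q i (n i) w).

Lemma cbm_rv_space (g : T -> R[i]) : cbm (g : rv_space alpha -> R[i]) -> cbm g.
Proof.
by move=> [[m1 b1] [m2 b2]]; split; split => //; exact: (rv_space_fun malpha).
Qed.

Let cbm_q i n : cbm ((fun w => (q i n w)%:C%C) : rv_space alpha -> R[i]).
Proof.
apply: cbm_real; apply: (bmeas_le (M := 1)); first exact: mq.
by move=> w; have /andP[h1 h2] := q01 i n w; rewrite ger0_norm.
Qed.

Let cbm_qT i n : cbm (fun w => (q i n w)%:C%C : R[i]).
Proof. exact: cbm_rv_space (cbm_q i n). Qed.

Let cbm_Z i n : cbm (fun w => (Z i w == n)%:R : R[i]).
Proof. exact: cbm_nat. Qed.

(** [fresh D b]: given [alpha], the noise indexed by [D] keeps its product law when [b]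
    is inserted as a weight. *)
Definition fresh (D : pred I) (b : T -> R[i]) : Prop :=
  cbm b /\ forall (s : seq I) (n : I -> nat) (g : T -> R[i]), uniq s -> all D s ->
    cbm (g : rv_space alpha -> R[i]) ->
    cE P (fun w => g w * b w * \prod_(i <- s) (Z i w == n i)%:R) =
    cE P (fun w => g w * b w * \prod_(i <- s) (q i (n i) w)%:C%C).

Lemma fresh_one : fresh predT (fun=> 1).
Proof.
split=> [|s n g us _ bg]; first exact: cbm_cst.
under eq_fun do rewrite mulr1; under [in RHS]eq_fun do rewrite mulr1.
have bZ : cbm (fun w => \prod_(i <- s) ((Z i w == n i)%:R : R[i])) by exact: cbm_prod.
have bq : cbm (fun w => \prod_(i <- s) (q i (n i) w)%:C%C : R[i]) by exact: cbm_prod.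
have mid : measurable_fun setT (id : T -> rv_space alpha).
  move=> _ E mE; rewrite setTI; apply: (sigma_rv_measurable malpha).
  by apply/measurable_rv_space.
rewrite (@cE_indic_ext R _ T P _ T P _ (rv_space alpha) id id
  (fun w => \prod_(i <- s) ((Z i w == n i)%:R : R[i])) (fun w => \prod_(i <- s) (q i (n i) w)%:C%C)
  mid mid bZ bq _ g bg) //.
move=> E /measurable_rv_space [A mA EA]; have /= := q_indep n us mA.
have Ein w : \1_E w = \1_A (alpha w) :> R.
  by rewrite -EA setTI indic_preimage.
move=> h; under eq_fun do rewrite Ein; under [in RHS]eq_fun do rewrite Ein.
have -> : (fun w => (\1_A (alpha w))%:C%C * \prod_(i <- s) ((Z i w == n i)%:R : R[i])) =
    (fun w => (\1_A (alpha w) * \prod_(i <- s) (Z i w == n i)%:R)%:C%C).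
  by apply/funext => w; rewrite rmorphM rmorph_prod; congr (_ * _); apply: eq_bigr => i _; rewrite rmorph_nat.
have -> : (fun w => (\1_A (alpha w))%:C%C * \prod_(i <- s) (q i (n i) w)%:C%C) =
    (fun w => (\1_A (alpha w) * \prod_(i <- s) (q i (n i) w))%:C%C : R[i]).
  by apply/funext => w; rewrite rmorphM rmorph_prod.
by rewrite !cE_real h.
Qed.

Lemma fresh_sub (D D' : pred I) b : {subset D' <= D} -> fresh D b -> fresh D' b.
Proof.
move=> sub [bb h]; split => // s n g us sD bg; apply: h => //.
by apply/allP => i /(allP sD); exact: sub.
Qed.

(** Using the value of [Z i] in the weight consumes the index [i]. *)
Lemma fresh_use (D : pred I) b i n : D i -> fresh D b ->
  fresh (fun j => D j && (j != i)) (fun w => b w * (Z i w == n)%:R).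
Proof.
move=> Di [bb h]; split=> [|s m g us sD bg]; first exact: cbmM.
have is_ : i \notin s by apply/negP => /(allP sD); rewrite eqxx andbF.
have sD' : all D s by apply/allP => j /(allP sD) /andP[].
pose m' j := if j == i then n else m j.
have mE (F : I -> nat -> R[i]) : \prod_(j <- s) F j (m' j) = \prod_(j <- s) F j (m j).
  apply: eq_big_seq => j js; rewrite /m' ifN//.
  by apply: contraNneq is_ => <-.
have := h (i :: s) m' g; rewrite /= is_ us Di sD' => /(_ isT isT bg).
have -> : (fun w => g w * b w * \prod_(j <- i :: s) (Z j w == m' j)%:R) =
    (fun w => g w * (b w * (Z i w == n)%:R) * \prod_(j <- s) (Z j w == m j)%:R).
  by apply/funext => w; rewrite big_cons (mE (fun j k => (Z j w == k)%:R)) {1}/m' eqxx !mulrA.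
move=> ->.
pose g' w := g w * \prod_(j <- s) (q j (m j) w)%:C%C.
have bg' : cbm (g' : rv_space alpha -> R[i]).
  by apply: cbmM => //; apply: cbm_prod => j; exact: cbm_q.
have := h [:: i] (fun=> n) g' isT; rewrite /= Di => /(_ isT bg').
under eq_fun do rewrite big_seq1; under [in RHS]eq_fun do rewrite big_seq1.
have -> : (fun w => g w * (b w * (Z i w == n)%:R) * \prod_(j <- s) (q j (m j) w)%:C%C) =
    (fun w => g' w * b w * (Z i w == n)%:R).
  by apply/funext => w; rewrite /g'; ring.
move=> ->; congr cE; apply/funext => w.
rewrite big_cons (mE (fun j k => (q j k w)%:C%C)) {1}/m' eqxx /g'.
by move: (\prod_(_ <- _) _) => p; ring.
Qed.

Lemma fresh_countable (D : pred I) (H : T -> nat) (f : nat -> T -> R[i]) (M : R) :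
  (forall n w, normc (f n w) <= M) ->
  (forall n, fresh D (fun w => (H w == n)%:R * f n w)) -> fresh D (fun w => f (H w) w).
Proof.
move=> fM hf; have bf n := (hf n).1.
split=> [|s n g us sD bg]; first exact: (cbm_countable bf fM).
have bg' := cbm_rv_space bg; have [Mg hMg] := cbm_bound bg'.
have Mg0 : 0 <= Mg.
  have [w _] : exists w : T, True by exists point.
  by apply: le_trans (hMg w); exact: normc_ge0.
have lim (G : T -> R[i]) : cbm G -> (forall w, normc (G w) <= 1) ->
    ccvg (fun N => \sum_(k < N) cE P (fun w => g w * ((H w == k)%:R * f k w) * G w))
      (cE P (fun w => g w * f (H w) w * G w)).
  move=> bG G1.
  have := @cE_countable _ _ _ P H (fun k w => g w * f k w * G w) (Mg * M).
  have E k : (fun w => (H w == k)%:R * (g w * f k w * G w)) =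
      (fun w => g w * ((H w == k)%:R * f k w) * G w).
    by apply/funext => w; ring.
  have h1 k : cbm (fun w => (H w == k)%:R * (g w * f k w * G w)).
    by rewrite E; apply: cbmM => //; exact: cbmM.
  have h2 k w : normc (g w * f k w * G w) <= Mg * M.
    rewrite !normcM -[leRHS]mulr1; apply: ler_pM; rewrite ?mulr_ge0 ?normc_ge0//.
    by apply: ler_pM; rewrite ?normc_ge0.
  move=> /(_ h1 h2); congr ccvg; apply/funext => N; apply: eq_bigr => k _.
  by rewrite E.
have l1 := lim (fun w => \prod_(i <- s) (Z i w == n i)%:R) (cbm_prod _ (fun i => cbm_Z i (n i)))
  (fun w => normc_prod_le1 _ (fun i => normc_bool _)).
have l2 := lim (fun w => \prod_(i <- s) (q i (n i) w)%:C%C) (cbm_prod _ (fun i => cbm_qT i (n i))).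
have q1 i k w : normc ((q i k w)%:C%C : R[i]) <= 1.
  by rewrite normc_real; have /andP[h1 h2] := q01 i k w; rewrite ger0_norm.
have {}l2 := l2 (fun w => normc_prod_le1 _ (fun i => q1 i (n i) w)).
apply: ccvg_unique l1 _; move: l2; congr ccvg; apply/funext => N; apply: eq_bigr => k _.
by rewrite (hf k).2.
Qed.

Lemma fresh_sum (r : seq I) (D : pred I) b (F : nat -> R[i]) (M : R) :
  uniq r -> all D r -> (forall n, normc (F n) <= M) -> fresh D b ->
  fresh (fun j => D j && (j \notin r)) (fun w => b w * F (\sum_(i <- r) Z i w)%N).
Proof.
elim: r D b F => [|i r IH] D b F.
  move=> _ _ FM [bb h]; split; first by under eq_fun do rewrite big_nil; apply: cbmM => //; exact: cbm_cst.
  move=> s n g us sD bg.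
  have sD' : all D s by apply/allP => j /(allP sD) /andP[].
  pose g' w := g w * F 0%N.
  have bg' : cbm (g' : rv_space alpha -> R[i]) by apply: cbmM => //; exact: cbm_cst.
  have := h s n g' us sD' bg'; congr (_ = _); congr cE; apply/funext => w;
    rewrite big_nil /g'; by move: (\prod_(_ <- _) _) => p; ring.
move=> /= /andP[ir ur] /andP[Di Dr] FM fb.
have [Mb hMb] := cbm_bound fb.1.
have M0 : 0 <= M by apply: le_trans (FM 0%N); exact: normc_ge0.
have := @fresh_countable (fun j => D j && (j \notin i :: r)) (Z i)
  (fun n w => b w * F (n + \sum_(j <- r) Z j w)%N) (Mb * M).
have -> : (fun w => b w * F (Z i w + \sum_(j <- r) Z j w)%N) =
    (fun w => b w * F (\sum_(j <- i :: r) Z j w)%N).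
  by apply/funext => w; rewrite big_cons.
apply=> [n w|n].
  by rewrite normcM; apply: ler_pM; rewrite ?normc_ge0.
have Dr' : all (fun j => D j && (j != i)) r.
  by apply/allP => j jr; rewrite (allP Dr)//=; apply: contraNneq ir => <-.
have := IH _ _ (fun k => F (n + k)%N) ur Dr' (fun k => FM _) (fresh_use n Di fb).
have -> : (fun w => (Z i w == n)%:R * (b w * F (n + \sum_(j <- r) Z j w)%N)) =
    (fun w => b w * (Z i w == n)%:R * F (n + \sum_(j <- r) Z j w)%N).
  by apply/funext => w; ring.
apply: fresh_sub => j; rewrite !unfold_in /= negb_or.
by move=> /andP[-> /andP[-> ->]].
Qed.

Variable G : I -> T -> R[i] -> R[i].
Hypothesis G_pgf : forall i w z, normc z <= 1 ->
  ccvg (fun N => \sum_(n < N) (q i n w)%:C%C * z ^+ n) (G i w z).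
Hypothesis q_sum : forall i w N, \sum_(n < N) q i n w <= 1.

Let G_partial i w z N : normc z <= 1 -> normc (\sum_(n < N) (q i n w)%:C%C * z ^+ n) <= 1.
Proof.
move=> z1; apply: le_trans (normc_sum _ _) _; apply: le_trans (q_sum i w N).
apply: ler_sum => n _; have /andP[h1 h2] := q01 i n w.
by rewrite normcM normc_real normcX ger0_norm// ler_piMr// exprn_ile1// normc_ge0.
Qed.

Lemma cbm_gen i (z : T -> R[i]) : cbm (z : rv_space alpha -> R[i]) -> (forall w, normc (z w) <= 1) ->
  cbm ((fun w => G i w (z w)) : rv_space alpha -> R[i]).
Proof.
move=> bz z1.
pose p N (w : rv_space alpha) := \sum_(n < N) (q i n w)%:C%C * z w ^+ n.
have bp N : cbm (p N).
  apply: cbm_sum => n; apply: cbmM; [exact: cbm_q|exact: cbmX].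
have cp w : ccvg (p^~ w) (G i w (z w)) by exact: G_pgf.
split.
  apply: (@bmeas_lim _ _ _ (fun N w => Re (p N w)) _ 1).
  - by move=> N; have [[]] := bp N.
  - by move=> N w; exact: le_trans (normc_Re _) (G_partial _ _ _ _).
  - by move=> w; have [] := cp w.
apply: (@bmeas_lim _ _ _ (fun N w => Im (p N w)) _ 1).
- by move=> N; have [_ []] := bp N.
- by move=> N w; exact: le_trans (normc_Im _) (G_partial _ _ _ _).
- by move=> w; have [] := cp w.
Qed.

Lemma normc_gen i w z : normc z <= 1 -> normc (G i w z) <= 1.
Proof. by move=> z1; apply: normc_lim (G_pgf i w z1) _ => N; exact: G_partial. Qed.

(** One noise variable at a time: its weights [q i n], summed against the powers
    [z ^+ n], give the generating function [G i]. *)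
Lemma fresh_pgf (r : seq I) (D : pred I) b (g z : T -> R[i]) : uniq r -> all D r ->
  fresh D b -> cbm (g : rv_space alpha -> R[i]) -> cbm (z : rv_space alpha -> R[i]) ->
  (forall w, normc (z w) <= 1) ->
  cE P (fun w => g w * b w * \prod_(i <- r) z w ^+ Z i w) =
  cE P (fun w => g w * b w * \prod_(i <- r) G i w (z w)).
Proof.
move=> + + + + bz z1; elim: r D b g => [|i r IH] D b g.
  by move=> _ _ _ _; congr cE; apply/funext => w; rewrite !big_nil.
move=> /= /andP[ir ur] /andP[Di Dr] fb bg.
have [Mb hMb] := cbm_bound fb.1; have [Mg hMg] := cbm_bound bg.
have bGr : cbm ((fun w => \prod_(j <- r) G j w (z w)) : rv_space alpha -> R[i]).
  by apply: cbm_prod => j; exact: cbm_gen.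
have Dr' : all (fun j => D j && (j != i)) r.
  by apply/allP => j jr; rewrite (allP Dr)//=; apply: contraNneq ir => <-.
pose f n w := g w * b w * (z w ^+ n * \prod_(j <- r) z w ^+ Z j w).
have zn1 n w : normc (z w ^+ n) <= 1 by rewrite normcX exprn_ile1// normc_ge0.
have step n : cE P (fun w => (Z i w == n)%:R * f n w) =
    cE P (fun w => g w * b w * \prod_(j <- r) G j w (z w) * ((q i n w)%:C%C * z w ^+ n)).
  have bgz : cbm ((fun w => g w * z w ^+ n) : rv_space alpha -> R[i]) by apply: cbmM => //; exact: cbmX.
  have := IH _ _ _ ur Dr' (fresh_use n Di fb) bgz.
  have -> : (fun w => g w * z w ^+ n * (b w * (Z i w == n)%:R) * \prod_(j <- r) z w ^+ Z j w) =
      (fun w => (Z i w == n)%:R * f n w).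
    by apply/funext => w; rewrite /f; move: (\prod_(_ <- _) _) (z w ^+ n) => *; ring.
  move=> ->.
  pose g' w := g w * z w ^+ n * \prod_(j <- r) G j w (z w).
  have bg' : cbm (g' : rv_space alpha -> R[i]) by exact: cbmM.
  have := fb.2 [:: i] (fun=> n) g' isT; rewrite /= Di => /(_ isT bg').
  under eq_fun do rewrite big_seq1; under [in RHS]eq_fun do rewrite big_seq1.
  move=> h; transitivity (cE P (fun w => g' w * b w * (Z i w == n)%:R)).
    by congr cE; apply/funext => w; rewrite /g'; move: (\prod_(_ <- _) _) (z w ^+ n) => *; ring.
  by rewrite h; congr cE; apply/funext => w; rewrite /g'; move: (\prod_(_ <- _) _) (z w ^+ n) => *; ring.
have bz' := cbm_rv_space bz.
have bf n : cbm (fun w => (Z i w == n)%:R * f n w).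
  apply: cbmM => //; apply: cbmM; first by apply: cbmM; [exact: cbm_rv_space|exact: fb.1].
  apply: cbmM; first exact: cbmX.
  apply: cbm_prod => j; apply: (cbm_countable (f := fun k w => z w ^+ k) (M := 1)) => //.
  by move=> k; apply: cbmM => //; exact: cbmX.
have l1 := @cE_countable _ _ _ P (Z i) f (Mg * Mb) bf.
have {}l1 : ccvg (fun N => \sum_(n < N) cE P (fun w => g w * b w * \prod_(j <- r) G j w (z w) * ((q i n w)%:C%C * z w ^+ n)))
    (cE P (fun w => g w * b w * \prod_(j <- i :: r) z w ^+ Z j w)).
  have -> : (fun w => g w * b w * \prod_(j <- i :: r) z w ^+ Z j w) = (fun w => f (Z i w) w).
    by apply/funext => w; rewrite big_cons.
  have <- : (fun N => \sum_(n < N) cE P (fun w => (Z i w == n)%:R * f n w)) = (fun N => \sum_(n < N) cE P (fun w => g w * b w * \prod_(j <- r) G j w (z w) * ((q i n w)%:C%C * z w ^+ n))).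
    by apply/funext => N; apply: eq_bigr => n _.
  apply: l1 => n w; rewrite /f !normcM -[leRHS]mulr1; apply: ler_pM; rewrite ?mulr_ge0 ?normc_ge0//.
    by apply: ler_pM; rewrite ?normc_ge0.
  by rewrite mulr_ile1 ?normc_ge0//; apply: normc_prod_le1 => j; exact: zn1.
apply: ccvg_unique l1 _.
have bgb : cbm (fun w => g w * b w * \prod_(j <- r) G j w (z w)).
  by apply: cbmM; [apply: cbmM; [exact: cbm_rv_space|exact: fb.1]|exact: cbm_rv_space].
have bqz n : cbm (fun w => (q i n w)%:C%C * z w ^+ n : R[i]) by apply: cbmM => //; exact: cbmX.
have -> : (fun N => \sum_(n < N) cE P (fun w => g w * b w * \prod_(j <- r) G j w (z w) * ((q i n w)%:C%C * z w ^+ n))) =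
   (fun N => cE P (fun w => g w * b w * \prod_(j <- r) G j w (z w) * \sum_(n < N) ((q i n w)%:C%C * z w ^+ n))).
  apply/funext => N; rewrite -cE_sum; last by move=> n; exact: cbmM.
  by congr cE; apply/funext => w; rewrite mulr_sumr.
have -> : (fun w => g w * b w * \prod_(j <- i :: r) G j w (z w)) =
    (fun w => g w * b w * \prod_(j <- r) G j w (z w) * G i w (z w)).
  by apply/funext => w; rewrite big_cons; move: (\prod_(_ <- _) _) => *; ring.
apply: (@cE_dct _ _ _ P _ _ (Mg * Mb)).
- by move=> N; apply: cbmM => //; exact: cbm_sum.
- move=> N w; rewrite !normcM -[leRHS]mulr1 -mulrA; apply: ler_pM; rewrite ?mulr_ge0 ?normc_ge0//.
    by apply: ler_pM; rewrite ?normc_ge0.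
  rewrite mulr_ile1 ?normc_ge0//; last exact: G_partial.
  by apply: normc_prod_le1 => j; exact: normc_gen.
- by apply: cbmM => //; apply: cbm_rv_space; exact: cbm_gen.
- apply: aeW => w; apply: ccvgM; first exact: ccvg_cst.
  exact: G_pgf.
Qed.

End ConditionallyIndependentNoise.

(** * The randomized INAR(1) process *)

Section PoissonSeries.
Context {R : realType}.

Lemma poisson_pmfE (r : R) n : 0 < r -> poisson_pmf r n = r ^+ n / n`!%:R * expR (- r).
Proof. by move=> r0; rewrite /poisson_pmf r0. Qed.

Lemma poisson_pgf (r : R) (z : R[i]) : 0 < r ->
  ccvg (fun N => \sum_(n < N) (poisson_pmf r n)%:C%C * z ^+ n) (cexp (r%:C%C * (z - 1))).
Proof.
move=> r0; have := ccvgM (ccvg_cst (expR (- r))%:C%C) (ccvg_exp_sum (r%:C%C * z)).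
rewrite -cexp_real -cexpD.
have -> : (- r)%:C%C + r%:C%C * z = r%:C%C * (z - 1) by rewrite rmorphN; ring.
congr ccvg; apply/funext => N; rewrite cexp_real /exp_sum mulr_sumr; apply: eq_bigr => n _.
rewrite poisson_pmfE// !rmorphM rmorphXn fmorphV rmorph_nat exprMn /=.
by move: (expR _)%:C%C (r%:C%C ^+ n) (z ^+ n) (n`!%:R^-1 : R[i]) => *; ring.
Qed.

Lemma poisson_sum_le1 (r : R) N : 0 < r -> \sum_(n < N) poisson_pmf r n <= 1.
Proof.
move=> r0.
pose S k := \sum_(n < k) r ^+ n / n`!%:R.
have c : S k @[k --> \oo] --> expR r.
  have [+ _] := ccvg_exp_sum r%:C%C; rewrite cexp_real.
  suff -> : (fun n => Re (exp_sum n r%:C%C)) = S by [].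
  apply/funext => k; have -> : exp_sum k r%:C%C = (S k)%:C%C => //.
  rewrite rmorph_sum; apply: eq_bigr => n _.
  by rewrite rmorphM rmorphXn fmorphV rmorph_nat.
have le : S N <= expR r.
  rewrite -(cvg_lim _ c)//; apply: nondecreasing_cvgn_le; last by apply/cvg_ex; exists (expR r).
  apply/nondecreasing_seqP => k; rewrite /S big_ord_recr /= lerDl.
  by rewrite divr_ge0// exprn_ge0// ltW.
under eq_bigr do rewrite poisson_pmfE//.
rewrite -mulr_suml expRN ler_pdivrMr ?expR_gt0// mul1r.
exact: le.
Qed.

End PoissonSeries.

Lemma indic_eqn {R : realType} (T : Type) (H : T -> nat) n w :
  \1_[set w | H w = n] w = (H w == n)%:R :> R.
Proof. by rewrite indicE; congr (nat_of_bool _)%:R; apply/idP/eqP; rewrite inE. Qed.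

Section INAR.
Context {R : realType} {d : measure_display} {T : measurableType d}.
Variables (P : probability T R) (lambda : R) (alpha : {RV P >-> R}).
Variables (X0 : {RV P >-> nat}) (xi : nat -> nat -> {RV P >-> nat}).
Variable eps : nat -> {RV P >-> nat}.
Hypothesis lambda_gt0 : 0 < lambda.
Hypothesis model : randomized_inar_noise lambda alpha X0 xi eps.

Let I : eqType := (unit + (nat * nat) + nat)%type.
Let Z : I -> T -> nat := noise X0 xi eps.

Let malpha : measurable_fun setT alpha. Proof. exact: measurable_funPT. Qed.

Let alpha01 w : 0 < alpha w < 1. Proof. by case: model. Qed.

Definition noise_pmf (i : I) (n : nat) (w : T) : R :=
  match i with
  | inl (inl _) => poisson_pmf (lambda / (1 - alpha w)) n
  | inl (inr _) => if n is k.+1 then (if k is 0%N then alpha w else 0) else 1 - alpha w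
  | inr _ => poisson_pmf lambda n
  end.

Definition noise_pgf (i : I) (w : T) (z : R[i]) : R[i] :=
  match i with
  | inl (inl _) => cexp ((lambda / (1 - alpha w))%:C%C * (z - 1))
  | inl (inr _) => 1 - (alpha w)%:C%C + (alpha w)%:C%C * z
  | inr _ => cexp (lambda%:C%C * (z - 1))
  end.

Let rate_gt0 w : 0 < lambda / (1 - alpha w).
Proof. by have /andP[h1 h2] := alpha01 w; rewrite divr_gt0// subr_gt0. Qed.

Let mZ i n : measurable [set w | Z i w = n].
Proof.
have m (X : {RV P >-> nat}) : measurable [set w | X w = n].
  have mn : measurable ([set n] : set nat) by [].
  by have := measurable_funPT X measurableT [set n] mn; rewrite setTI.
by case: i => [[[]|[k j]]|k]; exact: m.
Qed.

Let noise_pmf01 i n w : 0 <= noise_pmf i n w <= 1.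
Proof.
have poisson r : 0 < r -> 0 <= poisson_pmf r n <= 1.
  move=> r0; rewrite poisson_pmf_ge0; apply: le_trans (poisson_sum_le1 n.+1 r0).
  by rewrite big_ord_recr /= lerDr sumr_ge0// => k _; exact: poisson_pmf_ge0.
have /andP[a0 a1] := alpha01 w.
case: i => [[[]|[k j]]|k] /=; [exact: poisson| |exact: poisson].
move=> {poisson}; case: n => [|[|n]]; rewrite ?lexx ?ler01 ?(ltW a0) ?(ltW a1)//.
by apply/andP; split; lra.
Qed.

Let noise_pmf_sum i w N : \sum_(n < N) noise_pmf i n w <= 1.
Proof.
have /andP[a0 a1] := alpha01 w.
case: i => [[[]|[k j]]|k] /=; [exact: poisson_sum_le1| |exact: poisson_sum_le1].
case: N => [|[|N]]; rewrite ?big_ord0 ?ler01// !big_ord_recl ?big_ord0/=.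
  by rewrite addr0; lra.
by rewrite big1//; lra.
Qed.

Let noise_pgfP i w z : normc z <= 1 ->
  ccvg (fun N => \sum_(n < N) (noise_pmf i n w)%:C%C * z ^+ n) (noise_pgf i w z).
Proof.
move=> _; case: i => [[[]|[k j]]|k] /=; [exact: poisson_pgf| |exact: poisson_pgf].
suff E N : (1 < N)%N -> \sum_(n < N) (match n : nat with 0%N => 1 - alpha w | k0.+1 => match k0 with 0%N => alpha w | _ => 0 end end)%:C%C * z ^+ n
    = 1 - (alpha w)%:C%C + (alpha w)%:C%C * z.
  by split; apply: cvg_near_cst; exists 2%N => // N /= /E <-.
case: N => [|[|N]]// _; rewrite !big_ord_recl /= big1 => [|n _]; last by rewrite mul0r.
by rewrite expr0 mulr1 addr0 rmorphB rmorph1.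
Qed.

Let bmeas_alpha : bmeas alpha.
Proof.
apply: (bmeas_le (M := 1)) => // w; have /andP[a0 a1] := alpha01 w.
by rewrite ger0_norm ltW.
Qed.

Let xi_null k j n : is_cprob P alpha [set w | xi k j w = n.+2] (fun=> 0).
Proof.
have [_ _ xiP _ _] := model; have [x1 x0] := xiP k j.
have m l : measurable [set w | xi k j w = l] by exact: (mZ (inl (inr (k, j))) l).
have e (l : nat) (h : T -> R) : bmeas h -> is_cprob P alpha [set w | xi k j w = l] h ->
    Ex P (\1_[set w | xi k j w = l]) = Ex P h.
  move=> bh [_ /(_ _ measurableT)]; rewrite preimage_setT !EFin_Ex//; last exact: bmeas_indic.
  by move=> [->].
have b1 : bmeas (fun w => 1 - alpha w) by apply: bmeasB => //; exact: bmeas_cst.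
have z : Ex P (\1_[set w | xi k j w = n.+2]) = 0.
  apply/eqP; rewrite eq_le Ex_ge0 ?andbT => [|w]; last by rewrite indicE.
  have : Ex P (fun w => \1_[set w | xi k j w = 0%N] w + \1_[set w | xi k j w = 1%N] w +
      \1_[set w | xi k j w = n.+2] w) <= Ex P (fun=> 1 : R).
    apply: Ex_le; [|exact: bmeas_cst|].
      by apply: bmeasD; [apply: bmeasD|]; apply: bmeas_indic; exact: m.
    move=> w; rewrite !indic_eqn; case: (xi k j w) => [|[|x]]; rewrite /= ?addr0 ?add0r//.
    by case: (_ == _).
  rewrite !ExD; [|by apply: bmeas_indic; exact: m..|by apply: bmeasD; apply: bmeas_indic; exact: m|by apply: bmeas_indic; exact: m].
  rewrite (e _ _ b1 x0) (e _ _ bmeas_alpha x1) ExB ?Ex_cst; [|exact: bmeas_cst|exact: bmeas_alpha].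
  lra.
split.
  by apply/sigma_rv_fun; exact: measurable_cst.
move=> A mA; have mYA := preimageY_measurable malpha mA.
rewrite !integral_Ex_indic//; [|by apply: bmeas_indic; exact: m|exact: bmeas_cst].
congr EFin; under eq_fun do rewrite mulr0; rewrite Ex_cst.
apply/esym/eqP; rewrite eq_le Ex_ge0 ?andbT => [|w]; last by rewrite !indicE mulr_ge0.
rewrite -[leRHS]z; apply: Ex_le; [|by apply: bmeas_indic; exact: m|].
  by apply: bmeasM; apply: bmeas_indic => //; exact: m.
by move=> w; rewrite !indicE ler_piMl//; case: (_ \in _).
Qed.

Let noise_cprob i n : is_cprob P alpha [set w | Z i w = n] (noise_pmf i n).
Proof.
have [_ _ xiP epsP X0P] := model.
case: i => [[[]|[k j]]|k]; [exact: X0P| |exact: epsP].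
case: n => [|[|n]] /=; [by case: (xiP k j)|by case: (xiP k j)|exact: xi_null].
Qed.

Let m_noise_pmf i n : measurable_fun setT (noise_pmf i n : rv_space alpha -> R).
Proof. by apply/sigma_rv_fun; case: (noise_cprob i n). Qed.

Let noise_indep (s : seq I) (n : I -> nat) (A : set R) : uniq s -> measurable A ->
  Ex P (fun w => \1_A (alpha w) * \prod_(i <- s) (Z i w == n i)%:R) =
  Ex P (fun w => \1_A (alpha w) * \prod_(i <- s) noise_pmf i (n i) w).
Proof.
move=> us mA; have [_ ci _ _ _] := model.
have [|_ h] := ci s (fun i => [set w | Z i w = n i]) (fun i => noise_pmf i (n i)) us _ (fun i _ => noise_cprob i (n i)).
  by move=> i _; exists [set n i] => //; rewrite setTI.
have := h A mA; have mYA := preimageY_measurable malpha mA.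
have bq : bmeas (fun w => \prod_(i <- s) noise_pmf i (n i) w).
  apply: bmeas_prod => i; apply: (bmeas_le (M := 1)).
    exact: (rv_space_fun malpha (m_noise_pmf i (n i))).
  by move=> w; have /andP[h1 h2] := noise_pmf01 i (n i) w; rewrite ger0_norm.
have E : \1_(\big[setI/setT]_(i <- s) [set w | Z i w = n i]) =
    (fun w => \prod_(i <- s) (Z i w == n i)%:R : R).
  apply/funext => w; have /(_ R) := prod_indic s (fun i => [set w | Z i w = n i]) w.
  by rewrite -rmorph_prod => -[<-]; apply: eq_bigr => i _; rewrite indic_eqn.
rewrite !integral_Ex_indic//; last first.
  rewrite E; apply: bmeas_prod => i.
  have -> : (fun w => (Z i w == n i)%:R : R) = \1_[set w | Z i w = n i].
    by apply/funext => w; rewrite indic_eqn.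
  by apply: bmeas_indic; exact: mZ.
rewrite E => -[h'].
rewrite -[LHS]/(Ex P (fun w => \1_A (alpha w) * (fun w => \prod_(i <- s) (Z i w == n i)%:R) w)).
have ind w : \1_A (alpha w) = \1_(alpha @^-1` A) w :> R by rewrite indic_preimage.
by under eq_fun do rewrite ind; rewrite -h'; under [in RHS]eq_fun do rewrite ind.
Qed.

Let X := inar X0 xi eps.

Let M_step k : I -> bool := fun i => match i with
  | inl (inl _) => false
  | inl (inr kj) => (k <= kj.1)%N
  | inr k' => (k <= k')%N
  end.

Let freshN := fresh P alpha Z noise_pmf.

Let step_noise k n : seq I := inr k :: [seq inl (inr (k, j)) | j <- iota 0 n].

Let uniq_step_noise k n : uniq (step_noise k n).
Proof.
rewrite /= map_inj_uniq ?iota_uniq ?andbT; last by move=> x y [].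
by apply/mapP => -[].
Qed.

Let step_noise_fresh k n : all (M_step k) (step_noise k n).
Proof. by rewrite /= leqnn; apply/allP => i /mapP [j _ ->] /=. Qed.

Let X_step k w : X k.+1 w = (\sum_(i <- step_noise k (X k w)) Z i w)%N.
Proof.
rewrite big_cons big_map /= addnC; congr (_ + _)%N.
by rewrite -(big_mkord xpredT (fun j => xi k j w)) /index_iota subn0.
Qed.

(** The path up to time [k] does not involve the noise of the later steps. *)
Let fresh_path k (f : nat -> nat -> R[i]) : (forall l x, normc (f l x) <= 1) ->
  freshN (M_step k) (fun w => \prod_(l < k.+1) f l (X l w)).
Proof.
elim: k f => [|k IH] f f1.
  have := @fresh_sum _ _ _ P alpha malpha I Z noise_pmf mZ m_noise_pmf noise_pmf01 [:: inl (inl tt)] predT (fun=> 1) (f 0%N) 1 isT isT (f1 0%N) (fresh_one malpha mZ m_noise_pmf noise_pmf01 noise_indep).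
  have -> : (fun w => 1 * f 0%N (\sum_(i <- [:: inl (inl tt) : I]) Z i w)%N) =
      (fun w => \prod_(l < 1) f l (X l w)).
    by apply/funext => w; rewrite big_seq1 mul1r big_ord1.
  by apply: fresh_sub => -[[[]|[k j]]|k].
pose F n w := (\prod_(l < k.+1) f l (X l w)) * f k.+1 (\sum_(i <- step_noise k n) Z i w)%N.
have -> : (fun w => \prod_(l < k.+2) f l (X l w)) = (fun w => F (X k w) w).
  by apply/funext => w; rewrite big_ord_recr /= /F -X_step.
apply: (@fresh_countable _ _ _ P alpha malpha I Z noise_pmf mZ m_noise_pmf noise_pmf01 _ (X k) F 1).
  move=> n w; rewrite normcM mulr_ile1 ?normc_ge0 ?f1//.
  by apply: normc_prod_le1 => l; exact: f1.
move=> n; pose f' l x := if l == k then (x == n)%:R * f l x else f l x.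
have f'1 l x : normc (f' l x) <= 1.
  rewrite /f'; case: ifP => // _; rewrite normcM mulr_ile1 ?normc_ge0//; exact: normc_bool.
have := @fresh_sum _ _ _ P alpha malpha I Z noise_pmf mZ m_noise_pmf noise_pmf01 (step_noise k n) (M_step k) _ (f k.+1) 1
  (uniq_step_noise k n) (step_noise_fresh k n) (f1 k.+1) (IH f' f'1).
have -> : (fun w => (\prod_(l < k.+1) f' l (X l w)) * f k.+1 (\sum_(i <- step_noise k n) Z i w)%N) =
    (fun w => (X k w == n)%:R * F n w).
  apply/funext => w; rewrite /F mulrA; congr (_ * _).
  rewrite !big_ord_recr /= {2}/f' eqxx mulrCA; congr (_ * (_ * _)).
  by apply: eq_bigr => l _; rewrite /f' ltn_eqF.
apply: fresh_sub => j jk; rewrite unfold_in /=; apply/andP; split.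
  by move: jk; case: j => [[[]|[k' j]]|k'] //= /ltnW.
apply/negP; rewrite inE => /orP[/eqP e|/mapP [l _ e]]; move: jk; rewrite e unfold_in /= ltnn//.
Qed.

(** One step of the Markov property, in terms of generating functions. *)
Lemma inar_step k (f : nat -> nat -> R[i]) (g z : T -> R[i]) : (forall l x, normc (f l x) <= 1) ->
  cbm (g : rv_space alpha -> R[i]) -> cbm (z : rv_space alpha -> R[i]) ->
  (forall w, normc (z w) <= 1) ->
  cE P (fun w => g w * (\prod_(l < k.+1) f l (X l w)) * z w ^+ X k.+1 w) =
  cE P (fun w => g w * cexp (lambda%:C%C * (z w - 1)) * (\prod_(l < k.+1) f l (X l w)) *
    (1 - (alpha w)%:C%C + (alpha w)%:C%C * z w) ^+ X k w).
Proof.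
move=> f1 bg bz z1; have [Mg hMg] := cbm_bound bg.
pose b n w := (X k w == n)%:R * \prod_(l < k.+1) f l (X l w).
have fb n : freshN (M_step k) (b n).
  pose f' l x := if l == k then (x == n)%:R * f l x else f l x.
  have f'1 l x : normc (f' l x) <= 1.
    rewrite /f'; case: ifP => // _; rewrite normcM mulr_ile1 ?normc_ge0//; exact: normc_bool.
  suff -> : b n = (fun w => \prod_(l < k.+1) f' l (X l w)) by exact: fresh_path.
  apply/funext => w; rewrite /b !big_ord_recr /= {2}/f' eqxx mulrCA; congr (_ * (_ * _)).
  by apply: eq_bigr => l _; rewrite /f' ltn_eqF.
have step n := @fresh_pgf _ _ _ P alpha malpha I Z noise_pmf mZ m_noise_pmf noise_pmf01
  noise_pgf noise_pgfP noise_pmf_sum (step_noise k n) (M_step k) (b n) g z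
  (uniq_step_noise k n) (step_noise_fresh k n) (fb n) bg bz z1.
pose F n w := g w * \prod_(l < k.+1) f l (X l w) * \prod_(i <- step_noise k n) z w ^+ Z i w.
pose F' n w := g w * \prod_(l < k.+1) f l (X l w) * \prod_(i <- step_noise k n) noise_pgf i w (z w).
have path1 w : normc (\prod_(l < k.+1) f l (X l w)) <= 1 by apply: normc_prod_le1 => l; exact: f1.
have z1n w n : normc (z w ^+ n) <= 1 by rewrite normcX exprn_ile1// normc_ge0.
have FM n w : normc (F n w) <= Mg.
  rewrite /F !normcM -[leRHS]mulr1; apply: ler_pM; rewrite ?mulr_ge0 ?normc_ge0//.
    by rewrite -[leRHS]mulr1; apply: ler_pM; rewrite ?normc_ge0.
  by apply: normc_prod_le1 => i; exact: z1n.
have F'M n w : normc (F' n w) <= Mg.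
  rewrite /F' !normcM -[leRHS]mulr1; apply: ler_pM; rewrite ?mulr_ge0 ?normc_ge0//.
    by rewrite -[leRHS]mulr1; apply: ler_pM; rewrite ?normc_ge0.
  apply: normc_prod_le1 => i.
  exact: (@normc_gen _ _ _ I noise_pmf noise_pmf01 noise_pgf noise_pgfP noise_pmf_sum).
have bgT := cbm_rv_space malpha bg; have bzT := cbm_rv_space malpha bz.
have bF n : cbm (fun w => (X k w == n)%:R * F n w).
  have -> : (fun w => (X k w == n)%:R * F n w) = (fun w => g w * b n w * \prod_(i <- step_noise k n) z w ^+ Z i w).
    by apply/funext => w; rewrite /F /b; move: (\prod_(i <- _) _) => p; ring.
  apply: cbmM; first by apply: cbmM => //; exact: (fb n).1.
  apply: cbm_prod => i; apply: (cbm_countable (f := fun k w => z w ^+ k) (M := 1)) => //.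
  by move=> l; apply: cbmM; [by apply: cbm_nat; exact: mZ|exact: cbmX].
have bF' n : cbm (fun w => (X k w == n)%:R * F' n w).
  have -> : (fun w => (X k w == n)%:R * F' n w) = (fun w => g w * b n w * \prod_(i <- step_noise k n) noise_pgf i w (z w)).
    by apply/funext => w; rewrite /F' /b; move: (\prod_(i <- _) _) => p; ring.
  apply: cbmM; first by apply: cbmM => //; exact: (fb n).1.
  apply: cbm_prod => i; apply: (cbm_rv_space malpha).
  exact: (cbm_gen m_noise_pmf noise_pmf01 noise_pgfP noise_pmf_sum i bz z1).
have l1 := cE_countable P bF FM; have l2 := cE_countable P bF' F'M.
have -> : (fun w => g w * (\prod_(l < k.+1) f l (X l w)) * z w ^+ X k.+1 w) = (fun w => F (X k w) w).
  apply/funext => w; rewrite /F X_step; congr (_ * _).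
  by rewrite -[RHS](@big_morph _ _ (fun n => z w ^+ n) 1 *%R 0%N addn)// => x y; rewrite exprD.
have -> : (fun w => g w * cexp (lambda%:C%C * (z w - 1)) * (\prod_(l < k.+1) f l (X l w)) *
    (1 - (alpha w)%:C%C + (alpha w)%:C%C * z w) ^+ X k w) = (fun w => F' (X k w) w).
  apply/funext => w; rewrite /F' big_cons big_map /= [\prod_(j <- iota _ _) _]big_const_seq.
  rewrite count_predT size_iota iter_mulr_1.
  by move: (\prod_(l < _) _) (_ ^+ X k w) => p e; ring.
apply: ccvg_unique l1 _; move: l2; congr ccvg; apply/funext => N; apply: eq_bigr => n _.
transitivity (cE P (fun w => g w * b n w * \prod_(i <- step_noise k n) noise_pgf i w (z w))).
  by congr cE; apply/funext => w; rewrite /F' /b; move: (\prod_(i <- _) _) => p; ring.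
rewrite -step.
by congr cE; apply/funext => w; rewrite /F /b; move: (\prod_(i <- _) _) => p; ring.
Qed.

(** The case of the single noise variable [X0], which is fresh at the start. *)
Lemma inar_initial (g z : T -> R[i]) :
  cbm (g : rv_space alpha -> R[i]) -> cbm (z : rv_space alpha -> R[i]) ->
  (forall w, normc (z w) <= 1) ->
  cE P (fun w => g w * z w ^+ X 0 w) =
  cE P (fun w => g w * cexp ((lambda / (1 - alpha w))%:C%C * (z w - 1))).
Proof.
move=> bg bz z1.
have := @fresh_pgf _ _ _ P alpha malpha I Z noise_pmf mZ m_noise_pmf noise_pmf01
  noise_pgf noise_pgfP noise_pmf_sum [:: inl (inl tt)] predT (fun=> 1) g z isT isT
  (fresh_one malpha mZ m_noise_pmf noise_pmf01 noise_indep) bg bz z1.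
under eq_fun do rewrite big_seq1 mulr1; under [in RHS]eq_fun do rewrite big_seq1 mulr1.
exact.
Qed.

End INAR.

(** * The law of the path *)

Lemma cbm_cexp {R : realType} {d} {T : measurableType d} (f : T -> R[i]) :
  cbm f -> cbm (fun w => cexp (f w)).
Proof.
move=> bf; have [M hM] := cbm_bound bf; have [[m1 _] [m2 _]] := bf.
apply: (cbm_le (M := expR M)).
- apply: measurable_funM; first exact: measurableT_comp m1.
  by apply: measurableT_comp m2; exact: measurable_cos.
- apply: measurable_funM; first exact: measurableT_comp m1.
  by apply: measurableT_comp m2; exact: measurable_sin.
- move=> w; rewrite normc_cexp ler_expR; apply: le_trans (hM w).
  exact: le_trans (ler_norm _) (normc_Re _).
Qed.

Section PathFunctional.
Context {R : realType}.
Implicit Types (a : R) (zs : seq R[i]).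

(** [1 + thinned a zs] is the conditional expectation of the product of the
    [z ^ X] over the next steps, for a population started from one individual
    without immigration. *)
Fixpoint thinned a zs : R[i] :=
  if zs is z :: zs' then z * (1 + a%:C%C * thinned a zs') - 1 else 0.

Fixpoint immigration a zs : R[i] :=
  if zs is z :: zs' then thinned a zs + immigration a zs' else 0.

(** The logarithm of the conditional generating function of the stationary path,
    divided by its mean [lambda / (1 - a)]. *)
Fixpoint cumulant a zs : R[i] :=
  if zs is z :: zs' then (z - 1) * (1 + a%:C%C * thinned a zs') + cumulant a zs' else 0.

(** Immigrants arrive at rate [lambda] in each step, and the initial population
    has mean [lambda / (1 - a)] and survives the first step with probability [a]. *)
Lemma cumulantE a zs :
  cumulant a zs = (1 - a)%:C%C * immigration a zs + a%:C%C * thinned a zs.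
Proof.
elim: zs => [|z zs IH] /=; first by rewrite !mulr0 addr0.
by rewrite IH rmorphB rmorph1; ring.
Qed.

Lemma normc_mix a (z : R[i]) : 0 <= a <= 1 -> normc z <= 1 ->
  normc (1 - a%:C%C + a%:C%C * z) <= 1.
Proof.
move=> /andP[a0 a1] z1; apply: le_trans (normcD _ _) _.
have -> : 1 - a%:C%C = (1 - a)%:C%C :> R[i] by rewrite rmorphB rmorph1.
rewrite normcM !normc_real !ger0_norm ?subr_ge0//.
have : a * normc z <= a by rewrite ler_piMr.
by move: (normc z) => x h; lra.
Qed.

Lemma normc_thinned a zs : 0 <= a <= 1 -> (forall z, z \in zs -> normc z <= 1) ->
  normc (1 + a%:C%C * thinned a zs) <= 1.
Proof.
move=> a01; elim: zs => [|z zs IH] h; first by rewrite [thinned _ _]/= mulr0 addr0 normc1.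
rewrite [thinned _ _]/=.
have -> : 1 + a%:C%C * (z * (1 + a%:C%C * thinned a zs) - 1) =
    1 - a%:C%C + a%:C%C * (z * (1 + a%:C%C * thinned a zs)) by ring.
apply: normc_mix => //; rewrite normcM mulr_ile1 ?normc_ge0//.
  by apply: h; rewrite mem_head.
by apply: IH => x xs; apply: h; rewrite inE xs orbT.
Qed.

End PathFunctional.

Section PathLaw.
Context {R : realType} {d : measure_display} {T : measurableType d}.
Variables (P : probability T R) (lambda : R) (alpha : {RV P >-> R}).
Variables (X0 : {RV P >-> nat}) (xi : nat -> nat -> {RV P >-> nat}).
Variable eps : nat -> {RV P >-> nat}.
Hypothesis lambda_gt0 : 0 < lambda.
Hypothesis model : randomized_inar_noise lambda alpha X0 xi eps.

Let X := inar X0 xi eps.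
Let malpha : measurable_fun setT alpha. Proof. exact: measurable_funPT. Qed.
Let alpha01 w : 0 < alpha w < 1. Proof. by case: model. Qed.

Let cbm_alpha : cbm ((fun w => (alpha w)%:C%C) : rv_space alpha -> R[i]).
Proof.
apply: cbm_real; apply: (bmeas_le (M := 1)).
  by apply/sigma_rv_fun => A mA; exists A => //; rewrite setTI.
by move=> w; have /andP[a0 a1] := alpha01 w; rewrite ger0_norm ltW.
Qed.

Lemma cbm_thinned zs : cbm ((fun w => thinned (alpha w) zs) : rv_space alpha -> R[i]).
Proof.
elim: zs => [|z zs IH] /=; first exact: cbm_cst.
apply: cbmD; last exact: cbm_cst.
by apply: cbmM; [exact: cbm_cst|apply: cbmD; [exact: cbm_cst|exact: cbmM]].
Qed.

Lemma cbm_immigration zs : cbm ((fun w => immigration (alpha w) zs) : rv_space alpha -> R[i]).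
Proof.
elim: zs => [|z zs IH]; first exact: cbm_cst.
by apply: cbmD => //; exact: (cbm_thinned (z :: zs)).
Qed.

Let alpha01' w : 0 <= alpha w <= 1.
Proof. by have /andP[a0 a1] := alpha01 w; rewrite !ltW. Qed.

Lemma inar_steps zs k (f : nat -> nat -> R[i]) (g : T -> R[i]) :
  (forall z, z \in zs -> normc z <= 1) ->
  (forall l x, normc (f l x) <= 1) -> cbm (g : rv_space alpha -> R[i]) ->
  cE P (fun w => g w * (\prod_(l < k.+1) f l (X l w)) *
    \prod_(j < size zs) nth 0 zs j ^+ X (k.+1 + j) w) =
  cE P (fun w => g w * cexp (lambda%:C%C * immigration (alpha w) zs) *
    (\prod_(l < k.+1) f l (X l w)) * (1 + (alpha w)%:C%C * thinned (alpha w) zs) ^+ X k w).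
Proof.
elim: zs k f g => [|z zs IH] k f g zs1 f1 bg.
  congr cE; apply/funext => w; rewrite big_ord0 /= !mulr0 addr0 expr1n cexp0 !mulr1.
  by [].
have z1 : normc z <= 1 by apply: zs1; rewrite mem_head.
have {}zs1 y : y \in zs -> normc y <= 1 by move=> ys; apply: zs1; rewrite inE ys orbT.
pose f' l x := if l == k.+1 then z ^+ x else f l x.
have f'1 l x : normc (f' l x) <= 1.
  by rewrite /f'; case: ifP => // _; rewrite normcX exprn_ile1// normc_ge0.
have f'E w : \prod_(l < k.+2) f' l (X l w) = \prod_(l < k.+1) f l (X l w) * z ^+ X k.+1 w.
  rewrite big_ord_recr /= {2}/f' eqxx; congr (_ * _).
  by apply: eq_bigr => l _; rewrite /f' ltn_eqF.
transitivity (cE P (fun w => g w * (\prod_(l < k.+2) f' l (X l w)) *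
    \prod_(j < size zs) nth 0 zs j ^+ X (k.+2 + j) w)).
  congr cE; apply/funext => w; rewrite f'E.
  have -> : \prod_(j < size (z :: zs)) nth 0 (z :: zs) j ^+ X (k.+1 + j) w =
      z ^+ X k.+1 w * \prod_(j < size zs) nth 0 zs j ^+ X (k.+2 + j) w.
    rewrite big_ord_recl; congr (_ * _); first by rewrite /= addn0.
    by apply: eq_bigr => j _; rewrite lift0 /= addnS addSn.
  by rewrite !mulrA.
rewrite (IH _ _ _ zs1 f'1 bg).
have bg' : cbm ((fun w => g w * cexp (lambda%:C%C * immigration (alpha w) zs)) : rv_space alpha -> R[i]).
  by apply: cbmM => //; apply: cbm_cexp; apply: cbmM; [exact: cbm_cst|exact: cbm_immigration].
have bz : cbm ((fun w => z * (1 + (alpha w)%:C%C * thinned (alpha w) zs)) : rv_space alpha -> R[i]).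
  apply: cbmM; first exact: cbm_cst.
  by apply: cbmD; [exact: cbm_cst|apply: cbmM => //; exact: cbm_thinned].
have bz1 w : normc (z * (1 + (alpha w)%:C%C * thinned (alpha w) zs)) <= 1.
  by rewrite normcM mulr_ile1 ?normc_ge0//; exact: normc_thinned.
have := @inar_step _ _ _ P lambda alpha X0 xi eps lambda_gt0 model k f _ _ f1 bg' bz bz1.
rewrite -/X; set L := cE P _; set L' := cE P _ => LL.
have -> : cE P (fun w => g w * cexp (lambda%:C%C * immigration (alpha w) zs) *
    (\prod_(l < k.+2) f' l (X l w)) * (1 + (alpha w)%:C%C * thinned (alpha w) zs) ^+ X k.+1 w) = L.
  congr cE; apply/funext => w; rewrite f'E exprMn.
  by rewrite !mulrA.
rewrite LL; congr cE; apply/funext => w /=.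
have -> : lambda%:C%C * (z * (1 + (alpha w)%:C%C * thinned (alpha w) zs) - 1 + immigration (alpha w) zs) =
  lambda%:C%C * immigration (alpha w) zs + lambda%:C%C * (z * (1 + (alpha w)%:C%C * thinned (alpha w) zs) - 1).
  by ring.
rewrite cexpD [g w * (cexp _ * _)]mulrA; congr (_ * _ ^+ _).
by ring.
Qed.

(** Every conditional cumulant of the path is a sum over pairs of a time and a
    number of surviving steps, which [cumulant] collects recursively. *)
Theorem inar_path zs (g : T -> R[i]) : (forall z, z \in zs -> normc z <= 1) ->
  cbm (g : rv_space alpha -> R[i]) ->
  cE P (fun w => g w * \prod_(j < size zs) nth 0 zs j ^+ X j.+1 w) =
  cE P (fun w => g w * cexp ((lambda / (1 - alpha w))%:C%C * cumulant (alpha w) zs)).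
Proof.
move=> zs1 bg.
have := @inar_steps zs 0%N (fun _ _ => 1) g zs1 (fun _ _ => _) bg.
have n1 : normc (1 : R[i]) <= 1 by rewrite normc1.
move=> /(_ (fun _ _ => n1)).
under eq_fun do rewrite big_ord1 mulr1; under [in RHS]eq_fun do rewrite big_ord1 mulr1.
move=> ->.
pose g' w := g w * cexp (lambda%:C%C * immigration (alpha w) zs).
have bg' : cbm (g' : rv_space alpha -> R[i]).
  by apply: cbmM => //; apply: cbm_cexp; apply: cbmM; [exact: cbm_cst|exact: cbm_immigration].
have bz : cbm ((fun w => 1 + (alpha w)%:C%C * thinned (alpha w) zs) : rv_space alpha -> R[i]).
  by apply: cbmD; [exact: cbm_cst|apply: cbmM => //; exact: cbm_thinned].
have := @inar_initial _ _ _ P lambda alpha X0 xi eps lambda_gt0 model g' _ bg' bz (fun w => normc_thinned (alpha01' w) zs1).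
move=> ->; congr cE; apply/funext => w; rewrite /g' -mulrA -cexpD cumulantE; congr (_ * cexp _).
have a1 : (1 - alpha w)%:C%C != 0 :> R[i].
  have /andP[h0 h1] := alpha01 w.
  by rewrite (inj_eq (@complexI _)) subr_eq0 gt_eqF.
have alg (l b a V U : R[i]) : b != 0 ->
    l * V + l / b * (1 + a * U - 1) = l / b * (b * V + a * U) by move=> b0; field.
by rewrite (rmorphM _ lambda) fmorphV; exact: alg.
Qed.

End PathLaw.

(** * Means from generating functions *)

Section ConditionalMean.
Context {R : realType} {d : measure_display} {T : measurableType d}.
Variables (P : probability T R) (D : set T) (H : T -> nat) (r : T -> R) (M : R).
Hypothesis mD : measurable D.
Hypothesis mH : forall n, measurable [set w | H w = n].
Hypothesis mr : measurable_fun setT r.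
Hypothesis rM : forall w, D w -> 0 <= r w <= M.
Hypothesis pgf : forall s : R, 0 < s <= 1 ->
  Ex P (fun w => \1_D w * s ^+ H w) = Ex P (fun w => \1_D w * expR (- (r w * (1 - s)))).

Let h n : R := n.+2%:R^-1.
Let h_gt0 n : 0 < h n. Proof. by rewrite invr_gt0. Qed.
Let h_lt1 n : h n < 1. Proof. by rewrite invf_lt1 ?ltr1n. Qed.
Let s n : R := 1 - h n.
Let s01 n : 0 < s n <= 1.
Proof. by rewrite subr_gt0 h_lt1 gerBl ltW. Qed.

Let partial n w : R := \sum_(j < H w) s n ^+ j.
Let partialE n w : partial n w = (1 - s n ^+ H w) / h n.
Proof.
have h0 : h n != 0 by rewrite gt_eqF.
apply: (mulIf h0); rewrite divfK// mulrC /partial.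
have := subrX1 (s n) (H w); rewrite -[s n - 1]opprB -[_ ^+ _ - 1]opprB mulNr => /oppr_inj ->.
by congr (_ * _); rewrite /s subKr.
Qed.

Let bmeas_nat (f : nat -> R) (K : R) : (forall n, `|f n| <= K) -> bmeas (fun w => f (H w)).
Proof.
move=> fK.
have hE n : (fun w => (H w == n)%:R * (f n)%:C%C : R[i]) = (fun w => (\1_[set w | H w = n] w * f n)%:C%C).
  by apply/funext => w; rewrite indic_eqn rmorphM rmorph_nat.
have := @cbm_countable R d T H (fun n _ => (f n)%:C%C) K.
have h1 n : cbm (fun w => (H w == n)%:R * (f n)%:C%C : R[i]).
  by rewrite hE; apply: cbm_real; apply: bmeasM; [exact: bmeas_indic|exact: bmeas_cst].
have h2 n (w : T) : normc ((f n)%:C%C : R[i]) <= K by rewrite normc_real.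
by move=> /(_ h1 h2) [].
Qed.

Let bmeas_pow n : bmeas (fun w => s n ^+ H w).
Proof.
apply: (bmeas_nat (K := 1)) => k; have /andP[s0 s1] := s01 n.
by rewrite ger0_norm; [apply: exprn_ile1 => //; exact: ltW|apply: exprn_ge0; exact: ltW].
Qed.

Let cvg_h : h n @[n --> \oo] --> 0.
Proof. by have := @cvg_harmonic R; rewrite -cvg_shiftS. Qed.

Let left_mean : (\int[P]_(w in D) (partial n w)%:E @[n --> \oo] --> \int[P]_(w in D) ((H w)%:R : R)%:E)%E.
Proof.
have bp n : bmeas (partial n).
  have -> : partial n = (fun w => (1 - s n ^+ H w) / h n) by apply/funext => w; exact: partialE.
  by apply: bmeasM; [apply: bmeasB => //|]; exact: bmeas_cst.
have lim w : ((partial n w)%:E @[n --> \oo] --> ((H w)%:R : R)%:E)%E.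
  apply: cvg_EFin; first by near=> n.
  have -> : (H w)%:R = \sum_(j < H w) (1 : R) ^+ j.
    by under eq_bigr do rewrite expr1n; rewrite sumr_const card_ord.
  apply: cvg_bigsum => j.
  have c : s n @[n --> \oo] --> (1 : R).
    suff : s n @[n --> \oo] --> (1 - 0 : R) by rewrite subr0.
    exact: (cvgB (cvg_cst (1 : R)) cvg_h).
  elim: (nat_of_ord j) => [|k IH]; first by under eq_fun do rewrite expr0; rewrite expr0; exact: cvg_cst.
  by under eq_fun do rewrite exprS; rewrite exprS; exact: cvgM.
have := @cvg_monotone_convergence _ T R P D mD (fun n w => (partial n w)%:E).
have -> : (\int[P]_(x in D) limn (fun n => (partial n x)%:E) = \int[P]_(w in D) ((H w)%:R : R)%:E)%E.
  by apply: eq_integral => w _; apply: cvg_lim => //; exact: lim.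
apply.
- by move=> n; apply: measurable_funTS; apply/measurable_EFinP; exact: (bp n).1.
- move=> n w _; rewrite lee_fin sumr_ge0// => j _; rewrite exprn_ge0//.
  by have /andP[/ltW] := s01 n.
- move=> w _ n m nm; rewrite lee_fin; apply: ler_sum => j _.
  have /andP[s0 _] := s01 n; apply: lerXn2r; rewrite ?nnegrE ?(ltW s0)//.
    by have /andP[/ltW] := s01 m.
  by rewrite lerB// lef_pV2 ?posrE// ler_nat.
Unshelve. all: by end_near.
Qed.

Let quot n w : R := (1 - expR (- (r w * h n))) / h n.

Let quot_ge w n : 0 <= r w -> 0 <= quot n w <= r w.
Proof.
move=> r0; rewrite divr_ge0 ?(ltW (h_gt0 n))//=; last first.
  by rewrite subr_ge0 -expR0 ler_expR oppr_le0 mulr_ge0// ltW.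
rewrite ler_pdivrMr// lerBlDr -lerBlDl.
exact: expR_ge1Dx.
Qed.

Let quot_lim w : 0 <= r w -> quot n w @[n --> \oo] --> r w.
Proof.
move=> r0.
have low n : r w / (1 + r w * h n) <= quot n w.
  have x0 : 0 <= r w * h n by rewrite mulr_ge0// ltW.
  rewrite ler_pdivlMr// mulrAC.
  have e : expR (- (r w * h n)) <= (1 + r w * h n)^-1.
    rewrite expRN lef_pV2 ?posrE ?expR_gt0//; [exact: expR_ge1Dx|lra].
  move: e x0; move: (r w * h n) (expR _) => x y e x0.
  have d0 : 1 + x != 0 by apply: lt0r_neq0; lra.
  have -> : x / (1 + x) = 1 - (1 + x)^-1 by field.
  lra.
apply: (@squeeze_cvgr _ _ _ _ (fun n => r w / (1 + r w * h n)) (fun=> r w)).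
- by near=> n; rewrite low; have /andP[] := quot_ge n r0.
- have := cvgM (cvg_cst (r w)) (cvgV (a := 1 + r w * 0) _ (cvgD (cvg_cst (1 : R)) (cvgM (cvg_cst (r w)) cvg_h))).
  by rewrite mulr0 addr0 invr1 mulr1; apply; exact: oner_neq0.
- exact: cvg_cst.
Unshelve. all: by end_near.
Qed.

(** The mean is the derivative of the generating function at 1. *)
Lemma mean_of_pgf :
  (\int[P]_(w in D) ((H w)%:R : R)%:E = \int[P]_(w in D) (r w)%:E)%E.
Proof.
have bq n : bmeas (fun w => \1_D w * quot n w).
  apply: (bmeas_le (M := `|M|)).
    apply: measurable_funM; first by apply: (bmeas_indic mD).1.
    apply: measurable_funM; last exact: measurable_cst.
    apply: measurable_funB; first exact: measurable_cst.
    apply: measurableT_comp => //; apply: measurableT_comp => //.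
    by apply: measurable_funM => //; exact: measurable_cst.
  move=> w; rewrite indicE; case: (boolP (w \in D)) => [|_]; last by rewrite mul0r normr0.
  rewrite inE => /rM /andP[r0 rM']; rewrite mul1r.
  have /andP[q0 q1] := quot_ge n r0.
  by rewrite ger0_norm//; apply: le_trans q1 (le_trans rM' (ler_norm _)).
have br : bmeas (fun w => \1_D w * r w).
  apply: (bmeas_le (M := `|M|)).
    by apply: measurable_funM => //; exact: (bmeas_indic mD).1.
  move=> w; rewrite indicE; case: (boolP (w \in D)) => [|_]; last by rewrite mul0r normr0.
  by rewrite inE => /rM /andP[r0 rM']; rewrite mul1r ger0_norm// (le_trans rM')// ler_norm.
have int (f : T -> R) : bmeas (fun w => \1_D w * f w) ->
    (\int[P]_(w in D) (f w)%:E = (Ex P (fun w => \1_D w * f w))%:E)%E.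
  move=> bf; rewrite -EFin_Ex// integral_mkcond; apply: eq_integral => w _.
  by rewrite /patch indicE; case: (w \in D); rewrite ?mul1r ?mul0r.
have step n : (\int[P]_(w in D) (partial n w)%:E = (Ex P (fun w => \1_D w * quot n w))%:E)%E.
  have E1 : (fun w => \1_D w * partial n w) = (fun w => (h n)^-1 * (\1_D w - \1_D w * s n ^+ H w)).
    by apply/funext => w; rewrite partialE; move: (s n ^+ _) (\1_D w) => *; ring.
  have E2 : (fun w => \1_D w * quot n w) =
      (fun w => (h n)^-1 * (\1_D w - \1_D w * expR (- (r w * (1 - s n))))).
    by apply/funext => w; rewrite /quot /s subKr; move: (expR _) (\1_D w) => *; ring.
  have bD := bmeas_indic mD (R := R).
  have bs : bmeas (fun w => \1_D w * s n ^+ H w) by exact: bmeasM.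
  have be : bmeas (fun w => \1_D w * expR (- (r w * (1 - s n)))).
    have -> : (fun w => \1_D w * expR (- (r w * (1 - s n)))) = (fun w => \1_D w - (h n) * (\1_D w * quot n w)).
      apply/funext => w; rewrite /quot /s subKr.
      have h0 : h n != 0 by rewrite gt_eqF.
      move: (expR _) (\1_D w) h0 => x y; move: (h n) => z z0; by field.
    by apply: bmeasB => //; apply: bmeasM => //; exact: bmeas_cst.
  rewrite int; last by rewrite E1; apply: bmeasM; [exact: bmeas_cst|exact: bmeasB].
  by rewrite E1 E2 !ExZ ?ExB// ?pgf//; exact: bmeasB.
have := left_mean; under eq_fun do rewrite step.
move=> c; rewrite (int _ br); apply: cvg_unique c _ => //.
apply: cvg_EFin; first by near=> n.
apply: (@Ex_dct _ _ _ P _ _ `|M|).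
- by move=> n; exact: (bq n).1.
- move=> n w; rewrite indicE; case: (boolP (w \in D)) => [|_]; last by rewrite mul0r normr0.
  rewrite inE => /rM /andP[r0 rM']; rewrite mul1r.
  have /andP[q0 q1] := quot_ge n r0.
  by rewrite ger0_norm//; apply: le_trans q1 (le_trans rM' (ler_norm _)).
- apply: aeW => w; rewrite indicE; case: (boolP (w \in D)) => [|_].
    rewrite inE => /rM /andP[r0 _]; under eq_fun do rewrite mul1r.
    by rewrite mul1r; exact: quot_lim.
  by under eq_fun do rewrite mul0r; rewrite mul0r; exact: cvg_cst.
- exact: br.1.
Unshelve. all: by end_near.
Qed.

End ConditionalMean.

(** * Transfer to the copies *)

Section PathSpace.
Context {R : realType} (I : Type).

Definition path_space := g_sigma_algebraType
  [set E : set (I -> R) | exists i (A : set R), measurable A /\ E = [set f | A (f i)]].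

Lemma measurable_coord (i : I) : measurable_fun setT (fun x : path_space => x i : R).
Proof.
by move=> _ A mA; rewrite setTI; apply: sub_sigma_algebra; exists i, A.
Qed.

Lemma measurable_path {d} {T : measurableType d} (Z : I -> T -> R) :
  (forall i, measurable_fun setT (Z i)) ->
  measurable_fun setT ((fun w i => Z i w) : T -> path_space).
Proof.
move=> mZ; apply: (@measurability _ _ T path_space _ _
  [set E : set (I -> R) | exists i (A : set R), measurable A /\ E = [set f | A (f i)]]) => //.
by move=> _ [_ [i [A [mA ->]]] <-]; exact: mZ.
Qed.

Lemma cE_same_law {d1} {T1 : measurableType d1} (P1 : probability T1 R)
    {d2} {T2 : measurableType d2} (P2 : probability T2 R)
    (Z1 : I -> T1 -> R) (Z2 : I -> T2 -> R) (f : path_space -> R[i]) :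
  (forall i, measurable_fun setT (Z1 i)) -> (forall i, measurable_fun setT (Z2 i)) ->
  same_law P1 Z1 P2 Z2 -> cbm f ->
  cE P1 (fun w => f (fun i => Z1 i w)) = cE P2 (fun w => f (fun i => Z2 i w)).
Proof.
move=> m1 m2 law bf.
exact: (@cE_law R _ T1 P1 _ T2 P2 _ path_space (fun w i => Z1 i w) (fun w i => Z2 i w) f
  (measurable_path m1) (measurable_path m2) law bf).
Qed.

End PathSpace.
Arguments path_space {R} I.

Lemma measurable_natr {R : realType} {d} {T : measurableType d} (H : T -> nat) :
  measurable_fun setT H -> measurable_fun setT (fun w => (H w)%:R : R).
Proof. by move=> mH; apply: (@measurableT_comp _ _ _ _ _ _ (fun n : nat => n%:R : R)). Qed.

Section CountableSelection.
Context {R : realType} {d : measure_display} {T : measurableType d}.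

Lemma measurable_natP (H : T -> nat) : 
  measurable_fun setT (fun w => (H w)%:R : R) -> measurable_fun setT H.
Proof.
move=> mH _ A _; rewrite setTI.
have -> : H @^-1` A = \bigcup_(n in A) (fun w => (H w)%:R : R) @^-1` [set n%:R].
  apply/seteqP; split => [w Aw|w [n An /= /eqP]]; first by exists (H w).
  by rewrite eqr_nat => /eqP ->.
apply: bigcup_measurable => n _; rewrite -[X in measurable X]setTI; exact: mH.
Qed.

Lemma measurable_inar (X0 : T -> nat) (xi : nat -> nat -> T -> nat) (eps : nat -> T -> nat) k :
  measurable_fun setT X0 -> (forall i j, measurable_fun setT (xi i j)) ->
  (forall i, measurable_fun setT (eps i)) -> measurable_fun setT (inar X0 xi eps k).
Proof.
move=> m0 mxi meps; elim: k => [//|k IH].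
pose F m w := (\sum_(j < m) xi k j w + eps k w)%N.
have mF m : measurable_fun setT (F m).
  apply: measurable_natP; under eq_fun do rewrite natrD natr_sum.
  apply: measurable_funD; last exact: measurable_natr.
  by apply: measurable_sum => j; exact: measurable_natr.
move=> _ A mA; rewrite setTI.
have -> : inar X0 xi eps k.+1 @^-1` A =
    \bigcup_m ((inar X0 xi eps k @^-1` [set m]) `&` (F m @^-1` A)).
  apply/seteqP; split => [w Aw|w [m _ [/= <-]]]; last by [].
  by exists (inar X0 xi eps k w).
apply: bigcup_measurable => m _; apply: measurableI.
  by rewrite -[X in measurable X]setTI; exact: IH.
by rewrite -[X in measurable X]setTI; exact: mF.
Qed.

End CountableSelection.

Section Copy.
Context {R : realType} (lambda : R).
Context {d0 : measure_display} {T0 : measurableType d0} (P0 : probability T0 R).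
Variables (alpha0 : {RV P0 >-> R}) (X00 : {RV P0 >-> nat}).
Variables (xi : nat -> nat -> {RV P0 >-> nat}) (eps : nat -> {RV P0 >-> nat}).
Hypothesis lambda_gt0 : 0 < lambda.
Hypothesis model : randomized_inar_noise lambda alpha0 X00 xi eps.
Context {d : measure_display} {T : measurableType d} (P : probability T R).
Variables (alpha : {RV P >-> R}) (X : nat -> {RV P >-> nat}).
Hypothesis law : same_law P (joint alpha X) P0 (joint alpha0 (inar X00 xi eps)).

Let Z := inar X00 xi eps.
Let alpha01 w : 0 < alpha0 w < 1. Proof. by case: model. Qed.

(** The conditional mean [lambda / (1 - x)], in a form measurable on the whole line. *)
Definition rate (x : R) := lambda * (1 - x) `^ (-1).

Lemma rateE x : x < 1 -> rate x = lambda / (1 - x).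
Proof. by move=> x1; rewrite /rate powR_inv1// subr_ge0 ltW. Qed.

Lemma rate_ge0 x : 0 <= rate x.
Proof. by rewrite mulr_ge0 ?powR_ge0// ltW. Qed.

Lemma measurable_rate : measurable_fun setT rate.
Proof.
apply: measurable_funM; first exact: measurable_cst.
apply: (@measurableT_comp _ _ _ _ _ _ (@powR R ^~ (-1))); first exact: measurable_powR.
by apply: measurable_funB => //; exact: measurable_cst.
Qed.

Lemma measurable_joint i : measurable_fun setT (joint alpha X i).
Proof.
case: i => [k|] /=; last exact: measurable_funPT.
by apply: measurable_natr; exact: measurable_funPT.
Qed.

Lemma measurable_joint_inar i : measurable_fun setT (joint alpha0 Z i).
Proof.
case: i => [k|] /=; last exact: measurable_funPT.
apply: measurable_natr; apply: (@measurable_inar R _ T0 X00 (fun i j => xi i j) (fun i => eps i) k) => [|i j|i];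
  exact: measurable_funPT.
Qed.

Lemma cE_copy (f : path_space (option nat) -> R[i]) : cbm f ->
  cE P (fun w => f (joint alpha X ^~ w)) = cE P0 (fun w => f (joint alpha0 Z ^~ w)).
Proof. by apply: cE_same_law; [exact: measurable_joint|exact: measurable_joint_inar|]. Qed.

Lemma copy_alpha01 : {ae P, forall w, 0 < alpha w < 1}.
Proof.
have mI : measurable (`]0, 1[%classic : set R) by exact: measurable_itv.
have := law (E := [set f | `]0, 1[%classic (f None)]).
have c : @cylinder_sigma R (option nat) [set f | `]0, 1[%classic (f None)].
  by apply: sub_sigma_algebra; exists None, `]0, 1[%classic.
move=> /(_ c) /=.
have -> : [set w | alpha0 w \in `]0, 1[] = setT.
  by apply/seteqP; split => // w _ /=; rewrite in_itv; exact: alpha01.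
rewrite probability_setT => e.
have mA : measurable [set w | alpha w \in `]0, 1[].
  by rewrite -[X in measurable X]setTI; exact: (measurable_funPT alpha measurableT _ mI).
exists (~` [set w | alpha w \in `]0, 1[]); split.
- exact: measurableC.
- by rewrite probability_setC// e subee.
- by move=> w /= h; rewrite in_itv /= => h'; exact: h.
Qed.

Lemma inar_marginal k (s : R) (A : set R) : measurable A -> 0 < s <= 1 ->
  Ex P0 (fun w => \1_A (alpha0 w) * s ^+ Z k w) =
  Ex P0 (fun w => \1_A (alpha0 w) * expR (- (rate (alpha0 w) * (1 - s)))).
Proof.
move=> mA /andP[s0 s1].
have bg : cbm ((fun w => (\1_A (alpha0 w))%:C%C) : rv_space alpha0 -> R[i]).
  apply: cbm_real; apply: (bmeas_le (M := 1)).
    exact: (sigma_rv_comp (Y := alpha0) (f := \1_A) (bmeas_indic mA (R := R)).1).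
  by move=> w; rewrite indicE; case: (_ \in _); rewrite ?normr1 ?normr0.
have ns : normc (s%:C%C : R[i]) <= 1 by rewrite normc_real gtr0_norm.
have eL : (fun w => (\1_A (alpha0 w))%:C%C * s%:C%C ^+ Z k w) =
    (fun w => (\1_A (alpha0 w) * s ^+ Z k w)%:C%C) :> (T0 -> R[i]).
  by apply/funext => w; rewrite rmorphM rmorphXn.
have eR : (fun w => (\1_A (alpha0 w))%:C%C * cexp ((lambda / (1 - alpha0 w))%:C%C * (s%:C%C - 1))) =
    (fun w => (\1_A (alpha0 w) * expR (- (rate (alpha0 w) * (1 - s))))%:C%C) :> (T0 -> R[i]).
  apply/funext => w; rewrite [RHS]rmorphM; congr (_ * _).
  transitivity (cexp (- (rate (alpha0 w) * (1 - s)))%:C%C : R[i]); last exact: cexp_real.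
  congr cexp.
  have /andP[_ a1] := alpha01 w.
  rewrite rateE//; move: (lambda / _) => r.
  by rewrite rmorphN rmorphM rmorphB rmorph1; ring.
apply: (@complexI R); rewrite -!cE_real -eL -eR; case: k {eL} => [|k].
  exact: (inar_initial lambda_gt0 model bg (cbm_cst s%:C%C)).
pose zs : seq R[i] := rcons (nseq k 1) s%:C%C.
have zs1 z : z \in zs -> normc z <= 1.
  by rewrite mem_rcons inE => /orP[/eqP ->//|/nseqP [-> _]]; rewrite normc1.
have := @inar_path _ _ _ P0 lambda alpha0 X00 xi eps lambda_gt0 model zs _ zs1 bg.
have E1 w : \prod_(j < size zs) nth 0 zs j ^+ Z j.+1 w = s%:C%C ^+ Z k.+1 w.
  rewrite size_rcons size_nseq big_ord_recr /= nth_rcons size_nseq ltnn eqxx big1 ?mul1r// => j _.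
  by rewrite nth_rcons size_nseq ltn_ord nth_nseq ltn_ord expr1n.
have E2 a : cumulant a zs = s%:C%C - 1.
  rewrite /zs; elim: k {zs zs1 E1} => [|k IH] /=; first by rewrite !mulr0 !addr0 mulr1.
  by rewrite subrr mul0r add0r.
by under eq_fun do rewrite E1; under [in RHS]eq_fun do rewrite E2.
Qed.

(** The centering is the same for the copies: the mean over an event on which
    [alpha] stays away from 1 is read off the generating function. *)
Lemma copy_mean k (A : set R) (M : R) : measurable A -> (forall x, A x -> rate x <= M) ->
  (\int[P]_(w in alpha @^-1` A) ((X k w)%:R : R)%:E =
   \int[P]_(w in alpha @^-1` A) (rate (alpha w))%:E)%E.
Proof.
move=> mA AM; apply: (@mean_of_pgf _ _ _ P _ (X k) (fun w => rate (alpha w)) M).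
- by rewrite -[X in measurable X]setTI; exact: (measurable_funPT alpha measurableT _ mA).
- move=> n; rewrite -[X in measurable X]setTI.
  have mn : measurable ([set n] : set nat) by [].
  exact: (measurable_funPT (X k) measurableT [set n] mn).
- by apply: measurableT_comp; [exact: measurable_rate|exact: measurable_funPT].
- by move=> w Aw; rewrite rate_ge0 AM.
move=> s s01; have /andP[s0 s1] := s01; have eP (U : Type) (a : U -> R) w : \1_(a @^-1` A) w = \1_A (a w) :> R by exact: indic_preimage.
under eq_fun do rewrite eP; under [in RHS]eq_fun do rewrite eP.
have mc := @measurable_coord R (option nat).
pose f (x : path_space (option nat)) : R[i] := (\1_A (x None) * s `^ `|x (Some k)|)%:C%C.
pose g (x : path_space (option nat)) : R[i] := (\1_A (x None) * expR (- (rate (x None) * (1 - s))))%:C%C.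
have m1 : measurable_fun setT (fun x : path_space (option nat) => \1_A (x None) : R).
  exact: (measurableT_comp (bmeas_indic mA (R := R)).1 (mc None)).
have bf : cbm f.
  apply: cbm_real; apply: (bmeas_le (M := 1)).
    apply: measurable_funM => //; apply: (measurableT_comp (measurable_powRr s)).
    exact: (measurableT_comp (@normr_measurable R setT) (mc (Some k))).
  move=> x; rewrite indicE; case: (_ \in _); rewrite ?mul1r ?mul0r ?normr0//.
  have := normr_ge0 (x (Some k) : R); move: `|_| => y y0.
  rewrite ger0_norm ?powR_ge0//; have -> : 1 = 1 `^ y :> R by rewrite powR1.
  by apply: ge0_ler_powR; rewrite ?nnegrE// ltW.
have bg : cbm g.
  apply: cbm_real; apply: (bmeas_le (M := 1)).
    apply: measurable_funM => //; apply: measurableT_comp => //; apply: measurableT_comp => //.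
    apply: measurable_funM; last exact: measurable_cst.
    exact: (measurableT_comp measurable_rate (mc None)).
  move=> x; rewrite indicE; case: (_ \in _); rewrite ?mul1r ?mul0r ?normr0//.
  rewrite ger0_norm ?expR_ge0// -[leRHS]expR0 ler_expR oppr_le0 mulr_ge0 ?rate_ge0//.
  by rewrite subr_ge0.
have := inar_marginal k mA s01; move=> /(congr1 (fun x : R => x%:C%C : R[i])).
have := cE_copy bf; have := cE_copy bg; rewrite /f /g /= !cE_real.
have pw n : s `^ `|n%:R| = s ^+ n by rewrite ger0_norm// powR_mulrn// ltW.
have pwf (U : Type) (a : U -> R) (H : U -> nat) :
    (fun w => \1_A (a w) * s `^ `|(H w)%:R|) = (fun w => \1_A (a w) * s ^+ H w).
  by apply/funext => w; rewrite pw.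
by rewrite !pwf => eg ef e; apply: (@complexI R); rewrite ef e eg.
Qed.

(** On the events [rate (alpha w) <= n], which exhaust the sample space, the
    candidate is bounded and [copy_mean] determines the conditional mean. *)
Theorem copy_centering k (m : T -> R) : is_cexp P alpha (fun w => (X k w)%:R) m ->
  {ae P, forall w, m w = rate (alpha w)}.
Proof.
move=> [mm mE].
pose S (n : nat) : set R := [set x | rate x <= n%:R].
have mS n : measurable (S n).
  have -> : S n = rate @^-1` `]-oo, n%:R]%classic.
    by apply/seteqP; split => x /=; rewrite in_itv.
  by rewrite -[X in measurable X]setTI; apply: measurable_rate.
have key n : {ae P, forall w, S n (alpha w) -> m w = rate (alpha w)}.
  apply: (@cexp_unique _ _ _ P alpha _ (S n) n%:R m (fun w => rate (alpha w))) => //.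
  - by apply/sigma_rv_fun; exact: (sigma_rv_comp (Y := alpha) measurable_rate).
  - by move=> w /= h; rewrite rate_ge0.
  by move=> A mA AS; rewrite (mE _ mA); exact: (copy_mean k mA AS).
have : {ae P, forall w (n : nat), S n (alpha w) -> m w = rate (alpha w)}.
  exact: ae_foralln.
apply: filterS => w h; apply: (h (Num.truncn (rate (alpha w))).+1).
by rewrite /S /= ltW// truncnS_gt.
Qed.

End Copy.

(** * Second-order expansion of the cumulant *)

Section CumulantExpansion.
Context {R : realType}.
Implicit Types (a x c : R) (cs : seq R).

Lemma cis_cexp x : cis x = cexp ('i%C * x%:C%C).
Proof.
have -> : 'i%C * x%:C%C = (0 +i* x)%C :> R[i] by apply: complex_eq; rewrite ?ReM ?ImM /=; ring.
by rewrite /cexp /= expR0 !mul1r.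
Qed.

Let ic x : R[i] := 'i%C * x%:C%C.

Let icM x y : ic (x * y) = x%:C%C * ic y.
Proof. by rewrite /ic rmorphM mulrCA. Qed.

Let normc_ic x : normc (ic x) = `|x|.
Proof.
have ni : normc ('i%C : R[i]) = 1 by rewrite /= !expr0n /= expr1n add0r sqrtr1.
by rewrite normcM ni mul1r normc_real.
Qed.

Let ic0 : ic 0 = 0. Proof. by rewrite /ic rmorph0 mulr0. Qed.

Let normc0 : normc (0 : R[i]) = 0. Proof. by have := normc_real (0 : R); rewrite normr0. Qed.

Let deriv_cis x y : cderiv (fun y => cis (y * x)) y (ic x * cis (y * x)).
Proof.
have := cderiv_cexp (cderiv_linear (ic x) y).
have e z : cexp (z%:C%C * ic x) = cis (z * x).
  by rewrite cis_cexp; congr cexp; rewrite /ic rmorphM mulrCA.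
by rewrite e; congr cderiv; apply/funext => z; rewrite e.
Qed.

Let cis_scaled x (B : R) (g D : R -> R[i]) : (forall y, cderiv g y (ic x * D y)) ->
  (forall y, 0 <= y <= 1 -> normc (D y) <= B) -> normc (g 1 - g 0) <= 2 * (`|x| * B).
Proof.
move=> hg hD; apply: cderiv_bound hg _ => y y01.
by rewrite normcM normc_ic ler_wpM2l// hD.
Qed.

Lemma cis_taylor1 x : normc (cis x - 1) <= 2 * `|x|.
Proof.
have := @cis_scaled x 1 (fun y => cis (y * x)) _ (deriv_cis x) (fun y _ => _).
rewrite mul1r mul0r cis0 mulr1; apply=> y.
by rewrite normc_cis.
Qed.

Lemma cis_taylor2 x : normc (cis x - 1 - ic x) <= 4 * x ^+ 2.
Proof.
have := @cis_scaled x (2 * `|x|) (fun y => cis (y * x) - 1 - y%:C%C * ic x) (fun y => cis (y * x) - 1).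
have -> : 2 * (`|x| * (2 * `|x|)) = 4 * x ^+ 2 by rewrite -(real_normK (num_real x)); ring.
rewrite mul1r rmorph1 mul1r rmorph0 !mul0r cis0 subrr !subr0; apply => [y|y /andP[y0 y1]].
  have := cderivD (cderivD (deriv_cis x y) (cderiv_cst (- 1) y)) (cderivM (cderiv_cst (-1) y) (cderiv_linear (ic x) y)).
  rewrite (_ : ic x * _ + 0 + _ = ic x * (cis (y * x) - 1)); last by ring.
  by congr cderiv; apply/funext => z; rewrite mulN1r.
apply: le_trans (cis_taylor1 _) _; rewrite normrM (ger0_norm y0) ler_wpM2l//.
by rewrite ler_piMl.
Qed.

Lemma cis_taylor3 x : normc (cis x - 1 - ic x + (x ^+ 2 / 2)%:C%C) <= 8 * `|x| ^+ 3.
Proof.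
have := @cis_scaled x (4 * x ^+ 2) (fun y => cis (y * x) - 1 - y%:C%C * ic x + (y%:C%C * ic x) * (- (y%:C%C * ic x) / 2))
  (fun y => cis (y * x) - 1 - y%:C%C * ic x).
have -> : 2 * (`|x| * (4 * x ^+ 2)) = 8 * `|x| ^+ 3 by rewrite -(real_normK (num_real x)); ring.
have e : ic x * (- ic x / 2) = (x ^+ 2 / 2)%:C%C.
  have i2 : ('i%C * 'i%C : R[i]) = -1 by rewrite -expr2 sqr_i.
  have -> : ic x * (- ic x / 2) = - ('i%C * 'i%C) * ((x%:C%C) ^+ 2 / 2) by rewrite /ic; ring.
  by rewrite i2 opprK mul1r rmorphM rmorphXn fmorphV rmorph_nat.
rewrite mul1r rmorph1 !mul1r e rmorph0 !mul0r cis0 subrr subr0 addr0 subr0; apply => [y|y /andP[y0 y1]].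
  have l := cderiv_linear (ic x) y.
  have := cderivD (cderivD (cderivD (deriv_cis x y) (cderiv_cst (- 1) y)) (cderivM (cderiv_cst (-1) y) l))
    (cderivM l (cderivM (cderivM (cderiv_cst (-1) y) l) (cderiv_cst (2^-1) y))).
  have alg (i y' k h : R[i]) : h + h = 1 -> i * k + 0 + (0 * (y' * i) + -1 * i) + (i * (- 1 * (y' * i) * h) +
      y' * i * ((0 * (y' * i) + -1 * i) * h + -1 * (y' * i) * 0)) = i * (k - 1 - y' * i).
    move=> hh; have -> : i * (k - 1 - y' * i) = i * (k - 1 - (h + h) * (y' * i)) by rewrite hh mul1r.
    by ring.
  have hh : (2^-1 + 2^-1 : R[i]) = 1 by field.
  rewrite (alg _ _ _ _ hh).
  by congr cderiv; apply/funext => z; rewrite !mulN1r.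
have := cis_taylor2 (y * x); rewrite icM => h; apply: le_trans h _.
rewrite ler_wpM2l// exprMn ler_piMl ?sqr_ge0//.
by rewrite exprn_ile1.
Qed.

(** At the entries [cis c] with [c] in [cs], [thinned] is ['i * thinned_lin] up
    to second order, and [cumulant] is ['i * \sum c - cumulant_quad / 2] up to
    third order. *)
Fixpoint thinned_lin a cs : R := if cs is c :: cs' then c + a * thinned_lin a cs' else 0.

Fixpoint cumulant_quad a cs : R :=
  if cs is c :: cs' then c ^+ 2 + 2 * a * c * thinned_lin a cs' + cumulant_quad a cs' else 0.

(** Counting the jump to 0 after the last entry. *)
Fixpoint total_variation cs : R :=
  if cs is c :: cs' then `|c - head 0 cs'| + total_variation cs' else 0.

Variables (a delta : R) (a01 : 0 < a < 1) (d0 : 0 <= delta).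
Let b := (1 - a)^-1.
Let b_gt0 : 0 < b. Proof. by rewrite invr_gt0 subr_gt0; case/andP: a01. Qed.
Let bE : b = 1 + a * b.
Proof.
have /andP[_ a1] := a01; have : 1 - a != 0 by rewrite subr_eq0 gt_eqF.
by move=> h; rewrite /b; field.
Qed.
Let b_ge1 : 1 <= b.
Proof. by rewrite bE lerDl mulr_ge0// ltW//; case/andP: a01. Qed.
Let a_ge0 : 0 <= a. Proof. by rewrite ltW//; case/andP: a01. Qed.

Let small cs := forall c, c \in cs -> `|c| <= delta.
Let smallS c cs : small (c :: cs) -> `|c| <= delta /\ small cs.
Proof.
by move=> h; split; [apply: h; rewrite mem_head|move=> x xc; apply: h; rewrite inE xc orbT].
Qed.

Let normcis cs z : z \in map cis cs -> normc z <= 1.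
Proof. by move=> /mapP [x _ ->]; rewrite normc_cis. Qed.

Let a01' : 0 <= a <= 1. Proof. by case/andP: a01 => h1 h2; rewrite !ltW. Qed.

Let thinned_small cs : small cs -> normc (thinned a (map cis cs)) <= 2 * b * delta.
Proof.
elim: cs => [|c cs IH] /= sm.
  by rewrite expr0n /= addr0 sqrtr0 !mulr_ge0// ltW.
have [c1 /IH {}IH] := smallS sm.
have -> : cis c * (1 + a%:C%C * thinned a (map cis cs)) - 1 =
    (cis c - 1) * (1 + a%:C%C * thinned a (map cis cs)) + a%:C%C * thinned a (map cis cs) by ring.
apply: le_trans (normcD _ _) _; rewrite !normcM normc_real ger0_norm//.
have h1 := cis_taylor1 c.
have h2 := normc_thinned a01' (@normcis cs).
have h3 : normc (cis c - 1) * normc (1 + a%:C%C * thinned a (map cis cs)) <= 2 * delta.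
  apply: (@le_trans _ _ (normc (cis c - 1) * 1)); first by rewrite ler_wpM2l// normc_ge0.
  by rewrite mulr1; apply: le_trans h1 _; rewrite ler_wpM2l.
have h4 : a * normc (thinned a (map cis cs)) <= a * (2 * b * delta) by rewrite ler_wpM2l.
have -> : 2 * b * delta = 2 * delta + a * (2 * b * delta) by rewrite {1}bE; ring.
exact: lerD.
Qed.

Let thinned_expansion cs : small cs ->
  normc (thinned a (map cis cs) - ic (thinned_lin a cs)) <= 8 * b ^+ 2 * delta ^+ 2.
Proof.
elim: cs => [|c cs IH] sm.
  rewrite [thinned _ _]/= [thinned_lin _ _]/= ic0 subr0 normc0.
  by rewrite !mulr_ge0 ?exprn_ge0// ltW.
have [c1 sm'] := smallS sm; have {}IH := IH sm'; have U := thinned_small sm'.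
rewrite [thinned _ _]/= [thinned_lin _ _]/=.
move: IH U; set u := thinned a _; set v := thinned_lin a _ => IH U.
have -> : cis c * (1 + a%:C%C * u) - 1 - ic (c + a * v) =
    (cis c - 1 - ic c) + a%:C%C * (u * (cis c - 1)) + a%:C%C * (u - ic v).
  by rewrite /ic rmorphD rmorphM; ring.
have e1 : normc (cis c - 1 - ic c) <= 4 * delta ^+ 2.
  by apply: le_trans (cis_taylor2 c) _; rewrite ler_wpM2l// -(real_normK (num_real c)) lerXn2r// nnegrE.
have e2 : normc (a%:C%C * (u * (cis c - 1))) <= a * (4 * b * delta ^+ 2).
  rewrite !normcM normc_real ger0_norm// ler_wpM2l//.
  have -> : 4 * b * delta ^+ 2 = (2 * b * delta) * (2 * delta) by ring.
  apply: ler_pM; rewrite ?normc_ge0//.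
  by apply: le_trans (cis_taylor1 c) _; rewrite ler_wpM2l.
have e3 : normc (a%:C%C * (u - ic v)) <= a * (8 * b ^+ 2 * delta ^+ 2).
  by rewrite normcM normc_real ger0_norm// ler_wpM2l.
apply: le_trans (normcD _ _) _; apply: le_trans (lerD (normcD _ _) (lexx _)) _.
apply: le_trans (lerD (lerD e1 e2) e3) _.
have {2}-> : 8 * b ^+ 2 * delta ^+ 2 = 8 * b * delta ^+ 2 + a * (8 * b ^+ 2 * delta ^+ 2).
  by rewrite [b ^+ 2]expr2 {1}bE; ring.
rewrite lerD2r; have -> : 4 * delta ^+ 2 + a * (4 * b * delta ^+ 2) = 4 * (1 + a * b) * delta ^+ 2 by ring.
rewrite -bE ler_wpM2r ?sqr_ge0// ler_wpM2r ?ler_nat// ltW//.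
Qed.

(** Thinning contracts errors by [a], so that they stay of second order in
    [thinned] with a constant of order [b ^+ 2]. In [cumulant] they are
    multiplied by one more small factor and add up over the steps. *)
Lemma cumulant_expansion cs : small cs ->
  normc (cumulant a (map cis cs) - ic (\sum_(c <- cs) c) + (cumulant_quad a cs / 2)%:C%C) <=
  (size cs)%:R * (24 * b ^+ 2 * delta ^+ 3).
Proof.
elim: cs => [|c cs IH] sm.
  by rewrite [cumulant _ _]/= [cumulant_quad _ _]/= big_nil ic0 subr0 !mul0r addr0 normc0.
have [c1 sm'] := smallS sm; have {}IH := IH sm'; have U := thinned_small sm'.
have E := thinned_expansion sm'.
rewrite [cumulant _ _]/= [cumulant_quad _ _]/= big_cons.
move: IH U E; set u := thinned a _; set v := thinned_lin a _; set s := cumulant a _; set q := cumulant_quad a _.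
set t := \sum_(c <- cs) c => IH U E.
have -> : (cis c - 1) * (1 + a%:C%C * u) + s - ic (c + t) + ((c ^+ 2 + 2 * a * c * v + q) / 2)%:C%C =
   (cis c - 1 - ic c + (c ^+ 2 / 2)%:C%C) + a%:C%C * ((cis c - 1 - ic c) * u + ic c * (u - ic v))
   + (s - ic t + (q / 2)%:C%C).
  have -> : (c ^+ 2 + 2 * a * c * v + q) / 2 = c ^+ 2 / 2 + a * c * v + q / 2 by field.
  have i2 : ('i%C * 'i%C : R[i]) = -1 by rewrite -expr2 sqr_i.
  have iv : ic c * ic v = - (c%:C%C * v%:C%C).
    have -> : ic c * ic v = 'i%C * 'i%C * (c%:C%C * v%:C%C) by rewrite /ic; ring.
    by rewrite i2 mulN1r.
  have -> : ic c * (u - ic v) = ic c * u + c%:C%C * v%:C%C by rewrite mulrBr iv opprK.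
  have -> : ic (c + t) = ic c + ic t by rewrite /ic rmorphD mulrDr.
  by rewrite !rmorphD !(rmorphM _ (a * c)) (rmorphM _ a); ring.
have d2 : `|c| ^+ 2 <= delta ^+ 2 by rewrite lerXn2r// nnegrE.
have d3 : `|c| ^+ 3 <= delta ^+ 3 by rewrite lerXn2r// nnegrE.
have e1 : normc (cis c - 1 - ic c + (c ^+ 2 / 2)%:C%C) <= 8 * delta ^+ 3.
  by apply: le_trans (cis_taylor3 c) _; rewrite ler_wpM2l.
have e2 : normc ((cis c - 1 - ic c) * u) <= 8 * b * delta ^+ 3.
  rewrite normcM; have -> : 8 * b * delta ^+ 3 = (4 * delta ^+ 2) * (2 * b * delta) by ring.
  apply: ler_pM; rewrite ?normc_ge0//.
  by apply: le_trans (cis_taylor2 c) _; rewrite ler_wpM2l// -(real_normK (num_real c)).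
have e3 : normc (ic c * (u - ic v)) <= 8 * b ^+ 2 * delta ^+ 3.
  rewrite normcM normc_ic; have -> : 8 * b ^+ 2 * delta ^+ 3 = delta * (8 * b ^+ 2 * delta ^+ 2) by ring.
  by apply: ler_pM; rewrite ?normc_ge0.
have e4 : normc (a%:C%C * ((cis c - 1 - ic c) * u + ic c * (u - ic v))) <= 8 * b * delta ^+ 3 + 8 * b ^+ 2 * delta ^+ 3.
  rewrite normcM normc_real ger0_norm//; apply: (@le_trans _ _ (1 * normc ((cis c - 1 - ic c) * u + ic c * (u - ic v)))).
    by rewrite ler_wpM2r ?normc_ge0//; case/andP: a01'.
  by rewrite mul1r; apply: le_trans (normcD _ _) _; exact: lerD.
have -> : (size (c :: cs))%:R = (size cs)%:R + 1 :> R by rewrite natr1.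
rewrite [leRHS]mulrDl mul1r [leRHS]addrC.
apply: le_trans (normcD _ _) _; apply: lerD => //.
apply: le_trans (normcD _ _) _; apply: le_trans (lerD e1 e4) _.
have -> : 8 * delta ^+ 3 + (8 * b * delta ^+ 3 + 8 * b ^+ 2 * delta ^+ 3) = (8 + 8 * b + 8 * b ^+ 2) * delta ^+ 3 by ring.
rewrite ler_wpM2r ?exprn_ge0//.
have : b <= b ^+ 2 by rewrite expr2 ler_peMr// ltW.
by move: b_ge1; move: (b ^+ 2) => x; lra.
Qed.

(** For constant entries [c], [thinned_lin] is close to [b * c], and the quadratic
    part to [(1 + 2 a b) c ^+ 2] per step. In general [thinned_lin - b * c]
    obeys a recursion that contracts by [a] and is driven by the jumps of [cs],
    so that its sum is bounded by the total variation. *)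
Lemma quad_variation cs : small cs ->
  `|cumulant_quad a cs - (1 + a) / (1 - a) * \sum_(c <- cs) c ^+ 2| <=
  2 * delta * (b ^+ 2 * total_variation cs).
Proof.
move=> sm.
pose e := fix e cs := if cs is c :: cs' then `|thinned_lin a cs - b * c| + e cs' else 0.
have E : (1 - a) * e cs + a * `|thinned_lin a cs - b * head 0 cs| <= a * b * total_variation cs.
  elim: cs {sm} => [|c cs IH]; first by rewrite /= !mulr0 subr0 normr0 !mulr0 addr0.
  rewrite [e _]/= [head _ _]/= [total_variation _]/=.
  set x := thinned_lin a (c :: cs) - b * c.
  have -> : (1 - a) * (`|x| + e cs) + a * `|x| = `|x| + (1 - a) * e cs by ring.
  have hx : x = a * (thinned_lin a cs - b * head 0 cs) - a * b * (c - head 0 cs).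
    rewrite /x [thinned_lin _ (_ :: _)]/=; move: (thinned_lin a cs) (head 0 cs) => y z.
    by rewrite {1}bE; ring.
  have : `|x| <= a * `|thinned_lin a cs - b * head 0 cs| + a * b * `|c - head 0 cs|.
    rewrite hx; apply: le_trans (ler_normB _ _) _.
    by rewrite !normrM (ger0_norm a_ge0) (ger0_norm (ltW b_gt0)).
  by move: IH; move: (e cs) (`|x|) (`|_ - b * _|) (`|c - _|) (total_variation cs) (a * b) => *; lra.
have e0 cs' : 0 <= e cs' by elim: cs' => [|c cs' IH] //=; rewrite addr_ge0.
have tv0 cs' : 0 <= total_variation cs' by elim: cs' => [|c cs' IH] //=; rewrite addr_ge0.
have {}E : e cs <= b ^+ 2 * total_variation cs.
  have h : (1 - a) * e cs <= b * total_variation cs.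
    have h1 : a * b * total_variation cs <= b * total_variation cs.
      rewrite ler_wpM2r// ler_piMl ?(ltW b_gt0)//; by case/andP: a01'.
    by apply: le_trans h1; apply: le_trans E; rewrite lerDl mulr_ge0.
  have -> : e cs = b * ((1 - a) * e cs).
    by rewrite mulrA mulVf ?mul1r// subr_eq0 gt_eqF//; case/andP: a01.
  by rewrite expr2 -mulrA ler_wpM2l// ltW.
apply: (@le_trans _ _ (2 * delta * e cs)); last by rewrite ler_wpM2l// mulr_ge0.
elim: cs sm {E} => [|c cs IH] sm; first by rewrite /= big_nil !mulr0 subr0 normr0.
have [c1 /IH {}IH] := smallS sm; rewrite big_cons [cumulant_quad _ _]/= [e _]/=.
have /andP[_ a1] := a01; have a1' : 1 - a != 0 by rewrite subr_eq0 gt_eqF.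
set q := cumulant_quad a cs; set s := \sum_(c <- cs) c ^+ 2; set v := thinned_lin a cs.
have -> : c ^+ 2 + 2 * a * c * v + q - (1 + a) / (1 - a) * (c ^+ 2 + s) =
    2 * c * (c + a * v - b * c) + (q - (1 + a) / (1 - a) * s) by rewrite /b; field.
rewrite [leRHS]mulrDr; apply: le_trans (ler_normD _ _) _; apply: lerD => //.
by rewrite !normrM ger0_norm// -!mulrA !ler_wpM2l// ler_wpM2r.
Qed.

End CumulantExpansion.

(** * Partial sums at several times *)

Lemma total_variation_mkseq {R : realType} (f : nat -> R) K :
  (forall k, (K <= k)%N -> f k = 0) ->
  total_variation (mkseq f K) = \sum_(k < K) `|f k - f k.+1|.
Proof.
elim: K f => [|K IH] f f0; first by rewrite big_ord0.
have -> : mkseq f K.+1 = f 0%N :: mkseq (f \o S) K.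
  by rewrite /mkseq /= -[1%N]addn0 iotaDl -map_comp.
rewrite big_ord_recl /= IH => [|k Kk]; last exact: f0.
congr (`|_ - _| + _).
by case: K {IH} f0 => [|K] f0 //=; rewrite f0.
Qed.

Lemma big_iota_ord {R : realType} (F : nat -> R) K : \sum_(k <- iota 0 K) F k = \sum_(k < K) F k.
Proof. by rewrite -(big_mkord xpredT) /index_iota subn0. Qed.

Lemma count_below {R : realType} (p K : nat) : (p <= K)%N ->
  \sum_(k < K) ((k < p)%N%:R : R) = p%:R.
Proof.
move=> pK; rewrite -natr_sum; congr (_%:R).
rewrite -(big_mkord xpredT (fun k => nat_of_bool (k < p)%N)) (@big_cat_nat _ _ _ p)//=.
rewrite big_nat (eq_bigr (fun=> 1%N)); last by move=> k /andP[_ ->].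
rewrite -big_nat sum_nat_const_nat muln1 subn0 big_nat big1 ?addn0// => k /andP[pk _].
by rewrite ltnNge pk.
Qed.

Lemma cvg_truncn_ratio {R : realType} (t : R) : 0 <= t ->
  (Num.truncn (n%:R * t))%:R / n%:R @[n --> \oo] --> t.
Proof.
move=> t0.
have cinv : (n%:R^-1 : R) @[n --> \oo] --> 0.
  by rewrite -cvg_shiftS; exact: cvg_harmonic.
apply: (@squeeze_cvgr _ _ _ _ (fun n : nat => t - n%:R^-1) (fun=> t)).
- exists 1%N => // n /= n1; have n0 : 0 < n%:R :> R by rewrite ltr0n.
  have x0 : 0 <= n%:R * t by rewrite mulr_ge0.
  have /andP[h1 h2] := Num.Theory.truncn_itv x0.
  rewrite ler_pdivlMr// ler_pdivrMr// mulrBl mulVf ?gt_eqF// [t * _]mulrC h1 andbT.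
  by move: h2; rewrite -natr1 => h2; rewrite lerBlDr ltW.
- suff : t - n%:R^-1 @[n --> \oo] --> (t - 0 : R) by rewrite subr0.
  exact: (cvgB (cvg_cst t) cinv).
- exact: cvg_cst.
Qed.

Section SampledPath.
Context {R : realType} (m : nat) (u t : 'I_m -> R) (kappa : R).
Hypothesis t_ge0 : forall l, 0 <= t l.

Definition steps (n : nat) (l : 'I_m) : nat := Num.truncn (n%:R * t l).
Definition horizon (n : nat) : nat := \sum_l steps n l.
Definition scale_n (n : nat) : R := kappa * n%:R `^ (- 2^-1).

(** The weight of the time [k.+1] in a linear combination of the partial sums. *)
Definition weight (n k : nat) : R := scale_n n * \sum_l u l * (k < steps n l)%N%:R.

Lemma steps_horizon n l : (steps n l <= horizon n)%N.
Proof. by rewrite /horizon (bigD1 l)//= leq_addr. Qed.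

Lemma weight_sum n (D : nat -> R) :
  \sum_l u l * (scale_n n * \sum_(1 <= k < (steps n l).+1) D k) =
  \sum_(k < horizon n) weight n k * D k.+1.
Proof.
under [RHS]eq_bigr do rewrite /weight -mulrA mulr_suml mulr_sumr.
rewrite exchange_big /=; apply: eq_bigr => l _.
rewrite big_add1 /= mulrCA mulr_sumr mulr_sumr.
rewrite -(big_mkord xpredT (fun k => scale_n n * (u l * (k < steps n l)%N%:R * D k.+1))).
rewrite [RHS](@big_cat_nat _ _ _ (steps n l))//= ?steps_horizon// [X in _ = _ + X]big_nat.
rewrite [X in _ = _ + X]big1 ?addr0 => [|k /andP[h _]]; last by rewrite ltnNge h mulr0 mul0r mulr0.
rewrite big_nat [RHS]big_nat; apply: eq_bigr => k /andP[_ ->].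
by rewrite mulr1 mulrCA.
Qed.

Let size_n n := `|scale_n n| * \sum_l `|u l|.

Let size_ge0 n : 0 <= size_n n.
Proof. by rewrite mulr_ge0// sumr_ge0. Qed.

Let weight_le n k : `|weight n k| <= size_n n.
Proof.
rewrite normrM ler_wpM2l//; apply: le_trans (ler_norm_sum _ _ _) _; apply: ler_sum => l _.
by rewrite normrM ler_piMr// ger0_norm// lern1 leq_b1.
Qed.

Let weight_out n k : (horizon n <= k)%N -> weight n k = 0.
Proof.
move=> h; rewrite /weight big1 ?mulr0// => l _.
by rewrite ltnNge (leq_trans (steps_horizon n l) h) mulr0.
Qed.

Let weight_variation n : total_variation (mkseq (weight n) (horizon n)) <= size_n n.
Proof.
rewrite total_variation_mkseq; last exact: weight_out.
apply: (@le_trans _ _ (\sum_(k < horizon n) `|scale_n n| * \sum_l `|u l| * ((k < steps n l)%N%:R - (k.+1 < steps n l)%N%:R))).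
  apply: ler_sum => k _; rewrite /weight -mulrBr normrM ler_wpM2l// -sumrB.
  apply: le_trans (ler_norm_sum _ _ _) _; apply: ler_sum => l _.
  rewrite -mulrBr normrM ler_wpM2l// ger0_norm// subr_ge0 ler_nat.
  by case: (ltnP k.+1 (steps n l)) => // /ltnW ->.
rewrite -mulr_sumr ler_wpM2l// exchange_big /=; apply: ler_sum => l _.
rewrite -mulr_sumr ler_piMr//.
have e K : \sum_(k < K) ((k < steps n l)%N%:R - (k.+1 < steps n l)%N%:R) = (0 < steps n l)%N%:R - (K < steps n l)%N%:R :> R.
  elim: K => [|K IH]; first by rewrite big_ord0 subrr.
  by rewrite big_ord_recr /= IH addrA subrK.
by rewrite e [(horizon n < _)%N]ltnNge steps_horizon subr0 lern1 leq_b1.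
Qed.

Let scale_sqr n : (0 < n)%N -> scale_n n ^+ 2 = kappa ^+ 2 / n%:R.
Proof.
move=> n0; rewrite exprMn; congr (_ * _).
rewrite -powR_mulrn ?powR_ge0// -powRrM mulNr mulVf ?pnatr_eq0//.
by rewrite powR_inv1.
Qed.

Let cvg_scale : scale_n n @[n --> \oo] --> 0.
Proof.
have c0 : (n%:R^-1 : R) @[n --> \oo] --> 0 by rewrite -cvg_shiftS; exact: cvg_harmonic.
have h0 : 0 < 2^-1 :> R by rewrite invr_gt0.
have i0 n : 0 <= n%:R^-1 :> R by rewrite invr_ge0.
have -> : scale_n = (fun n => kappa * n%:R^-1 `^ 2^-1).
  apply/funext => n; have -> : n%:R^-1 = n%:R `^ (-1) :> R by rewrite powR_inv1.
  by rewrite /scale_n -powRrM mulN1r.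
suff : kappa * n%:R^-1 `^ 2^-1 @[n --> \oo] --> (kappa * 0 : R) by rewrite mulr0.
exact: (cvgM (cvg_cst kappa) (cvg_powR0 h0 i0 c0)).
Qed.

Let cvg_size : size_n n @[n --> \oo] --> 0.
Proof.
suff : size_n n @[n --> \oo] --> (`|0 : R| * \sum_l `|u l|) by rewrite normr0 mul0r.
exact: (cvgM (cvg_norm cvg_scale) (cvg_cst (\sum_l `|u l|))).
Qed.

Let weight_sqr n : \sum_(c <- mkseq (weight n) (horizon n)) c ^+ 2 =
  scale_n n ^+ 2 * \sum_i \sum_j u i * u j * (Num.truncn (n%:R * Num.min (t i) (t j)))%:R.
Proof.
rewrite big_map big_iota_ord.
under eq_bigr do rewrite exprMn.
rewrite -mulr_sumr; congr (_ * _).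
under eq_bigr => k _ do rewrite expr2 mulr_suml; rewrite exchange_big /=; apply: eq_bigr => i _.
under eq_bigr => k _ do rewrite mulr_sumr; rewrite exchange_big /=; apply: eq_bigr => j _.
set q := Num.truncn _.
have qE : q = minn (steps n i) (steps n j).
  have le := @Num.Theory.le_truncn R.
  have n0 : 0 <= n%:R :> R by [].
  rewrite /q /steps; case: (leP (t i) (t j)) => h.
    by rewrite (minn_idPl _)//; apply: le; rewrite ler_wpM2l.
  by rewrite (minn_idPr _)//; apply: le; rewrite ler_wpM2l// ltW.
have qK : (q <= horizon n)%N by rewrite qE; apply: leq_trans (geq_minl _ _) _; exact: steps_horizon.
rewrite -(count_below qK) mulr_sumr; apply: eq_bigr => k _.
by rewrite qE leq_min -mulnb natrM; ring.
Qed.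

Let cvg_sqr : \sum_(c <- mkseq (weight n) (horizon n)) c ^+ 2 @[n --> \oo] -->
  kappa ^+ 2 * fdd_variance u t.
Proof.
have c : kappa ^+ 2 * \sum_i \sum_j u i * u j * ((Num.truncn (n%:R * Num.min (t i) (t j)))%:R / n%:R) @[n --> \oo] -->
    kappa ^+ 2 * fdd_variance u t.
  apply: cvgM; first exact: cvg_cst.
  apply: cvg_bigsum => i; apply: cvg_bigsum => j; apply: cvgM; first exact: cvg_cst.
  by apply: cvg_truncn_ratio; rewrite le_min !t_ge0.
apply: cvg_trans c; apply: near_eq_cvg; exists 1%N => // n /= n1.
rewrite weight_sqr scale_sqr// -mulrA; congr (_ * _).
rewrite mulr_sumr; apply: eq_bigr => i _; rewrite mulr_sumr; apply: eq_bigr => j _.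
by rewrite [RHS]mulrC mulrA.
Qed.

(** The partial sums at the times [t l], conditionally centered, have
    asymptotically the cumulants of a Brownian motion with variance
    [lambda (1 + a) / (1 - a) ^+ 2]. *)
Lemma cvg_cumulant a : 0 < a < 1 ->
  ccvg (fun n => cumulant a (map cis (mkseq (weight n) (horizon n))) -
      'i%C * (\sum_(k < horizon n) weight n k)%:C%C)
    (- ((1 + a) / (1 - a) * (kappa ^+ 2 * fdd_variance u t) / 2))%:C%C.
Proof.
move=> a01; have /andP[a0 a1] := a01.
have small n c : c \in mkseq (weight n) (horizon n) -> `|c| <= size_n n.
  by move=> /mapP [k _ ->].
pose cs n := mkseq (weight n) (horizon n).
pose g := (1 + a) / (1 - a).
pose q := kappa ^+ 2 * fdd_variance u t.
pose b := (1 - a)^-1.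
have b0 : 0 <= b by rewrite invr_ge0 subr_ge0 ltW.
have g0 : 0 <= g 
  by apply: divr_ge0; [apply: addr_ge0 => //; exact: ltW|rewrite subr_ge0; exact: ltW].
pose E1 n := (horizon n)%:R * (24 * b ^+ 2 * size_n n ^+ 3).
pose E2 n := 2 * size_n n * (b ^+ 2 * size_n n).
pose E3 n := g * `|\sum_(c <- cs n) c ^+ 2 - q|.
apply: (@ccvg_squeeze _ _ _ (fun n => E1 n + E2 n + E3 n)) => [n|].
  have h1 := cumulant_expansion a01 (size_ge0 n) (small n).
  have h2 := quad_variation a01 (size_ge0 n) (small n).
  rewrite big_map big_iota_ord size_mkseq -/(cs n) -/b in h1.
  rewrite -/(cs n) -/b -/g in h2.
  set S := cumulant a _ in h1 *; set Q := cumulant_quad a _ in h1 h2.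
  set I := 'i%C * _ in h1 *.
  have -> : S - I - (- (g * q / 2))%:C%C = (S - I + (Q / 2)%:C%C) + ((g * q - Q) / 2)%:C%C.
    have -> : (g * q - Q) / 2 = - (- (g * q / 2)) - Q / 2 by field.
    by rewrite rmorphB [in X in _ = _ + (X - _)]rmorphN; ring.
  apply: le_trans (normcD _ _) _; rewrite -[leRHS]addrA; apply: lerD => //.
  rewrite normc_real normrM [`|2^-1|]ger0_norm// ler_pdivrMr//.
  have h3 : `|g * q - Q| <= E2 n + E3 n.
    have -> : g * q - Q = - (Q - g * \sum_(c <- cs n) c ^+ 2) + (- (g * (\sum_(c <- cs n) c ^+ 2 - q))) by ring.
    apply: le_trans (ler_normD _ _) _; rewrite !normrN; apply: lerD.
      apply: le_trans h2 _; apply: ler_wpM2l; first exact: mulr_ge0.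
      by apply: ler_wpM2l; [exact: sqr_ge0|exact: weight_variation].
    by rewrite normrM ger0_norm.
  apply: le_trans h3 _.
  have : 0 <= E2 n by apply: mulr_ge0; apply: mulr_ge0 => //; exact: sqr_ge0.
  have : 0 <= E3 n by rewrite mulr_ge0.
  by move: (E2 n) (E3 n) => x y; lra.
have c2 : E2 n @[n --> \oo] --> 0.
  suff : E2 n @[n --> \oo] --> (2 * 0 * (b ^+ 2 * 0) : R) by rewrite !mulr0.
  exact: (cvgM (cvgM (cvg_cst (2 : R)) cvg_size) (cvgM (cvg_cst (b ^+ 2)) cvg_size)).
have c3 : E3 n @[n --> \oo] --> 0.
  suff : E3 n @[n --> \oo] --> (g * `|q - q|) by rewrite subrr normr0 mulr0.
  exact: (cvgM (cvg_cst g) (cvg_norm (cvgB cvg_sqr (cvg_cst q)))).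
have c1 : E1 n @[n --> \oo] --> 0.
  pose U := \sum_l `|u l|; pose W := \sum_l t l.
  pose C := W * (24 * b ^+ 2) * (kappa ^+ 2 * U ^+ 2).
  have cC : C * size_n n @[n --> \oo] --> 0.
    suff : C * size_n n @[n --> \oo] --> (C * 0) by rewrite mulr0.
    exact: (cvgM (cvg_cst C) cvg_size).
  apply: (@squeeze_cvgr _ _ _ _ (fun=> 0) (fun n => C * size_n n)) => //; last exact: cvg_cst.
  exists 1%N => // n /= n1.
  have nn : 0 <= 24 * b ^+ 2 * size_n n ^+ 3.
    by apply: mulr_ge0; [apply: mulr_ge0 => //; exact: sqr_ge0|exact: exprn_ge0].
  apply/andP; split; first exact: mulr_ge0.
  have n0 : 0 < n%:R :> R by rewrite ltr0n.
  have K : (horizon n)%:R <= n%:R * W.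
    rewrite /horizon natr_sum mulr_sumr; apply: ler_sum => l _.
    by have /andP[] := Num.Theory.truncn_itv (mulr_ge0 (ltW n0) (t_ge0 l)).
  have s2 : size_n n ^+ 2 = kappa ^+ 2 / n%:R * U ^+ 2.
    by rewrite /size_n exprMn (real_normK (num_real _)) scale_sqr.
  have -> : C * size_n n = n%:R * W * (24 * b ^+ 2 * size_n n ^+ 3).
    rewrite [size_n n ^+ 3]exprS s2 /C.
    have n0' : n%:R != 0 :> R by rewrite gt_eqF.
    move: n0'; move: (n%:R : R) (size_n n) => x y x0; by field.
  exact: ler_wpM2r.
suff : E1 n + E2 n + E3 n @[n --> \oo] --> (0 + 0 + 0 : R) by rewrite !addr0.
exact: (cvgD (cvgD c1 c2) c3).
Qed.

End SampledPath.

(** * A Tauberian theorem *)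

Section ImproperIntegral.
Context {R : realType}.
Notation mu := (@lebesgue_measure R).

(** Exhaust the interval by compact intervals. *)
Lemma integral_oo_FTC (f F : R -> R) (a b A B : R) : a < b ->
  (forall x, a < x < b -> 0 <= f x) ->
  (forall x, a < x < b -> {for x, continuous f}) ->
  (forall x, a < x < b -> is_derive x 1 F (f x)) ->
  F x @[x --> a^'+] --> A -> F x @[x --> b^'-] --> B ->
  (\int[mu]_(x in `]a, b[) (f x)%:E = (B - A)%:E)%E.
Proof.
move=> ab f0 cf dF FA FB.
pose h n : R := (b - a) / n.+3%:R.
have ba : 0 < b - a by rewrite subr_gt0.
have h_gt0 n : 0 < h n by rewrite divr_gt0.
have h_le n : h n <= (b - a) / 3 by rewrite ler_pM2l// lef_pV2 ?posrE// ler_nat.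
have h_anti n m : (n <= m)%N -> h m <= h n.
  by move=> nm; rewrite ler_pM2l// lef_pV2 ?posrE// ler_nat.
have cvgh : h n @[n --> \oo] --> 0.
  have c : (n.+3%:R^-1 : R) @[n --> \oo] --> 0.
    have := @cvg_harmonic R; rewrite -(cvg_shiftn 2)/=.
    by under eq_fun do rewrite /harmonic addn2.
  suff : h n @[n --> \oo] --> ((b - a) * 0 : R) by rewrite mulr0.
  exact: (cvgM (cvg_cst (b - a)) c).
pose I n : set R := `[a + h n, b - h n]%classic.
have inab n x : I n x -> a < x < b.
  rewrite /I /= in_itv /= => /andP[h1 h2]; have := h_gt0 n; move: (h n) h1 h2 => y *.
  by apply/andP; split; lra.
have step n : (\int[mu]_(x in I n) (f x)%:E = (F (b - h n) - F (a + h n))%:E)%E.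
  have lt : a + h n < b - h n by have := h_le n; move: (h n) => y; lra.
  have cF x : a < x < b -> {for x, continuous F}.
    move=> xab; apply: differentiable_continuous; apply/derivable1_diffP.
    by have [] := dF _ xab.
  have ia : a < a + h n < b by apply: (inab n); rewrite /I /= in_itv /= lexx ltW.
  have ib : a < b - h n < b by apply: (inab n); rewrite /I /= in_itv /= lexx ltW.
  rewrite (@continuous_FTC2 _ f F) ?EFinB//.
  - apply: continuous_in_subspaceT => x; rewrite inE => /(inab n); exact: cf.
  - split; [|exact: cvg_at_right_filter (cF _ ia)|exact: cvg_at_left_filter (cF _ ib)].
    move=> x; rewrite in_itv => /andP[h1 h2].
    have xab : a < x < b by apply: (inab n); rewrite /I /= in_itv /= !ltW.
    by have [] := dF _ xab.
  - move=> x; rewrite in_itv => /andP[h1 h2].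
    have xab : a < x < b by apply: (inab n); rewrite /I /= in_itv /= !ltW.
    by rewrite derive1E; have := dF _ xab => D; exact: derive_val.
have UI : \bigcup_n I n = `]a, b[%classic.
  apply/seteqP; split => [x [n _ /inab]|x]; first by rewrite /= in_itv.
  rewrite /= in_itv /= => /andP[h1 h2].
  have m0 : 0 < Num.min (x - a) (b - x) by rewrite lt_min !subr_gt0 h1 h2.
  have [N _ HN] := cvgr_lt _ cvgh _ m0.
  exists N => //; have := HN N (leqnn N); rewrite /= lt_min => /andP[h3 h4].
  by rewrite /I /= in_itv /=; apply/andP; split; move: (h N) h3 h4 => y; lra.
have mI n : measurable (I n) by exact: measurable_itv.
have mf : measurable_fun (`]a, b[%classic : set R) (EFin \o f).
  apply/measurable_EFinP; apply: open_continuous_measurable_fun; first exact: interval_open.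
  by move=> x; rewrite inE /= in_itv /=; exact: cf.
have := @ge0_nondecreasing_set_cvg_integral _ (measurableTypeR R) R I (EFin \o f) lebesgue_measure.
rewrite UI => H; have {}H : (\int[mu]_(x in I n) (f x)%:E @[n --> \oo] --> \int[mu]_(x in `]a, b[) (f x)%:E)%E.
  apply: H.
  - move=> n m nm; apply/subsetPset => x; rewrite /I /= !in_itv /= => /andP[h1 h2].
    by have := h_anti _ _ nm; move: (h n) (h m) h1 h2 => y z *; apply/andP; split; lra.
  - by [].
  - by move=> n; apply: measurable_funS mf => // x /inab; rewrite /= in_itv.
  - by move=> n x /inab /f0; rewrite lee_fin.
apply: (cvg_unique _ H) => //.
have -> : (fun n => \int[mu]_(x in I n) (f x)%:E)%E = (fun n => (F (b - h n) - F (a + h n))%:E).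
  by apply/funext => n; exact: step.
apply: cvg_EFin; first by near=> n.
apply: cvgB.
  move/cvg_at_leftP : FB; apply; split => [n|]; first by rewrite gtrBl.
  suff : b - h n @[n --> \oo] --> (b - 0 : R) by rewrite subr0.
  exact: (cvgB (cvg_cst b) cvgh).
move/cvg_at_rightP : FA; apply; split => [n|]; first by rewrite ltrDl.
suff : a + h n @[n --> \oo] --> (a + 0 : R) by rewrite addr0.
exact: (cvgD (cvg_cst a) cvgh).
Unshelve. all: by end_near.
Qed.

Lemma continuous_powR (s x : R) : 0 < x -> {for x, continuous (fun y => y `^ s)}.
Proof.
move=> x0; apply: differentiable_continuous; apply/derivable1_diffP.
by have [] := @is_derive1_powR R s x x0.
Qed.

Lemma integral_powR (s : R) : 0 < s ->
  (\int[mu]_(x in `]0%R, 1%R[) (x `^ (s - 1))%:E = (s^-1)%:E)%E.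
Proof.
move=> s0; have s0' : s != 0 by rewrite gt_eqF.
rewrite -[s^-1 in RHS]subr0.
apply: (@integral_oo_FTC (fun x => x `^ (s - 1)) (fun x => s^-1 * x `^ s) 0 1 0 s^-1) => //.
- by move=> x _; exact: powR_ge0.
- by move=> x /andP[x0 _]; exact: continuous_powR.
- move=> x /andP[x0 _].
  have := is_deriveM (is_derive_cst s^-1 x 1) (is_derive1_powR s x0).
  by rewrite /GRing.scale /= mulr0 addr0 mulrA mulVf// mul1r.
- apply/cvg_at_rightP => v [v0 cv].
  suff : s^-1 * v n `^ s @[n --> \oo] --> (s^-1 * 0 : R) by rewrite mulr0.
  exact: (cvgM (cvg_cst s^-1) (cvg_powR0 s0 (fun n => ltW (v0 n)) cv)).
- suff : s^-1 * x `^ s @[x --> 1^'-] --> s^-1 * (1 : R) `^ s by rewrite powR1 mulr1.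
  apply: cvg_at_left_filter; apply: cvgM; first exact: cvg_cst.
  by apply: continuous_powR.
Qed.

Lemma integral_onem_powR (s d : R) : 0 < s -> 0 < d ->
  (\int[mu]_(x in `](1 - d)%R, 1%R[) ((1 - x) `^ (s - 1))%:E = (d `^ s / s)%:E)%E.
Proof.
move=> s0 d0; have s0' : s != 0 by rewrite gt_eqF.
have -> : d `^ s / s = 0 - - s^-1 * d `^ s by rewrite sub0r mulNr opprK mulrC.
apply: (@integral_oo_FTC (fun x => (1 - x) `^ (s - 1)) (fun x => - s^-1 * (1 - x) `^ s) (1 - d) 1 (- s^-1 * d `^ s) 0) => //.
- by rewrite gtrBl.
- by move=> x _; exact: powR_ge0.
- move=> x /andP[_ x1]; apply: (@continuous_comp _ _ _ (fun x : R => 1 - x) (fun y => y `^ (s - 1))).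
    by apply: cvgB; [exact: cvg_cst|exact: cvg_id].
  by apply: continuous_powR; rewrite subr_gt0.
- move=> x /andP[_ x1]; have x1' : 0 < 1 - x by rewrite subr_gt0.
  have d1 : is_derive x (1 : R) (fun x : R => 1 - x) (- 1).
    by have := is_deriveB (is_derive_cst (1 : R) x 1) (is_derive_id x (1 : R)); rewrite sub0r.
  have d2 := @is_derive1_comp _ (fun y => y `^ s) (fun x : R => 1 - x) x _ _ (is_derive1_powR s x1') d1.
  have := is_deriveM (is_derive_cst (- s^-1) x 1) d2.
  rewrite [X in is_derive _ _ _ X -> _](_ : _ = (1 - x) `^ (s - 1)); first exact.
  rewrite /GRing.scale /=; move: (_ `^ (s - 1)) (_ `^ s) => p q; field.
  exact: s0'.
- have c : {for 1 - d, continuous (fun x : R => (1 - x) `^ s)}; last first.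
    apply: cvg_at_right_filter; apply: cvgM; first exact: cvg_cst.
    by move: c; rewrite /prop_for /continuous_at subKr.
  apply: (@continuous_comp _ _ _ (fun x : R => 1 - x) (fun y => y `^ s)).
    by apply: cvgB; [exact: cvg_cst|exact: cvg_id].
  by apply: continuous_powR; rewrite subKr.
- apply/cvg_at_leftP => v [v1 cv].
  suff : - s^-1 * (1 - v n) `^ s @[n --> \oo] --> (- s^-1 * 0 : R) by rewrite mulr0.
  apply: cvgM; first exact: cvg_cst.
  apply: cvg_powR0 => //; first by move=> n; rewrite subr_ge0 ltW.
  suff : 1 - v n @[n --> \oo] --> (1 - 1 : R) by rewrite subrr.
  exact: (cvgB (cvg_cst (1 : R)) cv).
Qed.

End ImproperIntegral.

Section LaplaceTail.
Context {R : realType}.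
Notation mu := (@lebesgue_measure R).

Let halfline : set (measurableTypeR R) := `]0, +oo[%classic.

Let mhalf : measurable halfline. Proof. exact: measurable_itv. Qed.

Lemma integral_exp (y : R) : 0 < y ->
  (\int[mu]_(x in `]0%R, y]) (expR (- x))%:E = (1 - expR (- y))%:E)%E.
Proof.
move=> y0.
have := exponential_prob_itv0c 1 y0; rewrite mulN1r -EFinB => <-.
rewrite /exponential_prob integral_itv_obnd_cbnd.
  apply: eq_integral => x; rewrite inE /= in_itv /= => /andP[x0 _].
  by rewrite exponential_pdfE// mul1r mulN1r.
apply/measurable_EFinP; apply: measurable_funTS.
by apply: measurableT_comp => //; exact: measurable_funN.
Qed.

Let expN_meas : measurable_fun setT (fun x : R => expR (- x)).
Proof. by apply: measurableT_comp => //; exact: measurable_funN. Qed.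

Let powexp_meas (s : R) : measurable_fun halfline (fun x => (x `^ (s - 1) * expR (- x))%:E).
Proof.
apply/measurable_EFinP; apply: measurable_funTS; apply: measurable_funM => //.
Qed.

Lemma integrable_Gamma (s : R) : 0 < s <= 1 ->
  mu.-integrable halfline (fun x => (x `^ (s - 1) * expR (- x))%:E).
Proof.
move=> /andP[s0 s1]; apply/integrableP; split; first exact: powexp_meas.
have -> : (\int[mu]_(x in halfline) `|(x `^ (s - 1) * expR (- x))%:E| =
    \int[mu]_(x in halfline) (x `^ (s - 1) * expR (- x))%:E)%E.
  by apply: eq_integral => x _; rewrite gee0_abs// lee_fin mulr_ge0 ?powR_ge0 ?expR_ge0.
have -> : halfline = (`]0, 1[ `|` `[1, +oo[)%classic.
  apply/seteqP; split => x; rewrite /halfline /= !in_itv /= !andbT.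
    by move=> x0; case: (ltP x 1) => h; [left; rewrite x0|right].
  by move=> [/andP[]//|]; apply: lt_le_trans.
rewrite ge0_integral_setU//=; last 3 first.
- apply: measurable_funS (powexp_meas s) => //.
  move=> x; rewrite /halfline /= !in_itv /= !andbT => -[/andP[]//|]; exact: lt_le_trans.
- by move=> x _; rewrite lee_fin mulr_ge0 ?powR_ge0 ?expR_ge0.
- apply/disj_setPS => x []; rewrite /= !in_itv /= => /andP[_ h1] /andP[h2 _].
  by have := lt_le_trans h1 h2; rewrite ltxx.
apply: lte_add_pinfty.
  apply: (@le_lt_trans _ _ (\int[mu]_(x in `]0%R, 1%R[) (x `^ (s - 1))%:E)%E); last by rewrite integral_powR// ltry.
  apply: ge0_le_integral => //.
  - by move=> x _; rewrite lee_fin mulr_ge0 ?powR_ge0 ?expR_ge0.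
  - apply: measurable_funS (powexp_meas s) => // x; rewrite /halfline /= !in_itv /= => /andP[->]//.
  - by apply/measurable_EFinP; apply: measurable_funTS; exact: measurable_powR.
  - move=> x; rewrite /= in_itv /= => /andP[x0 _].
    by rewrite lee_fin ler_piMr ?powR_ge0// -[leRHS]expR0 ler_expR oppr_le0 ltW.
apply: (@le_lt_trans _ _ (\int[mu]_(x in setT) (exponential_pdf 1 x)%:E)%E); last first.
  by rewrite integral_exponential_pdf ?ltr01// ltry.
apply: (@le_trans _ _ (\int[mu]_(x in `[1%R, +oo[) (exponential_pdf 1 x)%:E)%E); last first.
  apply: ge0_subset_integral => //.
    by apply/measurable_EFinP; exact: measurable_exponential_pdf.
  by move=> x _; rewrite lee_fin exponential_pdf_ge0.
apply: ge0_le_integral => //.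
- by move=> x _; rewrite lee_fin mulr_ge0 ?powR_ge0 ?expR_ge0.
- apply: measurable_funS (powexp_meas s) => // x; rewrite /halfline /= !in_itv /= !andbT.
  exact: lt_le_trans.
- by apply/measurable_EFinP; apply: measurable_funTS; exact: measurable_exponential_pdf.
- move=> x; rewrite /= in_itv /= andbT => x1; have x0 : 0 < x by apply: lt_le_trans x1.
  rewrite lee_fin exponential_pdfE ?(ltW x0)// mul1r mulN1r ler_piMl ?expR_ge0//.
  rewrite -(opprK (s - 1)) opprB powRN invf_le1 ?powR_gt0//.
  rewrite -[leLHS](powRr0 x) ler_powR// subr_ge0//.
Qed.

Context {d : measure_display} {T : measurableType d} (P : probability T R).
Variable V : T -> R.
Hypothesis mV : measurable_fun setT V.
Hypothesis V_gt0 : forall w, 0 < V w.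

Let tail (v : R) : R := fine (P [set w | v <= V w]).

Let mset v : measurable [set w | v <= V w].
Proof.
have -> : [set w | v <= V w] = V @^-1` `[v, +oo[%classic.
  by apply/seteqP; split => w; rewrite /= in_itv /= andbT.
by rewrite -[X in measurable X]setTI; exact: mV.
Qed.

Let tail_fin v : P [set w | v <= V w] = (tail v)%:E.
Proof. by rewrite /tail fineK// fin_num_measure//; exact: mset. Qed.

Let tail01 v : 0 <= tail v <= 1.
Proof.
rewrite -!lee_fin -tail_fin measure_ge0/=; exact: probability_le1.
Qed.

(** Exchange the integrals over [x] and over the sample space in the integral of
    [expR (- x)] over [0 < x <= tau * V]. *)
Lemma laplace_tail (tau : R) : 0 < tau ->
  measurable_fun halfline (fun x => (expR (- x) * tail (x / tau))%:E) /\
  (\int[mu]_(x in halfline) (expR (- x) * tail (x / tau))%:E =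
   (1 - Ex P (fun w => expR (- (tau * V w))))%:E)%E.
Proof.
move=> tau0.
pose A : set (measurableTypeR R * T) := [set z | 0 < z.1 <= tau * V z.2].
have mA : measurable A.
  have -> : A = (fun z => z.1) @^-1` `]0, +oo[%classic `&` (fun z => tau * V z.2 - z.1) @^-1` `[0, +oo[%classic.
    apply/seteqP; split => z; rewrite /A /= !in_itv /= !andbT subr_ge0; first by move=> /andP[].
    by move=> [-> ->].
  have m1 : measurable_fun setT (fun z : measurableTypeR R * T => z.1) by exact: measurable_fst.
  have m2 : measurable_fun setT (fun z : measurableTypeR R * T => tau * V z.2 - z.1).
    apply: measurable_funB => //; apply: measurable_funM; first exact: measurable_cst.
    by apply: (measurableT_comp mV); exact: measurable_snd.
  apply: measurableI; rewrite -[X in measurable X]setTI.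
    by apply: m1 => //; exact: measurable_itv.
  by apply: m2 => //; exact: measurable_itv.
pose phi (z : measurableTypeR R * T) : \bar R := (expR (- z.1) * \1_A z)%:E.
have mphi : measurable_fun setT phi.
  apply/measurable_EFinP; apply: measurable_funM; last exact: (bmeas_indic mA (R := R)).1.
  by apply: (measurableT_comp expN_meas); exact: measurable_fst.
have phi0 z : (0 <= phi z)%E by rewrite lee_fin mulr_ge0 ?expR_ge0// indicE.
have section1 (x : R) : 0 < x -> (\int[P]_w phi (x, w) = (expR (- x) * tail (x / tau))%:E)%E.
  move=> x0.
  have -> : (fun w => phi (x, w)) = (fun w => (expR (- x) * \1_[set w | x / tau <= V w] w)%:E).
    apply/funext => w; rewrite /phi !indicE; congr (_ * (nat_of_bool _)%:R)%:E.
    by apply/idP/idP; rewrite !inE /A /= x0 /= ler_pdivrMr// mulrC.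
  rewrite EFin_Ex; last by apply: bmeasM; [exact: bmeas_cst|apply: bmeas_indic; exact: mset].
  by rewrite ExZ; [rewrite Ex_indic//; exact: mset|apply: bmeas_indic; exact: mset].
have section1' (x : R) : x <= 0 -> (\int[P]_w phi (x, w) = 0)%E.
  move=> x0; apply: integral0_eq => w _; rewrite /phi indicE memNset ?mulr0//.
  by rewrite /A /= ltNge x0.
have section2 w : (\int[mu]_x phi (x, w) = (1 - expR (- (tau * V w)))%:E)%E.
  rewrite -integral_exp ?mulr_gt0// [RHS]integral_mkcond; apply: eq_integral => x _.
  rewrite /phi patchE indicE /A.
  have -> : ((x, w) \in [set z : measurableTypeR R * T | 0 < z.1 <= tau * V z.2]) = (x \in `]0, (tau * V w)]%classic).
    by apply/idP/idP; rewrite !inE.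
  by case: ifP => _; rewrite ?mulr1 ?mulr0.
have mg : measurable_fun setT (fun x => \int[P]_w phi (x, w))%E.
  exact: measurable_fun_fubini_tonelli_F.
split.
  apply: (eq_measurable_fun (fun x => \int[P]_w phi (x, w))%E); last exact: measurable_funTS.
  by move=> x; rewrite inE /halfline /= in_itv /= andbT => /section1.
have bV : bmeas (fun w => 1 - expR (- (tau * V w))).
  apply: bmeasB; first exact: bmeas_cst.
  apply: (bmeas_le (M := 1)).
    apply: (measurableT_comp expN_meas); apply: measurable_funM => //; exact: measurable_cst.
  move=> w; rewrite ger0_norm ?expR_ge0// -[leRHS]expR0 ler_expR oppr_le0 mulr_ge0// ltW//.
have bV' : bmeas (fun w => expR (- (tau * V w))).
  have -> : (fun w => expR (- (tau * V w))) = (fun w => 1 - (1 - expR (- (tau * V w)))).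
    by apply/funext => w; rewrite subKr.
  by apply: bmeasB => //; exact: bmeas_cst.
transitivity (\int[mu]_x \int[P]_w phi (x, w))%E.
  rewrite integral_mkcond; apply: eq_integral => x _; rewrite patchE.
  case: ifPn; first by rewrite inE /halfline /= in_itv /= andbT => /section1 ->.
  rewrite notin_setE /halfline /= in_itv /= andbT => /negP; rewrite -leNgt => x0.
  by rewrite section1'.
have := @fubini_tonelli _ _ (measurableTypeR R) T R lebesgue_measure P phi mphi phi0.
rewrite /fubini_F /fubini_G => ->.
under eq_integral => w _ do rewrite section2.
by rewrite EFin_Ex// ExB ?Ex_cst//; exact: bmeas_cst.
Qed.

(** By [laplace_tail] the left-hand side is the integral of
    [x `^ (- a) * expR (- x)] weighted by [(x / tau) `^ a * tail (x / tau)],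
    which is bounded and converges to [c]. *)
Theorem laplace_tauberian (a c : R) (tau : nat -> R) : 0 < a < 1 ->
  v `^ a * tail v @[v --> +oo] --> c ->
  (forall n, 0 < tau n) -> tau n @[n --> \oo] --> 0 ->
  tau n `^ (- a) * (1 - Ex P (fun w => expR (- (tau n * V w)))) @[n --> \oo] -->
  c * Gamma (1 - a).
Proof.
move=> /andP[a0 a1] tc tau0 ctau.
have [M hM] : exists M : R, forall v, 0 < v -> v `^ a * tail v <= M.
  have : \forall v \near +oo, v `^ a * tail v < c + 1.
    by apply: (cvgr_lt _ tc); rewrite ltrDl.
  move=> [v0 [_ hv0]]; exists (Num.max (`|v0| `^ a) (c + 1)) => v vgt.
  have /andP[t0 t1] := tail01 v.
  rewrite le_max; case: (leP v `|v0|) => h; last first.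
    by rewrite (ltW (hv0 v _)) ?orbT//; apply: le_lt_trans h; exact: ler_norm.
  apply/orP; left; apply: (@le_trans _ _ (v `^ a)); first by rewrite ler_piMr ?powR_ge0.
  by apply: ge0_ler_powR; rewrite ?nnegrE// ltW.
have s01 : 0 < 1 - a <= 1 by rewrite subr_gt0 a1 gerBl ltW.
have iG := integrable_Gamma s01.
have eG : 1 - a - 1 = - a by ring.
pose f n x := (tau n `^ (- a) * (expR (- x) * tail (x / tau n)))%:E.
pose g x := (c * (x `^ (1 - a - 1) * expR (- x)))%:E.
have fE n x : 0 < x -> tau n `^ (- a) * (expR (- x) * tail (x / tau n)) =
    (x / tau n) `^ a * tail (x / tau n) * (x `^ (1 - a - 1) * expR (- x)).
  move=> x0; rewrite eG.
  have -> : (x / tau n) `^ a = x `^ a * tau n `^ (- a).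
    rewrite powRM ?invr_ge0 ?ltW//; congr (_ * _).
    by rewrite -powR_inv1 ?ltW// -powRrM mulN1r.
  have xx : x `^ a * x `^ (- a) = 1 by rewrite -powRD ?subrr ?powRr0// (gt_eqF x0) implybT.
  have -> : x `^ a * tau n `^ (- a) * tail (x / tau n) * (x `^ (- a) * expR (- x)) =
    (x `^ a * x `^ (- a)) * (tau n `^ (- a) * (expR (- x) * tail (x / tau n))) by ring.
  by rewrite xx mul1r.
have m1 n := (laplace_tail (tau0 n)).1.
have mf n : measurable_fun halfline (f n).
  apply/measurable_EFinP; apply: measurable_funM; first exact: measurable_cst.
  by apply/measurable_EFinP; exact: m1.
have mg : measurable_fun halfline g.
  apply/measurable_EFinP; apply: measurable_funM; first exact: measurable_cst.
  by apply/measurable_EFinP; exact: powexp_meas.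
have intf n : (\int[mu]_(x in halfline) f n x =
    (tau n `^ (- a) * (1 - Ex P (fun w => expR (- (tau n * V w)))))%:E)%E.
  rewrite /f; under eq_integral do rewrite EFinM.
  rewrite ge0_integralZl_EFin ?powR_ge0//; last first.
    by move=> x _; rewrite lee_fin mulr_ge0 ?expR_ge0//; case/andP: (tail01 (x / tau n)).
  by rewrite (laplace_tail (tau0 n)).2 -EFinM.
have lim x : 0 < x -> (f n x @[n --> \oo] --> g x)%E.
  move=> x0; apply: cvg_EFin; first by near=> n.
  have -> : fine \o (fun n => f n x) = (fun n => (x / tau n) `^ a * tail (x / tau n) * (x `^ (1 - a - 1) * expR (- x))).
    by apply/funext => n; rewrite /= fE.
  apply: cvgM; last exact: cvg_cst.
  apply: (@cvg_comp _ _ _ (fun n => x / tau n) (fun v => v `^ a * tail v) _ _ _ _ tc).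
  apply/cvgryPge => A; near=> n.
  have tn : tau n <= x / (`|A| + 1).
    near: n; have p : 0 < x / (`|A| + 1) by rewrite divr_gt0// ltr_wpDl.
    by apply: filterS (cvgr_lt _ ctau _ p) => n /ltW.
  apply: (@le_trans _ _ (`|A| + 1)); first by rewrite (le_trans (ler_norm A))// lerDl.
  by rewrite ler_pdivlMr// mulrC -ler_pdivlMr// ltr_wpDl.
have := @dominated_convergence _ (measurableTypeR R) R lebesgue_measure halfline mhalf f g
  (fun x => (M * (x `^ (1 - a - 1) * expR (- x)))%:E) mf mg.
have h1 : {ae lebesgue_measure, forall x : measurableTypeR R, halfline x -> (f n x @[n --> \oo] --> g x)%E}.
  by apply: aeW => x; rewrite /halfline /= in_itv /= andbT; exact: lim.
have h2 : mu.-integrable halfline (fun x => (M * (x `^ (1 - a - 1) * expR (- x)))%:E).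
  by under eq_fun do rewrite EFinM; exact: integrableZl.
have h3 : {ae lebesgue_measure, forall (x : measurableTypeR R) n, halfline x -> (`|f n x| <= (M * (x `^ (1 - a - 1) * expR (- x)))%:E)%E}.
  apply: aeW => x n; rewrite /halfline /= in_itv /= andbT => x0.
  rewrite lee_fin /= fE// ger0_norm; last first.
    by rewrite !mulr_ge0 ?powR_ge0 ?expR_ge0//; case/andP: (tail01 (x / tau n)).
  rewrite ler_wpM2r ?mulr_ge0 ?powR_ge0 ?expR_ge0//.
  by apply: hM; rewrite divr_gt0.
move=> /(_ h1 h2 h3) [_ _ C].
have {C} : ((tau n `^ (- a) * (1 - Ex P (fun w => expR (- (tau n * V w)))))%:E @[n --> \oo] --> (c * Gamma (1 - a))%:E)%E.
  have <- : (\int[mu]_(x in halfline) g x = (c * Gamma (1 - a))%:E)%E.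
    rewrite /g; under eq_integral do rewrite EFinM.
    rewrite integralZl//; rewrite EFinM; congr (_ * _)%E.
    rewrite /Gamma /Rintegral fineK//; exact: integrable_fin_num.
  by move: C; under eq_fun do rewrite intf.
exact: fine_cvg.
Unshelve. all: by end_near.
Qed.

End LaplaceTail.

(** * The tail of the long-run variance *)

(** Squeeze between [exp (- n x / (1 - x))] and [exp (- n x)]. *)
Lemma cvg_one_sub_pow {R : realType} (x : nat -> R) (l : R) :
  (forall n, 0 <= x n) -> n%:R * x n @[n --> \oo] --> l ->
  (1 - x n) ^+ n @[n --> \oo] --> expR (- l).
Proof.
move=> x0 cx.
have cinv : (n%:R^-1 : R) @[n --> \oo] --> 0 by rewrite -cvg_shiftS; exact: cvg_harmonic.
have c0 : x n @[n --> \oo] --> 0.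
  suff : n%:R^-1 * (n%:R * x n) @[n --> \oo] --> (0 * l : R).
    rewrite mul0r; apply: cvg_trans; apply: near_eq_cvg; exists 1%N => // n /= n1.
    by rewrite mulrA mulVf ?mul1r// pnatr_eq0 -lt0n.
  exact: (cvgM cinv cx).
have cexp (y : nat -> R) (m : R) : y n @[n --> \oo] --> m -> expR (y n) @[n --> \oo] --> expR m.
  by move=> cy; exact: (cvg_comp _ _ cy (@continuous_expR R m)).
have half : \forall n \near \oo, x n < 2^-1 by apply: (cvgr_lt _ c0); rewrite invr_gt0.
apply: (@squeeze_cvgr _ _ _ _ (fun n => expR (- (n%:R * x n / (1 - x n)))) (fun n => expR (- (n%:R * x n)))).
- apply: filterS half => n xn.
  have x1 : 0 < 1 - x n by lra.
  apply/andP; split.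
    have -> : - (n%:R * x n / (1 - x n)) = n%:R * - (x n / (1 - x n)) by ring.
    rewrite expRM_natl; apply: lerXn2r; rewrite ?nnegrE ?expR_ge0 ?(ltW x1)//.
    rewrite expRN invf_ple ?posrE ?expR_gt0//.
    rewrite [leLHS](_ : _ = 1 + x n / (1 - x n)); last first.
      by move: x1; move: (x n) => y y1; field; rewrite gt_eqF.
    exact: expR_ge1Dx.
  have -> : - (n%:R * x n) = n%:R * - x n by ring.
  rewrite expRM_natl; apply: lerXn2r; rewrite ?nnegrE ?expR_ge0 ?(ltW x1)//.
  exact: expR_ge1Dx.
- apply: cexp.
  suff : - (n%:R * x n / (1 - x n)) @[n --> \oo] --> - (l / (1 - 0)) by rewrite subr0 divr1.
  apply: cvgN; apply: cvgM => //; apply: cvgV; first by rewrite subr0 oner_neq0.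
  exact: (cvgB (cvg_cst (1 : R)) c0).
- by apply: cexp; exact: cvgN.
Qed.

Section LongRunVariance.
Context {R : realType} (lambda beta psi1 : R) (psi : R -> R).
Context {d : measure_display} {T : measurableType d} (P : probability T R).
Variable alpha : {RV P >-> R}.
Hypothesis lambda_gt0 : 0 < lambda.
Hypothesis alpha01 : forall w, 0 < alpha w < 1.
Hypothesis psi_meas : measurable_fun (`]0, 1[%classic : set R) psi.
Hypothesis psi_ge0 : forall x, 0 < x < 1 -> 0 <= psi x.
Hypothesis alpha_density : forall A : set R, measurable A ->
  P (alpha @^-1` A) =
  (\int[lebesgue_measure]_(x in A `&` `]0%R, 1%R[) (psi x * (1 - x) `^ beta)%:E)%E.
Hypothesis psi_lim : psi x @[x --> 1^'-] --> psi1.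
Hypothesis psi1_gt0 : 0 < psi1.
Hypothesis beta_itv : -1 < beta < 1.
Notation mu := (@lebesgue_measure R).

Let b1 : 0 < 1 + beta. Proof. by case/andP: beta_itv => h1 _; lra. Qed.

Let F (e : R) := fine (P [set w | 1 - e <= alpha w]).

Let density_meas : measurable_fun (`]0, 1[%classic : set R) (fun x => (psi x * (1 - x) `^ beta)%:E).
Proof.
apply/measurable_EFinP; apply: measurable_funM => //; apply: measurable_funTS.
apply: (measurableT_comp (measurable_powR beta)).
by apply: measurable_funB => //; exact: measurable_cst.
Qed.

Let F_E (e : R) : 0 < e < 1 ->
  (F e)%:E = (\int[mu]_(x in `](1 - e)%R, 1%R[) (psi x * (1 - x) `^ beta)%:E)%E.
Proof.
move=> /andP[e0 e1].
have mA : measurable (`[1 - e, +oo[%classic : set R) by exact: measurable_itv.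
have AE : [set w | 1 - e <= alpha w] = alpha @^-1` `[1 - e, +oo[%classic.
  by apply/seteqP; split => w; rewrite /= in_itv /= andbT.
rewrite /F AE fineK; last first.
  by apply: fin_num_measure; rewrite -[X in measurable X]setTI; exact: (measurable_funPT alpha measurableT _ mA).
rewrite alpha_density//.
have -> : (`[1 - e, +oo[ `&` `]0, 1[ = `[1 - e, 1[ :> set R)%classic.
  apply/seteqP; split => x; rewrite /= !in_itv /= andbT; first by move=> [-> /andP[_ ->]].
  by move=> /andP[h1 h2]; split => //; rewrite h2 andbT; lra.
rewrite integral_itv_obnd_cbnd//; apply: measurable_funS density_meas => //.
by move=> x; rewrite /= !in_itv /= => /andP[h1 ->]; rewrite andbT; lra.
Qed.

(** Close to 1 the law of [alpha] looks like that of a density [psi1 (1 - x) ^ beta]. *)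
Lemma density_tail : e `^ (- (1 + beta)) * F e @[e --> 0^'+] --> psi1 / (1 + beta).
Proof.
apply/cvgrPdist_le => eps eps0.
pose r := eps * (1 + beta).
have r0 : 0 < r by rewrite mulr_gt0.
have : \forall x \near 1^'-, `|psi1 - psi x| <= r by move/cvgrPdist_le : psi_lim; apply.
rewrite near_withinE => -[d0 /= d0_gt0 hd].
near=> e.
have e0 : 0 < e by near: e; exact: nbhs_right_gt.
have e1 : e < 1 by near: e; apply: nbhs_right_lt.
have ed : e < d0 by near: e; apply: nbhs_right_lt.
have e01 : 0 < e < 1 by rewrite e0.
have near1 x : 1 - e < x < 1 -> `|psi1 - psi x| <= r.
  move=> /andP[h1 h2]; apply: hd => //=; rewrite ger0_norm; lra.
have IE (c : R) : 0 <= c -> (\int[mu]_(x in `](1 - e)%R, 1%R[) (c * (1 - x) `^ beta)%:E = (c * (e `^ (1 + beta) / (1 + beta)))%:E)%E.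
  move=> c0; under eq_integral do rewrite EFinM.
  rewrite ge0_integralZl_EFin//.
  - have := integral_onem_powR b1 e0; have -> : 1 + beta - 1 = beta by ring.
    by move=> ->; rewrite EFinM.
  - by move=> x _; rewrite lee_fin powR_ge0.
  - apply/measurable_EFinP; apply: measurable_funTS; apply: (measurableT_comp (measurable_powR beta)).
    by apply: measurable_funB => //; exact: measurable_cst.
have sub x : x \in (`]1 - e, 1[%classic : set R) -> 0 < x < 1.
  by rewrite inE /= in_itv /= => /andP[h1 h2]; rewrite h2 andbT; lra.
have md : measurable_fun (`]1 - e, 1[%classic : set R) (fun x => (psi x * (1 - x) `^ beta)%:E).
  apply: measurable_funS density_meas => // x xI.
  by rewrite /= in_itv; apply: sub; rewrite inE.
have mc (c : R) : measurable_fun (`]1 - e, 1[%classic : set R) (fun x => (c * (1 - x) `^ beta)%:E).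
  apply/measurable_EFinP; apply: measurable_funTS; apply: measurable_funM; first exact: measurable_cst.
  apply: (measurableT_comp (measurable_powR beta)).
  by apply: measurable_funB => //; exact: measurable_cst.
have up : F e <= (psi1 + r) * (e `^ (1 + beta) / (1 + beta)).
  rewrite -lee_fin F_E// -IE; last by rewrite addr_ge0// ltW.
  apply: ge0_le_integral => //.
  - by move=> x xI; rewrite lee_fin mulr_ge0 ?powR_ge0// psi_ge0// sub// inE.
  - exact: mc.
  - move=> x xI; rewrite lee_fin ler_wpM2r ?powR_ge0//.
    have := near1 x; rewrite /= in_itv in xI; move=> /(_ xI); rewrite ler_norml => /andP[]; lra.
have lo : (psi1 - r) * (e `^ (1 + beta) / (1 + beta)) <= F e.
  case: (leP (psi1 - r) 0) => h.
    apply: (@le_trans _ _ 0); first by rewrite mulr_le0_ge0// divr_ge0 ?powR_ge0// ltW.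
    by rewrite /F fine_ge0.
  rewrite -lee_fin F_E// -IE; last exact: ltW.
  apply: ge0_le_integral => //.
  - by move=> x xI; rewrite lee_fin mulr_ge0 ?powR_ge0// ltW.
  - exact: mc.
  - move=> x xI; rewrite lee_fin ler_wpM2r ?powR_ge0//.
    have := near1 x; rewrite /= in_itv in xI; move=> /(_ xI); rewrite ler_norml => /andP[]; lra.
have p0 : 0 < e `^ (1 + beta) by rewrite powR_gt0.
rewrite powRN [_^-1 * F e]mulrC.
have dist : `|psi1 / (1 + beta) * e `^ (1 + beta) - F e| <= eps * e `^ (1 + beta).
  have bn : 1 + beta != 0 by rewrite gt_eqF.
  have e1' : (psi1 + r) * (e `^ (1 + beta) / (1 + beta)) = psi1 / (1 + beta) * e `^ (1 + beta) + eps * e `^ (1 + beta).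
    by rewrite /r; move: (e `^ _) => y; field.
  have e2' : (psi1 - r) * (e `^ (1 + beta) / (1 + beta)) = psi1 / (1 + beta) * e `^ (1 + beta) - eps * e `^ (1 + beta).
    by rewrite /r; move: (e `^ _) => y; field.
  by move: up lo; rewrite e1' e2' ler_norml; move: (F e) (psi1 / _ * _) (eps * _) => *; apply/andP; split; lra.
have -> : psi1 / (1 + beta) - F e / e `^ (1 + beta) = (psi1 / (1 + beta) * e `^ (1 + beta) - F e) / e `^ (1 + beta).
  by rewrite mulrBl mulfK// gt_eqF.
by rewrite normrM [`|_^-1|]ger0_norm ?invr_ge0 ?powR_ge0// ler_pdivrMr.
Unshelve. all: by end_near.
Qed.

(** The long-run variance [lambda (1 + x) / (1 - x) ^+ 2] of the process given [alpha = x]. *)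
Definition long_run_variance (x : R) : R := rate lambda x * (1 + x) * (1 - x) `^ (-1).

Lemma long_run_varianceE x : x < 1 ->
  long_run_variance x = lambda / (1 - x) * ((1 + x) / (1 - x)).
Proof.
move=> x1; rewrite /long_run_variance rateE// powR_inv1 ?subr_ge0 1?ltW//.
by rewrite mulrA.
Qed.

Lemma measurable_long_run_variance : measurable_fun setT long_run_variance.
Proof.
apply: measurable_funM; first apply: measurable_funM.
- exact: measurable_rate.
- by apply: measurable_funD => //; exact: measurable_cst.
- apply: (measurableT_comp (measurable_powR (-1))).
  by apply: measurable_funB => //; exact: measurable_cst.
Qed.

Lemma long_run_variance_gt0 x : 0 < x < 1 -> 0 < long_run_variance x.
Proof.
move=> /andP[x0 x1]; rewrite long_run_varianceE//.
by rewrite mulr_gt0// divr_gt0// ?subr_gt0// addr_gt0.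
Qed.

(** The solution [e] of [long_run_variance (1 - e) = v]. *)
Let inv (v : R) : R := 4 * lambda / (lambda + Num.sqrt (lambda ^+ 2 + 8 * lambda * v)).

Let inv_gt0 v : 0 < inv v.
Proof. by rewrite divr_gt0 ?mulr_gt0// ltr_wpDr ?sqrtr_ge0. Qed.

Let invE v : 0 <= v -> v * inv v ^+ 2 = 2 * lambda - lambda * inv v.
Proof.
move=> v0; rewrite /inv.
have x0 : 0 <= lambda ^+ 2 + 8 * lambda * v by rewrite addr_ge0 ?sqr_ge0 ?mulr_ge0// ltW.
have := sqr_sqrtr x0; have := sqrtr_ge0 (lambda ^+ 2 + 8 * lambda * v).
move: (Num.sqrt _) => s s0 sE.
have l0 : lambda != 0 by rewrite gt_eqF.
have ls : lambda + s != 0 by rewrite gt_eqF// ltr_wpDr.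
have -> : v = (s ^+ 2 - lambda ^+ 2) / (8 * lambda) by rewrite sE; field.
by field; rewrite l0 ls.
Qed.

Let inv_small v (e : R) : 0 < e -> 2 * lambda / e ^+ 2 <= v -> inv v <= e.
Proof.
move=> e0; rewrite ler_pdivrMr ?exprn_gt0// => ve.
have v0 : 0 < v by rewrite -(pmulr_lgt0 _ (exprn_gt0 2 e0)) (lt_le_trans _ ve)// mulr_gt0.
rewrite -(@ler_pXn2r _ 2)// ?nnegrE ?(ltW (inv_gt0 v)) ?(ltW e0)//.
rewrite -(ler_pM2l v0) (le_trans _ ve)// invE ?(ltW v0)// gerBl.
by rewrite mulr_ge0// ltW// inv_gt0.
Qed.

Let level v : 0 <= v -> [set w | v <= long_run_variance (alpha w)] = [set w | 1 - inv v <= alpha w].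
Proof.
move=> v0; apply/funext => w; apply/propext => /=; have /andP[a0 a1] := alpha01 w.
rewrite long_run_varianceE//.
set x := alpha w; set e := inv v.
have y0 : 0 < 1 - x by rewrite subr_gt0.
have yn : 1 - x != 0 by rewrite gt_eqF.
have -> : lambda / (1 - x) * ((1 + x) / (1 - x)) = lambda * (1 + x) / (1 - x) ^+ 2 by field.
rewrite ler_pdivlMr ?exprn_gt0//.
have key : v * (1 - x) ^+ 2 - lambda * (1 + x) = ((1 - x) - e) * (v * (1 - x + e) + lambda).
  have -> : ((1 - x) - e) * (v * (1 - x + e) + lambda) = v * (1 - x) ^+ 2 - v * e ^+ 2 + lambda * (1 - x) - lambda * e by ring.
  by rewrite /e invE//; ring.
have p : 0 < v * (1 - x + e) + lambda.
  by rewrite ltr_wpDl// mulr_ge0// addr_ge0 ?ltW// inv_gt0.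
rewrite -subr_le0 key pmulr_lle0// subr_le0.
by split; lra.
Qed.

Let a := (1 + beta) / 2.

(** As [inv v] solves a quadratic equation, [v * inv v ^+ 2] tends to
    [2 * lambda], and [density_tail] applies at [inv v]. *)
Lemma long_run_variance_tail :
  v `^ a * fine (P [set w | v <= long_run_variance (alpha w)]) @[v --> +oo] -->
  (2 * lambda) `^ a * psi1 / (1 + beta).
Proof.
have cinv : inv v @[v --> +oo] --> 0^'+.
  move=> A /= [e /= e0 hA]; exists (2 * lambda / (e / 2) ^+ 2); split; first by rewrite num_real.
  move=> v hv; apply: hA => /=; last exact: inv_gt0.
  rewrite sub0r normrN gtr0_norm//; have := inv_small (divr_gt0 e0 (ltr0n _ 2)) (ltW hv).
  by move=> h; apply: le_lt_trans h _; lra.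
have c1 : inv v `^ (- (1 + beta)) * F (inv v) @[v --> +oo] --> psi1 / (1 + beta).
  exact: (cvg_comp _ _ cinv density_tail).
have c2 : (2 * lambda - lambda * inv v) `^ a @[v --> +oo] --> (2 * lambda) `^ a.
  have c : 2 * lambda - lambda * inv v @[v --> +oo] --> (2 * lambda - lambda * 0 : R).
    apply: cvgB; first exact: cvg_cst.
    apply: cvgM; first exact: cvg_cst.
    by apply: cvg_trans cinv _; exact: cvg_within.
  rewrite mulr0 subr0 in c.
  have h : {for 2 * lambda, continuous (fun y => y `^ a)} by apply: continuous_powR; rewrite mulr_gt0.
  exact: (cvg_comp _ _ c h).
have C : (2 * lambda - lambda * inv v) `^ a * (inv v `^ (- (1 + beta)) * F (inv v)) @[v --> +oo] -->
    (2 * lambda) `^ a * (psi1 / (1 + beta)) by exact: cvgM.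
rewrite -mulrA; apply: cvg_trans C; apply: near_eq_cvg; near=> v.
have v0 : 0 < v by near: v; exact: nbhs_pinfty_gt.
rewrite /= level ?(ltW v0)// -/(F (inv v)) -invE ?(ltW v0)//.
rewrite powRM ?sqr_ge0 ?(ltW v0)// -(powR_mulrn _ (ltW (inv_gt0 v))) -powRrM.
have -> : 2%:R * a = 1 + beta by rewrite /a; field.
rewrite mulrA -[X in X * F _]mulrA powRN mulfV ?mulr1// gt_eqF// powR_gt0//.
Unshelve. all: by end_near.
Qed.

(** The Tauberian theorem at [tau = N `^ (- a^-1) * q], with
    [a = (1 + beta) / 2]. *)
Lemma long_run_variance_laplace (q : R) : 0 <= q ->
  Ex P (fun w => expR (- (N%:R `^ (- (1 + beta)^-1) ^+ 2 * q * long_run_variance (alpha w)))) ^+ N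
    @[N --> \oo] --> expR (- (k_beta lambda psi1 beta * q `^ a)).
Proof.
move=> q0; have /andP[bl bu] := beta_itv.
have a0 : 0 < a by rewrite divr_gt0.
have a01 : 0 < a < 1 by rewrite a0 ltr_pdivrMr//; lra.
have [q0'|qn] := eqVneq q 0.
  rewrite q0' powR0 ?gt_eqF// mulr0 oppr0 expR0.
  suff -> : (fun N : nat => Ex P (fun w => expR (- (N%:R `^ (- (1 + beta)^-1) ^+ 2 * 0 * long_run_variance (alpha w)))) ^+ N) = fun=> 1.
    exact: cvg_cst.
  apply/funext => N; under eq_fun do rewrite mulr0 mul0r oppr0 expR0.
  by rewrite Ex_cst expr1n.
have qgt : 0 < q by rewrite lt_def qn.
pose V w := long_run_variance (alpha w).
have mV : measurable_fun setT V.
  by apply: measurableT_comp; [exact: measurable_long_run_variance|exact: measurable_funPT].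
have V0 w : 0 < V w by exact: long_run_variance_gt0.
pose tau (N : nat) := N.+1%:R `^ (- (1 + beta)^-1) ^+ 2 * q.
have tau0 N : 0 < tau N by rewrite mulr_gt0// exprn_gt0// powR_gt0.
have bn : 1 + beta != 0 by rewrite gt_eqF.
have sqE (N : nat) : N.+1%:R `^ (- (1 + beta)^-1) ^+ 2 = N.+1%:R^-1 `^ a^-1 :> R.
  have n0 : 0 <= N.+1%:R :> R by [].
  move: n0; move: (N.+1%:R : R) => y y0.
  transitivity (y `^ (- (1 + beta)^-1 * 2%:R)); first by rewrite powRrM powR_mulrn ?powR_ge0.
  transitivity (y `^ (-1 * a^-1)); last by rewrite powRrM powR_inv1.
  by congr (_ `^ _); rewrite /a; field; rewrite bn.
have ctau : tau N @[N --> \oo] --> 0.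
  suff : tau N @[N --> \oo] --> (0 * q : R) by rewrite mul0r.
  apply: cvgM; last exact: cvg_cst.
  under eq_fun do rewrite sqE.
  apply: cvg_powR0; [by rewrite invr_gt0|by move=> n; rewrite invr_ge0|exact: cvg_harmonic].
have := laplace_tauberian mV V0 a01 long_run_variance_tail tau0 ctau.
set k := _ * Gamma _.
have -> : k = k_beta lambda psi1 beta.
  by rewrite /k /k_beta -/a; congr (_ * Gamma _); rewrite /a; field.
move=> C; pose x (N : nat) := 1 - Ex P (fun w => expR (- (N%:R `^ (- (1 + beta)^-1) ^+ 2 * q * V w))).
have x0 N : 0 <= x N.
  rewrite subr_ge0; have p : 0 <= N%:R `^ (- (1 + beta)^-1) ^+ 2 * q by rewrite mulr_ge0// sqr_ge0.
  have e1 w : expR (- (N%:R `^ (- (1 + beta)^-1) ^+ 2 * q * V w)) <= 1.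
    by rewrite -[leRHS]expR0 ler_expR oppr_le0 mulr_ge0// ltW.
  rewrite -[leRHS](Ex_cst P 1); apply: Ex_le => //; last exact: bmeas_cst.
  apply: (bmeas_le (M := 1)); last by move=> w; rewrite ger0_norm ?expR_ge0.
  apply: measurableT_comp => //; apply: measurableT_comp => //.
  by apply: measurable_funM => //; exact: measurable_cst.
have cx : N%:R * x N @[N --> \oo] --> k_beta lambda psi1 beta * q `^ a.
  rewrite -cvg_shiftS.
  have D : tau N `^ (- a) * (1 - Ex P (fun w => expR (- (tau N * V w)))) * q `^ a @[N --> \oo] -->
      k_beta lambda psi1 beta * q `^ a by apply: cvgM C _; exact: cvg_cst.
  apply: cvg_trans D; apply: near_eq_cvg; near=> N.
  rewrite /= mulrAC; congr (_ * _).
  rewrite /tau sqE powRM ?powR_ge0// -powRrM.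
  have -> : a^-1 * - a = -1 by rewrite mulrN mulVf// gt_eqF.
  rewrite powR_inv1 ?invr_ge0// invrK -mulrA -powRD ?qn ?implybT//.
  by rewrite addrC subrr powRr0 mulr1.
apply: cvg_trans (cvg_one_sub_pow x0 cx); apply: near_eq_cvg; near=> N.
by rewrite /x subKr.
Unshelve. all: by end_near.
Qed.

End LongRunVariance.

(** * The iterated limit *)

Lemma Gamma_gt0 {R : realType} (s : R) : 0 < s <= 1 -> 0 < Gamma s.
Proof.
move=> s01; have iG := integrable_Gamma s01; have /andP[s0 s1] := s01.
set G := fun x : R => x `^ (s - 1) * expR (- x).
have G0 x : 0 <= G x by rewrite mulr_ge0 ?powR_ge0 ?expR_ge0.
have GE : (Gamma s)%:E = (\int[lebesgue_measure]_(x in `]0%R, +oo[) (G x)%:E)%E.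
  by rewrite /Gamma /Rintegral fineK//; exact: integrable_fin_num.
have mG : measurable_fun (`]0, +oo[%classic : set R) (EFin \o G).
  exact: (measurable_int _ iG).
have le1 : ((expR (- 1) / s)%:E <= (Gamma s)%:E)%E.
  rewrite GE; apply: (@le_trans _ _ (\int[lebesgue_measure]_(x in `]0%R, 1%R[) (G x)%:E)%E); last first.
    apply: ge0_subset_integral => //; first by move=> x _; rewrite lee_fin.
    by move=> x; rewrite /= !in_itv /= => /andP[-> _].
  have -> : (expR (- 1) / s)%:E = (\int[lebesgue_measure]_(x in `]0%R, 1%R[) (expR (- 1) * x `^ (s - 1))%:E)%E.
    under eq_integral do rewrite EFinM.
    rewrite ge0_integralZl_EFin ?expR_ge0//.
    - by rewrite integral_powR// EFinM.
    - by move=> x _; rewrite lee_fin powR_ge0.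
    - by apply/measurable_EFinP; apply: measurable_funTS; exact: measurable_powR.
  apply: ge0_le_integral => //.
  - by move=> x _; rewrite lee_fin mulr_ge0 ?powR_ge0 ?expR_ge0.
  - apply/measurable_EFinP; apply: measurable_funTS; apply: measurable_funM; first exact: measurable_cst.
    exact: measurable_powR.
  - apply: measurable_funS mG => // x; by rewrite /= !in_itv /= => /andP[-> _].
  - move=> x; rewrite /= in_itv /= => /andP[_ x1].
    by rewrite lee_fin mulrC ler_wpM2l ?powR_ge0// ler_expR lerN2 ltW.
move: le1; rewrite lee_fin; apply: lt_le_trans.
by rewrite divr_gt0// expR_gt0.
Qed.

Lemma k_beta_gt0 {R : realType} (lambda psi1 beta : R) :
  0 < lambda -> 0 < psi1 -> -1 < beta < 1 -> 0 < k_beta lambda psi1 beta.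
Proof.
move=> l0 p0 /andP[b1 b2]; rewrite /k_beta mulr_gt0//; last by apply: Gamma_gt0; apply/andP; split; lra.
by rewrite divr_gt0 ?mulr_gt0 ?powR_gt0 ?mulr_gt0//; lra.
Qed.

Lemma char_funE {R : realType} d (T : measurableType d) (P : probability T R) (Y : T -> R) theta :
  char_fun P Y theta = cE P (fun w => cis (theta * Y w)).
Proof. by rewrite /char_fun /cE /Ex /Rintegral unlock. Qed.

(** It suffices to test the finite-dimensional laws on characteristic functions. *)
Lemma fdd_cvg_cf {R : realType} (Z : nat -> process R) (L : process R) :
  (forall n, is_process (Z n)) -> is_process L ->
  (forall m (u t : 'I_m -> R), (forall i, 0 <= t i) ->
    ccvg (fun n => cE (proc_prob (Z n)) (fun w => cis (\sum_i u i * proc_val (Z n) (t i) w)))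
      (cE (proc_prob L) (fun w => cis (\sum_i u i * proc_val L (t i) w)))) ->
  fdd_cvg Z L.
Proof.
move=> mZ mL cf; split => // m t f t0 cont [M fM].
have E (W : process R) : is_process W -> fdd_expectation W t f =
    (Ex (proc_prob W) (fun w => f (\row_i proc_val W (t i) w)))%:E.
  move=> mW; rewrite /fdd_expectation unlock EFin_Ex//.
  by apply: (bmeas_continuous (proc_prob W) _ cont fM) => i; exact: mW.
rewrite E//; under eq_fun do rewrite E//.
apply: cvg_EFin; first by near=> n.
apply: (levy_continuity (P_ := fun n => proc_prob (Z n)) (Z_ := fun n i => proc_val (Z n) (t i))
  (P := proc_prob L) (Z := fun i => proc_val L (t i)) _ _ _ cont fM).
- by move=> n i; exact: mZ.
- by move=> i; exact: mL.
- by move=> u; exact: cf.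
Unshelve. all: by end_near.
Qed.

Section ContractionBound.
Context {R : realType}.

Lemma Re_thinned_le0 (a : R) zs : 0 <= a <= 1 -> (forall z, z \in zs -> normc z <= 1) ->
  Re (thinned a zs) <= 0.
Proof.
case: zs => [|z zs] a01 h //=.
have zs1 y : y \in zs -> normc y <= 1 by move=> ys; apply: h; rewrite inE ys orbT.
have : normc (z * (1 + a%:C%C * thinned a zs)) <= 1.
  by rewrite normcM mulr_ile1 ?normc_ge0//; [apply: h; rewrite mem_head|exact: normc_thinned].
move=> h1; have := le_trans (ler_norm _) (le_trans (normc_Re _) h1).
rewrite ReD => h2.
have -> : Re (- 1 : R[i]) = -1 by [].
lra.
Qed.

(** The exponential of the cumulant is a conditional mean of numbers of norm at
    most 1. This bound is what dominated convergence needs. *)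
Lemma Re_cumulant_le0 (a : R) zs : 0 <= a <= 1 -> (forall z, z \in zs -> normc z <= 1) ->
  Re (cumulant a zs) <= 0.
Proof.
move=> a01 h; rewrite cumulantE ReD !ReM /= !mul0r !subr0.
have /andP[a0 a1] := a01.
have hU := Re_thinned_le0 a01 h.
have hV : Re (immigration a zs) <= 0.
  elim: zs h {hU} => [|z zs IH] h //.
  have zs1 y : y \in zs -> normc y <= 1 by move=> ys; apply: h; rewrite inE ys orbT.
  rewrite [immigration _ _]/= ReD; have := Re_thinned_le0 a01 h; have := IH zs1.
  by move=> h1 h2; rewrite -[leRHS]addr0; exact: lerD.
rewrite -[leRHS]addr0; apply: lerD; last exact: mulr_ge0_le0.
by apply: mulr_ge0_le0 => //; rewrite subr_ge0.
Qed.

End ContractionBound.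

Section CenteredPath.
Context {R : realType} (lambda : R).
Context {d0 : measure_display} {T0 : measurableType d0} (P0 : probability T0 R).
Variables (alpha0 : {RV P0 >-> R}) (X00 : {RV P0 >-> nat}).
Variables (xi : nat -> nat -> {RV P0 >-> nat}) (eps : nat -> {RV P0 >-> nat}).
Hypothesis lambda_gt0 : 0 < lambda.
Hypothesis model : randomized_inar_noise lambda alpha0 X00 xi eps.

Let Z := inar X00 xi eps.
Let alpha01 w : 0 < alpha0 w < 1. Proof. by case: model. Qed.
Let alpha01' w : 0 <= alpha0 w <= 1. Proof. by have /andP[h1 h2] := alpha01 w; rewrite !ltW. Qed.
Let malpha : measurable_fun setT alpha0. Proof. exact: measurable_funPT. Qed.

Variables (c : nat -> R) (K : nat).

(** Defined on the path space, not on the sample space, so that the same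
    functional applies to the process and to its copies. *)
Definition centered_sum (x : path_space (option nat)) : R :=
  \sum_(k < K) c k * (x (Some k.+1) - rate lambda (x None)).

Lemma measurable_centered_sum : measurable_fun setT centered_sum.
Proof.
apply: measurable_sum => k; apply: measurable_funM; first exact: measurable_cst.
apply: measurable_funB; first exact: measurable_coord.
exact: (measurableT_comp (measurable_rate lambda) (measurable_coord None)).
Qed.

Let zs := map cis (mkseq c K).

Let zs1 z : z \in zs -> normc z <= 1.
Proof. by move=> /mapP [x _ ->]; rewrite normc_cis. Qed.

Definition path_exponent (w : T0) : R[i] :=
  (rate lambda (alpha0 w))%:C%C *
  (cumulant (alpha0 w) zs - 'i%C * (\sum_(k < K) c k)%:C%C).

(** The centering contributes the factor [cis (- rate * \sum c)], which depends on
    [alpha] alone. *)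
Lemma centered_sum_cf : cE P0 (fun w => cis (centered_sum (joint alpha0 Z ^~ w))) =
  cE P0 (fun w => cexp (path_exponent w)).
Proof.
pose r w := rate lambda (alpha0 w).
pose g w : R[i] := cis (- (r w * \sum_(k < K) c k)).
have bg : cbm (g : rv_space alpha0 -> R[i]).
  apply: cbm_cis; apply: measurable_funN; apply: measurable_funM; last exact: measurable_cst.
  exact: (sigma_rv_comp (Y := alpha0) (measurable_rate lambda)).
have := inar_path lambda_gt0 model zs1 bg.
have E1 w : g w * \prod_(j < size zs) nth 0 zs j ^+ Z j.+1 w =
    cis (centered_sum (joint alpha0 Z ^~ w)).
  rewrite /zs size_map size_mkseq.
  have -> : \prod_(j < K) nth 0 (map cis (mkseq c K)) j ^+ Z j.+1 w =
      cis (\sum_(j < K) c j * (Z j.+1 w)%:R).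
    rewrite cis_sum; apply: eq_bigr => j _.
    by rewrite (nth_map 0) ?size_mkseq// nth_mkseq// cisX.
  rewrite -cisD; congr cis; rewrite /centered_sum /= mulr_sumr -sumrN -big_split /=.
  by apply: eq_bigr => k _; rewrite /r; ring.
have E2 w : g w * cexp ((lambda / (1 - alpha0 w))%:C%C * cumulant (alpha0 w) zs) =
    cexp (path_exponent w).
  have /andP[_ a1] := alpha01 w.
  rewrite -rateE// /g cis_cexp -cexpD /path_exponent -/(r w); congr cexp.
  by rewrite rmorphN rmorphM; ring.
by under eq_fun do rewrite E1; under [in RHS]eq_fun do rewrite E2.
Qed.

Lemma Re_path_exponent w : Re (path_exponent w) <= 0.
Proof.
have h := Re_cumulant_le0 (alpha01' w) zs1.
have hr := rate_ge0 lambda_gt0 (alpha0 w).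
rewrite /path_exponent ReM ReD ReN ReM /= !mul0r !mulr0 subrr !subr0.
exact: mulr_ge0_le0.
Qed.

Lemma cbm_path_exponent : cbm (fun w => cexp (path_exponent w)).
Proof.
have bS : cbm (fun w => cumulant (alpha0 w) zs - 'i%C * (\sum_(k < K) c k)%:C%C).
  apply: (cbm_rv_space malpha); apply: cbmD; last exact: cbm_cst.
  have ba : cbm ((fun w => (alpha0 w)%:C%C) : rv_space alpha0 -> R[i]).
    apply: cbm_real; apply: (bmeas_le (M := 1)).
      by apply/sigma_rv_fun => A mA; exists A => //; rewrite setTI.
    by move=> w; have /andP[a0 a1] := alpha01' w; rewrite ger0_norm.
  have -> : (fun w => cumulant (alpha0 w) zs) = (fun w => (1 - (alpha0 w)%:C%C) * immigration (alpha0 w) zs + (alpha0 w)%:C%C * thinned (alpha0 w) zs).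
    by apply/funext => w; rewrite cumulantE rmorphB rmorph1.
  apply: cbmD; apply: cbmM => //.
  - by apply: cbmD; [exact: cbm_cst|exact: cbmN].
  - exact: (cbm_immigration model).
  - exact: (cbm_thinned model).
have mr : measurable_fun setT (fun w => rate lambda (alpha0 w)).
  exact: (measurableT_comp (measurable_rate lambda) malpha).
have [[mR _] [mI _]] := bS.
have mRe : measurable_fun setT (fun w => Re (path_exponent w)).
  under eq_fun do rewrite /path_exponent ReM /= mul0r subr0.
  exact: measurable_funM.
have mIm : measurable_fun setT (fun w => Im (path_exponent w)).
  under eq_fun do rewrite /path_exponent ImM /= mul0r addr0.
  exact: measurable_funM.
apply: (cbm_le (M := 1)).
- apply: measurable_funM; first exact: measurableT_comp mRe.
  by apply: measurableT_comp mIm; exact: measurable_cos.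
- apply: measurable_funM; first exact: measurableT_comp mRe.
  by apply: measurableT_comp mIm; exact: measurable_sin.
- by move=> w; rewrite normc_cexp -[leRHS]expR0 ler_expR; exact: Re_path_exponent.
Qed.

End CenteredPath.

Section SampledCharacteristicFunction.
Context {R : realType} (lambda : R).
Context {d0 : measure_display} {T0 : measurableType d0} (P0 : probability T0 R).
Variables (alpha0 : {RV P0 >-> R}) (X00 : {RV P0 >-> nat}).
Variables (xi : nat -> nat -> {RV P0 >-> nat}) (eps : nat -> {RV P0 >-> nat}).
Hypothesis lambda_gt0 : 0 < lambda.
Hypothesis model : randomized_inar_noise lambda alpha0 X00 xi eps.

(** Dominated convergence, with the limit [cvg_cumulant] of the exponent for each
    value of [alpha]. *)
Lemma sampled_cf (m : nat) (u t : 'I_m -> R) (kappa : R) : (forall l, 0 <= t l) ->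
  0 <= fdd_variance u t ->
  ccvg (fun n => cE P0 (fun w => cis (centered_sum lambda (weight u t kappa n) (horizon t n)
      (joint alpha0 (inar X00 xi eps) ^~ w))))
    (Ex P0 (fun w => expR (- (kappa ^+ 2 * (fdd_variance u t / 2) *
      long_run_variance lambda (alpha0 w)))))%:C%C.
Proof.
move=> t0 q0.
have a01 w : 0 < alpha0 w < 1 by case: model.
have -> : (fun n => cE P0 (fun w => cis (centered_sum lambda (weight u t kappa n) (horizon t n)
      (joint alpha0 (inar X00 xi eps) ^~ w)))) =
  (fun n => cE P0 (fun w => cexp (path_exponent lambda alpha0 (weight u t kappa n) (horizon t n) w))).
  by apply/funext => n; exact: (centered_sum_cf lambda_gt0 model).
rewrite -cE_real; apply: (@cE_dct _ _ _ P0 _ _ 1).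
- by move=> n; exact: (cbm_path_exponent lambda_gt0 model).
- move=> n w; rewrite normc_cexp -[leRHS]expR0 ler_expR.
  exact: (Re_path_exponent lambda_gt0 model).
- apply: cbm_real; apply: (bmeas_le (M := 1)).
    apply: measurableT_comp => //; apply: measurableT_comp => //.
    apply: measurable_funM; first exact: measurable_cst.
    apply: (measurableT_comp (measurable_long_run_variance lambda)); exact: measurable_funPT.
  move=> w; rewrite ger0_norm ?expR_ge0// -[leRHS]expR0 ler_expR oppr_le0.
  apply: mulr_ge0; last by rewrite ltW// long_run_variance_gt0.
  by apply: mulr_ge0; [exact: sqr_ge0|exact: divr_ge0].
- apply: aeW => w; rewrite -cexp_real; apply: ccvg_cexp.
  have /andP[_ a1] := a01 w.
  rewrite (_ : - _ = rate lambda (alpha0 w) * - ((1 + alpha0 w) / (1 - alpha0 w) * (kappa ^+ 2 * fdd_variance u t) / 2)); last first.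
    rewrite long_run_varianceE// rateE//; move: (fdd_variance u t) => q.
    have : 1 - alpha0 w != 0 by rewrite subr_eq0 gt_eqF.
    by move: (alpha0 w) => a an; field.
  rewrite rmorphM; apply: ccvgM; first exact: ccvg_cst.
  exact: cvg_cumulant.
Qed.

End SampledCharacteristicFunction.

Lemma fdd_varianceZ {R : realType} (m : nat) (u t : 'I_m -> R) (c : R) :
  fdd_variance (fun i => u i * c) t = c ^+ 2 * fdd_variance u t.
Proof.
rewrite /fdd_variance mulr_sumr; apply: eq_bigr => i _.
by rewrite mulr_sumr; apply: eq_bigr => j _; ring.
Qed.

Section FamilySpace.
Context {R : realType} {d : measure_display} {T : measurableType d}.
Variables (I : Type) (Z : I -> T -> R).
Hypothesis mZ : forall i, measurable_fun setT (Z i).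

Lemma sigma_family_path (E : set (path_space I)) : measurable E ->
  sigma_family setT Z ((fun w i => Z i w) @^-1` E).
Proof.
move=> mE.
pose S := g_sigma_algebraType [set E : set T | exists i, [set: I] i /\ sigma_rv (Z i) E].
have mS i : measurable_fun setT (Z i : S -> R).
  move=> _ A mA; rewrite setTI; apply: sub_sigma_algebra; exists i; split => //.
  by exists A => //; rewrite setTI.
by have := measurable_path mS measurableT mE; rewrite setTI.
Qed.

Lemma sigma_family_measurable (E : set T) : sigma_family setT Z E -> measurable E.
Proof.
move=> mE; apply: (smallest_sub _ _ mE).
  split; [exact: measurable0|by move=> A; rewrite setTD; exact: measurableC|].
  by move=> F mF; exact: bigcupT_measurable.
by move=> A [i [_ [C mC <-]]]; exact: mZ.
Qed.

End FamilySpace.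

Section IteratedLimit.
Context {R : realType} (lambda beta psi1 : R) (psi : R -> R).
Context {d0 : measure_display} {T0 : measurableType d0} (P0 : probability T0 R).
Variables (alpha0 : {RV P0 >-> R}) (X00 : {RV P0 >-> nat}).
Variables (xi : nat -> nat -> {RV P0 >-> nat}) (eps : nat -> {RV P0 >-> nat}).
Context {d : measure_display} {T : measurableType d} (P : probability T R).
Variables (alpha : nat -> {RV P >-> R}) (X : nat -> nat -> {RV P >-> nat}).
Variable m : nat -> nat -> T -> R.
Context {d' : measure_display} {T' : measurableType d'} (P' : probability T' R).
Variable B : R -> {RV P' >-> R}.
Hypothesis lambda_gt0 : 0 < lambda.
Hypothesis model : randomized_inar_noise lambda alpha0 X00 xi eps.
Hypothesis psi_meas : measurable_fun (`]0, 1[%classic : set R) psi.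
Hypothesis psi_ge0 : forall x, 0 < x < 1 -> 0 <= psi x.
Hypothesis alpha0_density : forall A : set R, measurable A ->
  P0 (alpha0 @^-1` A) =
  (\int[lebesgue_measure]_(x in A `&` `]0%R, 1%R[) (psi x * (1 - x) `^ beta)%:E)%E.
Hypothesis psi_lim : psi x @[x --> 1^'-] --> psi1.
Hypothesis psi1_gt0 : 0 < psi1.
Hypothesis copies_law : forall j, same_law P (joint (alpha j) (X j))
  P0 (joint alpha0 (inar X00 xi eps)).
Hypothesis copies_indep : indep_sigma P
  (fun j : nat => sigma_family setT (joint (alpha j) (X j))).
Hypothesis m_cexp : forall j k, is_cexp P (alpha j) (fun w => (X j k w)%:R) (m j k).
Hypothesis beta_itv : -1 < beta < 1.
Hypothesis B_wiener : wiener P' B.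

Let Z0 := joint alpha0 (inar X00 xi eps).
Let path j (w : T) : path_space (option nat) := joint (alpha j) (X j) ^~ w.

Let alpha01 w : 0 < alpha0 w < 1. Proof. by case: model. Qed.

Let mpath j : measurable_fun setT (path j).
Proof. by apply: measurable_path; exact: measurable_joint. Qed.

(** Independence separates the copies, and each of them has the law of the
    original process. *)
Lemma cE_copies (f : path_space (option nat) -> R[i]) (N : nat) : cbm f ->
  cE P (fun w => \prod_(j < N) f (path j w)) = cE P0 (fun w => f (Z0 ^~ w)) ^+ N.
Proof.
move=> bf.
have mF (j : nat) (E : set T) : sigma_family setT (joint (alpha j) (X j)) E -> measurable E.
  by apply: sigma_family_measurable; exact: measurable_joint.
have := @cE_indep_prod R _ T P nat _ copies_indep mF (fun=> _) (fun=> path_space (option nat))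
  path mpath (fun j E => @sigma_family_path R _ T _ _ E) (fun=> f) (fun=> bf) (index_iota 0 N) (iota_uniq _ _).
under eq_fun do rewrite big_mkord.
move=> ->; rewrite big_mkord; under eq_bigr => j _ do rewrite (cE_copy (copies_law j) bf).
by rewrite prodr_const card_ord.
Qed.

Lemma centering j k : {ae P, forall w, m j k w = rate lambda (alpha j w)}.
Proof. exact: (copy_centering lambda_gt0 model (copies_law j) (m_cexp j k)). Qed.

Let mm j k : measurable_fun setT (m j k).
Proof.
apply: (rv_space_fun (measurable_funPT (alpha j))).
by apply/sigma_rv_fun; have [] := m_cexp j k.
Qed.

Let kappa (N : nat) : R := N%:R `^ (- (1 + beta)^-1).

Definition aggregated (N n : nat) : process R := Process P (fun t w =>
  N%:R `^ (- (1 + beta)^-1) * n%:R `^ (- 2^-1) * Stilde X m N n t w).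

(** The limit for N copies: a Brownian motion whose variance is the sum of the
    long-run variances of the copies, realized on a product space. *)
Definition mixed_brownian (N : nat) : process R := Process (P \x P')%E (fun t w =>
  kappa N * Num.sqrt (\sum_(j < N) `|long_run_variance lambda (alpha j w.1)|) * B t w.2).

Lemma aggregated_process N n : is_process (aggregated N n).
Proof.
move=> t _ /=; apply: measurable_funM; first exact: measurable_cst.
apply: measurable_sum => j; apply: measurable_sum => k.
apply: measurable_funB; last exact: mm.
by apply: measurable_natr; exact: measurable_funPT.
Qed.

Let mlrv j : measurable_fun setT (fun w => `|long_run_variance lambda (alpha j w)|).
Proof.
apply: (measurableT_comp (@normr_measurable R setT)).
by apply: (measurableT_comp (measurable_long_run_variance lambda)); exact: measurable_funPT.
Qed.

Let total N w := \sum_(j < N) `|long_run_variance lambda (alpha j w)|.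

Let total_ge0 N w : 0 <= total N w. Proof. by apply: sumr_ge0. Qed.

Let mtotal N : measurable_fun setT (total N).
Proof. by apply: measurable_sum => j; exact: mlrv. Qed.

Lemma mixed_brownian_process N : is_process (mixed_brownian N).
Proof.
move=> t _ /=; apply: measurable_funM.
  apply: measurable_funM; first exact: measurable_cst.
  apply: (measurableT_comp measurable_sqrt).
  exact: (measurableT_comp (mtotal N) measurable_fst).
exact: (measurableT_comp (measurable_funPT (B t)) measurable_snd).
Qed.

Section Cf.
Variables (l : nat) (u t : 'I_l -> R).
Hypothesis t_ge0 : forall i, 0 <= t i.
Let q := fdd_variance u t.
Let q_ge0 : 0 <= q. Proof. exact: (fdd_variance_ge0 B_wiener). Qed.

Lemma aggregated_cf N n :
  cE P (fun w => cis (\sum_i u i * proc_val (aggregated N n) (t i) w)) =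
  cE P0 (fun w => cis (centered_sum lambda (weight u t (kappa N) n) (horizon t n) (Z0 ^~ w))) ^+ N.
Proof.
pose f x := cis (centered_sum lambda (weight u t (kappa N) n) (horizon t n) x).
have bf : cbm f by apply: cbm_cis; exact: measurable_centered_sum.
rewrite -(cE_copies N bf); apply: cE_ae.
- apply: cbm_cis; apply: measurable_lin_comb => i; exact: aggregated_process.
- by apply: cbm_prod => j; exact: (cbm_comp bf (mpath j)).
have ae : {ae P, forall w (j k : nat), m j k w = rate lambda (alpha j w)}.
  by apply: ae_foralln => j; apply: ae_foralln => k; exact: centering.
apply: filterS ae => w hw; rewrite -cis_sum; congr cis.
have E i : u i * proc_val (aggregated N n) (t i) w =
    \sum_(j < N) u i * (scale_n (kappa N) n *
      \sum_(1 <= k < (steps t n i).+1) ((X j k w)%:R - m j k w)).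
  by rewrite /= /Stilde !mulr_sumr; apply: eq_bigr => j _; rewrite /scale_n.
under eq_bigr do rewrite E; rewrite exchange_big /=; apply: eq_bigr => j _.
rewrite (weight_sum u t (kappa N) n (fun k => (X j k w)%:R - m j k w)).
by apply: eq_bigr => k _; rewrite /path /= hw.
Qed.

Let laplace N : R := Ex P0 (fun w => expR (- (kappa N ^+ 2 * (q / 2) * long_run_variance lambda (alpha0 w)))).

Let bexp (c : R) : 0 <= c ->
  bmeas (fun x : path_space (option nat) => expR (- (c * `|long_run_variance lambda (x None)|))).
Proof.
move=> c0; apply: (bmeas_le (M := 1)).
  apply: measurableT_comp => //; apply: measurableT_comp => //.
  apply: measurable_funM; first exact: measurable_cst.
  apply: (measurableT_comp (@normr_measurable R setT)).
  exact: (measurableT_comp (measurable_long_run_variance lambda) (measurable_coord None)).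
by move=> x; rewrite ger0_norm ?expR_ge0// -[leRHS]expR0 ler_expR oppr_le0 mulr_ge0.
Qed.

(** Integrate the Wiener process first, with the copies fixed. *)
Lemma mixed_brownian_cf N :
  cE (P \x P')%E (fun w => cis (\sum_i u i * proc_val (mixed_brownian N) (t i) w)) =
  (laplace N)%:C%C ^+ N.
Proof.
pose c := kappa N ^+ 2 * (q / 2).
have c0 : 0 <= c by rewrite mulr_ge0 ?sqr_ge0// divr_ge0.
pose f (x : path_space (option nat)) : R[i] := (expR (- (c * `|long_run_variance lambda (x None)|)))%:C%C.
have bf : cbm f by apply: cbm_real; exact: bexp.
have bc : cbm (fun w : T * T' => cis (\sum_i u i * proc_val (mixed_brownian N) (t i) w)).
  by apply: cbm_cis; apply: measurable_lin_comb => i; exact: mixed_brownian_process.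
rewrite (cE_fubini P P' bc).2.
have <- : cE P0 (fun w => f (Z0 ^~ w)) = (laplace N)%:C%C.
  rewrite /f cE_real; congr (_ %:C)%C; congr Ex; apply/funext => w /=.
  by rewrite gtr0_norm//; exact: long_run_variance_gt0.
rewrite -(cE_copies N bf); congr cE; apply/funext => w.
pose s := kappa N * Num.sqrt (total N w).
transitivity (cE P' (fun y => cis (\sum_i (u i * s) * B (t i) y))).
  by congr cE; apply/funext => y; congr cis; apply: eq_bigr => i _; rewrite /= mulrA.
rewrite wiener_cf// fdd_varianceZ /f -rmorph_prod; congr (_ %:C)%C.
rewrite -expR_sum; congr expR.
rewrite /s exprMn sqr_sqrtr// sumrN -mulr_sumr; congr (- _).
by rewrite /c -/q -/(total N w); field.
Qed.

Lemma cvg_aggregated_cf N :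
  ccvg (fun n => cE P (fun w => cis (\sum_i u i * proc_val (aggregated N n) (t i) w)))
    (cE (P \x P')%E (fun w => cis (\sum_i u i * proc_val (mixed_brownian N) (t i) w))).
Proof.
rewrite mixed_brownian_cf; under eq_fun do rewrite aggregated_cf.
by apply: ccvgX; exact: (sampled_cf lambda_gt0 model (kappa N) t_ge0 q_ge0).
Qed.

Lemma cvg_mixed_brownian_cf :
  ccvg (fun N => cE (P \x P')%E (fun w => cis (\sum_i u i * proc_val (mixed_brownian N) (t i) w)))
    (expR (- (k_beta lambda psi1 beta * (q / 2) `^ ((1 + beta) / 2))))%:C%C.
Proof.
under eq_fun do rewrite mixed_brownian_cf -rmorphXn.
split; last exact: cvg_cst.
apply: (long_run_variance_laplace lambda_gt0 alpha01 psi_meas psi_ge0 alpha0_density psi_lim psi1_gt0 beta_itv).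
exact: divr_ge0.
Qed.

End Cf.

Lemma fdd_cvg_aggregated N : fdd_cvg (aggregated N) (mixed_brownian N).
Proof.
apply: fdd_cvg_cf; [exact: aggregated_process|exact: mixed_brownian_process|].
by move=> l u t t0; exact: cvg_aggregated_cf.
Qed.

Variable Y : {RV P' >-> R}.
Hypothesis Y_gt0 : {ae P', forall w, 0 < Y w}.
Hypothesis Y_laplace : forall theta, 0 <= theta ->
  ('E_P'[fun w => expR (- theta * Y w)])%E =
  (expR (- k_beta lambda psi1 beta * theta `^ ((1 + beta) / 2)))%:E.
Hypothesis YB_indep : forall E F, sigma_rv Y E ->
  sigma_family [set t : R | 0 <= t] B F -> P' (E `&` F) = (P' E * P' F)%E.

Lemma fdd_cvg_mixed_brownian : fdd_cvg mixed_brownian (Process P' (subordinated Y B)).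
Proof.
apply: fdd_cvg_cf; first exact: mixed_brownian_process.
  by move=> t _; exact: measurable_subordinated.
move=> l u t t0; rewrite /= (subordinated_cf Y_gt0 Y_laplace B_wiener YB_indep u t0).
exact: cvg_mixed_brownian_cf.
Qed.

End IteratedLimit.
Theorem theorem4p10 (R : realType) (lambda beta psi1 : R) (psi : R -> R)
  (* the randomized INAR(1) process *)
  (d0 : measure_display) (T0 : measurableType d0) (P0 : probability T0 R)
  (alpha0 : {RV P0 >-> R}) (X00 : {RV P0 >-> nat})
  (xi : nat -> nat -> {RV P0 >-> nat}) (eps : nat -> {RV P0 >-> nat})
  (* its copies *)
  (d : measure_display) (T : measurableType d) (P : probability T R)
  (alpha : nat -> {RV P >-> R}) (X : nat -> nat -> {RV P >-> nat})
  (m : nat -> nat -> T -> R)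
  (* the stable variable and the Wiener process *)
  (d' : measure_display) (T' : measurableType d') (P' : probability T' R)
  (Y : {RV P' >-> R}) (B : R -> {RV P' >-> R})
  (lambda_gt0 : 0 < lambda)
  (alpha0X : randomized_inar_noise lambda alpha0 X00 xi eps)
  (psi_meas : measurable_fun (`]0, 1[%classic : set R) psi)
  (psi_ge0 : forall x, 0 < x < 1 -> 0 <= psi x)
  (alpha0_density : forall A : set R, measurable A ->
     P0 (alpha0 @^-1` A) =
     (\int[lebesgue_measure]_(x in A `&` `]0%R, 1%R[)
        (psi x * (1 - x) `^ beta)%:E)%E)
  (psi_lim : psi x @[x --> 1^'-] --> psi1)
  (psi1_gt0 : 0 < psi1)
  (copies_law : forall j, same_law P (joint (alpha j) (X j))
     P0 (joint alpha0 (inar X00 xi eps)))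
  (copies_indep : indep_sigma P
     (fun j : nat => sigma_family setT (joint (alpha j) (X j))))
  (m_cexp : forall j k,
     is_cexp P (alpha j) (fun w => (X j k w)%:R) (m j k))
  (beta_itv : -1 < beta < 1)
  (Y_gt0 : {ae P', forall w, 0 < Y w})
  (Y_laplace : forall theta, 0 <= theta ->
     ('E_P'[fun w => expR (- theta * Y w)])%E =
     (expR (- k_beta lambda psi1 beta * theta `^ ((1 + beta) / 2)))%:E)
  (B_wiener : wiener P' B)
  (YB_indep : forall E F, sigma_rv Y E ->
     sigma_family [set t : R | 0 <= t] B F -> P' (E `&` F) = (P' E * P' F)%E) :
  let YB := fun t w => Num.sqrt (Y w) * B t w in
  [/\ (* the two expressions of the centering agree *)
      forall j k, {ae P, forall w, m j k w = lambda / (1 - alpha j w)},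
      (* the iterated limit *)
      exists L : nat -> process R,
        (forall N : nat, (0 < N)%N ->
           fdd_cvg (fun n => Process P (fun t w =>
               N%:R `^ (- (1 + beta)^-1) * n%:R `^ (- 2^-1) *
               Stilde X m N n t w))
             (L N)) /\
        fdd_cvg L (Process P' YB),
      stable_rv P' ((1 + beta) / 2) Y,
      forall theta : R, char_fun P' Y theta =
        cexp (- (k_beta lambda psi1 beta *
                 `|theta| `^ ((1 + beta) / 2))%:C%C *
              cexp (- ('i%C * (Num.sg theta * pi * (1 + beta) / 4)%:C%C))) &
      levy_given P' Y YB /\ stable_process P' (1 + beta) YB].

Proof.
move=> YB.
have [b0 b1] := andP beta_itv.
have a01 : 0 < (1 + beta) / 2 < 1 by apply/andP; split; lra.
have k0 := k_beta_gt0 lambda_gt0 psi1_gt0 beta_itv.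
split.
- move=> j k; have c := centering lambda_gt0 alpha0X copies_law m_cexp j k.
  have a := copy_alpha01 alpha0X (copies_law j).
  apply: filterS2 c a => w -> /andP[_ a1]; exact: rateE.
- exists (mixed_brownian lambda beta alpha B); split.
    move=> N _.
    exact: (fdd_cvg_aggregated beta lambda_gt0 alpha0X copies_law copies_indep m_cexp B_wiener).
  exact: (fdd_cvg_mixed_brownian lambda_gt0 alpha0X psi_meas psi_ge0 alpha0_density psi_lim
    psi1_gt0 copies_law copies_indep beta_itv B_wiener Y_gt0 Y_laplace YB_indep).
- exact: (stable_rv_subordinator a01 k0 Y_gt0 Y_laplace).
- move=> theta; rewrite char_funE (cf_abs Y_gt0).
  have mY : measurable_fun setT (fun w => `|Y w|).
    by apply: (measurableT_comp (@normr_measurable R setT)); exact: measurable_funPT.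
  have a0 : 0 < (1 + beta) / 2 by case/andP: a01.
  rewrite (stable_char_fun mY (fun w => normr_ge0 _) a0 (fun th => Ex_laplace Y_gt0 Y_laplace (theta := th))).
  have -> : Num.sg theta * ((1 + beta) / 2 * pi / 2) = Num.sg theta * pi * (1 + beta) / 4 by field.
  by congr cexp; exact: esym (mulNr _ _).
- split; first exact: (levy_given_subordinated a01 k0 Y_gt0 Y_laplace B_wiener YB_indep).
  have -> : 1 + beta = 2 * ((1 + beta) / 2) by field.
  exact: (stable_process_subordinated a01 k0 Y_gt0 Y_laplace B_wiener YB_indep).
Qed.
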